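(* Let $n\ge 2$ and let $U(t)=(U_{kj}(t))_{1\le k,j\le n}$, $t\ge 0$, be a Brownian motion on the unitary group $\mathbf{U}(n)$ started from a point $U(0)\in\mathcal{D}$. The stochastic process $w(t)=(w_{kj}(t))_{1\le k\le n-1,\,1\le j\le n}$, $t\ge0$, given by $$w_{kj}(t)=\frac{U_{kj}(t)}{U_{nj}(t)},\qquad 1\le k\le n-1,\ 1\le j\le n,$$ is a diffusion process with generator $\frac12\Delta$, where $\Delta$ is the following second order differential operator on smooth functions on $\mathbb{C}^{n-1}\times\dots\times\mathbb{C}^{n-1}$ ($n$ factors, with coordinates $w_j=(w_{1j},\dots,w_{(n-1)j})$, $1\le j\le n$): $$\Delta=4\sum_{j=1}^{n}(1+r_j^2)\sum_{k,m=1}^{n-1}(\delta_{km}+w_{kj}\overline{w}_{mj})\frac{\partial^2}{\partial w_{kj}\partial\overline{w}_{mj}}-2\sum_{1\le j\ne\ell\le n}\sum_{k,m=1}^{n-1}(w_{k\ell}-w_{kj})(w_{mj}-w_{m\ell})\frac{\partial^2}{\partial w_{kj}\partial w_{m\ell}}-2\sum_{1\le j\ne\ell\le n}\sum_{k,m=1}^{n-1}(\overline{w}_{k\ell}-\overline{w}_{kj})(\overline{w}_{mj}-\overline{w}_{m\ell})\frac{\partial^2}{\partial\overline{w}_{kj}\partial\overline{w}_{m\ell}},$$ with $r_j=\sqrt{|w_{1j}|^2+\cdots+|w_{(n-1)j}|^2}$.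
   Context: $\mathbf{U}(n)=\{M\in\mathbb{C}^{n\times n}: M^*M=I_n\}$ with Lie algebra $\mathfrak{u}(n)$ of skew-Hermitian matrices, equipped with the inner product $B(A_1,A_2)=-\frac12\mathrm{tr}(A_1A_2)$. With $E_{\ell j}$ the elementary matrices and $T_j=\sqrt2\, iE_{jj}$, Brownian motion on $\mathfrak{u}(n)$ is $$A(t)=\sum_{1\le\ell<j\le n}(E_{\ell j}-E_{j\ell})B_{\ell j}(t)+i\sum_{1\le\ell<j\le n}(E_{\ell j}+E_{j\ell})\tilde B_{\ell j}(t)+\sum_{j=1}^nT_jB_j(t),$$ where $B_{\ell j},\tilde B_{\ell j},B_j$ are independent standard real Brownian motions. A Brownian motion on $\mathbf{U}(n)$ is a solution of the Stratonovich equation $dU(t)=U(t)\circ dA(t)$, equivalently in It\^o form $dU=U\,dA-nU\,dt$. $\mathcal{D}=\{(a_{kj})\in\mathbf{U}(n): a_{n1}\ne0,\dots,a_{nn}\ne0\}$; almost surely $U(t)\in\mathcal{D}$ for all $t\ge0$. The map $p:\mathcal{D}\to(\mathbb{C}^{n-1})^n$, $p((a_{kj}))=(a_{kj}/a_{nj})_{1\le k\le n-1,1\le j\le n}$ has image $\mathcal{O}=\{w=(w_1,\dots,w_n)\in(\mathbb{C}^{n-1})^n: w_i^*w_j=-1,\ 1\le i<j\le n\}$, which parametrizes a dense open subset of the complex full flag manifold $F_{1,2,\dots,n-1}(\mathbb{C}^n)\cong\mathbf{U}(n)/\mathbf{U}(1)^n$ (with the metric making $\mathbf{U}(n)\to\mathbf{U}(n)/\mathbf{U}(1)^n$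 a Riemannian submersion). The process $w(t)$ takes values in $\mathcal{O}$ and is called the Brownian motion on the full flag manifold. $\partial/\partial w_{kj}$, $\partial/\partial\overline w_{kj}$ are Wirtinger derivatives. *)

(* Defs.v *)
From HB Require Import structures.
From mathcomp Require Import all_boot all_order all_algebra.
From mathcomp Require Import all_classical all_reals all_analysis.
From mathcomp Require Import complex.

Set Implicit Arguments.
Unset Strict Implicit.
Unset Printing Implicit Defensive.

Import Order.TTheory GRing.Theory Num.Theory.
Import numFieldNormedType.Exports.

Local Open Scope classical_set_scope.
Local Open Scope ring_scope.

(* R[i] carries no topology in the library, so continuity, smoothness and size
   of complex matrices are expressed through the real coordinates
   (Re w, Im w), an element of a finite-dimensional real normed space. *)
Section RealCoordinates.
Variable R : realType.

Definition to_xy (a b : nat) (w : 'M[R[i]]_(a, b)) : 'M[R]_(a, b) * 'M[R]_(a, b) :=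
  (\matrix_(k, j) complex.Re (w k j), \matrix_(k, j) complex.Im (w k j)).

Definition of_xy (a b : nat) (z : 'M[R]_(a, b) * 'M[R]_(a, b)) : 'M[R[i]]_(a, b) :=
  \matrix_(k, j) (z.1 k j +i* z.2 k j)%C.

(* [differentiable_upto p g] : g is of class C^p.  In finite dimension g is
   C^(p+1) iff all its directional derivatives exist and are C^p. *)
Fixpoint differentiable_upto (V : normedModType R) (p : nat) (g : V -> R) : Prop :=
  if p is q.+1 then
    continuous g /\
    forall v : V, (forall x, derivable g x v) /\
                  differentiable_upto q (fun x => 'D_v g x)
  else continuous g.

Definition smooth (V : normedModType R) (g : V -> R) : Prop :=
  forall p, differentiable_upto p g.

(* Complex-valued C^oo functions with compact support. *)
Definition test_function (a b : nat) (f : 'M[R[i]]_(a, b) -> R[i]) : Prop :=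
  [/\ smooth (fun z => complex.Re (f (of_xy z))),
      smooth (fun z => complex.Im (f (of_xy z))) &
      exists K : R, forall w, K < `|to_xy w| -> f w = 0].

Definition borel_mx (a b : nat) : set (set 'M[R[i]]_(a, b)) :=
  <<s [set A | exists (k : 'I_a) (j : 'I_b) (B : set R), measurable B /\
         (A = [set w : 'M[R[i]]_(a, b) | B (complex.Re (w k j))] \/
          A = [set w : 'M[R[i]]_(a, b) | B (complex.Im (w k j))])] >>.

End RealCoordinates.

Section GeneratorOperator.
Variables (R : realType) (m : nat).
Local Notation state := 'M[R[i]]_(m, m.+1).

Definition real_deriv (v : 'M[R]_(m, m.+1) * 'M[R]_(m, m.+1))
    (f : state -> R[i]) (w : state) : R[i] :=
  ('D_v (fun z => complex.Re (f (of_xy z)) : R) (to_xy w) +i*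
   'D_v (fun z => complex.Im (f (of_xy z)) : R) (to_xy w))%C.

Definition d_w (k : 'I_m) (j : 'I_m.+1) (f : state -> R[i]) (w : state) : R[i] :=
  (real_deriv (delta_mx k j, 0) f w - 'i%C * real_deriv (0, delta_mx k j) f w) / 2.

Definition d_wbar (k : 'I_m) (j : 'I_m.+1) (f : state -> R[i]) (w : state) : R[i] :=
  (real_deriv (delta_mx k j, 0) f w + 'i%C * real_deriv (0, delta_mx k j) f w) / 2.

Definition col_radius (w : state) (j : 'I_m.+1) : R :=
  Num.sqrt (\sum_(k < m) complex.Re `|w k j| ^+ 2).

Definition flag_laplacian (f : state -> R[i]) (w : state) : R[i] :=
  4 * (\sum_(j < m.+1) (1 + (col_radius w j)%:C%C ^+ 2) *
         \sum_(k < m) \sum_(h < m)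
           ((k == h)%:R + w k j * (w h j)^*) * d_w k j (d_wbar h j f) w)
  - 2 * (\sum_(j < m.+1) \sum_(l < m.+1 | j != l) \sum_(k < m) \sum_(h < m)
           (w k l - w k j) * (w h j - w h l) * d_w k j (d_w h l f) w)
  - 2 * (\sum_(j < m.+1) \sum_(l < m.+1 | j != l) \sum_(k < m) \sum_(h < m)
           ((w k l)^* - (w k j)^*) * ((w h j)^* - (w h l)^*) *
             d_wbar k j (d_wbar h l f) w).

(* The set D and the map p : D -> (C^m)^(m+1).  Division by zero is 0 in R[i], so [flag_chart] is
   total; it is the map p on [flag_domain].  For unitary a with a nonzero in the
   last row at column j, 1 + r_j^2 = |a ord_max j|^-2, so a.s. continuity of
   [flag_chart (U t)] from a point of [flag_domain] already forces U to stay in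
   [flag_domain] a.s.  Rows are numbered from 0 to m, so
   [ord_max] is the last row. *)
Definition flag_domain : set 'M[R[i]]_(m.+1) :=
  [set a | a \is unitarymx /\ forall j, a ord_max j != 0].

Definition flag_chart (a : 'M[R[i]]_(m.+1)) : state :=
  \matrix_(k, j) (a (widen_ord (leqnSn m) k) j / a ord_max j).

End GeneratorOperator.

Section Processes.
Context (d : measure_display) (T : measurableType d) (R : realType).
Variables (P : probability T R) (F : R -> set (set T)).

(* Time is the half-line [0, +oo[; values at negative times are irrelevant. *)

Definition complete_filtration : Prop :=
  [/\ forall t : R, 0 <= t -> sigma_algebra setT (F t),
      forall t : R, 0 <= t -> F t `<=` measurable,
      forall s t : R, 0 <= s -> s <= t -> F s `<=` F t &
      forall N, P.-negligible N -> F 0 N].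

Definition measurable_wrt (S : Type) (G : set (set S)) (g : S -> R) : Prop :=
  forall B : set R, measurable B -> G (g @^-1` B).

Definition mx_adapted (a b : nat) (X : R -> T -> 'M[R[i]]_(a, b)) : Prop :=
  forall t : R, 0 <= t -> forall k j,
    measurable_wrt (F t) (fun x => complex.Re (X t x k j)) /\
    measurable_wrt (F t) (fun x => complex.Im (X t x k j)).

Definition mx_continuous_paths (a b : nat) (X : R -> T -> 'M[R[i]]_(a, b)) : Prop :=
  {ae P, forall x, {within `[0, +oo[, continuous (fun t => to_xy (X t x))}}.

(* Independent standard real Brownian motions (W i), jointly relative to F. *)
Definition brownian_family (I : finType) (W : I -> R -> T -> R) : Prop :=
  [/\ forall i, {ae P, forall x, W i 0 x = 0},
      forall i, {ae P, forall x, {within `[0, +oo[, continuous (fun t => W i t x)}},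
      forall i (t : R), 0 <= t -> measurable_wrt (F t) (W i t) &
      forall s t : R, 0 <= s -> s < t -> forall E, F s E ->
        forall B : I -> set R, (forall i, measurable (B i)) ->
        (P [set x | E x /\ forall i, B i (W i t x - W i s x)%R] =
         P E * \prod_(i : I) normal_prob 0%R (Num.sqrt (t - s)%R) (B i))%E].

Definition upper_pair (n : nat) : finType := {p : 'I_n * 'I_n | (p.1 < p.2)%N}.

Definition noise (n : nat) (B Bt : 'I_n -> 'I_n -> R -> T -> R)
    (Bd : 'I_n -> R -> T -> R)
    (i : upper_pair n + upper_pair n + 'I_n) : R -> T -> R :=
  match i with
  | inl (inl p) => B (val p).1 (val p).2
  | inl (inr p) => Bt (val p).1 (val p).2
  | inr j => Bd j
  end.

(* Brownian motion on the Lie algebra u(n). *)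
Definition brownian_u (n : nat) (A : R -> T -> 'M[R[i]]_n) : Prop :=
  exists (B Bt : 'I_n -> 'I_n -> R -> T -> R) (Bd : 'I_n -> R -> T -> R),
    brownian_family (noise B Bt Bd) /\
    forall t x, 0 <= t ->
      A t x =
        \sum_(l < n) \sum_(j < n | (l < j)%N)
          (B l j t x)%:C%C *: (delta_mx l j - delta_mx j l)
        + 'i%C *: \sum_(l < n) \sum_(j < n | (l < j)%N)
          (Bt l j t x)%:C%C *: (delta_mx l j + delta_mx j l)
        + \sum_(j < n) (Bd j t x)%:C%C *:
            (((Num.sqrt 2)%:C%C * 'i%C) *: delta_mx j j).

(* For a partition 0 = t_0 < t_1 < ... < t_N = t, [s] is [:: t_1; ...; t_N]
   as in [itv_partition 0 t s]. *)
Definition mesh (s : seq R) : R :=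
  \big[Num.max/0]_(i < size s) (nth 0 s i - nth 0 (0 :: s) i).

Definition left_sum (n : nat) (H A : R -> T -> 'M[R[i]]_n) (s : seq R) (x : T) :
    'M[R[i]]_n :=
  \sum_(i < size s)
    H (nth 0 (0 :: s) i) x *m (A (nth 0 s i) x - A (nth 0 (0 :: s) i) x).

(* [ito_integral H A t J] : J is the Ito integral of H dA over [0, t].  For a
   continuous adapted H (the only case used) it is the limit in probability of
   the left-point Riemann sums as the mesh of the partition tends to 0. *)
Definition ito_integral (n : nat) (H A : R -> T -> 'M[R[i]]_n) (t : R)
    (J : T -> 'M[R[i]]_n) : Prop :=
  forall e del : R, 0 < e -> 0 < del -> exists2 eta : R, 0 < eta &
    forall s : seq R, itv_partition 0 t s -> mesh s < eta ->
      (P [set x | (e < `|to_xy (left_sum H A s x - J x)|)%R] < del%:E)%E.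

Definition time_integral (h : R -> R[i]) (t : R) : R[i] :=
  (\int[lebesgue_measure]_(s in `[0, t]) complex.Re (h s) +i*
   \int[lebesgue_measure]_(s in `[0, t]) complex.Im (h s))%C.

(* Brownian motion on U(n): a continuous adapted U(n)-valued solution of
   dU = U o dA, written in its Ito form dU = U dA - n U dt. *)
Definition brownian_unitary (n : nat) (U : R -> T -> 'M[R[i]]_n) : Prop :=
  [/\ forall t x, 0 <= t -> U t x \is unitarymx,
      mx_adapted U,
      mx_continuous_paths U &
      exists2 A, brownian_u A &
        forall t : R, 0 <= t -> ito_integral U A t (fun x =>
          U t x - U 0 x +
          n%:R *: \matrix_(k, j) time_integral (fun s => U s x k j) t)].

(* Y = E[X | G]. *)
Definition cond_expectation (G : set (set T)) (X Y : T -> R) : Prop :=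
  [/\ measurable_wrt G Y,
      P.-integrable setT (EFin \o X),
      P.-integrable setT (EFin \o Y) &
      forall E, G E ->
        (\int[P]_(x in E) (Y x)%:E = \int[P]_(x in E) (X x)%:E)%E].

Definition martingale (M : R -> T -> R) : Prop :=
  forall s t : R, 0 <= s -> s <= t -> cond_expectation (F s) (M t) (M s).

(* Time-homogeneous Markov property: E[phi(X_(s+h)) | F_s] = psi(X_s), with
   psi depending on h and phi but not on s. *)
Definition markov_process (a b : nat) (X : R -> T -> 'M[R[i]]_(a, b)) : Prop :=
  forall (h : R) (phi : 'M[R[i]]_(a, b) -> R), 0 <= h ->
    measurable_wrt (@borel_mx R a b) phi ->
    (exists K : R, forall w, `|phi w| <= K) ->
    exists2 psi : 'M[R[i]]_(a, b) -> R,
      measurable_wrt (@borel_mx R a b) psi &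
      forall s : R, 0 <= s ->
        cond_expectation (F s) (fun x => phi (X (s + h) x)) (fun x => psi (X s x)).

(* Diffusion process with generator L (Revuz-Yor, Definition VII.2.1 and
   Proposition VII.2.2): a Markov process with continuous paths such that
   f(X_t) - f(X_0) - int_0^t (L f)(X_s) ds is a martingale for every test
   function f. *)
Definition diffusion_with_generator (a b : nat)
    (L : ('M[R[i]]_(a, b) -> R[i]) -> 'M[R[i]]_(a, b) -> R[i])
    (X : R -> T -> 'M[R[i]]_(a, b)) : Prop :=
  [/\ mx_adapted X,
      mx_continuous_paths X,
      markov_process X &
      forall f, test_function f ->
        let M t x := f (X t x) - f (X 0 x) -
                     time_integral (fun s => L f (X s x)) t in
        martingale (fun t x => complex.Re (M t x)) /\
        martingale (fun t x => complex.Im (M t x))].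

End Processes.

(* Main.v *)
(* A function G on U(n) with a second-order expansion G(u') = G(u) + D1 u (u' - u) +
   D2 u (u' - u) (u' - u) + O(|u' - u|^3) satisfies
     E[1_E (G(U_(t+h)) - G(U_t) - h L G(U_t))] = O(h^(3/2)) for E in F_t,
     L G(u) = - n D1 u u + sum_b D2 u (u X_b) (u X_b), with (X_b) the noise basis of u(n),
   because U_(t+h) - U_t = U_t (A_(t+h) - A_t) - n h U_t + (negligible in L2).  Summing over finer and
   finer grids gives Dynkin's formula, which is used three times.
   - For G = - ln(|u_kj|^2 + eps) one has L G <= 2n uniformly in eps, so a maximal inequality shows
     that an entry which is nonzero at time 0 never vanishes.
   - L is invariant under left and right translations, so for an independent copy V of U the
     expectation of 1_E q(l U_(s+r) c V_t) changes by O(d^(3/2)) when time d is moved from r to t.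
     Hence, given F_s, U_s^-1 U_(s+h) has the law of U_0^-1 U_h; this law is invariant under conjugation
     by diagonal unitaries, so the transition probabilities descend to the chart: Markov property.
   - For f smooth with compact support, f o p extends by zero to such a G.  The second-order part of
     p is killed by the sum over b, and sum_b (u X_b)_kj (u X_b)_hl = -2 u_kl u_hj together with
     sum_b (u X_b)_kj conj((u X_b)_hl) = 2 delta_jl delta_kh turns L G into half the Laplacian. *)

Require Import Defs.
From HB Require Import structures.
From mathcomp Require Import all_boot all_order all_algebra.
From mathcomp Require Import all_classical all_reals all_analysis.
From mathcomp Require Import measurable_realfun complex ring lra.

Set Implicit Arguments.
Unset Strict Implicit.
Unset Printing Implicit Defensive.

Import Order.TTheory GRing.Theory Num.Theory.
Import numFieldNormedType.Exports.

Local Open Scope classical_set_scope.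
Local Open Scope ring_scope.

(** * Moments and independence *)

(** The Ito integral is given only as a limit in probability of left-point sums, so neither an
    isometry nor an Ito formula is at hand. Bounds for the discrete sums are carried through that
    limit by truncation, and the increment of U is compared in L2 with a Gaussian step whose
    coefficients are frozen at the left endpoint. The exponent 3/2 is what makes this enough: the
    errors over a grid of mesh h add up to order h^(1/2). A [jet] stores an expansion of a function
    on matrices whose remainder is controlled only between unitary points, so no differential
    calculus on the group is needed. Because the filtration is abstract, no conditional laws are
    used: the Markov property is an identity between integrals on the product of two copies of the
    space, proved for smooth functions approximating boxes and then extended to bounded Borel
    functions. *)

Section Toolkit.
Context d (T : measurableType d) (R : realType).
Variable P : probability T R.
Implicit Types (X Y Z : T -> R) (K c : R).

(** The real-valued integral reads an infinite value as 0, which is why most rules below carry [L1]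
    side conditions. *)
Definition mean X : R := \int[P]_x X x.
Definition L1 X : Prop := P.-integrable setT (EFin \o X).
Definition L2 X : Prop := measurable_fun setT X /\ L1 (fun x => X x ^+ 2).

Lemma L1_meas X : L1 X -> measurable_fun setT X.
Proof. by move=> /integrableP[/measurable_EFinP]. Qed.

Lemma L1_le X Y : measurable_fun setT X -> (forall x, `|X x| <= Y x) -> L1 Y -> L1 X.
Proof.
move=> mX XY; apply: le_integrable => //; first exact/measurable_EFinP.
move=> x _ /=; rewrite lee_fin; apply: (le_trans (XY x)).
exact: ler_norm.
Qed.

Lemma L1_cst c : L1 (fun=> c).
Proof. exact: finite_measure_integrable_cst. Qed.

Lemma L1D X Y : L1 X -> L1 Y -> L1 (fun x => X x + Y x).
Proof. by move=> iX iY; apply: (@integrableD _ _ _ P _ _ _ _ iX iY). Qed.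

Lemma L1Z c X : L1 X -> L1 (fun x => c * X x).
Proof. by move=> iX; apply: (@integrableZl _ _ _ P _ _ c _ iX). Qed.

Lemma L1N X : L1 X -> L1 (fun x => - X x).
Proof.
by move=> /(L1Z (-1)); congr L1; apply/funext => x; rewrite mulN1r.
Qed.

Lemma L1B X Y : L1 X -> L1 Y -> L1 (fun x => X x - Y x).
Proof. by move=> iX iY; apply: L1D => //; apply: L1N. Qed.

Lemma L1_norm X : L1 X -> L1 (fun x => `|X x|).
Proof.
move=> iX; apply: (@L1_le _ (fun x => `|X x|)) => //.
- by apply: measurableT_comp => //; apply: L1_meas.
- by move=> x; rewrite normr_id.
exact: (integrable_norm iX).
Qed.

Lemma L1_sum (I : Type) (s : seq I) (p : pred I) (X : I -> T -> R) :
  (forall i, p i -> L1 (X i)) -> L1 (fun x => \sum_(i <- s | p i) X i x).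
Proof.
move=> iX; elim: s => [|i s IH].
  under eq_fun do rewrite big_nil; exact: L1_cst.
case: (boolP (p i)) => pi.
  by under eq_fun do rewrite big_cons pi; apply: L1D => //; apply: iX.
by under eq_fun do rewrite big_cons (negbTE pi).
Qed.

Lemma L1_bnd K X : measurable_fun setT X -> (forall x, `|X x| <= K) -> L1 X.
Proof. by move=> mX XK; apply: (L1_le mX XK); apply: L1_cst. Qed.

Lemma L1M_bnd K X Y : measurable_fun setT X -> (forall x, `|X x| <= K) -> L1 Y ->
  L1 (fun x => X x * Y x).
Proof.
move=> mX XK iY; apply: (@L1_le _ (fun x => K * `|Y x|)).
- by apply: measurable_funM => //; apply: L1_meas.
- by move=> x; rewrite normrM ler_wpM2r.
- by apply: L1Z; apply: L1_norm.
Qed.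

Lemma mean_cst c : mean (fun=> c) = c.
Proof.
rewrite /mean Rintegral_cst//.
transitivity (c * 1); last by rewrite mulr1.
congr (_ * _); exact: (f_equal fine (probability_setT P)).
Qed.

Lemma meanD X Y : L1 X -> L1 Y -> mean (fun x => X x + Y x) = mean X + mean Y.
Proof. by move=> iX iY; apply: RintegralD. Qed.

Lemma meanB X Y : L1 X -> L1 Y -> mean (fun x => X x - Y x) = mean X - mean Y.
Proof. by move=> iX iY; apply: RintegralB. Qed.

Lemma meanZ c X : L1 X -> mean (fun x => c * X x) = c * mean X.
Proof. by move=> iX; apply: RintegralZl. Qed.

Lemma mean_sum (I : Type) (s : seq I) (p : pred I) (X : I -> T -> R) :
  (forall i, p i -> L1 (X i)) ->
  mean (fun x => \sum_(i <- s | p i) X i x) = \sum_(i <- s | p i) mean (X i).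
Proof.
move=> iX; elim: s => [|i s IH].
  by rewrite big_nil -[RHS](mean_cst 0); congr mean; apply/funext => x; rewrite big_nil.
rewrite big_cons -IH; case: (boolP (p i)) => pi.
  rewrite -meanD; [|exact: iX|exact: L1_sum].
  by congr mean; apply/funext => x; rewrite big_cons pi.
by congr mean; apply/funext => x; rewrite big_cons (negbTE pi).
Qed.

Lemma mean_le X Y : L1 X -> L1 Y -> (forall x, X x <= Y x) -> mean X <= mean Y.
Proof. by move=> iX iY XY; apply: le_Rintegral. Qed.

Lemma mean_ge0 X : (forall x, 0 <= X x) -> 0 <= mean X.
Proof. by move=> X0; apply: Rintegral_ge0. Qed.

Lemma mean_le_cst K X : L1 X -> (forall x, X x <= K) -> mean X <= K.
Proof. by move=> iX XK; rewrite -[leRHS]mean_cst; apply: mean_le => //; apply: L1_cst. Qed.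

Lemma mean_norm_le X Y : L1 X -> L1 Y -> (forall x, `|X x| <= Y x) -> `|mean X| <= mean Y.
Proof.
move=> iX iY XY; apply: (le_trans (le_normr_Rintegral _ _)) => //.
by apply: mean_le => //; apply: L1_norm.
Qed.

Lemma mean_ae X Y : measurable_fun setT X -> measurable_fun setT Y ->
  {ae P, forall x, X x = Y x} -> mean X = mean Y.
Proof.
move=> mX mY XY; rewrite /mean /Rintegral; congr fine; apply: ae_eq_integral => //.
- exact/measurable_EFinP.
- exact/measurable_EFinP.
by case: XY => N [mN PN sN]; exists N; split=> //; apply: subset_trans sN => x /=;
  apply: contra_not => ->.
Qed.

Lemma L2_L1 X : L2 X -> L1 X.
Proof.
move=> [mX iX]; apply: (@L1_le _ (fun x => 1 + X x ^+ 2)) => //.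
  move=> x; have := sqr_ge0 (`|X x| - 1); rewrite -(real_normK (num_real (X x))); nra.
by apply: L1D => //; apply: L1_cst.
Qed.

Lemma L2_meas X : L2 X -> measurable_fun setT X. Proof. by case. Qed.

Lemma L2_sq X : L2 X -> L1 (fun x => X x ^+ 2). Proof. by case. Qed.

Lemma L2M X Y : L2 X -> L2 Y -> L1 (fun x => X x * Y x).
Proof.
move=> [mX iX] [mY iY]; apply: (@L1_le _ (fun x => X x ^+ 2 + Y x ^+ 2)).
- exact: measurable_funM.
- move=> x; rewrite normrM -(real_normK (num_real (X x))) -(real_normK (num_real (Y x))).
  have := normr_ge0 (X x); have := normr_ge0 (Y x); nra.
- exact: L1D.
Qed.

Lemma L2_bnd K X : measurable_fun setT X -> (forall x, `|X x| <= K) -> L2 X.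
Proof.
move=> mX XK; split => //; apply: (@L1_bnd (K ^+ 2)); first exact: measurable_funX.
by move=> x; rewrite normrX lerXn2r// nnegrE (le_trans _ (XK x)).
Qed.

Lemma L2_cst c : L2 (fun=> c).
Proof. by apply: (@L2_bnd `|c|). Qed.

Lemma L2D X Y : L2 X -> L2 Y -> L2 (fun x => X x + Y x).
Proof.
move=> LX LY; split; first by apply: measurable_funD; [case: LX|case: LY].
under eq_fun do rewrite sqrrD mulr2n.
by do ![apply: L1D]; try exact: L2_sq; exact: L2M.
Qed.

Lemma L2M_bnd K X Y : measurable_fun setT X -> (forall x, `|X x| <= K) -> L2 Y ->
  L2 (fun x => X x * Y x).
Proof.
move=> mX XK [mY iY]; split; first exact: measurable_funM.
under eq_fun do rewrite exprMn; apply: (@L1M_bnd (K ^+ 2)) => //.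
  exact: measurable_funX.
by move=> x; rewrite normrX lerXn2r// nnegrE (le_trans _ (XK x)).
Qed.

Lemma L2Z c X : L2 X -> L2 (fun x => c * X x).
Proof. exact: (@L2M_bnd `|c|). Qed.

Lemma L2N X : L2 X -> L2 (fun x => - X x).
Proof.
by move=> /(L2Z (-1)); congr L2; apply/funext => x; rewrite mulN1r.
Qed.

Lemma L2B X Y : L2 X -> L2 Y -> L2 (fun x => X x - Y x).
Proof. by move=> iX iY; apply: L2D => //; apply: L2N. Qed.

Lemma L2_sum (I : Type) (s : seq I) (p : pred I) (X : I -> T -> R) :
  (forall i, p i -> L2 (X i)) -> L2 (fun x => \sum_(i <- s | p i) X i x).
Proof.
move=> iX; elim: s => [|i s IH].
  under eq_fun do rewrite big_nil; exact: L2_cst.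
case: (boolP (p i)) => pi.
  by under eq_fun do rewrite big_cons pi; apply: L2D => //; apply: iX.
by under eq_fun do rewrite big_cons (negbTE pi).
Qed.

(** Young's inequality with a free weight replaces Cauchy-Schwarz. It avoids square roots of
    moments; the weight is later the square root of the time step or its inverse. *)
Lemma mean_mul_le X Y l a b : 0 < l -> L2 X -> L2 Y ->
  mean (fun x => X x ^+ 2) <= a -> mean (fun x => Y x ^+ 2) <= b ->
  mean (fun x => `|X x * Y x|) <= l * a + b / l.
Proof.
move=> l0 LX LY Xa Yb.
apply: (@le_trans _ _ (mean (fun x => l * X x ^+ 2 + l^-1 * Y x ^+ 2))).
  apply: mean_le.
  - by apply: L1_norm; apply: L2M.
  - by apply: L1D; apply: L1Z; apply: L2_sq.
  move=> x; rewrite normrM -(real_normK (num_real (X x))) -(real_normK (num_real (Y x))).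
  have := normr_ge0 (X x); have := normr_ge0 (Y x).
  move: `|X x| `|Y x| => p q q0 p0.
  have li : l * l^-1 = 1 by rewrite divff// gt_eqF.
  have li0 : 0 < l^-1 by rewrite invr_gt0.
  have : 0 <= l^-1 * (l * p - q) ^+ 2 by rewrite mulr_ge0 ?sqr_ge0// ltW.
  have -> : l^-1 * (l * p - q) ^+ 2 = (l * l^-1) * l * p ^+ 2 - 2 * (l * l^-1) * p * q + l^-1 * q ^+ 2.
    ring.
  rewrite li; nra.
rewrite meanD; [|by apply: L1Z; apply: L2_sq..].
rewrite !meanZ ?(L2_sq LX) ?(L2_sq LY)//; try exact: L2_sq.
by apply: lerD; rewrite 1?[_ / _]mulrC ler_pM2l ?invr_gt0.
Qed.

(** [G] need not be a sigma-algebra: the notion is also used on a pi-system before passing to what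
    it generates. *)
Definition indep (G : set (set T)) Y : Prop :=
  forall E B, G E -> measurable B -> P (E `&` Y @^-1` B) = (P E * P (Y @^-1` B))%E.

(** By uniqueness of product measures the joint law of X and Y is the product of their laws. Tonelli
    then gives integrability of the product and Fubini its factorisation. *)
Lemma indep_mean (G : set (set T)) X Y : measurable_wrt G X ->
  L1 X -> L1 Y -> indep G Y ->
  L1 (fun x => X x * Y x) /\ mean (fun x => X x * Y x) = mean X * mean Y.
Proof.
move=> gX LX LY iXY.
have mX := L1_meas LX; have mY := L1_meas LY.
pose Xm : {mfun T >-> R} := HB.pack X (isMeasurableFun.Build _ _ _ _ _ mX).
pose Ym : {mfun T >-> R} := HB.pack Y (isMeasurableFun.Build _ _ _ _ _ mY).
have mXY : measurable_fun setT (fun x => (X x, Y x)) by exact: measurable_fun_pair.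
pose XYm : {mfun T >-> (R * R)%type} := HB.pack (fun x => (X x, Y x))
  (isMeasurableFun.Build _ _ _ _ _ mXY).
pose mu := distribution P Xm; pose nu := distribution P Ym.
have jointE A : measurable A -> (mu \x nu)%E A = distribution P XYm A.
  move=> mA; apply: (@product_measure_unique _ _ _ _ R mu nu) => // B C mB mC.
  by rewrite /mu /nu /distribution /pushforward/= -iXY//; apply: gX.
pose f (z : R * R) := z.1 * z.2.
have mf : measurable_fun setT f.
  by apply: measurable_funM; [exact: measurable_fst|exact: measurable_snd].
have absint : (\int[mu \x nu]_z `|(f z)%:E| < +oo)%E.
  rewrite fubini_tonelli1//=; last first.
    by do 2 apply: measurableT_comp => //.
  rewrite /fubini_F /f/=.
  under eq_integral => x _.
    under eq_integral do rewrite normrM EFinM.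
    rewrite ge0_integralZl//; last by do 2 apply: measurableT_comp => //.
    over.
  rewrite ge0_integralZr//; last 2 first.
  - by do 2 apply: measurableT_comp => //.
  - by apply: integral_ge0 => z _; rewrite lee_fin.
  rewrite lte_mul_pinfty//.
  - by apply: integral_ge0 => z _; rewrite lee_fin.
  - rewrite ge0_fin_numE; last by apply: integral_ge0 => z _; rewrite lee_fin.
    rewrite ge0_integral_distribution//; last by do 2 apply: measurableT_comp => //.
    by case/integrableP : LX.
  - rewrite ge0_integral_distribution//; last by do 2 apply: measurableT_comp => //.
    by case/integrableP : LY.
have intf : (mu \x nu)%E.-integrable setT (EFin \o f).
  by apply/integrableP; split => //; exact/measurable_EFinP.
have LXY : L1 (fun x => X x * Y x).
  apply/integrableP; split; first exact/measurable_EFinP/measurable_funM.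
  move: absint; rewrite (@eq_measure_integral _ _ _ setT (distribution P XYm)); last first.
    by move=> A mA _; exact: jointE.
  by rewrite ge0_integral_distribution//; do 2 apply: measurableT_comp => //.
split => //.
have := integral12_prod_meas1 intf.
rewrite (@eq_measure_integral _ _ _ setT (distribution P XYm)); last first.
  by move=> A mA _; exact: jointE.
rewrite (@integral_distribution _ _ _ _ _ P XYm); first last.
- exact: LXY.
- by apply: measurableT_comp.
rewrite /mean /Rintegral /comp /= => <-.
rewrite /fubini_F /f/=.
have LY' : nu.-integrable setT (EFin \o id).
  apply/integrableP; split; first exact/measurable_EFinP.
  rewrite ge0_integral_distribution//; last by do 2 apply: measurableT_comp => //.
  by case/integrableP : LY.
have LX' : mu.-integrable setT (EFin \o id).
  apply/integrableP; split; first exact/measurable_EFinP.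
  rewrite ge0_integral_distribution//; last by do 2 apply: measurableT_comp => //.
  by case/integrableP : LX.
have -> : (\int[P]_x (X x)%:E = \int[mu]_x x%:E)%E by rewrite integral_distribution.
have -> : (\int[P]_x (Y x)%:E = \int[nu]_x x%:E)%E by rewrite integral_distribution.
under eq_integral => x _.
  under eq_integral do rewrite EFinM.
  rewrite integralZl//.
  over.
have fY := integrable_fin_num measurableT LY'.
have fX := integrable_fin_num measurableT LX'.
rewrite /comp/= in fX fY.
by rewrite -(fineK fY) integralZr// fineM.
Qed.

End Toolkit.

(** * Gaussian moments *)

Section GaussianMoments.
Variable R : realType.
Local Notation mu := (@lebesgue_measure R).

(** The fundamental theorem of calculus on growing symmetric intervals: dominated convergence
    handles the integral, the assumed decay the boundary terms. Applied to polynomials times the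
    Gaussian density it yields all moments below. *)
Lemma integral_derivative_eq0 (F f : R -> R) (C : R) :
  (forall x : R, is_derive x 1 F (f x)) -> continuous f ->
  mu.-integrable setT (EFin \o f) ->
  (forall n : nat, `|F n.+1%:R - F (- n.+1%:R)| <= C / n.+1%:R) ->
  (\int[mu]_x (f x)%:E = 0)%E.
Proof.
move=> dF cf intf FC.
pose fn (n : nat) := (EFin \o f) \_ (`[- n.+1%:R, n.+1%:R]%classic : set R).
have mf : measurable_fun setT (EFin \o f) by case/integrableP : intf.
have lim1 : (\int[mu]_x fn n x)%E @[n --> \oo] --> (\int[mu]_x (f x)%:E)%E.
  apply: (@dominated_cvg _ _ _ mu setT measurableT fn (EFin \o f) (fun x => `|f x|%:E)%E) => //.
  - by move=> n; apply/(measurable_restrictT _ _).1 => //; apply: measurable_funTS.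
  - move=> x _; apply: cvg_near_cst.
    near=> n; rewrite /fn patchE ifT// inE/= in_itv/= -ler_norml.
    near: n; exists (Num.truncn `|x|).+1 => // n /= xn.
    by apply: ltW; apply: (lt_le_trans (truncnS_gt _)); rewrite ler_nat (leq_trans xn).
  - exact: integrable_norm intf.
  - move=> n x _; rewrite /fn patchE; case: ifP => //= _.
    by rewrite normr0 lee_fin.
have lim2 : (\int[mu]_x fn n x)%E @[n --> \oo] --> (0 : \bar R)%E.
  have -> : (fun n => \int[mu]_x fn n x)%E = (fun n => (F n.+1%:R - F (- n.+1%:R))%:E).
    apply/funext => n; rewrite /fn -integral_mkcond EFinB.
    have cF : continuous F.
      by move=> x; apply: differentiable_continuous; apply/derivable1_diffP; apply: ex_derive.
    rewrite (@continuous_FTC2 _ f F)//.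
    - by rewrite -subr_gt0 opprK; apply: addr_gt0.
    - exact: continuous_subspaceT.
    - split => [x _||]; first exact: ex_derive.
        by apply: cvg_at_right_filter; exact: cF.
      by apply: cvg_at_left_filter; exact: cF.
    - by move=> x _; rewrite derive1E; exact: derive_val.
  apply: cvg_EFin; first by near=> n.
  apply: (@squeeze_cvgr _ _ _ _ (fun n => - (C / n.+1%:R)) (fun n => C / n.+1%:R)).
  - by near=> n; rewrite /= -ler_norml; exact: FC.
  - rewrite -oppr0; apply: cvgN; rewrite -(mulr0 C); apply: cvgMr; exact: cvg_harmonic.
  - rewrite -(mulr0 C); apply: cvgMr; exact: cvg_harmonic.
exact: (cvg_unique _ lim1 lim2).
Unshelve. all: by end_near. Qed.

Variable s : R.
Hypothesis s0 : 0 < s.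
Let G (x : R) : R := normal_pdf 0 s x.

Let GE x : G x = normal_peak s * expR (- (s ^+ 2 *+ 2)^-1 * x ^+ 2).
Proof.
rewrite /G normal_pdfE ?gt_eqF// /normal_fun subr0; congr (_ * expR _).
by rewrite mulNr mulNr mulrC.
Qed.

Let dG (x : R) : is_derive x 1 G (- (s ^+ 2)^-1 * x * G x).
Proof.
have -> : G = (fun x => normal_peak s * (expR \o (fun x => - (s ^+ 2 *+ 2)^-1 * x ^+ 2)) x).
  by apply/funext => y; rewrite GE.
pose k := (s ^+ 2 *+ 2)^-1.
have h1 : is_derive x 1 (fun x : R => - k * x ^+ 2) (- k * (2 * x)).
  by apply: is_derive_eq; rewrite /GRing.scale/=; ring.
have h2 := is_derive1_comp (is_derive_expR _) h1.
have h3 : is_derive x 1 (fun x => normal_peak s * (expR \o (fun x => - k * x ^+ 2)) x)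
   (normal_peak s * (expR (- k * x ^+ 2) * (- k * (2 * x)))).
  by apply: is_derive_eq.
apply: (is_derive_eq h3); rewrite /= /k.
have s2 : s != 0 by rewrite gt_eqF.
by rewrite -[s ^+ 2 *+ 2]mulr_natl; field.
Qed.

Let G_ge0 x : 0 <= G x. Proof. exact: normal_pdf_ge0. Qed.

Let cG : continuous G. Proof. by apply: continuous_normal_pdf; rewrite gt_eqF. Qed.

(** Domination by a Gaussian of doubled variance. With y = x^2 / (4 s^2) the density contains
    exp(-2y), one factor exp(-y) is kept, and y^2 exp(-y) <= 4 with x^4 = 16 s^4 y^2 produces the
    64. Hence polynomials of degree at most 4 are integrable. *)
Let x4G_bound : exists2 C, 0 <= C & forall x, x ^+ 4 * G x <= C * normal_pdf 0 (Num.sqrt 2 * s) x.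
Proof.
have s'0 : 0 < Num.sqrt 2 * s by rewrite mulr_gt0.
exists (64 * s ^+ 4 * normal_peak s / normal_peak (Num.sqrt 2 * s)).
  by rewrite divr_ge0 ?normal_peak_ge0// !mulr_ge0 ?normal_peak_ge0// ltW.
move=> x; rewrite GE normal_pdfE ?gt_eqF// /normal_fun subr0.
rewrite [X in _ <= X]mulrA divfK ?gt_eqF ?normal_peak_gt0 ?gt_eqF//.
rewrite [X in _ <= X](_ : _ = normal_peak s * (64 * s ^+ 4 * expR (- x ^+ 2 / ((Num.sqrt 2 * s) ^+ 2 *+ 2)))); last by ring.
rewrite mulrCA ler_pM2l ?normal_peak_gt0 ?gt_eqF//.
have -> : - x ^+ 2 / ((Num.sqrt 2 * s) ^+ 2 *+ 2) = - (x ^+ 2 / (4 * s ^+ 2)).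
  rewrite exprMn sqr_sqrtr// mulNr; congr (- (_ / _)); ring.
have -> : - (s ^+ 2 *+ 2)^-1 * x ^+ 2 = - (x ^+ 2 / (4 * s ^+ 2)) - x ^+ 2 / (4 * s ^+ 2).
  have sn : s != 0 by rewrite gt_eqF.
  by rewrite -[s ^+ 2 *+ 2]mulr_natl; field.
set y := x ^+ 2 / _.
have y0 : 0 <= y by rewrite divr_ge0 ?sqr_ge0// mulr_ge0// sqr_ge0.
rewrite expRD mulrCA; rewrite -{1}[x ^+ 4](@mulfK _ (s ^+ 4)) ?gt_eqF ?exprn_gt0//.
have -> : x ^+ 4 * s ^+ 4 / s ^+ 4 = 16 * s ^+ 4 * y ^+ 2.
  have sn : s != 0 by rewrite gt_eqF.
  by rewrite /y; field.
rewrite [X in X <= _]mulrC [X in _ <= X]mulrC.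
have yb : y ^+ 2 * expR (- y) <= 4.
  rewrite expRN ler_pdivrMr ?expR_gt0//.
  have -> : expR y = expR (y / 2) ^+ 2 by rewrite -expRM_natl; congr expR; field.
  have := expR_ge1Dx (y / 2); move: (expR (y / 2)) => e he.
  have : (1 + y/2) ^+ 2 <= e ^+ 2 by rewrite lerXn2r// nnegrE; nra.
  nra.
have s4 : 0 <= 16 * s ^+ 4 by rewrite mulr_ge0// exprn_ge0// ltW.
have e0 := expR_ge0 (- y).
rewrite [X in X <= _](_ : _ = (16 * s ^+ 4) * (y ^+ 2 * expR (- y)) * expR (- y)); last by ring.
rewrite [X in _ <= X](_ : _ = (16 * s ^+ 4) * 4 * expR (- y)); last by ring.
by rewrite ler_wpM2r// ler_wpM2l.
Qed.

Let int_poly (p : R -> R) : measurable_fun setT p -> (exists C, forall x, `|p x| <= C * (1 + x ^+ 4)) ->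
  mu.-integrable setT (fun x => (p x * G x)%:E).
Proof.
move=> mp [C pC]; have [D D0 HD] := x4G_bound.
have C0 : 0 <= C by have := pC 0; rewrite expr0n/= addr0 mulr1; apply: le_trans.
apply: (@le_integrable _ _ _ mu setT _ _
  (fun x => (C * (G x + D * normal_pdf 0 (Num.sqrt 2 * s) x))%:E)) => //.
- apply/measurable_EFinP/measurable_funM => //; exact: measurable_normal_pdf.
- move=> x _ /=; rewrite lee_fin normrM (ger0_norm (G_ge0 x)).
  rewrite [X in _ <= X]ger0_norm; last first.
    by rewrite mulr_ge0// addr_ge0// mulr_ge0// normal_pdf_ge0.
  apply: (le_trans (ler_wpM2r (G_ge0 x) (pC x))).
  by rewrite -mulrA ler_wpM2l// mulrDl mul1r lerD2l.
- under eq_fun do rewrite EFinM EFinD EFinM.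
  apply: integrableZl => //; apply: integrableD => //; first exact: integrable_normal_pdf.
  by apply: integrableZl => //; exact: integrable_normal_pdf.
Qed.

(** Stein's identity: the integrand is the derivative of p times the density. The choices p = 1, x,
    x^3 give the moments of order 1, 2 and 4. *)
Let moment0 (p q : R -> R) : (forall x : R, is_derive x 1 p (q x)) ->
  continuous q -> (exists C, forall x, `|q x - (s ^+ 2)^-1 * x * p x| <= C * (1 + x ^+ 4)) ->
  (exists C, forall n : nat, `|p n.+1%:R - p (- n.+1%:R)| <= C * n.+1%:R ^+ 3) ->
  (\int[mu]_x ((q x - (s ^+ 2)^-1 * x * p x) * G x)%:E = 0)%E.
Proof.
move=> dp cq qC [C pC]; have [D D0 HD] := x4G_bound.
have Geven x : G (- x) = G x by rewrite !GE sqrrN.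
apply: (@integral_derivative_eq0 (fun x => p x * G x) _
  (C * (D * normal_peak (Num.sqrt 2 * s)))).
- move=> x; have dGx := dG x; have dpx := dp x.
  by apply: is_derive_eq; rewrite /GRing.scale/=; ring.
- have cp : continuous p.
    by move=> x; apply: differentiable_continuous; apply/derivable1_diffP; apply: ex_derive.
  move=> x; apply: cvgM; last exact: cG.
  apply: cvgB; first exact: cq.
  by apply: cvgM; [apply: cvgM; [exact: cvg_cst|exact: cvg_id]|exact: cp].
- apply: int_poly => //.
  have cp : continuous p.
    by move=> x; apply: differentiable_continuous; apply/derivable1_diffP; apply: ex_derive.
  apply: measurable_funB; first exact: continuous_measurable_fun.
  by apply: measurable_funM; [exact: measurable_funM|exact: continuous_measurable_fun].
- move=> n; rewrite Geven -mulrBl normrM (ger0_norm (G_ge0 _)).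
  apply: (le_trans (ler_wpM2r (G_ge0 _) (pC n))).
  have C0 : 0 <= C.
    have := le_trans (normr_ge0 _) (pC 0%N); by rewrite expr1n mulr1.
  rewrite ler_pdivlMr// -!mulrA ler_wpM2l//.
  rewrite [X in X <= _](_ : _ = n.+1%:R ^+ 4 * G n.+1%:R); last by ring.
  apply: (le_trans (HD _)); rewrite ler_wpM2l//.
  by apply: normal_pdf_ub; rewrite gt_eqF// mulr_gt0.
Qed.


Let int1 : mu.-integrable setT (fun x => (1 * G x)%:E).
Proof. by apply: int_poly => //; exists 1 => x; rewrite mul1r normr1 lerDl exprn_even_ge0. Qed.

Let intX : mu.-integrable setT (fun x => (x * G x)%:E).
Proof.
apply: int_poly => //; exists 1 => x.
have := sqr_ge0 (x ^+ 2 - 1); have := sqr_ge0 (x - 1); have := sqr_ge0 (x + 1).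
rewrite ler_norml => h1 h2 h3; apply/andP; split; nra.
Qed.

Let intX2 : mu.-integrable setT (fun x => (x ^+ 2 * G x)%:E).
Proof.
apply: int_poly => //; exists 1 => x.
have := sqr_ge0 (x ^+ 2 - 1); have := sqr_ge0 x.
rewrite ger0_norm ?sqr_ge0//; nra.
Qed.

Let intX4 : mu.-integrable setT (fun x => (x ^+ 4 * G x)%:E).
Proof.
apply: int_poly => //; exists 1 => x.
by rewrite ger0_norm ?exprn_even_ge0// mul1r lerDr.
Qed.

Let intZ c (f : R -> R) : mu.-integrable setT (EFin \o f) ->
  mu.-integrable setT (EFin \o (fun x => c * f x)).
Proof. by move=> h; exact: (@integrableZl _ _ _ mu setT measurableT c _ h). Qed.

Let I0 : \int[mu]_x (1 * G x) = 1.
Proof.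
by under eq_Rintegral do rewrite mul1r; rewrite /Rintegral integral_normal_pdf.
Qed.

Lemma normal_pdf_moment1 : \int[mu]_x (x * normal_pdf 0 s x) = 0.
Proof.
have dp (x : R) : is_derive x 1 (fun _ : R => 1 : R) 0 by exact: is_derive_cst.
have := moment0 dp.
have s2 : (s ^+ 2)^-1 != 0 by rewrite invr_eq0 expf_eq0 gt_eqF.
move=> /(_ (fun x => cvg_cst _)) h.
have /(f_equal fine) : (\int[mu]_x (((fun=> 0) x - s ^- 2 * x * 1) * G x)%:E = 0)%E.
  apply: h.
    exists (`|(s ^+ 2)^-1|) => x; have -> : 0 - s ^- 2 * x * 1 = - (s ^- 2 * x) by ring.
    rewrite normrN normrM ler_wpM2l//.
    have := sqr_ge0 (x ^+ 2 - 1); have := sqr_ge0 (x - 1); have := sqr_ge0 (x + 1).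
    rewrite ler_norml => h1 h2 h3; apply/andP; split; nra.
  by exists 0 => n; rewrite subrr normr0 mul0r.
rewrite -/(Rintegral _ _ _).
have -> : \int[mu]_x ((0 - s ^- 2 * x * 1) * G x) = - s ^- 2 * \int[mu]_x (x * G x).
  rewrite -RintegralZl//; apply: eq_Rintegral => x _; ring.
by move/eqP; rewrite /= mulf_eq0 oppr_eq0 (negbTE s2) => /eqP.
Qed.

Lemma normal_pdf_moment2 : \int[mu]_x (x ^+ 2 * normal_pdf 0 s x) = s ^+ 2.
Proof.
have dp (x : R) : is_derive x 1 (fun x : R => x) 1 by exact: is_derive_id.
have s2 : (s ^+ 2)^-1 != 0 by rewrite invr_eq0 expf_eq0 gt_eqF.
have := moment0 dp.
move=> /(_ (fun x => cvg_cst _)) h.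
have /(f_equal fine) : (\int[mu]_x (((fun=> 1) x - s ^- 2 * x * x) * G x)%:E = 0)%E.
  apply: h.
    exists (1 + (s ^+ 2)^-1) => x.
    apply: (le_trans (ler_normB _ _)); rewrite normr1 mulrDl lerD//.
      by rewrite mul1r lerDl exprn_even_ge0.
    have i0 : 0 <= (s ^+ 2)^-1 by rewrite invr_ge0 sqr_ge0.
    rewrite -mulrA normrM (ger0_norm i0) ler_wpM2l// -expr2 ger0_norm ?sqr_ge0//.
    have := sqr_ge0 (x ^+ 2 - 1); have := sqr_ge0 x; nra.
  exists 2 => n; have : 1 <= n.+1%:R :> R by rewrite ler1n.
  by move: (n.+1%:R) => y y1; rewrite ger0_norm; nra.
rewrite -/(Rintegral _ _ _).
have -> : \int[mu]_x ((1 - s ^- 2 * x * x) * G x) = \int[mu]_x (1 * G x) - s ^- 2 * \int[mu]_x (x ^+ 2 * G x).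
  rewrite -RintegralZl// -RintegralB//.
    by apply: eq_Rintegral => x _; ring.
  exact: intZ.
rewrite I0 /= => /eqP; rewrite subr_eq0 => /eqP h1.
by rewrite -[RHS]mulr1 h1 mulrA divff ?mul1r// sqrf_eq0 gt_eqF.
Qed.

Lemma normal_pdf_moment4 : \int[mu]_x (x ^+ 4 * normal_pdf 0 s x) = 3 * s ^+ 4.
Proof.
have dp (x : R) : is_derive x 1 (fun x : R => x ^+ 3) (3 * x ^+ 2).
  have -> : (fun x : R => x ^+ 3) = (id : R -> R) ^+ 3 by apply/funext => y; rewrite exprfctE.
  apply: (is_derive_eq (is_deriveX 3 (is_derive_id x 1))).
  by rewrite /GRing.scale/= mulr1.
have s2 : (s ^+ 2)^-1 != 0 by rewrite invr_eq0 expf_eq0 gt_eqF.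
have := moment0 dp.
have c3 : continuous (fun x : R => 3 * x ^+ 2).
  by move=> x; apply: cvgM; [exact: cvg_cst|exact: sqr_continuous].
move=> /(_ c3) h.
have /(f_equal fine) : (\int[mu]_x ((3 * x ^+ 2 - s ^- 2 * x * x ^+ 3) * G x)%:E = 0)%E.
  apply: h.
    exists (3 + (s ^+ 2)^-1) => x.
    have i0 : 0 <= (s ^+ 2)^-1 by rewrite invr_ge0 sqr_ge0.
    have x4 : 0 <= x ^+ 4 by rewrite exprn_even_ge0.
    apply: (le_trans (ler_normB _ _)); rewrite [X in _ <= X]mulrDl; apply: lerD.
      rewrite ger0_norm; last by rewrite mulr_ge0// sqr_ge0.
      have := sqr_ge0 (x ^+ 2 - 1); have := sqr_ge0 x; nra.
    by rewrite -mulrA normrM (ger0_norm i0) ler_wpM2l// -exprS ger0_norm// lerDr.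
  exists 2 => n; have : 1 <= n.+1%:R :> R by rewrite ler1n.
  move: (n.+1%:R) => y y1; have y3 : 0 <= y ^+ 3 by rewrite exprn_ge0// (le_trans _ y1).
  by rewrite exprNn -signr_odd/= expr1 mulN1r ger0_norm; lra.
rewrite -/(Rintegral _ _ _).
have -> : \int[mu]_x ((3 * x ^+ 2 - s ^- 2 * x * x ^+ 3) * G x) =
    3 * \int[mu]_x (x ^+ 2 * G x) - s ^- 2 * \int[mu]_x (x ^+ 4 * G x).
  rewrite -!RintegralZl// -RintegralB//.
  - by apply: eq_Rintegral => x _; ring.
  - exact: intZ.
  - exact: intZ.
rewrite normal_pdf_moment2 /= => /eqP; rewrite subr_eq0 => /eqP h1.
have sn : s != 0 by rewrite gt_eqF.
transitivity (s ^+ 2 * (s ^- 2 * \int[mu]_x (x ^+ 4 * G x))).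
  by rewrite mulrA divff ?mul1r// sqrf_eq0.
by rewrite -h1; ring.
Qed.

(** The Radon-Nikodym derivative of the normal law is identified almost everywhere with the density,
    which turns change of variables into an explicit formula. *)
Lemma integral_normal_prob (f : R -> \bar R) : measurable_fun setT f ->
  (\int[normal_prob 0 s]_x `|f x| < +oo)%E ->
  (\int[normal_prob 0 s]_x f x = \int[mu]_x (f x * (normal_pdf 0 s x)%:E))%E.
Proof.
move=> mf finf.
rewrite -(Radon_Nikodym_change_of_variables (normal_prob_dominates 0 s))//=; last first.
  by apply/integrableP; split.
apply: ae_eq_integral => //.
- apply: emeasurable_funM => //; apply: (measurable_int mu).
  by apply: Radon_Nikodym_integrable; exact: normal_prob_dominates.
- apply: emeasurable_funM => //=; apply/measurableT_comp => //=.
  exact: measurable_normal_pdf.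
- apply: ae_eqe_mul2l => /=.
  rewrite Radon_NikodymE//=; first exact: normal_prob_dominates.
  move=> abmu.
  case: cid => /= h [h1 h2 h3].
  apply: integral_ae_eq => //=.
  + by apply/measurableT_comp =>//; exact: measurable_normal_pdf.
  + by move=> E E01 mE; rewrite -h3.
Qed.

(** [integral_normal_prob] already assumes a finite integral, so it is applied to the truncations of
    f, and monotone convergence carries the bound over. *)
Lemma ge0_integral_normal_prob (f : R -> R) : measurable_fun setT f -> (forall x, 0 <= f x) ->
  mu.-integrable setT (fun x => (f x * normal_pdf 0 s x)%:E) ->
  (normal_prob 0 s).-integrable setT (EFin \o f).
Proof.
move=> mf f0 intf.
have key (n : nat) : (\int[normal_prob 0 s]_x (Num.min (f x) n%:R)%:E <= \int[mu]_x (f x * normal_pdf 0 s x)%:E)%E.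
  have mm : measurable_fun setT (fun x => Num.min (f x) n%:R).
    exact: measurable_minr.
  rewrite integral_normal_prob.
  - apply: ge0_le_integral => //.
    + by move=> x _; rewrite -EFinM lee_fin mulr_ge0 ?normal_pdf_ge0// le_min f0/=.
    + by under eq_fun do rewrite -EFinM; apply/measurable_EFinP/measurable_funM => //; exact: measurable_normal_pdf.
    + by apply/measurable_EFinP/measurable_funM => //; exact: measurable_normal_pdf.
    + move=> x _; rewrite -EFinM lee_fin ler_wpM2r ?normal_pdf_ge0//.
      by rewrite ge_min lexx.
  - exact/measurable_EFinP.
  - apply: (@le_lt_trans _ _ (\int[normal_prob 0%R s]_x (n%:R)%:E)%E).
      apply: ge0_le_integral => //.
      + by apply: measurableT_comp => //; exact/measurable_EFinP.
      + move=> x _; rewrite abse_EFin ger0_norm ?lee_fin ?ge_min ?lexx ?orbT//.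
        by rewrite le_min f0/=.
    by rewrite integral_cst//= probability_setT mule1 ltry.
apply/integrableP; split; first exact/measurable_EFinP.
under eq_integral do rewrite /= ger0_norm//.
apply: (@le_lt_trans _ _ (\int[mu]_x (f x * normal_pdf 0 s x)%:E)%E); last first.
  have /integrableP[_] := intf.
  by under eq_integral do rewrite /= ger0_norm ?mulr_ge0 ?normal_pdf_ge0//.
have lim x : (Num.min (f x) n%:R)%:E @[n --> \oo] --> (f x)%:E.
  apply: cvg_near_cst; near=> n; rewrite min_l//.
  near: n; exists (Num.truncn `|f x|).+1 => // n /= xn.
  apply: ltW; apply: (le_lt_trans (ler_norm _)); apply: (lt_le_trans (truncnS_gt _)).
  by rewrite ler_nat.
have -> : (\int[normal_prob 0%R s]_x (f x)%:E = \int[normal_prob 0%R s]_x limn (fun n : nat => (Num.min (f x) n%:R)%:E))%E.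
  by apply: eq_integral => x _; apply/esym/cvg_lim.
rewrite monotone_convergence//.
- apply: lime_le; last by near=> n; exact: key.
  apply: ereal_nondecreasing_is_cvgn => a b ab; apply: ge0_le_integral => //.
  + by move=> x _; rewrite lee_fin le_min f0/=.
  + by apply/measurable_EFinP/measurable_minr.
  + by apply/measurable_EFinP/measurable_minr.
  + by move=> x _; rewrite lee_fin le_min !ge_min lexx/= ler_nat ab orbT.
- by move=> n; apply/measurable_EFinP/measurable_minr.
- by move=> n x _; rewrite lee_fin le_min f0/=.
- by move=> x _ a b ab; rewrite lee_fin le_min !ge_min lexx/= ler_nat ab orbT.
Unshelve. all: by end_near. Qed.

Section law.
Context d (T : measurableType d) (P : probability T R) (Y : T -> R).
Hypothesis mY : measurable_fun setT Y.
Hypothesis lawY : forall B, measurable B -> P (Y @^-1` B) = normal_prob 0 s B.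

Let Ym : {mfun T >-> measurableTypeR R} := HB.pack Y (isMeasurableFun.Build _ _ _ (measurableTypeR R) _ mY).

Let transfer (f : R -> R) : measurable_fun setT f -> (normal_prob 0 s).-integrable setT (EFin \o f) ->
  L1 P (fun x => f (Y x)) /\ mean P (fun x => f (Y x)) = \int[mu]_x (f x * normal_pdf 0 s x).
Proof.
move=> mf /integrableP[mf' intf].
have Lf : L1 P (fun x => f (Y x)).
  apply/integrableP; split; first by apply/measurable_EFinP; exact: measurableT_comp.
  move: intf; rewrite (@eq_measure_integral _ _ _ setT (distribution P Ym) (normal_prob 0 s)).
    by rewrite ge0_integral_distribution//; do 2 apply: measurableT_comp => //.
  by move=> A mA _; exact: esym (lawY mA).
split => //; rewrite /mean /Rintegral; congr fine.
under [RHS]eq_integral do rewrite EFinM.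
rewrite -integral_normal_prob//.
rewrite (@eq_measure_integral _ _ _ setT (distribution P Ym) (normal_prob 0 s)).
  by rewrite integral_distribution.
by move=> A mA _; exact: esym (lawY mA).
Qed.

Lemma normal_mean : L1 P Y /\ mean P Y = 0.
Proof.
rewrite -normal_pdf_moment1; apply: (transfer (f := id)) => //.
apply: (@le_integrable _ _ R (normal_prob 0 s) setT measurableT (EFin \o id) (EFin \o (fun x : R => 1 + x ^+ 2))) => //.
- exact/measurable_EFinP.
- move=> x _ /=; rewrite lee_fin [X in _ <= X]ger0_norm ?addr_ge0 ?sqr_ge0//.
  have := sqr_ge0 (`|x| - 1); rewrite -(real_normK (num_real x)); nra.
apply: ge0_integral_normal_prob.
- by apply: measurable_funD => //; apply: measurable_funX.
- by move=> x; rewrite addr_ge0 ?sqr_ge0.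
under eq_fun do rewrite mulrDl EFinD.
by apply: integrableD.
Qed.

Lemma normal_sq : L1 P (fun x => Y x ^+ 2) /\ mean P (fun x => Y x ^+ 2) = s ^+ 2.
Proof.
rewrite -normal_pdf_moment2; apply: (transfer (f := fun x => x ^+ 2)).
  exact: measurable_funX.
by apply: ge0_integral_normal_prob => //; first [exact: measurable_funX|move=> x; exact: sqr_ge0].
Qed.

Lemma normal_pow4 : L1 P (fun x => Y x ^+ 4) /\ mean P (fun x => Y x ^+ 4) = 3 * s ^+ 4.
Proof.
rewrite -normal_pdf_moment4; apply: (transfer (f := fun x => x ^+ 4)).
  exact: measurable_funX.
by apply: ge0_integral_normal_prob => //; first [exact: measurable_funX|move=> x; exact: exprn_even_ge0].
Qed.

End law.

End GaussianMoments.

(** * Measurability and Brownian increments *)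

Section MeasurableWrt.
Context (S : pointedType) (R : realType) (G : set (set S)).
Hypothesis hG : sigma_algebra setT G.
Implicit Types f g : S -> R.

(** Bridge to measurable functions on the type generated by [G], whose closure properties then
    become available for every [F t]. *)
Lemma mwrP f : measurable_wrt G f <-> measurable_fun setT (f : g_sigma_algebraType G -> R).
Proof.
split => [mf _ B mB|mf B mB].
  by rewrite setTI; apply: sub_gen_smallest; exact: mf.
have := mf measurableT B mB; rewrite setTI /measurable/=.
by rewrite sigma_algebra_id.
Qed.

Lemma mwr_cst c : measurable_wrt G (fun=> c : R).
Proof. by apply/mwrP; exact: measurable_cst. Qed.

Lemma mwrD f g : measurable_wrt G f -> measurable_wrt G g -> measurable_wrt G (fun x => f x + g x).
Proof. by move=> /mwrP mf /mwrP mg; apply/mwrP; exact: measurable_funD. Qed.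

Lemma mwrM f g : measurable_wrt G f -> measurable_wrt G g -> measurable_wrt G (fun x => f x * g x).
Proof. by move=> /mwrP mf /mwrP mg; apply/mwrP; exact: measurable_funM. Qed.

Lemma mwr_comp (h : R -> R) f : measurable_fun setT h -> measurable_wrt G f ->
  measurable_wrt G (fun x => h (f x)).
Proof.
move=> mh mf B mB; have := mf (h @^-1` B); apply.
by rewrite -[X in measurable X]setTI; exact: mh.
Qed.

Lemma mwrN f : measurable_wrt G f -> measurable_wrt G (fun x => - f x).
Proof. by apply: mwr_comp; exact: oppr_measurable. Qed.

Lemma mwrB f g : measurable_wrt G f -> measurable_wrt G g -> measurable_wrt G (fun x => f x - g x).
Proof. by move=> mf mg; apply: mwrD => //; exact: mwrN. Qed.

Lemma mwr_sum (I : Type) (s : seq I) (p : pred I) (f : I -> S -> R) :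
  (forall i, p i -> measurable_wrt G (f i)) ->
  measurable_wrt G (fun x => \sum_(i <- s | p i) f i x).
Proof.
move=> mf; elim: s => [|i s IH].
  under eq_fun do rewrite big_nil; exact: mwr_cst.
case: (boolP (p i)) => pi.
  by under eq_fun do rewrite big_cons pi; apply: mwrD => //; apply: mf.
by under eq_fun do rewrite big_cons (negbTE pi).
Qed.

Lemma mwr_indic E : G E -> measurable_wrt G (fun x => \1_E x : R).
Proof.
move=> GE; apply/mwrP; have := @measurable_indic _ (g_sigma_algebraType G) R setT E; apply.
by apply: sub_gen_smallest.
Qed.

End MeasurableWrt.

Lemma mwr_sub (S : Type) (R : realType) (G H : set (set S)) (f : S -> R) :
  G `<=` H -> measurable_wrt G f -> measurable_wrt H f.
Proof. by move=> GH mf B mB; apply: GH; apply: mf. Qed.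

(** * Independence from a generated sigma-algebra *)

Section Independence.
Context d (T : measurableType d) (R : realType) (P : probability T R).

Lemma mwr_meas (G : set (set T)) (f : T -> R) : G `<=` measurable ->
  measurable_wrt G f -> measurable_fun setT f.
Proof. by move=> Gm mf _ B mB; rewrite setTI; apply: Gm; apply: mf. Qed.

Lemma indep_comp (G : set (set T)) (Y : T -> R) (h : R -> R) : measurable_fun setT h ->
  indep P G Y -> indep P G (fun x => h (Y x)).
Proof.
move=> mh iY E B GE mB; have := iY E (h @^-1` B) GE; apply.
by rewrite -[X in measurable X]setTI; exact: mh.
Qed.

(** Pi-lambda argument: for fixed B the finite measures A -> P(A and Y in B) and A -> P(Y in B) P(A)
    agree on a pi-system containing the whole space. *)
Lemma indep_gen (G : set (set T)) (Y : T -> R) : G `<=` measurable -> setI_closed G -> G setT ->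
  measurable_fun setT Y -> indep P G Y -> indep P <<s G>> Y.
Proof.
move=> Gm GI GT mY iY E B GE mB.
have mYB : measurable (Y @^-1` B) by rewrite -[X in measurable X]setTI; exact: mY.
pose m1 : {measure set T -> \bar R} := mrestr P mYB.
have p0 : (0 <= fine (P (Y @^-1` B))) by rewrite fine_ge0.
pose m2 : {measure set T -> \bar R} := mscale (NngNum p0) P.
have fP A : measurable A -> P A \is a fin_num by move=> mA; exact: fin_num_measure.
have E12 : m1 E = m2 E.
  apply: (@g_sigma_algebra_measure_unique _ _ _ G Gm (fun=> setT)) => //.
  - by rewrite bigcup_const.
  - move=> A GA; rewrite /m1 /m2/= /mrestr /mscale/= iY// muleC fineK//; exact: fP.
  - move=> k; rewrite /m1 /= /mrestr setTI ltey_eq fP//.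
have := E12; rewrite /m1 /m2/= /mrestr /mscale/= => ->.
by rewrite muleC fineK//; exact: fP.
Qed.

End Independence.

Section Brownian.
Context d (T : measurableType d) (R : realType) (P : probability T R) (F : R -> set (set T)).
Hypothesis hF : complete_filtration P F.
Context (I : finType) (W : I -> R -> T -> R).
Hypothesis hW : brownian_family P F W.

Lemma filt_sigma t : 0 <= t -> sigma_algebra setT (F t).
Proof. by case: hF => h _ _ _; exact: h. Qed.

Lemma filt_meas t : 0 <= t -> F t `<=` measurable.
Proof. by case: hF => _ h _ _; exact: h. Qed.

Lemma filt_mono s t : 0 <= s -> s <= t -> F s `<=` F t.
Proof. by case: hF => _ _ h _; exact: h. Qed.

Lemma adapted_meas t (X : T -> R) : 0 <= t -> measurable_wrt (F t) X -> measurable_fun setT X.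
Proof. by move=> t0; apply: mwr_meas; exact: filt_meas. Qed.

Lemma filtT t : 0 <= t -> F t setT.
Proof.
move=> t0; have [h0 hC _] := filt_sigma t0.
by rewrite -(setD0 setT); apply: hC.
Qed.

Variables s t : R.
Hypotheses (s0 : 0 <= s) (st : s < t).
Let t0 : 0 <= t. Proof. exact: le_trans s0 (ltW st). Qed.
Let dW i x := W i t x - W i s x.

Let Wad i u : 0 <= u -> measurable_wrt (F u) (W i u).
Proof. by case: hW => _ _ h _; exact: h. Qed.

Lemma bm_incr_adapted i : measurable_wrt (F t) (dW i).
Proof.
apply: (mwrB (filt_sigma t0)); first exact: Wad.
by apply: (mwr_sub (filt_mono s0 (ltW st))); exact: Wad.
Qed.

Lemma bm_incr_meas i : measurable_fun setT (dW i).
Proof. by apply: (adapted_meas t0); exact: bm_incr_adapted. Qed.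

Let N := normal_prob 0%R (Num.sqrt (t - s)) : set R -> \bar R.

Let joint E (B : I -> set R) : F s E -> (forall i, measurable (B i)) ->
  P [set x | E x /\ forall i, B i (dW i x)] = (P E * \prod_i N (B i))%E.
Proof. by case: hW => _ _ _ h FE mB; exact: (h s t s0 st E FE B mB). Qed.

Let NT : N setT = 1%E. Proof. exact: probability_setT. Qed.

Let single E i B : F s E -> measurable B ->
  P (E `&` dW i @^-1` B) = (P E * N B)%E.
Proof.
move=> FE mB; have := @joint E (fun j => if j == i then B else setT) FE.
rewrite (bigD1 i)//= eqxx big1 ?mule1; last by move=> j /negbTE ->.
move=> <-; last by move=> j; case: ifP => _ //; exact: measurableT.
congr (P _); apply/seteqP; split => x [Ex /= Bx]; split => //.
  by move=> j; case: eqP => // ->.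
by have := Bx i; rewrite eqxx.
Qed.

Let double E i j B C : i != j -> F s E -> measurable B -> measurable C ->
  P (E `&` dW i @^-1` B `&` dW j @^-1` C) = (P E * N B * N C)%E.
Proof.
move=> ij FE mB mC.
have := @joint E (fun k => if k == i then B else if k == j then C else setT) FE.
have eji : (j == i) = false by rewrite eq_sym (negbTE ij).
rewrite (bigD1 i)//= (bigD1 j) /=; last by rewrite eji.
rewrite !eqxx ?eji ?eqxx big1 ?mule1; last first.
  by move=> k /andP[/negbTE -> /negbTE ->].
rewrite -muleA => <-; last by move=> k; do 2 case: ifP => _ //; exact: measurableT.
congr (P _); apply/seteqP; split => x /=.
  by move=> [[Ex Bx] Cx]; split => // k; case: eqP => [->//|_]; case: eqP => [->|].
move=> [Ex h]; split; [split => //|].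
  by have := h i; rewrite eqxx.
by have := h j; rewrite eji eqxx.
Qed.

Lemma bm_law i B : measurable B -> P (dW i @^-1` B) = N B.
Proof.
by move=> mB; have := single i (filtT s0) mB; rewrite setTI probability_setT mul1e.
Qed.

Lemma bm_indep i : indep P (F s) (dW i).
Proof. by move=> E B FE mB; rewrite bm_law// single. Qed.

Let sd0 : 0 < Num.sqrt (t - s). Proof. by rewrite sqrtr_gt0 subr_gt0. Qed.
Let sd2 : Num.sqrt (t - s) ^+ 2 = t - s. Proof. by rewrite sqr_sqrtr// subr_ge0 ltW. Qed.

Lemma bm_L2 i : L2 P (dW i).
Proof.
split; first exact: bm_incr_meas.
by have [] := normal_sq sd0 (bm_incr_meas i) (@bm_law i).
Qed.

Lemma bm_pow4 i : L1 P (fun x => dW i x ^+ 4) /\ mean P (fun x => dW i x ^+ 4) = 3 * (t - s) ^+ 2.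
Proof.
have := normal_pow4 sd0 (bm_incr_meas i) (@bm_law i).
have -> : Num.sqrt (t - s) ^+ 4 = (t - s) ^+ 2 by rewrite -{2}sd2 -exprM.
by [].
Qed.

Lemma bm_moment1 i al : measurable_wrt (F s) al -> L1 P al ->
  L1 P (fun x => al x * dW i x) /\ mean P (fun x => al x * dW i x) = 0.
Proof.
move=> mal Lal; have [h1 h2] := normal_mean sd0 (bm_incr_meas i) (@bm_law i).
have [h3 ->] := indep_mean mal Lal h1 (@bm_indep i).
by split => //; rewrite h2 mulr0.
Qed.

Lemma bm_moment2 i al : measurable_wrt (F s) al -> L1 P al ->
  L1 P (fun x => al x * (dW i x * dW i x)) /\
  mean P (fun x => al x * (dW i x * dW i x)) = mean P al * (t - s).
Proof.
move=> mal Lal; have [h1 h2] := normal_sq sd0 (bm_incr_meas i) (@bm_law i).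
rewrite -[X in mean P al * X]sd2 -h2.
apply: (indep_mean mal Lal h1).
apply: (@indep_comp _ _ _ _ _ (dW i) (fun x => x ^+ 2)); [exact: measurable_funX|exact: bm_indep].
Qed.

(** The variable al dW_i is not measurable for [F s]. It is measurable for the sigma-algebra
    generated by [F s] and dW_i, from which dW_j is independent because of the joint law tested on
    the pi-system [G]. *)
Lemma bm_moment11 i j al : i != j -> measurable_wrt (F s) al -> L1 P al ->
  L1 P (fun x => al x * (dW i x * dW j x)) /\
  mean P (fun x => al x * (dW i x * dW j x)) = 0.
Proof.
move=> ij mal Lal.
pose G : set (set T) := [set X | exists E B, [/\ F s E, measurable B & X = E `&` dW i @^-1` B]].
have sF := filt_sigma s0.
have FI : setI_closed (F s).
  by move=> A B FA FB; have [_ _ _ h] := (sigma_algebraP (fun X _ => @subsetT _ X)).1 sF; exact: h.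
have mdW k B : measurable B -> measurable (dW k @^-1` B).
  by move=> mB; rewrite -[X in measurable X]setTI; exact: bm_incr_meas.
have Gm : G `<=` measurable.
  by move=> _ [E [B [FE mB ->]]]; apply: measurableI; [exact: (filt_meas s0)|exact: mdW].
have GI : setI_closed G.
  move=> _ _ [E [B [FE mB ->]]] [E' [B' [FE' mB' ->]]].
  exists (E `&` E'), (B `&` B'); split; [exact: FI|exact: measurableI|].
  by rewrite preimage_setI setIACA.
have GT : G setT.
  by exists setT, setT; split; [exact: filtT|exact: measurableT|rewrite preimage_setT setIT].
have iG : indep P G (dW j).
  move=> _ B' [E [B [FE mB ->]]] mB'.
  by rewrite double// single// bm_law.
have iGs := indep_gen Gm GI GT (bm_incr_meas j) iG.
have sG : sigma_algebra setT <<s G>> by exact: smallest_sigma_algebra.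
have m1 : measurable_wrt <<s G>> (fun x => al x * dW i x).
  apply: (mwrM sG).
    move=> B mB; apply: sub_gen_smallest; exists (al @^-1` B), setT; split.
    - exact: mal.
    - exact: measurableT.
    - by rewrite preimage_setT setIT.
  move=> B mB; apply: sub_gen_smallest; exists setT, B; split => //.
  - exact: filtT.
  - by rewrite setTI.
have [L _] := bm_moment1 i mal Lal.
have [h1 h2] := normal_mean sd0 (bm_incr_meas j) (@bm_law j).
have := indep_mean m1 L h1 iGs.
rewrite h2 mulr0.
by have -> : (fun x => al x * dW i x * dW j x) = (fun x => al x * (dW i x * dW j x)) by apply/funext => x; rewrite mulrA.
Qed.

End Brownian.

(** * Discrete Ito sums *)

Section LimitInProbability.
Context d (T : measurableType d) (R : realType) (P : probability T R).
Implicit Types X Y Z D S al : T -> R.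

Definition pr (A : set T) : R := fine (P A).

Lemma mean_indic A : measurable A -> mean P (fun x => \1_A x) = pr A.
Proof. by move=> mA; rewrite /mean /Rintegral integral_indic// setIT. Qed.

Lemma L1_indic A : measurable A -> L1 P (fun x => \1_A x).
Proof. by move=> mA; exact: integrable_indic. Qed.

(** Reduces a bound on a mean to bounded variables, for which convergence in probability is strong
    enough. *)
Lemma mean_trunc X B : L1 P X -> (forall x, 0 <= X x) ->
  (forall n : nat, mean P (fun x => Num.min (X x) n%:R) <= B) -> mean P X <= B.
Proof.
move=> LX X0 hB.
have mX := L1_meas LX.
have Lm n : L1 P (fun x => Num.min (X x) n%:R).
  apply: L1_le LX; first exact: measurable_minr.
  by move=> x; rewrite ger0_norm ?ge_min ?lexx// le_min X0/=.
have : (\int[P]_x (Num.min (X x) n%:R)%:E)%E @[n --> \oo] --> (\int[P]_x (X x)%:E)%E.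
  apply: (@dominated_cvg _ _ _ P setT measurableT _ _ (EFin \o X)) => //.
  - by move=> n; apply/measurable_EFinP/measurable_minr.
  - move=> x _; apply: cvg_near_cst; near=> n; rewrite min_l//.
    near: n; exists (Num.truncn `|X x|).+1 => // n /= xn.
    apply: ltW; apply: (le_lt_trans (ler_norm _)); apply: (lt_le_trans (truncnS_gt _)).
    by rewrite ler_nat.
  - move=> n x _; rewrite lee_fin /= ger0_norm ?ge_min ?lexx// le_min X0/=.
    by rewrite ler0n.
move=> h; rewrite -lee_fin.
have -> : ((mean P X)%:E = \int[P]_x (X x)%:E)%E.
  by rewrite /mean /Rintegral fineK//; exact: integrable_fin_num LX.
rewrite -(cvg_lim _ h)//; apply: lime_le; first by apply/cvg_ex; eexists; exact: h.
near=> n; have := hB n; rewrite -lee_fin; congr (_ <= _)%E.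
by rewrite /mean /Rintegral fineK//; exact: (integrable_fin_num _ (Lm n)).
Unshelve. all: by end_near. Qed.

Lemma measurable_gt_set X e : measurable_fun setT X -> measurable [set x | e < `|X x|].
Proof.
move=> mX; rewrite (_ : [set _ | _] = (fun x => `|X x|) @^-1` `]e, +oo[%classic).
  rewrite -[X in measurable X]setTI.
  have mn : measurable_fun setT (fun x => `|X x|) by apply: measurableT_comp.
  by apply: mn => //; exact: measurable_itv.
by apply/seteqP; split => x /=; rewrite in_itv/= andbT.
Qed.

Variables (D Y : T -> R) (B : R).
Hypotheses (LD : L2 P D) (LY : L2 P Y) (B0 : 0 <= B).

(** Second-moment bounds survive limits in probability. Where S is within e of D, (D - Y)^2 <= (1 +
    eta) (S - Y)^2 + (1 + 1/eta) e^2; elsewhere the truncated square costs at most n times a small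
    probability. *)
Lemma lim_prob_sq :
  (forall e del, 0 < e -> 0 < del -> exists2 S, L2 P S &
    mean P (fun x => (S x - Y x) ^+ 2) <= B /\ pr [set x | e < `|S x - D x|] <= del) ->
  mean P (fun x => (D x - Y x) ^+ 2) <= B.
Proof.
move=> H; have LDY := L2B LD LY.
apply: mean_trunc; [exact: L2_sq|by move=> x; exact: sqr_ge0|move=> n].
have Lm : L1 P (fun x => Num.min ((D x - Y x) ^+ 2) n%:R).
  apply: L1_le (L2_sq LDY).
    by apply: measurable_minr => //; exact: L1_meas (L2_sq LDY).
  by move=> x; rewrite ger0_norm ?ge_min ?lexx// le_min sqr_ge0/=.
apply/ler_addgt0Pr => r r0.
(* The three errors eta B, (1 + 1/eta) e^2 and n del each receive a third of the tolerance r. *)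
pose eta := r / (3 * (B + 1)).
have eta0 : 0 < eta by rewrite divr_gt0// mulr_gt0// ltr_wpDl.
pose e := Num.min 1 (r / (3 * (1 + eta^-1))).
have i0 : 0 < 1 + eta^-1 by rewrite ltr_wpDl// invr_gt0.
have e0 : 0 < e by rewrite lt_min ltr01/= divr_gt0// mulr_gt0.
pose del := r / (3 * (n%:R + 1)).
have n1 : 0 < n%:R + 1 :> R by rewrite ltr_wpDl.
have del0 : 0 < del by rewrite divr_gt0// mulr_gt0.
have [S LS [SB Sdel]] := H e del e0 del0.
pose A := [set x | e < `|S x - D x|].
have mA : measurable A by apply: measurable_gt_set; exact: (L2_meas (L2B LS LD)).
have LSY := L2B LS LY.
have LA := L1_indic mA.
apply: (@le_trans _ _ (mean P (fun x => (1 + eta) * (S x - Y x) ^+ 2 +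
   ((1 + eta^-1) * e ^+ 2 + n%:R * \1_A x)))).
  apply: mean_le => //.
    apply: L1D; first by apply: L1Z; exact: L2_sq.
    by apply: L1D; [exact: L1_cst|exact: L1Z].
  move=> x; have [xA|xA] := pselect (A x).
    rewrite indicE mem_set// mulr1; apply: (@le_trans _ _ n%:R).
      by rewrite ge_min lexx orbT.
    rewrite addrA lerDr addr_ge0// mulr_ge0// ?sqr_ge0//; apply: ltW => //.
    by rewrite ltr_wpDr// ltW.
  rewrite indicE memNset// mulr0 addr0; apply: (@le_trans _ _ ((D x - Y x) ^+ 2)).
    by rewrite ge_min lexx.
  have : `|D x - S x| <= e by rewrite distrC leNgt; apply/negP.
  have -> : D x - Y x = (D x - S x) + (S x - Y x) by ring.
  move: (D x - S x) (S x - Y x) => u v ue.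
  have u2 : u ^+ 2 <= e ^+ 2.
    by rewrite -(real_normK (num_real u)) lerXn2r// nnegrE ltW.
  have ei : eta * eta^-1 = 1 by rewrite divff// gt_eqF.
  have : 0 <= eta^-1 * (eta * v - u) ^+ 2 by rewrite mulr_ge0 ?sqr_ge0// invr_ge0 ltW.
  have -> : eta^-1 * (eta * v - u) ^+ 2 = eta * eta^-1 * eta * v ^+ 2 - 2 * (eta * eta^-1) * u * v + eta^-1 * u ^+ 2 by ring.
  rewrite ei => h.
  have : (1 + eta^-1) * u ^+ 2 <= (1 + eta^-1) * e ^+ 2 by rewrite ler_wpM2l// ltW.
  nra.
rewrite meanD; [|by apply: L1Z; exact: L2_sq|by apply: L1D; [exact: L1_cst|exact: L1Z]].
rewrite meanD; [|exact: L1_cst|exact: L1Z].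
rewrite mean_cst !meanZ//; last exact: L2_sq.
rewrite mean_indic//.
have h1 : eta * B <= r / 3.
  rewrite /eta mulrAC ler_pdivrMr ?mulr_gt0//; last by rewrite ltr_wpDl.
  nra.
have h2 : (1 + eta^-1) * e ^+ 2 <= r / 3.
  apply: (@le_trans _ _ ((1 + eta^-1) * e)).
    apply: ler_wpM2l; first exact: ltW.
    by rewrite expr2 ler_piMr ?(ltW e0)// ge_min lexx.
  have : e <= r / (3 * (1 + eta^-1)) by rewrite ge_min lexx orbT.
  rewrite ler_pdivlMr ?mulr_gt0//; nra.
have h3 : n%:R * pr A <= r / 3.
  apply: (@le_trans _ _ (n%:R * del)); first by rewrite ler_wpM2l.
  rewrite /del mulrA ler_pdivrMr ?mulr_gt0//; nra.
nra.
Qed.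

(** The uniform L2 bound supplies uniform integrability, so vanishing means also pass to the limit:
    |S - D| <= e + M 1_A + |S - D|^2 / M, with A the event that S and D differ by more than e. *)
Lemma lim_prob_mean al K : measurable_fun setT al -> (forall x, `|al x| <= K) ->
  (forall e del, 0 < e -> 0 < del -> exists2 S, L2 P S &
    [/\ mean P (fun x => (S x - Y x) ^+ 2) <= B, mean P (fun x => al x * S x) = 0 &
      pr [set x | e < `|S x - D x|] <= del]) ->
  mean P (fun x => al x * D x) = 0.
Proof.
move=> mal alK H.
have DYB : mean P (fun x => (D x - Y x) ^+ 2) <= B.
  by apply: lim_prob_sq => e del e0 del0; have [S LS [? ? ?]] := H e del e0 del0; exists S.
apply/eqP; rewrite -normr_le0; apply/ler_addgt0Pr => r r0; rewrite add0r.
have K0 : 0 <= `|K| by [].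
pose K1 := `|K| + 1.
have K1p : 0 < K1 by rewrite ltr_wpDl.
pose e := r / (3 * K1); have e0 : 0 < e by rewrite divr_gt0// mulr_gt0.
(* S - D has second moment at most 4B, so this M makes K1 (4B) / M at most r / 3. *)
pose M := (12 * K1 * (B + 1)) / r.
have B1 : 0 < B + 1 by rewrite ltr_wpDl.
have M0 : 0 < M by rewrite divr_gt0// !mulr_gt0.
pose del := r / (3 * K1 * M); have del0 : 0 < del by apply: divr_gt0 => //; apply: mulr_gt0 => //; exact: mulr_gt0.
have [S LS [SB S0 Sdel]] := H e del e0 del0.
pose A := [set x | e < `|S x - D x|].
have LSD := L2B LS LD.
have mA : measurable A by apply: measurable_gt_set; exact: (L2_meas LSD).
have LA := L1_indic mA.
have -> : mean P (fun x => al x * D x) = mean P (fun x => - (al x * (S x - D x))).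
  have -> : (fun x => - (al x * (S x - D x))) = (fun x => al x * D x - al x * S x).
    by apply/funext => x; ring.
  rewrite meanB ?S0 ?subr0//; apply: (L1M_bnd mal alK); exact: L2_L1.
pose V x := (S x - D x) ^+ 2.
have LV : L1 P V by exact: L2_sq.
apply: (@le_trans _ _ (mean P (fun x => K1 * (e + (M * \1_A x + M^-1 * V x))))).
  apply: mean_norm_le.
  - by apply: L1N; apply: (L1M_bnd mal alK); exact: L2_L1.
  - by apply: L1Z; apply: L1D; [exact: L1_cst|apply: L1D; exact: L1Z].
  move=> x; rewrite normrN normrM; apply: ler_pM => //.
    by rewrite (le_trans (alK x))// (le_trans (ler_norm K))// lerDl.
  rewrite /V -(real_normK (num_real (S x - D x))).
  have [xA|xA] := pselect (A x); last first.
    rewrite indicE memNset// mulr0 add0r.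
    have : `|S x - D x| <= e by rewrite leNgt; apply/negP.
    by move=> h; rewrite (le_trans h)// lerDl mulr_ge0 ?sqr_ge0// invr_ge0 ltW.
  rewrite indicE mem_set// mulr1; move: `|S x - D x| => v.
  have ei : M * M^-1 = 1 by rewrite divff// gt_eqF.
  have : 0 <= M^-1 * (v - M) ^+ 2 by rewrite mulr_ge0 ?sqr_ge0// invr_ge0 ltW.
  have -> : M^-1 * (v - M) ^+ 2 = M^-1 * v ^+ 2 - 2 * (M * M^-1) * v + M * M^-1 * M by ring.
  rewrite ei.
  have : 0 <= M^-1 * v ^+ 2 by rewrite mulr_ge0 ?sqr_ge0// invr_ge0 ltW.
  nra.
have L3 : L1 P (fun x => M * \1_A x + M^-1 * V x) by apply: L1D; exact: L1Z.
rewrite meanZ; last by apply: L1D => //; exact: L1_cst.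
rewrite meanD//; last exact: L1_cst.
rewrite mean_cst meanD; [|exact: L1Z..].
rewrite !meanZ// mean_indic//.
have VB : mean P V <= 4 * B.
  apply: (@le_trans _ _ (mean P (fun x => 2 * (S x - Y x) ^+ 2 + 2 * (D x - Y x) ^+ 2))).
    apply: mean_le => //.
      by apply: L1D; apply: L1Z; apply: L2_sq; exact: L2B.
    move=> x; rewrite /V; have -> : S x - D x = (S x - Y x) - (D x - Y x) by ring.
    by move: (S x - Y x) (D x - Y x) => u v; have := sqr_ge0 (u + v); nra.
  rewrite meanD; [|by apply: L1Z; apply: L2_sq; exact: L2B..].
  rewrite !meanZ; [|by apply: L2_sq; exact: L2B..].
  lra.
have h1 : K1 * e <= r / 3.
  by rewrite /e invfM mulrA mulrA mulrC !mulrA mulVf ?gt_eqF// mul1r.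
have h2 : K1 * (M * pr A) <= r / 3.
  apply: (@le_trans _ _ (K1 * (M * del))).
    by apply: ler_wpM2l; [exact: ltW|apply: ler_wpM2l => //; exact: ltW].
  have KM : K1 * M != 0 by rewrite mulf_neq0// gt_eqF.
  rewrite /del le_eqVlt; apply/orP; left; apply/eqP.
  by field; rewrite !gt_eqF.
have h3 : K1 * (M^-1 * mean P V) <= r / 3.
  apply: (@le_trans _ _ (K1 * (M^-1 * (4 * B)))).
    by apply: ler_wpM2l; [exact: ltW|apply: ler_wpM2l => //; rewrite invr_ge0 ltW].
  have -> : K1 * (M^-1 * (4 * B)) = (r / 3) * (B / (B + 1)).
    by rewrite /M; field; rewrite !gt_eqF.
  rewrite ler_piMr ?divr_ge0 ?ltW// ltr_pdivrMr//; lra.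
rewrite !mulrDr; lra.
Qed.

End LimitInProbability.

(** * Discrete Ito isometry *)

Section DiscreteIto.
Context d (T : measurableType d) (R : realType) (P : probability T R) (F : R -> set (set T)).
Hypothesis hF : complete_filtration P F.
Context (I : finType) (W : I -> R -> T -> R).
Hypothesis hW : brownian_family P F W.
Implicit Types (c : I -> R -> T -> R) (a b : R).

Definition istep (c0 : I -> T -> R) a b x := \sum_i c0 i x * (W i b x - W i a x).

Fixpoint isum c a (s : seq R) x :=
  if s is b :: s' then istep (c ^~ a) a b x + isum c b s' x else 0.

(** Cross terms between different noises vanish because the coefficients are known at time a; only
    the squares remain in the last clause. *)
Lemma istep_facts (c0 : I -> T -> R) K a b : 0 <= a -> a < b ->
  (forall i, measurable_wrt (F a) (c0 i)) -> (forall i x, `|c0 i x| <= K) ->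
  [/\ L2 P (istep c0 a b), measurable_wrt (F b) (istep c0 a b),
      (forall al, measurable_wrt (F a) al -> L2 P al ->
         mean P (fun x => al x * istep c0 a b x) = 0) &
      mean P (fun x => istep c0 a b x ^+ 2) = (b - a) * \sum_i mean P (fun x => c0 i x ^+ 2)].
Proof.
move=> a0 ab mc cK.
have b0 := le_trans a0 (ltW ab).
have mcT i : measurable_fun setT (c0 i) by exact: (adapted_meas hF a0).
have sA := filt_sigma hF a0.
have Lc i : L2 P (c0 i) by apply: (@L2_bnd _ _ _ _ K).
split.
- apply: L2_sum => i _; apply: (@L2M_bnd _ _ _ _ K) => //; exact: (bm_L2 hF hW a0 ab i).
- apply: (mwr_sum (filt_sigma hF b0)) => i _; apply: (mwrM (filt_sigma hF b0)).
    exact: (mwr_sub (filt_mono hF a0 (ltW ab))).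
  exact: (bm_incr_adapted hF hW a0 ab).
- move=> al mal Lal.
  have h i := bm_moment1 hF hW a0 ab i (mwrM sA mal (mc i)) (L2M Lal (Lc i)).
  under eq_fun do rewrite /istep mulr_sumr.
  rewrite mean_sum; last first.
    by move=> i _; have [+ _] := h i; congr L1; apply/funext => x; rewrite mulrA.
  rewrite big1// => i _; have [_ <-] := h i.
  by congr mean; apply/funext => x; rewrite mulrA.
have hij i j : L1 P (fun x => (c0 i x * c0 j x) * ((W i b x - W i a x) * (W j b x - W j a x))) /\
    mean P (fun x => (c0 i x * c0 j x) * ((W i b x - W i a x) * (W j b x - W j a x))) =
    if i == j then (b - a) * mean P (fun x => c0 i x ^+ 2) else 0.
  case: eqP => [<-|/eqP ij].
    have [h1 h2] := bm_moment2 hF hW a0 ab i (mwrM sA (mc i) (mc i)) (L2M (Lc i) (Lc i)).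
    by split => //; rewrite h2 mulrC.
  exact: (bm_moment11 hF hW a0 ab ij (mwrM sA (mc i) (mc j)) (L2M (Lc i) (Lc j))).
have -> : (fun x => istep c0 a b x ^+ 2) = (fun x => \sum_i \sum_j (c0 i x * c0 j x) * ((W i b x - W i a x) * (W j b x - W j a x))).
  apply/funext => x; rewrite expr2 /istep mulr_suml; apply: eq_bigr => i _.
  by rewrite mulr_sumr; apply: eq_bigr => j _; ring.
rewrite mean_sum; last by move=> i _; apply: L1_sum => j _; have [] := hij i j.
rewrite mulr_sumr; apply: eq_bigr => i _.
rewrite mean_sum; last by move=> j _; have [] := hij i j.
rewrite (bigD1 i)//= big1 ?addr0; last first.
  by move=> j ji; have [_ ->] := hij i j; rewrite eq_sym (negbTE ji).
by have [_ ->] := hij i i; rewrite eqxx.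
Qed.

(** Induction along the partition. The first step is orthogonal to the rest of the sum, which is why
    the mean-zero clause is carried through the induction for every square-integrable [al] known at
    the left endpoint. *)
Lemma isum_facts c K B a (s : seq R) : 0 <= a -> path <%R a s ->
  (forall t i, a <= t -> measurable_wrt (F t) (c i t)) ->
  (forall t i x, a <= t -> `|c i t x| <= K) ->
  (forall t, a <= t -> t <= last a s -> \sum_i mean P (fun x => c i t x ^+ 2) <= B) ->
  [/\ L2 P (isum c a s),
      (forall al, measurable_wrt (F a) al -> L2 P al -> mean P (fun x => al x * isum c a s x) = 0) &
      mean P (fun x => isum c a s x ^+ 2) <= B * (last a s - a)].
Proof.
elim: s a => [|b s IH] a a0 /=.
  move=> _ _ _ _; split; first exact: L2_cst.
    by move=> al _ _; under eq_fun do rewrite mulr0; exact: mean_cst.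
  by under eq_fun do rewrite expr0n; rewrite mean_cst subrr mulr0.
move=> /andP[ab pbs] mc cK cB.
have b0 := le_trans a0 (ltW ab).
have bl : b <= last b s.
  move: pbs; clear; elim: s b => //= c s IH b /andP[bc /IH h].
  exact: le_trans (ltW bc) h.
have [L2b mb lb] := IH b b0 pbs (fun t i bt => mc t i (le_trans (ltW ab) bt))
   (fun t i x bt => cK t i x (le_trans (ltW ab) bt))
   (fun t bt tl => cB t (le_trans (ltW ab) bt) tl).
have [L2s ms s0 ssq] := istep_facts a0 ab (fun i => mc a i (lexx a)) (fun i x => cK a i x (lexx a)).
split.
- exact: L2D.
- move=> al mal Lal; under eq_fun do rewrite mulrDr.
  rewrite meanD; [|exact: L2M..]; rewrite s0// add0r mb//.
  exact: (mwr_sub (filt_mono hF a0 (ltW ab))).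
under eq_fun do rewrite sqrrD mulr2n -addrA.
rewrite meanD; [|exact: L2_sq|apply: L1D; [apply: L1D; exact: L2M|exact: L2_sq]].
rewrite meanD; [|apply: L1D; exact: L2M|exact: L2_sq].
rewrite meanD; [|exact: L2M..].
rewrite mb// addr0 add0r ssq.
have := cB a (lexx a) (le_trans (ltW ab) bl).
move: (\sum_i _) => q qB; move: lb; move: (mean P _) => u ub.
have : (b - a) * q <= (b - a) * B by rewrite ler_wpM2l// subr_ge0 ltW.
nra.
Qed.

End DiscreteIto.

(** * Time integrals along paths *)

Section TimeIntegral.
Variable R : realType.
Local Notation mu := (@lebesgue_measure R).

(** Epsilon-delta form of continuity on the closed half-line, so that negative times never enter. *)
Definition wcont (V : normedModType R) (g : R -> V) : Prop :=
  forall x, 0 <= x -> forall e, 0 < e -> exists2 del, 0 < del &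
    forall y, 0 <= y -> `|y - x| < del -> `|g y - g x| < e.

Lemma wcontP (V : normedModType R) (g : R -> V) :
  {within `[0, +oo[, continuous g} <-> wcont g.
Proof.
have inP (x : R) : x \in `[0, +oo[ = (0 <= x) by rewrite in_itv/= andbT.
split => [/subspace_continuousP cg x x0 e e0|cg].
  have /cvgrPdist_lt/(_ e e0) : g y @[y --> within `[0, +oo[%classic (nbhs x)] --> g x.
    by apply: cg; rewrite /= inP.
  rewrite /prop_near1/within/= => -[/= del del0 H]; exists del => // y y0 yx.
  by rewrite distrC; apply: H => //=; rewrite ?inP// distrC.
apply/subspace_continuousP => x; rewrite /= inP => x0; apply/cvgrPdist_lt => e e0.
have [del del0 H] := cg x x0 e e0; exists del => //= y /= yx; rewrite inP => y0.
by rewrite distrC; apply: H => //; rewrite distrC.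
Qed.

(** Heine's theorem, through the near-covering form of compactness. *)
Lemma wcont_unif (g : R -> R) a b e : wcont g -> 0 <= a -> 0 < e ->
  exists2 del, 0 < del & forall x y, a <= x <= b -> a <= y <= b -> `|y - x| < del -> `|g y - g x| < e.
Proof.
move=> cg a0 e0.
pose Q (del x : R) := forall y, a <= x <= b -> a <= y <= b -> `|y - x| < del -> `|g y - g x| < e.
have /compact_near_coveringP /(_ R (0^'+) Q _) : compact (`[a, b]%classic : set R) by exact: segment_compact.
move=> /(_ _)[].
  move=> x; rewrite /= in_itv/= => /andP[ax xb].
  have e2 : 0 < e / 2 by rewrite divr_gt0.
  have [del del0 H] := cg x (le_trans a0 ax) _ e2.
  have d2 : 0 < del / 2 by rewrite divr_gt0.
  exists ([set z | `|x - z| < del / 2], [set t | t < del / 2]) => /=.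
    by split; [exists (del / 2)|exact: nbhs_right_lt].
  move=> [z t] /= [zx tdel] y /andP[az zb] /andP[ay yb] yz.
  have h1 : `|g z - g x| < e / 2.
    by apply: H; [exact: le_trans az|rewrite distrC; lra].
  have h2 : `|g y - g x| < e / 2.
    apply: H; first exact: le_trans ay.
    have -> : y - x = (y - z) - (x - z) by ring.
    by apply: (le_lt_trans (ler_normB _ _)); lra.
  have -> : g y - g z = (g y - g x) - (g z - g x) by ring.
  by apply: (le_lt_trans (ler_normB _ _)); lra.
move=> del0 /= del00 H; exists (del0 / 2); first by rewrite divr_gt0.
move=> x y axb ayb yx; apply: (H (del0 / 2)) => //=.
- rewrite sub0r normrN gtr0_norm ?divr_gt0//; lra.
- by rewrite divr_gt0.
Qed.

Definition tint (g : R -> R) (t : R) : R := \int[mu]_(s in `[0, t]) g s.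

Lemma wcont_integrable g t : wcont g -> mu.-integrable `[0, t] (EFin \o g).
Proof.
move=> /wcontP cg; apply: continuous_compact_integrable; first exact: segment_compact.
apply: continuous_subspaceW cg => x /=; rewrite !in_itv/= => /andP[-> _]//.
Qed.

Lemma tint_sub g a b : wcont g -> 0 <= a -> a <= b ->
  tint g b - tint g a = \int[mu]_(s in `]a, b]) g s.
Proof.
move=> cg a0 ab; rewrite /tint; apply: Rintegral_itvB; rewrite ?bnd_simp//.
exact: wcont_integrable.
Qed.

Lemma tint_step g a b e : wcont g -> 0 <= a -> a <= b ->
  (forall r, a <= r <= b -> `|g r - g a| <= e) ->
  `|tint g b - tint g a - (b - a) * g a| <= e * (b - a).
Proof.
move=> cg a0 ab ge.
have iab : mu.-integrable `]a, b] (EFin \o g).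
  apply: integrableS (wcont_integrable b cg) => //.
  move=> x /=; rewrite !in_itv/= => /andP[ax ->]; rewrite andbT.
  exact: (le_trans a0 (ltW ax)).
have muab : mu `]a, b] = (b - a)%:E.
  rewrite lebesgue_measure_itv/= lte_fin; case: ltP => // ba.
  by have -> : a = b by [apply/eqP; rewrite eq_le ab ba]; rewrite subrr.
have ic c : mu.-integrable `]a, b] (EFin \o cst c).
  apply/integrableP; split; first by apply/measurable_EFinP; exact: measurable_cst.
  by rewrite (eq_integral (cst (`|c|%:E)))// integral_cst//= muab -EFinM; exact: ltry.
have cstE c : \int[mu]_(s in `]a, b]) c = (b - a) * c.
  transitivity (c * fine (mu `]a, b]%classic)); first exact: Rintegral_cst.
  by rewrite muab/= mulrC.
rewrite tint_sub//.
have -> : (b - a) * g a = \int[mu]_(s in `]a, b]) g a.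
  by rewrite cstE.
rewrite -RintegralB//; last exact: ic.
have iB : mu.-integrable `]a, b] (EFin \o (fun s => g s - g a)).
  by apply: (@integrableB _ _ _ mu _ _ (EFin \o g) (EFin \o cst (g a))) => //; exact: ic.
apply: (le_trans (le_normr_Rintegral _ iB)) => //.
have -> : e * (b - a) = \int[mu]_(s in `]a, b]) e by rewrite cstE mulrC.
apply: le_Rintegral => //.
- exact: (integrable_norm iB).
- exact: ic.
by move=> x /=; rewrite in_itv/= => /andP[ax xb]; apply: ge; rewrite ltW.
Qed.

(** Left-point sums serve in place of Fubini in time and probability: being finite sums, they
    inherit adaptedness and commute with expectations. *)
Definition riem (g : R -> R) a b (N : nat) : R :=
  \sum_(i < N.+1) (b - a) / N.+1%:R * g (a + (b - a) / N.+1%:R * i%:R).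

Lemma riem_cvg g a b : wcont g -> 0 <= a -> a <= b ->
  riem g a b N @[N --> \oo] --> tint g b - tint g a.
Proof.
move=> cg a0 ab; apply/cvgrPdist_le => e e0.
pose e1 := e / (b - a + 1).
have ba1 : 0 < b - a + 1 by rewrite ltr_wpDl// subr_ge0.
have e10 : 0 < e1 by rewrite divr_gt0.
have [del del0 H] := wcont_unif b cg a0 e10.
near=> N.
have N0 : 0 < N.+1%:R :> R by [].
pose dl := (b - a) / N.+1%:R.
have dl0 : 0 <= dl by rewrite divr_ge0// subr_ge0.
have dldel : dl < del.
  have : (b - a) / del < N.+1%:R.
    near: N; exists (Num.truncn `|(b - a) / del|).+1 => // n /= nn.
    apply: (le_lt_trans (ler_norm _)); apply: (lt_le_trans (truncnS_gt _)).
    by rewrite ler_nat (leq_trans nn).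
  by rewrite ltr_pdivrMr// => h; rewrite /dl ltr_pdivrMr// mulrC.
pose tt (i : nat) := a + dl * i%:R.
have tt0 : tt 0%N = a by rewrite /tt mulr0 addr0.
have ttN : tt N.+1 = b by rewrite /tt /dl divfK ?gt_eqF// addrC subrK.
have ttS i : tt i.+1 = tt i + dl by rewrite /tt mulrSr mulrDr mulr1 addrA.
have tta i : a <= tt i by rewrite /tt lerDl mulr_ge0.
have ttb i : (i <= N.+1)%N -> tt i <= b.
  by move=> iN; rewrite -ttN /tt lerD2l ler_wpM2l// ler_nat.
have -> : tint g b - tint g a = \sum_(i < N.+1) (tint g (tt i.+1) - tint g (tt i)).
  rewrite -(big_mkord xpredT (fun i => tint g (tt i.+1) - tint g (tt i))).
  by rewrite telescope_sumr// ttN tt0.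
rewrite /riem -sumrB.
apply: (le_trans (ler_norm_sum _ _ _)).
apply: (@le_trans _ _ (\sum_(i < N.+1) e1 * dl)); last first.
  rewrite sumr_const card_ord -mulr_natr -mulrA divfK ?gt_eqF//.
  rewrite /e1 mulrAC ler_pdivrMr//.
  by rewrite ler_pM2l// lerDl.
apply: ler_sum => i _; rewrite -/dl -/(tt i).
have -> : dl = tt i.+1 - tt i by rewrite ttS addrAC subrr add0r.
apply: tint_step => //; [exact: le_trans (tta _)|by rewrite ttS lerDl|].
move=> r /andP[r1 r2]; apply: ltW; apply: H.
- by rewrite tta ttb// ltnW.
- by rewrite (le_trans (tta i))//= (le_trans r2)// ttb.
- by rewrite ger0_norm ?subr_ge0//; move: r2; rewrite ttS; lra.
Unshelve. all: by end_near. Qed.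

Lemma riem_bound g a b K N : a <= b -> (forall r, a <= r <= b -> `|g r| <= K) ->
  `|riem g a b N| <= (b - a) * K.
Proof.
move=> ab gK; apply: (le_trans (ler_norm_sum _ _ _)).
have N0 : 0 < N.+1%:R :> R by [].
have dl0 : 0 <= (b - a) / N.+1%:R by rewrite divr_ge0// subr_ge0.
apply: (@le_trans _ _ (\sum_(i < N.+1) (b - a) / N.+1%:R * K)).
  apply: ler_sum => i _; rewrite normrM (ger0_norm dl0) ler_wpM2l//; apply: gK.
  rewrite lerDl mulr_ge0//= -lerBrDl.
  rewrite -[X in _ <= X]mulr1 -mulrA ler_wpM2l ?subr_ge0//.
  by rewrite mulrC ler_pdivrMr// mul1r ler_nat ltnW.
rewrite sumr_const card_ord -[X in X <= _]mulr_natr.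
have -> // : forall y, y != 0 -> (b - a) / y * K * y = (b - a) * K by move=> y y0; field.
Qed.

Lemma tint_bound g a b K : wcont g -> 0 <= a -> a <= b ->
  (forall r, a <= r <= b -> `|g r| <= K) -> `|tint g b - tint g a| <= (b - a) * K.
Proof.
move=> cg a0 ab gK; have h : `|riem g a b N| @[N --> \oo] --> `|tint g b - tint g a| by apply: cvg_norm; exact: riem_cvg.
rewrite -(cvg_lim _ h)//; apply: limr_le; first by apply/cvg_ex; eexists; exact: h.
by near=> N; exact: riem_bound.
Unshelve. all: by end_near. Qed.

End TimeIntegral.

(** * Adapted time integrals and their expectations *)

Section ProcessIntegral.
Context d (T : measurableType d) (R : realType) (P : probability T R) (F : R -> set (set T)).
Hypothesis hF : complete_filtration P F.

(** Null sets belong to [F 0], hence to every [F t], so a change on a null set preserves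
    measurability. *)
Lemma mwr_ae t (X Y : T -> R) : 0 <= t -> {ae P, forall x, X x = Y x} ->
  measurable_wrt (F t) Y -> measurable_wrt (F t) X.
Proof.
move=> t0 [N [mN PN sN]] mY B mB.
have sF := filt_sigma hF t0.
have [h0 hC hU] := sF.
have nF A : A `<=` N -> F t A.
  move=> AN; apply: (filt_mono hF (lexx 0) t0); case: hF => _ _ _; apply.
  by exists N; split.
have -> : X @^-1` B = ((Y @^-1` B) `\` N) `|` (X @^-1` B `&` N).
  apply/seteqP; split => x /=.
    move=> Bx; have [Nx|Nx] := pselect (N x); [by right|left; split => //].
    suff <- : X x = Y x by [].
    by apply: contrapT => h; apply: Nx; exact: sN.
  move=> [[Bx Nx]|[]//]; suff -> : X x = Y x by [].
  by apply: contrapT => h; apply: Nx; exact: sN.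
have [FT FD _ FI] := (sigma_algebraP (fun X _ => @subsetT _ X)).1 sF.
have FU A A' : F t A -> F t A' -> F t (A `|` A').
  move=> FA FA'; rewrite -bigcup2E; apply: hU => -[|[|n]] //=; exact: h0.
apply: FU; last by apply: nF => x [].
by rewrite setDE -setTD; apply: FI; [exact: mY|apply: hC; exact: nF].
Qed.

Lemma mwr_ae_cvg t (X : T -> R) (Xn : nat -> T -> R) : 0 <= t ->
  (forall n, measurable_wrt (F t) (Xn n)) ->
  {ae P, forall x, Xn n x @[n --> \oo] --> X x} -> measurable_wrt (F t) X.
Proof.
move=> t0 mX [N [mN PN sN]].
have sF := filt_sigma hF t0.
have FN : F t (~` N).
  rewrite -setTD; have [_ hC _] := sF; apply: hC.
  by apply: (filt_mono hF (lexx 0) t0); case: hF => _ _ _; apply; exists N; split.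
(* Multiplying by the indicator of the complement of the null set makes the sequence converge
   everywhere. *)
apply: (@mwr_ae _ _ (fun x => \1_(~` N) x * X x)) => //.
  exists N; split => // x /=; apply: contra_notP => Nx.
  by rewrite indicE mem_set// mul1r.
apply/(mwrP sF); apply: (@measurable_fun_cvg _ (g_sigma_algebraType (F t)) R setT (fun n x => \1_(~` N) x * Xn n x)).
  by move=> n; apply/(mwrP sF)/(mwrM sF) => //; exact: mwr_indic.
move=> x _; have [Nx|Nx] := pselect (N x).
  rewrite indicE memNset ?mul0r; last by move=> /=; apply.
  by under eq_fun do rewrite mul0r; exact: cvg_cst.
rewrite indicE mem_set//; under eq_fun do rewrite mul1r.
by rewrite mul1r; apply: contrapT => h; apply: Nx; exact: sN.
Qed.

Lemma mean_cvg (X : T -> R) (Xn : nat -> T -> R) K : measurable_fun setT X ->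
  (forall n, measurable_fun setT (Xn n)) -> (forall n, {ae P, forall x, `|Xn n x| <= K}) ->
  {ae P, forall x, Xn n x @[n --> \oo] --> X x} ->
  mean P (Xn n) @[n --> \oo] --> mean P X.
Proof.
move=> mX mXn XK cX.
have [] := @dominated_convergence _ _ _ P setT measurableT (fun n => EFin \o Xn n) (EFin \o X) (fun=> K%:E).
- by move=> n; exact/measurable_EFinP.
- exact/measurable_EFinP.
- apply: filterS cX => x h _; apply: (@cvg_EFin _ _ _ _ (fun n => (Xn n x)%:E)) => //; by near=> n.
- exact: (L1_cst P K).
- have := ae_foralln XK; apply: filterS => x h n _; by rewrite lee_fin.
move=> iX _ h.
have -> : mean P X = fine (\int[P]_x (EFin \o X) x)%E by [].
apply: fine_cvg; rewrite fineK//; last exact: integrable_fin_num iX.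
Unshelve. all: by end_near. Qed.

Variables (g : R -> T -> R) (K : R).
Hypothesis gad : forall t, 0 <= t -> measurable_wrt (F t) (g t).
Hypothesis gK : forall t x, 0 <= t -> `|g t x| <= K.
Hypothesis gc : {ae P, forall x, wcont (g ^~ x)}.

Let K0 : 0 <= K.
Proof.
have [x _] : exists x : T, True by exists point.
exact: (le_trans (normr_ge0 _) (gK x (lexx 0))).
Qed.

Lemma riem_adapted a b N : 0 <= a -> a <= b -> measurable_wrt (F b) (fun x => riem (g ^~ x) a b N).
Proof.
move=> a0 ab; have b0 := le_trans a0 ab; have sF := filt_sigma hF b0.
have N0 : 0 < N.+1%:R :> R by [].
apply: (mwr_sum sF) => i _; apply: (mwrM sF); first exact: mwr_cst.
apply: (mwr_sub (filt_mono hF _ _)); last apply: gad.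
- by rewrite addr_ge0// mulr_ge0// divr_ge0// subr_ge0.
- rewrite -lerBrDl -[X in _ <= X]mulr1 -mulrA ler_wpM2l ?subr_ge0//.
  by rewrite mulrC ler_pdivrMr// mul1r ler_nat ltnW.
- by rewrite addr_ge0// mulr_ge0// divr_ge0// subr_ge0.
Qed.

Lemma tint_adapted t : 0 <= t -> measurable_wrt (F t) (fun x => tint (g ^~ x) t).
Proof.
move=> t0; apply: (@mwr_ae_cvg _ _ (fun N x => riem (g ^~ x) 0 t N)) => //.
  by move=> n; exact: riem_adapted.
apply: filterS gc => x cx; have := riem_cvg cx (lexx 0) t0.
suff -> : tint (g ^~ x) 0 = 0 by rewrite subr0.
by rewrite /tint set_itv1 Rintegral_set1.
Qed.

Lemma tint_ae_bound a b : 0 <= a -> a <= b ->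
  {ae P, forall x, `|tint (g ^~ x) b - tint (g ^~ x) a| <= (b - a) * K}.
Proof.
move=> a0 ab; apply: filterS gc => x cx; apply: tint_bound => // r /andP[ar _].
by apply: gK; exact: le_trans ar.
Qed.

(** Expectation and time integral are exchanged at the level of Riemann sums; bounded convergence
    then applies along almost every path. *)
Lemma mean_tint (al : T -> R) (Ka a b : R) : 0 <= a -> a <= b -> measurable_fun setT al -> (forall x, `|al x| <= Ka) ->
  riem (fun r => mean P (fun x => al x * g r x)) a b N @[N --> \oo] -->
  mean P (fun x => al x * (tint (g ^~ x) b - tint (g ^~ x) a)).
Proof.
move=> a0 ab mal alK; have b0 := le_trans a0 ab.
have N0 (N : nat) : 0 < N.+1%:R :> R by [].
have tt0 N i : 0 <= a + (b - a) / N.+1%:R * i%:R :> R.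
  by rewrite addr_ge0// mulr_ge0// divr_ge0// subr_ge0.
have Lg r : 0 <= r -> L1 P (fun x => al x * g r x).
  move=> r0; apply: (L1M_bnd mal alK); apply: (@L1_bnd _ _ _ _ K).
    by apply: (adapted_meas hF r0); exact: gad.
  by move=> x; exact: gK.
have -> : (fun N => riem (fun r => mean P (fun x => al x * g r x)) a b N) =
   (fun N => mean P (fun x => al x * riem (g ^~ x) a b N)).
  apply/funext => N; rewrite /riem.
  under [X in mean P X]eq_fun do rewrite mulr_sumr.
  rewrite mean_sum; last first.
    move=> i _; have := L1Z ((b - a) / N.+1%:R) (Lg _ (tt0 N i)).
    by congr L1; apply/funext => x; ring.
  apply: eq_bigr => i _; rewrite -meanZ; last exact: Lg.
  by congr mean; apply/funext => x; ring.
have mr N : measurable_fun setT (fun x => riem (g ^~ x) a b N).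
  by apply: (adapted_meas hF b0); exact: riem_adapted.
have Ka0 : 0 <= Ka by exact: (le_trans (normr_ge0 _) (alK point)).
apply: (@mean_cvg _ _ (Ka * ((b - a) * K))).
- apply: measurable_funM => //; apply: measurable_funB.
    by apply: (adapted_meas hF b0); exact: tint_adapted.
  by apply: (adapted_meas hF a0); exact: tint_adapted.
- by move=> N; exact: measurable_funM.
- move=> N; near=> x; rewrite normrM; apply: ler_pM => //; apply: riem_bound => // r /andP[ar _].
  by apply: gK; exact: le_trans ar.
apply: filterS gc => x cx; apply: cvgMr; exact: riem_cvg.
Unshelve. all: by end_near. Qed.

Lemma mean_tint_approx (al : T -> R) (Ka a b e : R) : 0 <= a -> a <= b -> measurable_fun setT al ->
  (forall x, `|al x| <= Ka) ->
  (forall r, a <= r <= b -> mean P (fun x => `|g r x - g a x|) <= e) ->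
  `|mean P (fun x => al x * (tint (g ^~ x) b - tint (g ^~ x) a)) -
    (b - a) * mean P (fun x => al x * g a x)| <= (b - a) * (Ka * e).
Proof.
move=> a0 ab mal alK ge; have h := mean_tint a0 ab mal alK.
have mg r : 0 <= r -> measurable_fun setT (g r).
  by move=> r0; apply: (adapted_meas hF r0); exact: gad.
have Lgg r : 0 <= r -> L1 P (g r).
  by move=> r0; apply: (@L1_bnd _ _ _ _ K); [exact: mg|move=> x; exact: gK].
have Lg r : 0 <= r -> L1 P (fun x => al x * g r x).
  by move=> r0; apply: (L1M_bnd mal alK); exact: Lgg.
set c := mean P (fun x => al x * g a x).
pose gm r := mean P (fun x => al x * g r x) - c.
have Ka0 : 0 <= Ka by exact: (le_trans (normr_ge0 _) (alK point)).
have h2 : riem gm a b N @[N --> \oo] -->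
   mean P (fun x => al x * (tint (g ^~ x) b - tint (g ^~ x) a)) - (b - a) * c.
  have -> : riem gm a b = (fun N => riem (fun r => mean P (fun x => al x * g r x)) a b N - (b - a) * c).
    apply/funext => N; rewrite /riem /gm.
    under eq_bigr do rewrite mulrBr.
    rewrite sumrB; congr (_ - _).
    rewrite sumr_const card_ord -[LHS]mulr_natr.
    by rewrite mulrAC divfK.
  by apply: cvgB => //; exact: cvg_cst.
have h3 : `|riem gm a b N| @[N --> \oo] -->
  `|mean P (fun x => al x * (tint (g ^~ x) b - tint (g ^~ x) a)) - (b - a) * c| by apply: cvg_norm.
rewrite -(cvg_lim _ h3)//; apply: limr_le; first by apply/cvg_ex; eexists; exact: h3.
near=> N; apply: riem_bound => // r /andP[ar rb].
have r0 := le_trans a0 ar.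
rewrite /gm /c -meanB; [|exact: Lg..].
apply: (@le_trans _ _ (mean P (fun x => Ka * `|g r x - g a x|))).
  apply: mean_norm_le.
  - by apply: L1B; exact: Lg.
  - by apply: L1Z; apply: L1_norm; apply: L1B; exact: Lgg.
  - by move=> x; rewrite -mulrBr normrM ler_wpM2r.
rewrite meanZ; last by apply: L1_norm; apply: L1B; exact: Lgg.
by rewrite ler_wpM2l// ge// ar rb.
Unshelve. all: by end_near. Qed.

End ProcessIntegral.

(** * Complex matrices in real coordinates *)

Section ComplexCoordinates.
Variable R : realType.
Local Notation C := R[i].
Implicit Types (x y z : C) (c : R).

(** Indexing the two real parts by a boolean treats both at once; a real coordinate of a matrix is
    then a triple of part, row and column. *)
Definition pt (e : bool) z : R := if e then complex.Im z else complex.Re z.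

Lemma ptD e x y : pt e (x + y) = pt e x + pt e y.
Proof. by case: e; case: x; case: y. Qed.
Lemma pt0 e : pt e 0 = 0. Proof. by case: e. Qed.
Lemma ptN e x : pt e (- x) = - pt e x. Proof. by case: e; case: x. Qed.
Lemma ptB e x y : pt e (x - y) = pt e x - pt e y. Proof. by rewrite ptD ptN. Qed.
Lemma ptZ e c x : pt e (c%:C%C * x) = c * pt e x.
Proof. by case: e; case: x => a b /=; rewrite mul0r ?subr0 ?addr0. Qed.
Lemma pt_sum (I : Type) (s : seq I) (p : pred I) (f : I -> C) e :
  pt e (\sum_(i <- s | p i) f i) = \sum_(i <- s | p i) pt e (f i).
Proof. by elim/big_ind2 : _ => [|x a y b <- <-|//]; rewrite ?pt0 ?ptD. Qed.

Lemma eq_pt x y : (forall e, pt e x = pt e y) -> x = y.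
Proof.
by case: x => a b; case: y => a' b' h; have /= -> := h false; have /= -> := h true.
Qed.

Lemma ptM e x y : pt e (x * y) =
  if e then pt false x * pt true y + pt true x * pt false y
  else pt false x * pt false y - pt true x * pt true y.
Proof. by case: e; case: x => a b; case: y => a' b' /=. Qed.

Lemma ptJ e x : pt e (x^*) = if e then - pt true x else pt false x.
Proof. by case: e; case: x. Qed.

(** An l1 norm with values in the reals, whereas the modulus of the library takes values in the
    complex numbers; it is still submultiplicative. *)
Definition nm z : R := `|pt false z| + `|pt true z|.

Lemma nm_ge0 z : 0 <= nm z. Proof. by rewrite addr_ge0. Qed.
Lemma nmM x y : nm (x * y) <= nm x * nm y.
Proof.
rewrite /nm !ptM; apply: (le_trans (lerD (ler_normB _ _) (ler_normD _ _))).
rewrite !normrM; lra.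
Qed.
Lemma nmD x y : nm (x + y) <= nm x + nm y.
Proof. rewrite /nm !ptD; have := ler_normD (pt false x) (pt false y); have := ler_normD (pt true x) (pt true y); lra. Qed.
Lemma nm0 : nm 0 = 0. Proof. by rewrite /nm !pt0 normr0 addr0. Qed.
Lemma nm_sum (I : Type) (s : seq I) (p : pred I) (f : I -> C) :
  nm (\sum_(i <- s | p i) f i) <= \sum_(i <- s | p i) nm (f i).
Proof.
elim/big_ind2 : _ => [|x a y b h1 h2|//]; first by rewrite nm0.
exact: (le_trans (nmD _ _) (lerD h1 h2)).
Qed.
Lemma nmZ c z : nm (c%:C%C * z) = `|c| * nm z.
Proof. by rewrite /nm !ptZ !normrM mulrDr. Qed.
Lemma nmN z : nm (- z) = nm z. Proof. by rewrite /nm !ptN !normrN. Qed.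

Section Coordinates.
Variables a b : nat.
Local Notation M := 'M[C]_(a, b).
Local Notation idx := (bool * 'I_a * 'I_b)%type.
Implicit Types u v : M.

Definition co u (i : idx) : R := pt i.1.1 (u i.1.2 i.2).
Definition ebase (i : idx) : M := (if i.1.1 then 'i%C else 1) *: delta_mx i.1.2 i.2.
Definition N1 u : R := \sum_i `|co u i|.

Lemma coD u v i : co (u + v) i = co u i + co v i. Proof. by rewrite /co mxE ptD. Qed.
Lemma coN u i : co (- u) i = - co u i. Proof. by rewrite /co mxE ptN. Qed.
Lemma coB u v i : co (u - v) i = co u i - co v i. Proof. by rewrite coD coN. Qed.
Lemma coZ c u i : co (c%:C%C *: u) i = c * co u i. Proof. by rewrite /co mxE ptZ. Qed.
Lemma co0 i : co 0 i = 0. Proof. by rewrite /co mxE pt0. Qed.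
Lemma co_sum (I : Type) (s : seq I) (p : pred I) (f : I -> M) i :
  co (\sum_(j <- s | p j) f j) i = \sum_(j <- s | p j) co (f j) i.
Proof. by elim/big_ind2 : _ => [|x y z t <- <-|//]; rewrite ?co0 ?coD. Qed.
Lemma eq_co u v : (forall i, co u i = co v i) -> u = v.
Proof. by move=> h; apply/matrixP => k j; apply: eq_pt => e; have := h (e, k, j). Qed.

Lemma co_ebase i j : co (ebase i) j = (i == j)%:R.
Proof.
case: i => -[e k] l; case: j => -[e' k'] l'; rewrite /co /ebase /= !mxE.
rewrite -pair_eqE/= -pair_eqE/= [k' == k]eq_sym [l' == l]eq_sym.
case: (k == k); case: e; case: e' => /=; case: (k == k') => /=; case: (l == l') => /=;
by rewrite ?mulr0 ?mulr1 ?mul1r ?subr0 ?add0r ?addr0 ?mul0r.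
Qed.

Lemma co_expand u : u = \sum_i (co u i)%:C%C *: ebase i.
Proof.
apply: eq_co => j; rewrite co_sum (bigD1 j)//= big1 ?addr0; last first.
  by move=> i ij; rewrite coZ co_ebase (negbTE ij) mulr0.
by rewrite coZ co_ebase eqxx mulr1.
Qed.

Lemma N1_ge0 u : 0 <= N1 u. Proof. by apply: sumr_ge0. Qed.
Lemma co_N1 u i : `|co u i| <= N1 u.
Proof. by rewrite /N1 (bigD1 i)//= lerDl sumr_ge0. Qed.
Lemma N1D u v : N1 (u + v) <= N1 u + N1 v.
Proof. by rewrite /N1 -big_split/=; apply: ler_sum => i _; rewrite coD ler_normD. Qed.
Lemma N1N u : N1 (- u) = N1 u.
Proof. by apply: eq_bigr => i _; rewrite coN normrN. Qed.
Lemma N1B u v : N1 (u - v) <= N1 u + N1 v.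
Proof. by rewrite -(N1N v) N1D. Qed.
Lemma N1_nm u : N1 u = \sum_k \sum_j nm (u k j).
Proof.
rewrite /N1 pair_big/=.
rewrite -(pair_big xpredT xpredT (fun (p : bool * 'I_a) j => `|co u (p, j)|))/=.
rewrite -(pair_big xpredT xpredT (fun (p : bool) k => \sum_j `|co u (p, k, j)|))/=.
rewrite big_bool/= -big_split/=; rewrite -(pair_big xpredT xpredT (fun k j => nm (u k j)))/=.
apply: eq_bigr => k _; rewrite -big_split/=; apply: eq_bigr => j _.
by rewrite /nm addrC.
Qed.

Lemma nm_N1 u k j : nm (u k j) <= N1 u.
Proof.
rewrite N1_nm (bigD1 k)//= (bigD1 j)//= -addrA lerDl addr_ge0//.
  by apply: sumr_ge0 => *; exact: nm_ge0.
by do 2 apply: sumr_ge0 => *; exact: nm_ge0.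
Qed.

Lemma sqr_sum_le (I : finType) (f : I -> R) : (\sum_i `|f i|) ^+ 2 <= #|I|%:R * \sum_i f i ^+ 2.
Proof.
apply: (@le_trans _ _ (\sum_i \sum_j (f i ^+ 2 / 2 + f j ^+ 2 / 2))).
  rewrite expr2 mulr_suml; apply: ler_sum => i _; rewrite mulr_sumr; apply: ler_sum => j _.
  rewrite -(real_normK (num_real (f i))) -(real_normK (num_real (f j))).
  move: `|f i| `|f j| => p q; have := sqr_ge0 (p - q); nra.
under eq_bigr do rewrite big_split/= sumr_const -mulr_suml.
rewrite big_split/= sumr_const sumrMnl -mulr_suml -[X in X + _]mulr_natl -[X in _ + X]mulr_natl.
by rewrite le_eqVlt; apply/orP; left; apply/eqP; field.
Qed.

Lemma N1_sq u : N1 u ^+ 2 <= #|{: idx}|%:R * \sum_i co u i ^+ 2.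
Proof. exact: sqr_sum_le. Qed.

End Coordinates.

(** Expanding the product entrywise and bounding each column sum of v by the sum over all entries;
    the terms added are nonnegative. *)
Lemma N1M a b l (u : 'M[C]_(a, b)) (v : 'M[C]_(b, l)) : N1 (u *m v) <= N1 u * N1 v.
Proof.
rewrite !N1_nm mulr_suml; apply: ler_sum => k _.
apply: (@le_trans _ _ (\sum_j \sum_q nm (u k q) * nm (v q j))).
  apply: ler_sum => j _; rewrite mxE; apply: (le_trans (nm_sum _ _ _)).
  by apply: ler_sum => q _; exact: nmM.
rewrite exchange_big/= mulr_suml; apply: ler_sum => q _.
rewrite -mulr_sumr ler_wpM2l ?nm_ge0//.
rewrite [X in _ <= X](bigD1 q)//= lerDl; do 2 apply: sumr_ge0 => *; exact: nm_ge0.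
Qed.

Lemma xy_norm_le a b (u : 'M[C]_(a, b)) e : 0 <= e ->
  (`|to_xy u| <= e) = [forall i, `|co u i| <= e].
Proof.
move=> e0; rewrite prod_normE /= ge_max.
have E (v : 'M[R]_(a, b)) : (`|v| <= e) = [forall ij, `|v ij.1 ij.2| <= e].
  rewrite [`|v|]mx_normrE; apply/idP/forallP => [h ij|h].
    by apply: le_trans h; rewrite (bigD1 ij)//= le_max lexx.
  by elim/big_ind : _ => // x y xe ye; rewrite ge_max xe ye.
rewrite !E; apply/andP/forallP => [[/forallP h1 /forallP h2] [[e' k] j]|h].
  have := h1 (k, j); have := h2 (k, j); rewrite !mxE /co /=.
  by case: e'.
split; apply/forallP => -[k j] /=; rewrite mxE.
  exact: h (false, k, j).
exact: h (true, k, j).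
Qed.

Lemma co_xy_norm a b (u : 'M[C]_(a, b)) i : `|co u i| <= `|to_xy u|.
Proof. by have := lexx `|to_xy u|; rewrite xy_norm_le// => /forallP; apply. Qed.

(** * Unitary matrices and the noise basis *)

Section Unitary.
Variable n : nat.
Implicit Types u v : 'M[C]_n.

Lemma unitary_row u k : u \is unitarymx -> \sum_j (pt false (u k j) ^+ 2 + pt true (u k j) ^+ 2) = 1.
Proof.
move=> /unitarymxP /matrixP/(_ k k); rewrite mxE [RHS]mxE eqxx => h.
have := f_equal (pt false) h; rewrite pt_sum => h1.
rewrite -[RHS]h1; apply: eq_bigr => j _.
by rewrite !mxE ptM !ptJ; ring.
Qed.

Lemma unitary_co u i : u \is unitarymx -> `|co u i| <= 1.
Proof.
case: i => -[e k] j /(unitary_row k); rewrite (bigD1 j)//= => h.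
have h2 : 0 <= \sum_(i < n | i != j) (pt false (u k i) ^+ 2 + pt true (u k i) ^+ 2).
  by apply: sumr_ge0 => l _; rewrite addr_ge0 ?sqr_ge0.
have : pt e (u k j) ^+ 2 <= 1.
  have := sqr_ge0 (pt false (u k j)); have := sqr_ge0 (pt true (u k j)); case: (e) => /=; lra.
by rewrite -(real_normK (num_real _)) expr_le1.
Qed.

Lemma unitary_N1 u : u \is unitarymx -> N1 u <= #|{: bool * 'I_n * 'I_n}|%:R.
Proof.
move=> hu; apply: (@le_trans _ _ (\sum_(i : bool * 'I_n * 'I_n) 1)).
  by apply: ler_sum => i _; exact: unitary_co.
by rewrite sumr_const.
Qed.

Definition noise_idx := (upper_pair n + upper_pair n + 'I_n)%type.

(** Orthonormal basis of the Lie algebra for -tr(AB)/2, indexed like [noise]. *)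
Definition Xb (b : upper_pair n + upper_pair n + 'I_n) : 'M[C]_n :=
  match b with
  | inl (inl p) => delta_mx (val p).1 (val p).2 - delta_mx (val p).2 (val p).1
  | inl (inr p) => 'i%C *: (delta_mx (val p).1 (val p).2 + delta_mx (val p).2 (val p).1)
  | inr j => ((Num.sqrt 2)%:C%C * 'i%C) *: delta_mx j j
  end.

Lemma big_noise (V : nmodType) (f : upper_pair n + upper_pair n + 'I_n -> V) :
  \sum_b f b = \sum_p (f (inl (inl p)) + f (inl (inr p))) + \sum_j f (inr j).
Proof.
by rewrite big_sumType/= big_sumType/= big_split.
Qed.

Lemma big_upper (V : nmodType) (f : 'I_n -> 'I_n -> V) :
  \sum_(p : upper_pair n) f (val p).1 (val p).2 = \sum_(l < n) \sum_(j < n | (l < j)%N) f l j.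
Proof.
rewrite pair_big_dep/= -(big_sub_cond (fun p : 'I_n * 'I_n => (p.1 < p.2)%N) xpredT (fun p => f p.1 p.2)).
by apply: eq_bigl => p; rewrite andbT.
Qed.

Lemma Xb_skew b p q : (Xb b p q)^* = - Xb b q p.
Proof.
have dJ (k j l r : 'I_n) : ((delta_mx k j l r : C))^* = delta_mx k j l r.
  by rewrite mxE; apply: eq_pt => -[]; case: (_ && _) => //=; rewrite oppr0.
have dT (k j l r : 'I_n) : (delta_mx k j l r : C) = delta_mx j k r l by rewrite !mxE andbC.
case: b => [[[[k j] kj]|[[k j] kj]]|j] /=.
- by rewrite !mxE rmorphB /= !conjC_nat opprB; congr (_%:R - _%:R); rewrite andbC.
- rewrite !mxE rmorphM rmorphD /= !conjC_nat.
  have -> : ('i%C)^* = - 'i%C :> C by apply: eq_pt => -[] /=; rewrite ?oppr0.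
  rewrite mulNr addrC; congr (- (_ * (_%:R + _%:R))); by rewrite andbC.
- rewrite !mxE !rmorphM /= conjC_nat.
  have -> : ('i%C)^* = - 'i%C :> C by apply: eq_pt => -[] /=; rewrite ?oppr0.
  have -> : ((Num.sqrt 2)%:C%C)^* = (Num.sqrt 2)%:C%C :> C by apply: eq_pt => -[] /=; rewrite ?oppr0.
  by rewrite mulrN mulNr andbC.
Qed.

(** The sum of the tensors of X_b with itself is -2 times the flip. For a pair l < j the
    antisymmetric and symmetric generators have the same squared terms up to the sign i^2 = -1, so
    only the products of E_lj with E_jl survive; the diagonal generators complete the formula. *)
Lemma casimir p q r s :
  \sum_b Xb b p q * Xb b r s = - 2 * ((p == s) && (q == r))%:R.
Proof.
rewrite big_noise.
pose dl (k j l m : 'I_n) : C := ((l == k) && (m == j))%:R.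
have h1 : \sum_(P : upper_pair n) (Xb (inl (inl P)) p q * Xb (inl (inl P)) r s +
    Xb (inl (inr P)) p q * Xb (inl (inr P)) r s) =
  \sum_(l < n) \sum_(j < n | (l < j)%N) - 2 * (dl l j p q * dl j l r s + dl j l p q * dl l j r s).
  rewrite -big_upper; apply: eq_bigr => -[[l j] lj] _ /=; rewrite !mxE /dl.
  have i2 : 'i%C * 'i%C = -1 :> C by rewrite -expr2 sqr_i.
  move: ((_ && _)%:R) ((_ && _)%:R) ((_ && _)%:R) ((_ && _)%:R) => x y z t.
  transitivity ((x - y) * (z - t) + ('i%C * 'i%C) * ((x + y) * (z + t))); first by ring.
  by rewrite i2; ring.
have h2 : \sum_(j < n) Xb (inr j) p q * Xb (inr j) r s = \sum_(j < n) - 2 * (dl j j p q * dl j j r s).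
  apply: eq_bigr => j _; rewrite /= !mxE /dl.
  have i2 : 'i%C * 'i%C = -1 :> C by rewrite -expr2 sqr_i.
  have s2 : (Num.sqrt 2)%:C%C * (Num.sqrt 2)%:C%C = 2 :> C.
    by rewrite -rmorphM -expr2 sqr_sqrtr// rmorph_nat.
  move: ((_ && _)%:R) ((_ && _)%:R) => x y.
  transitivity (((Num.sqrt 2)%:C%C * (Num.sqrt 2)%:C%C) * ('i%C * 'i%C) * (x * y)); first by ring.
  by rewrite i2 s2; ring.
rewrite h1 h2.
have -> : \sum_(l < n) \sum_(j < n | (l < j)%N) - 2 * (dl l j p q * dl j l r s + dl j l p q * dl l j r s) =
   - 2 * ((p < q)%N && (p == s) && (q == r))%:R - 2 * ((q < p)%N && (p == s) && (q == r))%:R :> C.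
  (* At most one ordered pair contributes to each double sum, and only when it is increasing. *)
  have hs (f : 'I_n -> 'I_n -> C) (x y : 'I_n) : (forall l j, (l, j) != (x, y) -> f l j = 0) ->
      \sum_(l < n) \sum_(j < n | (l < j)%N) f l j = (x < y)%N%:R * f x y.
    move=> hf; rewrite (bigD1 x)//= [X in _ + X]big1 ?addr0; last first.
      by move=> l lx; apply: big1 => j _; apply: hf; rewrite -pair_eqE/= (negbTE lx).
    rewrite big_mkcond (bigD1 y)//= big1 ?addr0; last first.
      by move=> j jy; case: ifP => // _; apply: hf; rewrite -pair_eqE/= (negbTE jy) andbF.
    by case: ifP; rewrite ?mul1r ?mul0r.
  under eq_bigr do under eq_bigr do rewrite mulrDr.
  under eq_bigr do rewrite big_split/=.
  rewrite big_split/= (hs (fun l j => - 2 * (dl l j p q * dl j l r s)) p q); last first.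
    move=> l j; rewrite -pair_eqE/= negb_and => h; rewrite /dl.
    by case/orP: h; rewrite eq_sym => /negbTE ->; rewrite ?andbF ?mul0r ?mulr0.
  rewrite (hs (fun l j => - 2 * (dl j l p q * dl l j r s)) q p); last first.
    move=> l j; rewrite -pair_eqE/= negb_and => h; rewrite /dl.
    by case/orP: h; rewrite eq_sym => /negbTE ->; rewrite ?andbF ?mul0r ?mulr0.
  rewrite /dl !eqxx !mul1r [r == q]eq_sym [s == p]eq_sym.
  by case: (q == r); case: (p == s); case: (p < q)%N; case: (q < p)%N => /=; ring.
have -> : \sum_(j < n) - 2 * (dl j j p q * dl j j r s) = - 2 * ((p == q) && (p == s) && (q == r))%:R :> C.
  rewrite (bigD1 p)//= big1 ?addr0; last first.
    by move=> j jp; rewrite /dl eq_sym (negbTE jp) mul0r mulr0.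
  rewrite /dl eqxx/= [q == p]eq_sym [s == p]eq_sym; case: (eqVneq p q) => [->|_] /=; last by rewrite mul0r.
  by rewrite [r == q]eq_sym andbC; case: (_ && _); rewrite ?mulr1 ?mulr0 ?mul1r.
case: (ltngtP p q) => [pq|pq|/val_inj pq]; rewrite /= ?mulr0 ?addr0 ?subr0 ?sub0r ?add0r.
- by rewrite (_ : (p == q) = false) ?mulr0 ?addr0//; apply/eqP => e; rewrite e ltnn in pq.
- by rewrite (_ : (p == q) = false) ?mulr0 ?addr0 ?mulNr//; apply/eqP => e; rewrite e ltnn in pq.
- by rewrite pq eqxx.
Qed.

End Unitary.
End ComplexCoordinates.

(** The continuous functions x / (x^2 + 1/(n+1)) converge to the inverse everywhere, including at 0,
    where the inverse is 0 by convention. *)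
Lemma measurable_inv (R : realType) : measurable_fun setT (fun x : R => x^-1).
Proof.
apply: (@measurable_fun_cvg _ _ R setT (fun n (x : R) => x * (x ^+ 2 + n.+1%:R^-1)^-1)).
  move=> n; apply: continuous_measurable_fun => x.
  apply: cvgM; first exact: cvg_id.
  apply: cvgV; first by rewrite gt_eqF// ltr_wpDl ?sqr_ge0// invr_gt0.
  by apply: cvgD; [exact: sqr_continuous|exact: cvg_cst].
move=> x _; have [->|x0] := eqVneq x 0.
  by under eq_fun do rewrite mul0r; rewrite invr0; exact: cvg_cst.
have -> : x^-1 = x * (x ^+ 2 + 0)^-1 by rewrite addr0 expr2 invfM mulrA divff// mul1r.
apply: cvgMr; apply: cvgV; first by rewrite addr0 sqrf_eq0.
by apply: cvgD; [exact: cvg_cst|exact: cvg_harmonic].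
Qed.

(** * Measurability of complex and matrix-valued maps *)

Section ComplexMeasurability.
Context (S : pointedType) (R : realType) (G : set (set S)).
Hypothesis hG : sigma_algebra setT G.
Local Notation C := R[i].

Definition cmw (f : S -> C) := forall e, measurable_wrt G (fun x => pt e (f x)).

Lemma cmw_cst c : cmw (fun=> c). Proof. by move=> e; exact: mwr_cst. Qed.
Lemma cmwD f g : cmw f -> cmw g -> cmw (fun x => f x + g x).
Proof. by move=> mf mg e; under eq_fun do rewrite ptD; exact: mwrD. Qed.
Lemma cmwN f : cmw f -> cmw (fun x => - f x).
Proof. by move=> mf e; under eq_fun do rewrite ptN; exact: mwrN. Qed.
Lemma cmwM f g : cmw f -> cmw g -> cmw (fun x => f x * g x).
Proof.
move=> mf mg e; under eq_fun do rewrite ptM; case: e.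
  by apply: mwrD => //; exact: mwrM.
by apply: mwrB => //; exact: mwrM.
Qed.
Lemma cmw_sum (I : Type) (s : seq I) (p : pred I) (f : I -> S -> C) :
  (forall i, p i -> cmw (f i)) -> cmw (fun x => \sum_(i <- s | p i) f i x).
Proof. by move=> mf e; under eq_fun do rewrite pt_sum; apply: mwr_sum => // i pi; exact: mf. Qed.
Lemma cmwV f : cmw f -> cmw (fun x => (f x)^-1).
Proof.
move=> mf e.
have E z : pt e (z^-1) = (if e then - pt true z else pt false z) * (pt false z ^+ 2 + pt true z ^+ 2)^-1.
  by case: (e); case: z => a b /=; rewrite ?mulNr.
under eq_fun do rewrite E.
apply: mwrM => //; first by case: (e); [exact: mwrN|].
apply: (mwr_comp (h := fun z => z^-1)); first exact: measurable_inv.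
by apply: mwrD => //; apply: (mwr_comp (h := fun z => z ^+ 2)) => //; exact: measurable_funX.
Qed.
Lemma cmw_pt (f : S -> R) : measurable_wrt G f -> cmw (fun x => (f x)%:C%C).
Proof. by move=> mf -[] //=; exact: mwr_cst. Qed.

Definition mmw (a b : nat) (X : S -> 'M[C]_(a, b)) := forall k j, cmw (fun x => X x k j).

Lemma mmw_cst a b (X : 'M[C]_(a, b)) : mmw (fun=> X). Proof. by move=> k j; exact: cmw_cst. Qed.
Lemma mmwM a b l (X : S -> 'M[C]_(a, b)) (Y : S -> 'M[C]_(b, l)) :
  mmw X -> mmw Y -> mmw (fun x => X x *m Y x).
Proof.
move=> mX mY k j e; under eq_fun do rewrite mxE; move: e.
by apply: cmw_sum => q _; exact: cmwM.
Qed.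
Lemma mmw_co a b (X : S -> 'M[C]_(a, b)) i : mmw X -> measurable_wrt G (fun x => co (X x) i).
Proof. by move=> mX; exact: mX. Qed.

End ComplexMeasurability.

(** * Partitions of small mesh *)

Section Partitions.
Variable R : realType.

(** Induction on the number of steps of length eta / 2 needed to reach b, the last step being
    possibly shorter. *)
Lemma partition_exists (a b eta : R) : 0 < eta -> a <= b ->
  exists2 s, path (fun x y => (x < y) && (y - x < eta)) a s & last a s = b.
Proof.
move=> eta0 ab.
have e2 : 0 < eta / 2 by rewrite divr_gt0.
have [N] : exists N : nat, b - a <= N%:R * (eta / 2).
  exists (Num.truncn `|(b - a) / (eta / 2)|).+1; rewrite -ler_pdivrMr//.
  by apply: (le_trans (ler_norm _)); apply: ltW; exact: truncnS_gt.
elim: N a ab => [|N IH] a ab.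
  rewrite mul0r subr_le0 => ba; exists [::] => //=.
  by apply/eqP; rewrite eq_le ab ba.
rewrite mulrSr mulrDl mul1r => h.
have [ba|ba] := leP b (a + eta / 2).
  move: ab; rewrite le_eqVlt => /predU1P[->|ab]; first by exists [::].
  by exists [:: b] => //=; rewrite ab andbT/=; lra.
have [||s ps ls] := IH (a + eta / 2); [exact: ltW|lra|].
by exists (a + eta / 2 :: s) => //=; rewrite ps andbT; apply/andP; split; lra.
Qed.

Lemma mesh_lt (s : seq R) eta : 0 < eta -> path (fun x y => y - x < eta) 0 s -> mesh s < eta.
Proof.
move=> eta0 /(pathP 0) ps; rewrite /mesh.
elim/big_ind : _ => // [x y xe ye|i _]; first by rewrite gt_max xe ye.
exact: ps.
Qed.

End Partitions.

Section LawExtra.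
Context d (T : measurableType d) (R : realType) (P : probability T R).

Lemma mean_le_ae (X Y : T -> R) : L1 P X -> L1 P Y -> {ae P, forall x, X x <= Y x} ->
  mean P X <= mean P Y.
Proof.
move=> LX LY XY; have mX := L1_meas LX; have mY := L1_meas LY.
have mm : measurable_fun setT (fun x => Num.min (X x) (Y x)) by exact: measurable_minr.
rewrite (@mean_ae _ _ _ P X (fun x => Num.min (X x) (Y x)))//; last first.
  by apply: filterS XY => x xy; rewrite min_l.
apply: mean_le => //; last by move=> x; rewrite ge_min lexx orbT.
apply: (@L1_le _ _ _ _ _ (fun x => `|X x| + `|Y x|)) => //.
  by move=> x; case: (leP (X x) (Y x)) => _; rewrite ?lerDl ?lerDr.
by apply: L1D; exact: L1_norm.
Qed.

Lemma L2_bnd_ae (X : T -> R) K : measurable_fun setT X -> {ae P, forall x, `|X x| <= K} -> L2 P X.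
Proof.
move=> mX XK; split => //.
have mX2 : measurable_fun setT (fun x => X x ^+ 2) by exact: measurable_funX.
apply/integrableP; split; first exact/measurable_EFinP.
apply: (@le_lt_trans _ _ (\int[P]_x (`|K| ^+ 2)%:E)%E); last first.
  by rewrite integral_cst//= probability_setT mule1 ltry.
apply: ae_ge0_le_integral => //.
- by apply: measurableT_comp => //; exact/measurable_EFinP.
- apply: filterS XK => x xK _ /=; rewrite lee_fin ger0_norm ?sqr_ge0//.
  rewrite -(real_normK (num_real (X x))) lerXn2r// ?nnegrE//.
  exact: (le_trans xK (ler_norm K)).
Qed.

Lemma pr_le (A B : set T) : measurable A -> measurable B -> A `<=` B -> pr P A <= pr P B.
Proof.
move=> mA mB AB; rewrite /pr fine_le//; [exact: fin_num_measure..|].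
by apply: le_measure => //; rewrite inE.
Qed.

Lemma pr_U (A B : set T) : measurable A -> measurable B -> pr P (A `|` B) <= pr P A + pr P B.
Proof.
move=> mA mB; rewrite /pr -fineD; [|exact: fin_num_measure..].
rewrite fine_le//.
- by apply: fin_num_measure; exact: measurableU.
- by rewrite fin_numD !fin_num_measure.
- exact: measureU2.
Qed.

End LawExtra.

(** * Increments of the unitary Brownian motion *)

Section UnitaryIncrements.
Context d (T : measurableType d) (R : realType) (P : probability T R) (F : R -> set (set T)).
Hypothesis hF : complete_filtration P F.
Variable n : nat.
Local Notation C := R[i].
Local Notation M := 'M[C]_n.
Local Notation idx := (bool * 'I_n * 'I_n)%type.
Local Notation nidx := (upper_pair n + upper_pair n + 'I_n)%type.

Lemma brownian_u_noise (A : R -> T -> M) : brownian_u P F A ->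
  exists2 W : nidx -> R -> T -> R, brownian_family P F W &
    forall t x, 0 <= t -> A t x = \sum_b (W b t x)%:C%C *: Xb R b.
Proof.
move=> [B [Bt [Bd [hW hA]]]]; exists (noise B Bt Bd) => // t x t0.
rewrite hA// big_noise/= big_split/=; congr (_ + _ + _).
- rewrite -(big_upper (fun l j => (B l j t x)%:C%C *: (delta_mx l j - delta_mx j l))).
  by apply: eq_bigr.
- rewrite -(big_upper (fun l j => (Bt l j t x)%:C%C *: (delta_mx l j + delta_mx j l))) scaler_sumr.
  by apply: eq_bigr => p _ /=; rewrite !scalerA mulrC.
Qed.

Variables (U A : R -> T -> M) (W : nidx -> R -> T -> R).
Hypothesis Uu : forall t x, 0 <= t -> U t x \is unitarymx.
Hypothesis Uad : mx_adapted F U.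
Hypothesis Uc : mx_continuous_paths P U.
Hypothesis hW : brownian_family P F W.
Hypothesis hAW : forall t x, 0 <= t -> A t x = \sum_b (W b t x)%:C%C *: Xb R b.
Hypothesis hI : forall t : R, 0 <= t -> ito_integral P U A t (fun x =>
          U t x - U 0 x +
          n%:R *: \matrix_(k, j) time_integral (fun s => U s x k j) t).

Lemma U_mmw t : 0 <= t -> mmw (F t) (U t).
Proof. by move=> t0 k j e; have [] := Uad t0 k j; case: e. Qed.

Lemma U_co_bound t x i : 0 <= t -> `|co (U t x) i| <= 1.
Proof. by move=> t0; apply: unitary_co; exact: Uu. Qed.

Lemma U_co_adapted t i : 0 <= t -> measurable_wrt (F t) (fun x => co (U t x) i).
Proof. by move=> t0; exact: U_mmw. Qed.

Lemma U_co_wcont i : {ae P, forall x, wcont (fun t => co (U t x) i)}.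
Proof.
apply: filterS Uc => x /wcontP cx t t0 e e0; have [del del0 H] := cx t t0 e e0.
exists del => // y y0 yt; apply: le_lt_trans (H y y0 yt).
have -> : to_xy (U y x) - to_xy (U t x) = to_xy (U y x - U t x).
  congr (_, _); apply/matrixP => k j; rewrite !mxE.
    by case: (U y x k j) => ? ?; case: (U t x k j).
  by case: (U y x k j) => ? ?; case: (U t x k j).
by rewrite -coB; exact: co_xy_norm.
Qed.

(** Coefficient of dW_b in the i-th real coordinate of V dA. *)
Definition noise_coef (V : M) (i : idx) (b : nidx) : R := co (V *m Xb R b) i.

Definition noise_const : R := \sum_(b : nidx) N1 (Xb R b).

Lemma noise_const_ge0 : 0 <= noise_const.
Proof. by apply: sumr_ge0 => b _; exact: N1_ge0. Qed.

Lemma noise_coef_le V i b : `|noise_coef V i b| <= N1 V * noise_const.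
Proof.
apply: (le_trans (co_N1 _ _)); apply: (le_trans (N1M _ _)).
rewrite ler_wpM2l ?N1_ge0// /noise_const (bigD1 b)//= lerDl sumr_ge0// => *; exact: N1_ge0.
Qed.

Lemma noise_coefB V V' i b : noise_coef (V - V') i b = noise_coef V i b - noise_coef V' i b.
Proof. by rewrite /noise_coef mulmxBl coB. Qed.

Let cU (i : idx) (b : nidx) (r : R) (x : T) := noise_coef (U r x) i b.
Let n2 : R := #|{: idx}|%:R.
Let K1 : R := n2 * noise_const.

Lemma noise_coef_unitary V i b : V \is unitarymx -> `|noise_coef V i b| <= K1.
Proof.
move=> hV; apply: (le_trans (noise_coef_le _ _ _)).
by rewrite ler_wpM2r ?noise_const_ge0// unitary_N1.
Qed.

Let cU_adapted i b r : 0 <= r -> measurable_wrt (F r) (cU i b r).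
Proof.
move=> r0; apply: mmw_co; apply: (mmwM (filt_sigma hF r0)); first exact: U_mmw.
exact: (mmw_cst (filt_sigma hF r0)).
Qed.

Let cU_bound i b r x : 0 <= r -> `|cU i b r x| <= K1.
Proof. by move=> r0; apply: noise_coef_unitary; exact: Uu. Qed.

Let left_sum_isum i a s x : 0 <= a -> path <%R a s ->
  co (\sum_(j < size s) U (nth 0 (a :: s) j) x *m (A (nth 0 s j) x - A (nth 0 (a :: s) j) x)) i =
  isum W (cU i) a s x.
Proof.
elim: s a => [|b s IH] a a0 /=; first by rewrite big_ord0 co0.
move=> /andP[ab pbs]; rewrite big_ord_recl coD /=; congr (_ + _).
  rewrite !hAW//; last exact: (le_trans a0 (ltW ab)).
  rewrite -sumrB mulmx_sumr co_sum /istep; apply: eq_bigr => c _.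
  by rewrite -scalerBl -rmorphB/= -scalemxAr coZ mulrC.
by rewrite -IH//; exact: (le_trans a0 (ltW ab)).
Qed.

(** Coordinate of the stochastic integral of U dA over [0, t], solved from the equation for U. *)
Definition ito_co (i : idx) (t : R) (x : T) : R :=
  co (U t x) i - co (U 0 x) i + n%:R * tint (fun s => co (U s x) i) t.

Let ito_coE i t x : co (U t x - U 0 x +
    n%:R *: \matrix_(k, j) time_integral (fun s => U s x k j) t) i = ito_co i t x.
Proof.
rewrite /ito_co coD coB; congr (_ + _).
have -> : n%:R = (n%:R : R)%:C%C :> C by rewrite rmorph_nat.
rewrite coZ; congr (_ * _); case: i => -[e k] j; rewrite /co mxE /=.
by case: e.
Qed.

Lemma ito_co_adapted i t : 0 <= t -> measurable_wrt (F t) (ito_co i t).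
Proof.
move=> t0; have sF := filt_sigma hF t0.
apply: (mwrD sF).
  apply: (mwrB sF); first exact: U_co_adapted.
  by apply: (mwr_sub (filt_mono hF (lexx 0) t0)); exact: U_co_adapted.
apply: (mwrM sF); first exact: mwr_cst.
apply: (tint_adapted hF (g := fun t x => co (U t x) i)) => //.
- by move=> r r0; exact: U_co_adapted.
- exact: U_co_wcont.
Qed.

Let isum_mwr i a s : 0 <= a -> path <%R a s -> L2 P (isum W (cU i) a s).
Proof.
move=> a0 ps; have [] // := isum_facts hF hW (B := \sum_(b : nidx) K1 ^+ 2) a0 ps
   (fun t b at_ => @cU_adapted i b t (le_trans a0 at_))
   (fun t b x at_ => @cU_bound i b t x (le_trans a0 at_)).
move=> t at_ _; apply: ler_sum => b _; apply: mean_le_cst.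
  apply: L2_sq; apply: (@L2_bnd _ _ _ _ K1); last by move=> x; apply: cU_bound; exact: le_trans at_.
  by apply: (adapted_meas hF (le_trans a0 at_)); apply: cU_adapted; exact: le_trans at_.
move=> x; rewrite -(real_normK (num_real _)) lerXn2r// ?nnegrE//.
  by rewrite mulr_ge0// noise_const_ge0.
by apply: cU_bound; exact: le_trans at_.
Qed.

(** The norm in real coordinates exceeds e exactly when one coordinate does, so the matrix statement
    gives one for each coordinate. *)
Let ito_prob i t e del : 0 <= t -> 0 < e -> 0 < del -> exists2 eta : R, 0 < eta &
  forall s, path (fun x y => (x < y) && (y - x < eta)) 0 s -> last 0 s = t ->
    pr P [set x | e < `|isum W (cU i) 0 s x - ito_co i t x|] <= del.
Proof.
move=> t0 e0 del0; have [eta eta0 H] := hI t0 e0 del0; exists eta => // s ps ls.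
have ps1 : path <%R 0 s by apply: sub_path ps => x y /andP[].
have ps2 : path (fun x y => y - x < eta) 0 s by apply: sub_path ps => x y /andP[].
have ip : itv_partition 0 t s by split => //; apply/eqP.
have := H s ip (mesh_lt eta0 ps2).
pose J x := U t x - U 0 x + n%:R *: \matrix_(k, j) time_integral (fun s => U s x k j) t.
have coS x j : co (left_sum U A s x - J x) j = isum W (cU j) 0 s x - ito_co j t x.
  by rewrite coB -left_sum_isum// ito_coE.
have mj j : measurable [set x | e < `|isum W (cU j) 0 s x - ito_co j t x|].
  apply: measurable_gt_set; apply: measurable_funB.
    exact: L2_meas (isum_mwr j (lexx 0) ps1).
  by apply: (adapted_meas hF t0); exact: ito_co_adapted.
have -> : [set x | (e < `|to_xy (left_sum U A s x - J x)|)%R] =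
   \bigcup_(j in [set: idx]) [set x | e < `|isum W (cU j) 0 s x - ito_co j t x|].
  apply/seteqP; split => x /=.
    rewrite ltNge xy_norm_le ?ltW// negb_forall => /existsP[j]; rewrite -ltNge coS => h.
    by exists j.
  move=> [j _ /=] h; apply: (lt_le_trans h); rewrite -coS; exact: co_xy_norm.
have mU : measurable (\bigcup_(j in [set: idx]) [set x | e < `|isum W (cU j) 0 s x - ito_co j t x|]).
  by apply: fin_bigcup_measurable => //; exact: finite_finset.
move=> h; rewrite -lee_fin; apply: (@le_trans _ _ (P (\bigcup_(j in [set: idx])
    [set x | e < `|isum W (cU j) 0 s x - ito_co j t x|]))); last exact: ltW.
rewrite /pr fineK; last exact: fin_num_measure.
by apply: le_measure; rewrite ?inE// => x /= hx; exists i.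
Qed.

Lemma isum_cat (I : finType) (V : I -> R -> T -> R) c a s1 s2 x :
  isum V c a (s1 ++ s2) x = isum V c a s1 x + isum V c (last a s1) s2 x.
Proof. by elim: s1 a => [|b s1 IH] a /=; rewrite ?add0r// IH addrA. Qed.

(** With frozen coefficients the increments telescope to a single step, so the comparison with it is
    again a discrete Ito sum, for the difference of coefficients. *)
Lemma isum_sub_istep (I : finType) (V : I -> R -> T -> R) c c0 a s x :
  isum V c a s x - istep V c0 a (last a s) x =
  isum V (fun i r x => c i r x - c0 i x) a s x.
Proof.
elim: s a => [|b s IH] a /=.
  by rewrite /istep big1 ?subr0// => i _; rewrite subrr mulr0.
rewrite -IH.
have -> : istep V (fun i x => c i a x - c0 i x) a b x = istep V (c ^~ a) a b x - istep V c0 a b x.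
  by rewrite /istep -sumrB; apply: eq_bigr => i _; ring.
have -> : istep V c0 a (last b s) x = istep V c0 a b x + istep V c0 b (last b s) x.
  by rewrite /istep -big_split/=; apply: eq_bigr => i _; ring.
ring.
Qed.

Section Increment.
Variables (a b : R) (i : idx).
Hypotheses (a0 : 0 <= a) (ab : a < b).
Let b0 : 0 <= b. Proof. exact: (le_trans a0 (ltW ab)). Qed.
Let D x := ito_co i b x - ito_co i a x.

Let DE x : D x = (co (U b x) i - co (U a x) i) +
  n%:R * (tint (fun s => co (U s x) i) b - tint (fun s => co (U s x) i) a).
Proof. rewrite /D /ito_co; ring. Qed.

Let D_L2 : L2 P D.
Proof.
apply: (@L2_bnd_ae _ _ _ _ _ (2 + n%:R * ((b - a) * 1))).
  apply: measurable_funB.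
    by apply: (adapted_meas hF b0); exact: ito_co_adapted.
  by apply: (adapted_meas hF a0); exact: ito_co_adapted.
have := tint_ae_bound (g := fun t x => co (U t x) i) (K := 1)
  (fun t x t0 => U_co_bound x i t0) (U_co_wcont i) a0 (ltW ab).
apply: filterS => x hx; rewrite DE; apply: (le_trans (ler_normD _ _)); apply: lerD.
  by apply: (le_trans (ler_normB _ _)); rewrite -[2]/(1 + 1) lerD// U_co_bound.
by rewrite normrM ger0_norm// ler_wpM2l.
Qed.

(** [ito_integral] concerns integrals started at 0, while [D] is an increment over [a, b]. A fine
    partition of [0, a] is extended by one of [a, b]; subtracting the two sums leaves the sum over
    [a, b], and each contributes half of the error. *)
Let approx (c0 : nidx -> T -> R) K B : (forall b', measurable_wrt (F a) (c0 b')) ->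
  (forall b' x, `|c0 b' x| <= K) ->
  (forall r, a <= r -> r <= b -> \sum_b' mean P (fun x => (cU i b' r x - c0 b' x) ^+ 2) <= B) ->
  forall e del, 0 < e -> 0 < del -> exists2 S, L2 P S &
    [/\ mean P (fun x => (S x - istep W c0 a b x) ^+ 2) <= B * (b - a),
        (forall al, measurable_wrt (F a) al -> L2 P al -> mean P (fun x => al x * S x) = 0) &
        pr P [set x | e < `|S x - D x|] <= del].
Proof.
move=> mc0 c0K cB e del e0 del0.
have e2 : 0 < e / 2 by rewrite divr_gt0.
have d2 : 0 < del / 2 by rewrite divr_gt0.
have [eta1 eta10 H1] := ito_prob i a0 e2 d2.
have [eta2 eta20 H2] := ito_prob i b0 e2 d2.
pose eta := Num.min eta1 eta2.
have eta0 : 0 < eta by rewrite lt_min eta10.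
have [s1 p1 l1] := partition_exists eta0 a0.
have [s2 p2 l2] := partition_exists eta0 (ltW ab).
have p1' : path <%R 0 s1 by apply: sub_path p1 => x y /andP[].
have p2' : path <%R a s2 by apply: sub_path p2 => x y /andP[].
have p12 : path <%R 0 (s1 ++ s2) by rewrite cat_path p1' l1.
have LS := isum_mwr i a0 p2'.
exists (isum W (cU i) a s2) => //; split.
- have := isum_facts hF hW (c := fun b' r x => cU i b' r x - c0 b' x) (K := K1 + K) (B := B) a0 p2'
    (fun t b' at_ => mwrB (filt_sigma hF (le_trans a0 at_)) (@cU_adapted i b' t (le_trans a0 at_))
        (mwr_sub (filt_mono hF a0 at_) (mc0 b')))
    (fun t b' x at_ => le_trans (ler_normB _ _) (lerD (@cU_bound i b' t x (le_trans a0 at_)) (c0K b' x))).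
  rewrite l2 => /(_ cB) [_ _]; apply: le_trans; rewrite le_eqVlt; apply/orP; left; apply/eqP.
  by congr mean; apply/funext => x; rewrite -{1}l2 isum_sub_istep.
- have [] // := isum_facts hF hW (B := \sum_(b' : nidx) K1 ^+ 2) a0 p2'
    (fun t b' at_ => @cU_adapted i b' t (le_trans a0 at_))
    (fun t b' x at_ => @cU_bound i b' t x (le_trans a0 at_)).
  move=> t at_ _; apply: ler_sum => b' _; apply: mean_le_cst.
    apply: L2_sq; apply: (@L2_bnd _ _ _ _ K1); last by move=> x; apply: cU_bound; exact: le_trans at_.
    by apply: (adapted_meas hF (le_trans a0 at_)); apply: cU_adapted; exact: le_trans at_.
  move=> x; rewrite -(real_normK (num_real _)) lerXn2r// ?nnegrE//.
    by rewrite mulr_ge0// noise_const_ge0.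
  by apply: cU_bound; exact: le_trans at_.
have mI t s : 0 <= t -> path <%R 0 s -> measurable_fun setT (fun x => isum W (cU i) 0 s x - ito_co i t x).
  move=> t0 ps; apply: measurable_funB; first exact: L2_meas (isum_mwr i (lexx 0) ps).
  by apply: (adapted_meas hF t0); exact: ito_co_adapted.
have m1 := measurable_gt_set (e / 2) (mI a s1 a0 p1').
have m2 := measurable_gt_set (e / 2) (mI b (s1 ++ s2) b0 p12).
have h1 := H1 s1 (sub_path (fun x y => _) p1) l1.
have h2 := H2 (s1 ++ s2).
apply: (@le_trans _ _ (pr P ([set x | e / 2 < `|isum W (cU i) 0 s1 x - ito_co i a x|] `|`
    [set x | e / 2 < `|isum W (cU i) 0 (s1 ++ s2) x - ito_co i b x|]))).
  apply: pr_le; [|exact: measurableU|].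
    by apply: measurable_gt_set; exact: (L2_meas (L2B LS D_L2)).
  move=> x /= hx.
  have : isum W (cU i) a s2 x - D x = (isum W (cU i) 0 (s1 ++ s2) x - ito_co i b x) -
      (isum W (cU i) 0 s1 x - ito_co i a x).
    by rewrite isum_cat l1 /D; ring.
  move=> E; rewrite E in hx; have := lt_le_trans hx (ler_normB _ _).
  case: (ltP (e / 2) `|isum W (cU i) 0 s1 x - ito_co i a x|) => [|h]; first by left.
  by move=> h'; right; lra.
apply: (le_trans (pr_U P m1 m2)).
have -> : del = del / 2 + del / 2 by lra.
apply: lerD.
  apply: H1 => //; apply: sub_path p1 => x y /andP[-> h]/=; apply: (lt_le_trans h).
  by rewrite ge_min lexx.
apply: H2; last by rewrite last_cat l1.
rewrite cat_path l1; apply/andP; split; [apply: sub_path p1|apply: sub_path p2];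
  move=> x y /andP[-> h]/=; apply: (lt_le_trans h); by rewrite ge_min lexx orbT.
Qed.

Let mean_cU2 r b' : 0 <= r -> mean P (fun x => cU i b' r x ^+ 2) <= K1 ^+ 2.
Proof.
move=> r0; apply: mean_le_cst.
  apply: L2_sq; apply: (@L2_bnd _ _ _ _ K1); last by move=> x; apply: cU_bound.
  by apply: (adapted_meas hF r0); exact: cU_adapted.
move=> x; rewrite -(real_normK (num_real _)) lerXn2r// ?nnegrE//.
  by rewrite mulr_ge0// noise_const_ge0.
exact: cU_bound.
Qed.

Let istep0 x : istep W (fun _ _ => 0) a b x = 0.
Proof. by rewrite /istep big1// => j _; rewrite mul0r. Qed.

Let approx0 e del : 0 < e -> 0 < del -> exists2 S, L2 P S &
    [/\ mean P (fun x => (S x - 0) ^+ 2) <= (\sum_(b' : nidx) K1 ^+ 2) * (b - a),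
        (forall al, measurable_wrt (F a) al -> L2 P al -> mean P (fun x => al x * S x) = 0) &
        pr P [set x | e < `|S x - D x|] <= del].
Proof.
move=> e0 del0.
have [|||S LS [h1 h2 h3]] := @approx (fun _ _ => 0) 0 (\sum_(b' : nidx) K1 ^+ 2) _ _ _ e del e0 del0.
- by move=> b'; exact: (mwr_cst (filt_sigma hF a0)).
- by move=> b' x; rewrite normr0.
- move=> r ar rb; apply: ler_sum => b' _; under [X in mean P X]eq_fun do rewrite subr0.
  by apply: mean_cU2; exact: le_trans ar.
exists S => //; split => //; move: h1; congr (mean P _ <= _).
by apply/funext => x; rewrite istep0.
Qed.

Let Bge0 : 0 <= (\sum_(b' : nidx) K1 ^+ 2) * (b - a).
Proof. by rewrite mulr_ge0 ?subr_ge0 ?(ltW ab)// sumr_ge0// => b' _; exact: sqr_ge0. Qed.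

Lemma ito_incr_mean al K : measurable_wrt (F a) al -> (forall x, `|al x| <= K) ->
  mean P (fun x => al x * D x) = 0.
Proof.
move=> mal alK; have malT := adapted_meas hF a0 mal.
apply: (lim_prob_mean D_L2 (L2_cst P 0) Bge0 malT alK) => e del e0 del0.
have [S LS [h1 h2 h3]] := approx0 e0 del0; exists S => //; split => //.
by apply: h2 => //; exact: L2_bnd malT alK.
Qed.

Lemma ito_incr_sq : mean P (fun x => D x ^+ 2) <= (\sum_(b' : nidx) K1 ^+ 2) * (b - a).
Proof.
have : mean P (fun x => (D x - 0) ^+ 2) <= (\sum_(b' : nidx) K1 ^+ 2) * (b - a).
  apply: (lim_prob_sq D_L2 (L2_cst P 0) Bge0) => e del e0 del0.
  by have [S LS [h1 h2 h3]] := approx0 e0 del0; exists S.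
by under [X in mean P X]eq_fun do rewrite subr0.
Qed.

Lemma ito_incr_approx B : 0 <= B ->
  (forall r, a <= r -> r <= b -> \sum_b' mean P (fun x => (cU i b' r x - cU i b' a x) ^+ 2) <= B) ->
  mean P (fun x => (D x - istep W (fun b' => cU i b' a) a b x) ^+ 2) <= B * (b - a).
Proof.
move=> B0 hB.
have [LY _ _ _] := istep_facts hF hW a0 ab (fun b' => @cU_adapted i b' a a0)
  (fun b' x => @cU_bound i b' a x a0).
apply: (lim_prob_sq D_L2 LY) => [|e del e0 del0].
  by rewrite mulr_ge0// subr_ge0 ltW.
have [||S LS [h1 h2 h3]] := @approx (fun b' => cU i b' a) K1 B _ _ hB e del e0 del0.
- by move=> b'; exact: cU_adapted.
- by move=> b' x; exact: cU_bound.
by exists S.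
Qed.

Lemma U_incr_L2 : L2 P (fun x => co (U b x) i - co (U a x) i).
Proof.
have mU t : 0 <= t -> measurable_fun setT (fun x => co (U t x) i).
  by move=> t0; apply: (adapted_meas hF t0); exact: U_co_adapted.
apply: (@L2_bnd _ _ _ _ 2); first by apply: measurable_funB; exact: mU.
by move=> x; apply: (le_trans (ler_normB _ _)); rewrite -[2]/(1 + 1) lerD// U_co_bound.
Qed.

Let tint_L2 : L2 P (fun x => tint (fun s => co (U s x) i) b - tint (fun s => co (U s x) i) a).
Proof.
apply: (@L2_bnd_ae _ _ _ _ _ ((b - a) * 1)).
  have mt t : 0 <= t -> measurable_fun setT (fun x => tint (fun s => co (U s x) i) t).
    move=> t0; apply: (adapted_meas hF t0); apply: (tint_adapted hF (g := fun t x => co (U t x) i)) => //.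
    - by move=> r r0; exact: U_co_adapted.
    - exact: U_co_wcont.
  by apply: measurable_funB; exact: mt.
exact: (tint_ae_bound (g := fun t x => co (U t x) i) (K := 1)
  (fun t x t0 => U_co_bound x i t0) (U_co_wcont i) a0 (ltW ab)).
Qed.

Let tint_sq : mean P (fun x => (tint (fun s => co (U s x) i) b - tint (fun s => co (U s x) i) a) ^+ 2) <= (b - a) ^+ 2.
Proof.
rewrite -[leRHS](mean_cst P); apply: mean_le_ae.
- exact: L2_sq tint_L2.
- exact: L1_cst.
have := tint_ae_bound (g := fun t x => co (U t x) i) (K := 1)
  (fun t x t0 => U_co_bound x i t0) (U_co_wcont i) a0 (ltW ab).
apply: filterS => x; rewrite mulr1 => hx.
by rewrite -(real_normK (num_real _)) lerXn2r// nnegrE subr_ge0 ltW.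
Qed.

(** The drift integral is almost surely at most b - a in absolute value, so removing it costs only
    the second summand. *)
Lemma U_incr_sq_gen (Y : T -> R) q : L2 P Y -> mean P (fun x => (D x - Y x) ^+ 2) <= q ->
  mean P (fun x => (co (U b x) i - co (U a x) i - Y x) ^+ 2) <= 2 * q + 2 * n%:R ^+ 2 * (b - a) ^+ 2.
Proof.
move=> LY hq; set I0 := fun x => tint (fun s => co (U s x) i) b - tint (fun s => co (U s x) i) a.
apply: (@le_trans _ _ (mean P (fun x => 2 * (D x - Y x) ^+ 2 + 2 * n%:R ^+ 2 * I0 x ^+ 2))).
  apply: mean_le.
  - by apply: L2_sq; apply: L2B => //; exact: U_incr_L2.
  - by apply: L1D; apply: L1Z; apply: L2_sq => //; exact: L2B.
  move=> x; rewrite DE -/(I0 x).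
  move: (co (U b x) i - co (U a x) i) (I0 x) (Y x) => u v y.
  have -> : 2 * n%:R ^+ 2 * v ^+ 2 = 2 * (n%:R * v) ^+ 2 by ring.
  by move: (n%:R * v) => w; have := sqr_ge0 (u - y + 2 * w); nra.
rewrite meanD; [|by apply: L1Z; apply: L2_sq; exact: L2B|by apply: L1Z; exact: L2_sq].
rewrite !meanZ; [|exact: L2_sq|by apply: L2_sq; exact: L2B].
apply: lerD; first by rewrite ler_pM2l.
by rewrite ler_wpM2l// mulr_ge0// sqr_ge0.
Qed.

End Increment.

Definition incr_const : R := 2 * (\sum_(b' : nidx) K1 ^+ 2) + 2 * n%:R ^+ 2.

Lemma incr_const_ge0 : 0 <= incr_const.
Proof. by rewrite addr_ge0// mulr_ge0// ?sqr_ge0// sumr_ge0// => b _; exact: sqr_ge0. Qed.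

(** Steps of length at most 1 allow (b - a)^2 from the drift to be absorbed into b - a. *)
Lemma U_incr_sq a b i : 0 <= a -> a < b -> b <= a + 1 ->
  mean P (fun x => (co (U b x) i - co (U a x) i) ^+ 2) <= incr_const * (b - a).
Proof.
move=> a0 ab b1.
have h : mean P (fun x => (ito_co i b x - ito_co i a x - 0) ^+ 2) <= (\sum_(b' : nidx) K1 ^+ 2) * (b - a).
  under [X in mean P X]eq_fun do rewrite subr0; exact: ito_incr_sq.
have := U_incr_sq_gen a0 ab (L2_cst P 0) h.
under [X in mean P X]eq_fun do rewrite subr0.
move=> /le_trans; apply; rewrite /incr_const.
have h0 : 0 <= b - a by lra.
have h1 : 0 <= 1 - (b - a) by lra.
have := mulr_ge0 (sqr_ge0 (n%:R : R)) (mulr_ge0 h0 h1).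
move: (b - a) (\sum_b' _) (n%:R ^+ 2) => u v w; nra.
Qed.

Let U_incr_N1 a b : 0 <= a -> a < b -> b <= a + 1 ->
  L1 P (fun x => N1 (U b x - U a x) ^+ 2) /\
  mean P (fun x => N1 (U b x - U a x) ^+ 2) <= n2 * (n2 * (incr_const * (b - a))).
Proof.
move=> a0 ab b1; have b0 := le_trans a0 (ltW ab).
have LS : L1 P (fun x => n2 * \sum_i (co (U b x) i - co (U a x) i) ^+ 2).
  by apply: L1Z; apply: L1_sum => i _; apply: L2_sq; exact: U_incr_L2.
have hle x : N1 (U b x - U a x) ^+ 2 <= n2 * \sum_i (co (U b x) i - co (U a x) i) ^+ 2.
  by apply: (le_trans (N1_sq _)); rewrite ler_wpM2l//; apply: ler_sum => i _; rewrite coB.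
have LN : L1 P (fun x => N1 (U b x - U a x) ^+ 2).
  apply: L1_le LS; last by move=> x; rewrite ger0_norm ?sqr_ge0.
  apply: measurable_funX; apply: measurable_sum => i.
  apply: measurableT_comp => //; under eq_fun do rewrite coB; apply: measurable_funB.
    by apply: (adapted_meas hF b0); exact: U_co_adapted.
  by apply: (adapted_meas hF a0); exact: U_co_adapted.
split => //; apply: (le_trans (mean_le LN LS hle)).
rewrite meanZ; last by apply: L1_sum => i _; apply: L2_sq; exact: U_incr_L2.
rewrite ler_wpM2l// mean_sum; last by move=> i _; apply: L2_sq; exact: U_incr_L2.
apply: (@le_trans _ _ (\sum_(i : idx) incr_const * (b - a))).
  by apply: ler_sum => i _; exact: U_incr_sq.
by rewrite sumr_const -[X in X <= _]mulr_natl.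
Qed.

Let noise_const_incr_ge0 : 0 <= noise_const ^+ 2 * (n2 * (n2 * incr_const)).
Proof.
apply: mulr_ge0; first exact: sqr_ge0.
apply: mulr_ge0; first exact: ler0n.
by apply: mulr_ge0; [exact: ler0n|exact: incr_const_ge0].
Qed.

Definition approx_const : R :=
  2 * (\sum_(b : nidx) noise_const ^+ 2 * (n2 * (n2 * incr_const))) + 2 * n%:R ^+ 2.

Lemma approx_const_ge0 : 0 <= approx_const.
Proof.
by rewrite addr_ge0 ?mulr_ge0 ?sqr_ge0// sumr_ge0.
Qed.

(** A bootstrap: [U_incr_sq] bounds the change of the coefficients by order b - a in mean square,
    and the isometry contributes a second factor b - a. The increment is thus a Gaussian step with
    frozen coefficients up to order (b - a)^2. *)
Lemma U_incr_approx a b i : 0 <= a -> a < b -> b <= a + 1 ->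
  mean P (fun x => (co (U b x) i - co (U a x) i -
    istep W (fun b' x => noise_coef (U a x) i b') a b x) ^+ 2) <= approx_const * (b - a) ^+ 2.
Proof.
move=> a0 ab b1; have ba0 : 0 <= b - a by rewrite subr_ge0 ltW.
pose B := (\sum_(b' : nidx) noise_const ^+ 2 * (n2 * (n2 * incr_const))) * (b - a).
have B0 : 0 <= B.
  by rewrite mulr_ge0// sumr_ge0.
have hB r : a <= r -> r <= b ->
    \sum_b' mean P (fun x => (cU i b' r x - cU i b' a x) ^+ 2) <= B.
  rewrite le_eqVlt => /predU1P[<- _|ar rb].
    rewrite big1// => b' _; under [X in mean P X]eq_fun do rewrite subrr expr0n.
    exact: mean_cst.
  rewrite /B mulr_suml; apply: ler_sum => b' _.
  have r1 : r <= a + 1 by exact: le_trans b1.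
  have r0 := le_trans a0 (ltW ar).
  have [LN hN] := U_incr_N1 a0 ar r1.
  apply: (@le_trans _ _ (mean P (fun x => noise_const ^+ 2 * N1 (U r x - U a x) ^+ 2))).
    apply: mean_le.
    - apply: L2_sq; apply: L2B; apply: (@L2_bnd _ _ _ _ K1).
      + by apply: (adapted_meas hF r0); exact: cU_adapted.
      + by move=> x; exact: cU_bound.
      + by apply: (adapted_meas hF a0); exact: cU_adapted.
      + by move=> x; exact: cU_bound.
    - exact: L1Z.
    move=> x; rewrite /cU -noise_coefB -exprMn -(real_normK (num_real _)).
    rewrite lerXn2r// ?nnegrE// ?mulr_ge0 ?noise_const_ge0 ?N1_ge0//.
    by rewrite mulrC; exact: noise_coef_le.
  rewrite meanZ// -mulrA ler_wpM2l ?sqr_ge0//; apply: (le_trans hN).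
  rewrite !mulrA ler_wpM2l//; last by lra.
  by rewrite -mulrA mulr_ge0// mulr_ge0// incr_const_ge0.
have [LY _ _ _] := istep_facts hF hW a0 ab (fun b' => @cU_adapted i b' a a0)
  (fun b' x => @cU_bound i b' a x a0).
have := U_incr_sq_gen a0 ab LY (ito_incr_approx a0 ab B0 hB).
by move=> /le_trans; apply; rewrite /approx_const /B le_eqVlt; apply/orP; left; apply/eqP; ring.
Qed.

(** Against [al] the stochastic integral averages to zero, so only the drift remains; replacing U by
    its value at time a inside it costs the mean of |U_r - U_a|, of order (b - a)^(1/2). *)
Lemma U_incr_mean a b i al K : 0 <= a -> a < b -> b <= a + 1 -> measurable_wrt (F a) al ->
  (forall x, `|al x| <= K) ->
  `|mean P (fun x => al x * (co (U b x) i - co (U a x) i)) +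
    n%:R * (b - a) * mean P (fun x => al x * co (U a x) i)| <=
    n%:R * (b - a) * (K * ((incr_const + 1) * Num.sqrt (b - a))).
Proof.
move=> a0 ab b1 mal alK; have b0 := le_trans a0 (ltW ab).
have malT := adapted_meas hF a0 mal.
have mt t : 0 <= t -> measurable_fun setT (fun x => tint (fun s => co (U s x) i) t).
  move=> t0; apply: (adapted_meas hF t0); apply: (tint_adapted hF (g := fun t x => co (U t x) i)) => //.
  - by move=> r r0; exact: U_co_adapted.
  - exact: U_co_wcont.
have mU t : 0 <= t -> measurable_fun setT (fun x => co (U t x) i).
  by move=> t0; apply: (adapted_meas hF t0); exact: U_co_adapted.
have s0 : 0 < Num.sqrt (b - a) by rewrite sqrtr_gt0 subr_gt0.
have ge r : a <= r <= b -> mean P (fun x => `|co (U r x) i - co (U a x) i|) <= (incr_const + 1) * Num.sqrt (b - a).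
  move=> /andP[]; rewrite le_eqVlt => /predU1P[<- _|ar rb].
    under [X in mean P X]eq_fun do rewrite subrr normr0.
    by rewrite mean_cst mulr_ge0 ?ltW// ltr_wpDl// incr_const_ge0.
  have r0 := le_trans a0 (ltW ar).
  have LD := U_incr_L2 i a0 ar.
  have hq : mean P (fun x => (co (U r x) i - co (U a x) i) ^+ 2) <= incr_const * (b - a).
    apply: (le_trans (U_incr_sq i a0 ar (le_trans rb b1))).
    by rewrite ler_wpM2l ?incr_const_ge0//; lra.
  have h1 : mean P (fun _ => 1 ^+ 2) <= 1 by rewrite mean_cst expr1n.
  (* With this weight both terms of Young's inequality have order (b - a)^(1/2). *)
  have is0 : 0 < (Num.sqrt (b - a))^-1 by rewrite invr_gt0.
  have := mean_mul_le is0 LD (L2_cst P 1) hq h1.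
  under [X in mean P X]eq_fun do rewrite mulr1.
  move=> /le_trans; apply.
  have E : Num.sqrt (b - a) ^+ 2 = b - a by rewrite sqr_sqrtr// subr_ge0 ltW.
  rewrite -{2}E; move: (Num.sqrt (b - a)) s0 => s s0.
  by rewrite le_eqVlt; apply/orP; left; apply/eqP; field; rewrite gt_eqF.
have h := mean_tint_approx hF (g := fun t x => co (U t x) i) (K := 1)
  (fun t t0 => U_co_adapted i t0) (fun t x t0 => U_co_bound x i t0) (U_co_wcont i) a0 (ltW ab) malT alK ge.
set I1 := fun x => tint (fun s => co (U s x) i) b - tint (fun s => co (U s x) i) a.
have LaU : L1 P (fun x => al x * (co (U b x) i - co (U a x) i)).
  by apply: (L1M_bnd malT alK); apply: L2_L1; exact: U_incr_L2.
have LI : L1 P (fun x => al x * I1 x).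
  apply: (L1M_bnd malT alK); apply: L2_L1.
  apply: (@L2_bnd_ae _ _ _ _ _ ((b - a) * 1)); first by apply: measurable_funB; exact: mt.
  exact: (tint_ae_bound (g := fun t x => co (U t x) i) (K := 1)
    (fun t x t0 => U_co_bound x i t0) (U_co_wcont i) a0 (ltW ab)).
have : mean P (fun x => al x * (co (U b x) i - co (U a x) i)) + n%:R * mean P (fun x => al x * I1 x) = 0.
  rewrite -[RHS](ito_incr_mean i a0 ab mal alK) -meanZ// -meanD//; last exact: L1Z.
  by congr mean; apply/funext => x; rewrite /I1 /ito_co; ring.
move=> /eqP; rewrite addr_eq0 => /eqP ->.
rewrite addrC -mulrA -mulrBr normrM ger0_norm// -mulrA ler_wpM2l// distrC.
exact: h.
Qed.


End UnitaryIncrements.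

(** * Jets and the one-step estimate *)

(** A distinguished point on the complex numbers makes matrices pointed, as the measurability rules
    above require of their domain. *)
HB.instance Definition _ (R : rcfType) := isPointed.Build (R[i]) 0.

Section BorelMatrices.
Variables (R : realType) (a b : nat).
Local Notation M := 'M[R[i]]_(a, b).

Lemma borel_sigma : sigma_algebra setT (@borel_mx R a b).
Proof. exact: smallest_sigma_algebra. Qed.

Lemma borel_mmw : mmw (@borel_mx R a b) (fun u : M => u).
Proof.
by move=> k j e B mB; apply: sub_gen_smallest; exists k, j, B; split => //; case: e; [right|left].
Qed.

(** The sets whose preimage lies in [G] form a sigma-algebra, which contains the generators. *)
Lemma mmw_preimage (S : pointedType) (G : set (set S)) (X : S -> M) : sigma_algebra setT G -> mmw G X ->
  forall B, @borel_mx R a b B -> G (X @^-1` B).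
Proof.
move=> [G0 GC GU] mX B bB; apply: (bB (fun B => G (X @^-1` B))); split.
  split => [|C GC'|C GC'].
  - by rewrite preimage_set0.
  - by rewrite setTD preimage_setC -setTD; exact: GC.
  - by rewrite preimage_bigcup; exact: GU.
move=> _ [k [j [C [mC [->|->]]]]].
  exact: (mX k j false C mC).
exact: (mX k j true C mC).
Qed.

Lemma mwr_mmw (S : pointedType) (G : set (set S)) (X : S -> M) (g : M -> R) : sigma_algebra setT G ->
  mmw G X -> measurable_wrt (@borel_mx R a b) g -> measurable_wrt G (fun x => g (X x)).
Proof. by move=> hG mX mg B mB; apply: (mmw_preimage hG mX (B := g @^-1` B)); exact: mg. Qed.

Lemma borel_co i : measurable_wrt (@borel_mx R a b) (fun u : M => co u i).
Proof. exact: borel_mmw. Qed.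

End BorelMatrices.

Section Jets.
Variables (R : realType) (n : nat).
Local Notation C := R[i].
Local Notation M := 'M[C]_n.
Local Notation idx := (bool * 'I_n * 'I_n)%type.

(* Second-order expansion with cubic remainder on the unitary group: [D1 u] is real-linear and
   [D2 u] real-bilinear (it plays the role of half the Hessian and need not be symmetric). *)
Record jet (G : M -> R) (D1 : M -> M -> R) (D2 : M -> M -> M -> R) (K : R) : Prop := Jet {
  jet_lin1 : forall u c v w, D1 u (c%:C%C *: v + w) = c * D1 u v + D1 u w;
  jet_lin2 : forall u c v w z, D2 u (c%:C%C *: v + w) z = c * D2 u v z + D2 u w z;
  jet_lin3 : forall u c v w z, D2 u z (c%:C%C *: v + w) = c * D2 u z v + D2 u z w;
  jet_meas0 : measurable_wrt (@borel_mx R n n) G;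
  jet_meas1 : forall v, measurable_wrt (@borel_mx R n n) (D1 ^~ v);
  jet_meas2 : forall v w, measurable_wrt (@borel_mx R n n) (fun u => D2 u v w);
  jet_bound0 : forall u, u \is unitarymx -> `|G u| <= K;
  jet_bound1 : forall u v, u \is unitarymx -> `|D1 u v| <= K * N1 v;
  jet_bound2 : forall u v w, u \is unitarymx -> `|D2 u v w| <= K * (N1 v * N1 w);
  jet_rem : forall u u', u \is unitarymx -> u' \is unitarymx ->
    `|G u' - G u - D1 u (u' - u) - D2 u (u' - u) (u' - u)| <= K * N1 (u' - u) ^+ 3 }.

Definition gen (D1 : M -> M -> R) (D2 : M -> M -> M -> R) (u : M) : R :=
  - n%:R * D1 u u + \sum_b D2 u (u *m Xb R b) (u *m Xb R b).

Lemma lin_expand (f : M -> R) : (forall c v w, f (c%:C%C *: v + w) = c * f v + f w) ->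
  forall v, f v = \sum_i co v i * f (ebase R i).
Proof.
move=> lf.
have f0 : f 0 = 0.
  by have := lf (-1) 0 0; rewrite scaler0 addr0 mulN1r addNr.
move=> v; rewrite {1}(co_expand v).
elim: (index_enum _) => [|i s IH]; first by rewrite !big_nil.
by rewrite !big_cons lf IH.
Qed.

Lemma bilin_expand (f : M -> M -> R) :
  (forall c v w z, f (c%:C%C *: v + w) z = c * f v z + f w z) ->
  (forall c v w z, f z (c%:C%C *: v + w) = c * f z v + f z w) ->
  forall v w, f v w = \sum_i \sum_j co v i * co w j * f (ebase R i) (ebase R j).
Proof.
move=> l1 l2 v w; rewrite (lin_expand (f := f^~ w)); last by move=> c x y; exact: l1.
apply: eq_bigr => i _; rewrite (lin_expand (f := f _)); last by move=> c x y; exact: l2.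
by rewrite mulr_sumr; apply: eq_bigr => j _; rewrite mulrA.
Qed.

Lemma N1_ebase (i : idx) : N1 (ebase R i) = 1.
Proof.
rewrite /N1 (bigD1 i)//= co_ebase eqxx normr1 big1 ?addr0// => j ji.
by rewrite co_ebase eq_sym (negbTE ji) normr0.
Qed.

Lemma gen_meas G D1 D2 K : jet G D1 D2 K -> measurable_wrt (@borel_mx R n n) (gen D1 D2).
Proof.
move=> J; have sB := @borel_sigma R n n; rewrite /gen.
apply: (mwrD sB).
  apply: (mwrM sB); first exact: mwr_cst.
  under eq_fun do rewrite (lin_expand (jet_lin1 J _)).
  apply: (mwr_sum sB) => i _; apply: (mwrM sB); [exact: borel_co|exact: jet_meas1 J _].
apply: (mwr_sum sB) => b _.
under eq_fun do rewrite (bilin_expand (jet_lin2 J _) (jet_lin3 J _)).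
have mX i : measurable_wrt (@borel_mx R n n) (fun u : M => co (u *m Xb R b) i).
  apply: mmw_co; apply: (mmwM sB); first exact: borel_mmw.
  exact: mmw_cst.
apply: (mwr_sum sB) => i _; apply: (mwr_sum sB) => j _.
apply: (mwrM sB); last exact: jet_meas2 J _ _.
by apply: (mwrM sB).
Qed.

Definition gen_const : R :=
  n%:R * #|{: idx}|%:R + \sum_(b : upper_pair n + upper_pair n + 'I_n) (#|{: idx}|%:R * noise_const R n) ^+ 2.

Lemma gen_bound G D1 D2 K u : 0 <= K -> jet G D1 D2 K -> u \is unitarymx ->
  `|gen D1 D2 u| <= K * gen_const.
Proof.
move=> K0 J hu; rewrite /gen /gen_const mulrDr; apply: (le_trans (ler_normD _ _)); apply: lerD.
  have -> : `|- n%:R * D1 u u| = n%:R * `|D1 u u| by rewrite normrM normrN normr_nat.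
  rewrite mulrCA; apply: ler_wpM2l; first exact: ler0n.
  by apply: (le_trans (jet_bound1 J _ hu)); rewrite ler_wpM2l// unitary_N1.
apply: (le_trans (ler_norm_sum _ _ _)); rewrite mulr_sumr; apply: ler_sum => b _.
apply: (le_trans (jet_bound2 J _ _ hu)); rewrite ler_wpM2l// -expr2 lerXn2r// ?nnegrE ?N1_ge0//.
  by rewrite mulr_ge0// noise_const_ge0.
apply: (le_trans (N1M _ _)); apply: ler_pM; rewrite ?N1_ge0 ?unitary_N1//.
by rewrite /noise_const (bigD1 b)//= lerDl sumr_ge0// => *; exact: N1_ge0.
Qed.

End Jets.

(** * The one-step estimate *)

Section OneStep.
Context d (T : measurableType d) (R : realType) (P : probability T R) (F : R -> set (set T)).
Hypothesis hF : complete_filtration P F.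
Variable n : nat.
Local Notation C := R[i].
Local Notation M := 'M[C]_n.
Local Notation idx := (bool * 'I_n * 'I_n)%type.
Local Notation nidx := (upper_pair n + upper_pair n + 'I_n)%type.
Variables (U : R -> T -> M).

Hypothesis hU : brownian_unitary P F U.

Let Uu t x : 0 <= t -> U t x \is unitarymx. Proof. by case: hU => h _ _ _; exact: h. Qed.
Let Uad : mx_adapted F U. Proof. by case: hU. Qed.

Let n2 : R := #|{: idx}|%:R.
Let K1 : R := n2 * noise_const R n.
Let K1_ge0 : 0 <= K1. Proof. by rewrite mulr_ge0// noise_const_ge0. Qed.

Let dU s t i x := co (U t x) i - co (U s x) i.

Variables (A : R -> T -> M) (W : nidx -> R -> T -> R).
Hypothesis hW : brownian_family P F W.
Hypothesis hAW : forall t x, 0 <= t -> A t x = \sum_b (W b t x)%:C%C *: Xb R b.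
Hypothesis hI : forall t : R, 0 <= t -> ito_integral P U A t (fun x =>
          U t x - U 0 x +
          n%:R *: \matrix_(k, j) time_integral (fun s => U s x k j) t).
Let Uc : mx_continuous_paths P U. Proof. by case: hU. Qed.

Section Step.
Variables (s t : R).
Hypotheses (s0 : 0 <= s) (st : s < t) (t1 : t <= s + 1).
Let h := t - s.
Let h0 : 0 < h. Proof. by rewrite subr_gt0. Qed.
Let h1 : h <= 1. Proof. by rewrite /h lerBlDl. Qed.
Let t0 : 0 <= t. Proof. exact: (le_trans s0 (ltW st)). Qed.
Let q := Num.sqrt h.
Let q0 : 0 < q. Proof. by rewrite sqrtr_gt0. Qed.
Let q2 : q ^+ 2 = h. Proof. by rewrite sqr_sqrtr// ltW. Qed.
Let cf i b (x : T) := noise_coef (U s x) i b.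
Let Y i := istep W (cf i) s t.

Let cf_meas i b : measurable_wrt (F s) (cf i b).
Proof.
apply: mmw_co; apply: (mmwM (filt_sigma hF s0)); first exact: (U_mmw Uad s0).
exact: (mmw_cst (filt_sigma hF s0)).
Qed.

Let cf_bound i b x : `|cf i b x| <= K1. Proof. by apply: noise_coef_unitary; exact: Uu. Qed.

Let cfT i b : measurable_fun setT (cf i b). Proof. exact: (adapted_meas hF s0 (cf_meas i b)). Qed.
Let cf_L2 i b : L2 P (cf i b). Proof. exact: (L2_bnd P (cfT i b) (cf_bound i b)). Qed.

Let Y_L2 i : L2 P (Y i).
Proof. by have [] := istep_facts hF hW s0 st (cf_meas i) (cf_bound i). Qed.

Let dU_L2 i : L2 P (dU s t i). Proof. exact: (U_incr_L2 hF Uu Uad i s0 st). Qed.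

Let mean_sqr_bound (f : T -> R) k : L2 P f -> (forall x, `|f x| <= k) -> mean P (fun x => f x ^+ 2) <= k ^+ 2.
Proof.
move=> Lf fk; apply: mean_le_cst; first exact: L2_sq.
move=> x; rewrite -(real_normK (num_real _)) lerXn2r// nnegrE//.
exact: (le_trans _ (fk x)).
Qed.

Let CY : R := \sum_(b : nidx) K1 ^+ 2.
Let CY_ge0 : 0 <= CY. Proof. by apply: sumr_ge0 => b _; exact: sqr_ge0. Qed.

Let Y_sq i : mean P (fun x => Y i x ^+ 2) <= CY * h.
Proof.
have [_ _ _ ->] := istep_facts hF hW s0 st (cf_meas i) (cf_bound i).
rewrite mulrC ler_wpM2r ?(ltW h0)//; apply: ler_sum => b _.
exact: (mean_sqr_bound (cf_L2 i b) (cf_bound i b)).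
Qed.

Let dU_sq i : mean P (fun x => dU s t i x ^+ 2) <= incr_const R n * h.
Proof. exact: (U_incr_sq hF Uu Uad Uc hW hAW hI i s0 st t1). Qed.

Let Q_sq i : mean P (fun x => (dU s t i x - Y i x) ^+ 2) <= approx_const R n * h ^+ 2.
Proof. exact: (U_incr_approx hF Uu Uad Uc hW hAW hI i s0 st t1). Qed.

Let hq3 a : a * h ^+ 2 / q = a * (h * q).
Proof. by rewrite -q2; field; rewrite gt_eqF. Qed.

Let mean_YY i j al K : measurable_wrt (F s) al -> (forall x, `|al x| <= K) ->
  mean P (fun x => al x * (Y i x * Y j x)) = h * \sum_b mean P (fun x => al x * (cf i b x * cf j b x)).
Proof.
move=> mal alK; have sF := filt_sigma hF s0; have malT := adapted_meas hF s0 mal.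
have mal2 b c : measurable_wrt (F s) (fun x => al x * (cf i b x * cf j c x)).
  by apply: (mwrM sF) => //; exact: (mwrM sF).
have Lal b c : L1 P (fun x => al x * (cf i b x * cf j c x)).
  by apply: (L1M_bnd malT alK); exact: L2M.
have hbc b c : L1 P (fun x => (al x * (cf i b x * cf j c x)) * ((W b t x - W b s x) * (W c t x - W c s x))) /\
    mean P (fun x => (al x * (cf i b x * cf j c x)) * ((W b t x - W b s x) * (W c t x - W c s x))) =
    if b == c then h * mean P (fun x => al x * (cf i b x * cf j b x)) else 0.
  case: eqP => [<-|/eqP bc].
    have [g1 g2] := bm_moment2 hF hW s0 st b (mal2 b b) (Lal b b).
    by split => //; rewrite g2 mulrC.
  exact: (bm_moment11 hF hW s0 st bc (mal2 b c) (Lal b c)).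
have -> : (fun x => al x * (Y i x * Y j x)) = (fun x => \sum_b \sum_c (al x * (cf i b x * cf j c x)) *
    ((W b t x - W b s x) * (W c t x - W c s x))).
  apply/funext => x; rewrite /Y /istep mulr_suml mulr_sumr; apply: eq_bigr => b _.
  by rewrite !mulr_sumr; apply: eq_bigr => c _; ring.
rewrite mean_sum; last by move=> b _; apply: L1_sum => c _; have [] := hbc b c.
rewrite mulr_sumr; apply: eq_bigr => b _.
rewrite mean_sum; last by move=> c _; have [] := hbc b c.
rewrite (bigD1 b)//= big1 ?addr0; last first.
  by move=> c cb; have [_ ->] := hbc b c; rewrite eq_sym (negbTE cb).
by have [_ ->] := hbc b b; rewrite eqxx.
Qed.

Definition pair_const : R := CY + incr_const R n + 2 * approx_const R n.

(** dU_i dU_j - Y_i Y_j = Y_i (dU_j - Y_j) + dU_j (dU_i - Y_i): each product has one factor with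
    second moment of order h and one of order h^2, so Young's inequality with weight h^(1/2) gives
    h^(3/2). *)
Let second_moment i j al K : measurable_wrt (F s) al -> (forall x, `|al x| <= K) ->
  `|mean P (fun x => al x * (dU s t i x * dU s t j x)) -
    h * \sum_b mean P (fun x => al x * (cf i b x * cf j b x))| <= K * (pair_const * (h * q)).
Proof.
move=> mal alK; have malT := adapted_meas hF s0 mal.
have K0 : 0 <= K by exact: (le_trans (normr_ge0 _) (alK point)).
rewrite -(mean_YY i j mal alK).
have LYY : L1 P (fun x => al x * (Y i x * Y j x)) by apply: (L1M_bnd malT alK); exact: L2M.
have LUU : L1 P (fun x => al x * (dU s t i x * dU s t j x)) by apply: (L1M_bnd malT alK); exact: L2M.
have LQ k : L2 P (fun x => dU s t k x - Y k x) by exact: L2B.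
rewrite -meanB//.
apply: (@le_trans _ _ (mean P (fun x => K * (`|Y i x * (dU s t j x - Y j x)| + `|dU s t j x * (dU s t i x - Y i x)|)))).
  apply: mean_norm_le.
  - exact: L1B.
  - by apply: L1Z; apply: L1D; apply: L1_norm; exact: L2M.
  move=> x; rewrite -mulrBr normrM; apply: ler_pM => //.
  have -> : dU s t i x * dU s t j x - Y i x * Y j x =
     Y i x * (dU s t j x - Y j x) + dU s t j x * (dU s t i x - Y i x) by ring.
  exact: ler_normD.
rewrite meanZ; last by apply: L1D; apply: L1_norm; exact: L2M.
rewrite ler_wpM2l// meanD; [|by apply: L1_norm; exact: L2M..].
have e1 := mean_mul_le q0 (Y_L2 i) (LQ j) (Y_sq i) (Q_sq j).
have e2 := mean_mul_le q0 (dU_L2 j) (LQ i) (dU_sq j) (Q_sq i).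
apply: (le_trans (lerD e1 e2)).
rewrite /pair_const !hq3 le_eqVlt; apply/orP; left; apply/eqP; ring.
Qed.

Let nI : R := #|{: nidx}|%:R.

(** Two uses of Cauchy-Schwarz give nI^3, summing over the noises gives one more nI, and 3 h^2 is
    the fourth moment of a single increment. *)
Let Y4 i : L2 P (fun x => Y i x ^+ 2) /\
  mean P (fun x => (Y i x ^+ 2) ^+ 2) <= nI ^+ 4 * K1 ^+ 4 * 3 * h ^+ 2.
Proof.
pose S x := \sum_b (W b t x - W b s x) ^+ 4.
have LS : L1 P S by apply: L1_sum => b _; have [] := bm_pow4 hF hW s0 st b.
have bnd x : (Y i x ^+ 2) ^+ 2 <= nI ^+ 3 * K1 ^+ 4 * S x.
  have y2 : Y i x ^+ 2 <= nI * (K1 ^+ 2 * \sum_b (W b t x - W b s x) ^+ 2).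
    apply: (@le_trans _ _ ((\sum_b `|cf i b x * (W b t x - W b s x)|) ^+ 2)).
      have s0' : 0 <= \sum_b `|cf i b x * (W b t x - W b s x)| by apply: sumr_ge0.
      by rewrite -[X in X <= _](real_normK (num_real _)) lerXn2r// ?nnegrE//; exact: ler_norm_sum.
    apply: (le_trans (sqr_sum_le _)); rewrite ler_wpM2l// mulr_sumr.
    apply: ler_sum => b _; rewrite exprMn ler_wpM2r ?sqr_ge0//.
    by rewrite -[X in X <= _](real_normK (num_real _)) lerXn2r.
  have y4 : (Y i x ^+ 2) ^+ 2 <= (nI * (K1 ^+ 2 * \sum_b (W b t x - W b s x) ^+ 2)) ^+ 2.
    have s0' : 0 <= \sum_b (W b t x - W b s x) ^+ 2 by apply: sumr_ge0 => b _; exact: sqr_ge0.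
    apply: lerXn2r => //; rewrite nnegrE ?sqr_ge0//.
    by apply: mulr_ge0; [exact: ler0n|apply: mulr_ge0 => //; exact: sqr_ge0].
  apply: (le_trans y4); rewrite exprMn (exprMn 2 (K1 ^+ 2)).
  have -> : nI ^+ 3 * K1 ^+ 4 * S x = nI ^+ 2 * (K1 ^+ 4 * (nI * S x)) by ring.
  have -> : K1 ^+ 2 ^+ 2 = K1 ^+ 4 by rewrite -exprM.
  rewrite ler_wpM2l ?sqr_ge0// ler_wpM2l ?exprn_ge0//.
  have := sqr_sum_le (fun b : nidx => (W b t x - W b s x) ^+ 2).
  under eq_bigr do rewrite ger0_norm ?sqr_ge0//.
  move/le_trans; apply; rewrite ler_wpM2l//.
  by rewrite /S le_eqVlt; apply/orP; left; apply/eqP; apply: eq_bigr => b _; rewrite -exprM.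
have LS' : L1 P (fun x => nI ^+ 3 * K1 ^+ 4 * S x) by exact: L1Z.
have L4 : L2 P (fun x => Y i x ^+ 2).
  have mY2 : measurable_fun setT (fun x => Y i x ^+ 2).
    by apply: measurable_funX; exact: L2_meas (Y_L2 i).
  split => //; apply: L1_le LS'; first exact: measurable_funX.
  by move=> x; rewrite ger0_norm ?sqr_ge0.
split => //; apply: (le_trans (mean_le (L2_sq L4) LS' bnd)).
rewrite meanZ// /S mean_sum; last by move=> b _; have [] := bm_pow4 hF hW s0 st b.
rewrite (eq_bigr (fun=> 3 * h ^+ 2)); last by move=> b _; have [] := bm_pow4 hF hW s0 st b.
rewrite sumr_const -[X in _ * X]mulr_natl -/nI le_eqVlt; apply/orP; left; apply/eqP; ring.
Qed.

Definition cubic_const : R :=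
  n2 * \sum_(i : idx) (4 * n2 * approx_const R n + 2 * (n2 * (n2 * incr_const R n) + nI ^+ 4 * K1 ^+ 4 * 3)).

Let N1_L2 : L2 P (fun x => N1 (U t x - U s x)).
Proof.
apply: L2_sum => i _; under eq_fun do rewrite coB.
have [m i2] := dU_L2 i; split; first exact: measurableT_comp.
by under eq_fun do rewrite real_normK ?num_real//.
Qed.

Let N1_sq_mean : mean P (fun x => N1 (U t x - U s x) ^+ 2) <= n2 * (n2 * incr_const R n) * h.
Proof.
have LS : L1 P (fun x => n2 * \sum_i dU s t i x ^+ 2).
  by apply: L1Z; apply: L1_sum => i _; apply: L2_sq; exact: dU_L2.
apply: (le_trans (mean_le (L2_sq N1_L2) LS (fun x => _))).
  by move=> x; apply: (le_trans (N1_sq _)); rewrite ler_wpM2l//; apply: ler_sum => i _; rewrite coB -/(dU s t i x).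
rewrite meanZ; last by apply: L1_sum => i _; apply: L2_sq; exact: dU_L2.
rewrite -mulrA ler_wpM2l// mean_sum; last by move=> i _; apply: L2_sq; exact: dU_L2.
apply: (@le_trans _ _ (\sum_(i : idx) incr_const R n * h)).
  by apply: ler_sum => i _; exact: dU_sq.
by rewrite sumr_const -[X in X <= _]mulr_natl mulrA.
Qed.

(** Only second moments of dU are known. One factor N of N^3 is kept and dU_i^2 <= 2 (dU_i - Y_i)^2
    + 2 Y_i^2. In the first term N is bounded by unitarity and the rest has order h^2; in the
    second, the second moment of N and the fourth moment of Y combine to h^(3/2). *)
Let N1_cubic : L1 P (fun x => N1 (U t x - U s x) ^+ 3) /\
  mean P (fun x => N1 (U t x - U s x) ^+ 3) <= cubic_const * (h * q).
Proof.
pose Z i x := 4 * n2 * (dU s t i x - Y i x) ^+ 2 + 2 * `|N1 (U t x - U s x) * Y i x ^+ 2|.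
have LQ i : L2 P (fun x => dU s t i x - Y i x) by exact: L2B.
have LZ i : L1 P (Z i).
  apply: L1D; first by apply: L1Z; exact: L2_sq.
  by apply: L1Z; apply: L1_norm; apply: L2M => //; have [] := Y4 i.
have LSZ : L1 P (fun x => n2 * \sum_i Z i x) by apply: L1Z; apply: L1_sum => i _.
have bnd x : N1 (U t x - U s x) ^+ 3 <= n2 * \sum_i Z i x.
  set N := N1 _; have N0 : 0 <= N by exact: N1_ge0.
  have N2 : N <= 2 * n2.
    apply: (le_trans (N1B _ _)); have := unitary_N1 (Uu x t0); have := unitary_N1 (Uu x s0).
    rewrite -/n2; lra.
  rewrite exprS; apply: (le_trans (ler_wpM2l N0 (N1_sq _))); rewrite mulrCA ler_wpM2l//.
  rewrite mulr_sumr; apply: ler_sum => i _; rewrite coB -/(dU s t i x) /Z -/N.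
  rewrite (ger0_norm (mulr_ge0 N0 (sqr_ge0 _))).
  have : dU s t i x ^+ 2 <= 2 * (dU s t i x - Y i x) ^+ 2 + 2 * Y i x ^+ 2.
    have := sqr_ge0 (dU s t i x - 2 * Y i x); nra.
  move/(ler_wpM2l N0) => /le_trans; apply; rewrite mulrDr; apply: lerD; last first.
    by rewrite mulrCA.
  rewrite mulrA ler_wpM2r ?sqr_ge0//; lra.
have LN : L1 P (fun x => N1 (U t x - U s x) ^+ 3).
  apply: L1_le LSZ; first by apply: measurable_funX; exact: L2_meas N1_L2.
  by move=> x; rewrite ger0_norm// exprn_ge0// N1_ge0.
split => //; apply: (le_trans (mean_le LN LSZ bnd)).
rewrite meanZ; last by apply: L1_sum => i _.
rewrite /cubic_const -mulrA ler_wpM2l// mean_sum//.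
rewrite mulr_suml; apply: ler_sum => i _.
have [L4 h4] := Y4 i.
rewrite /Z meanD; [|by apply: L1Z; exact: L2_sq|by apply: L1Z; apply: L1_norm; exact: L2M].
rewrite !meanZ; [|by apply: L1_norm; exact: L2M|exact: L2_sq].
rewrite [X in _ <= X]mulrDl; apply: lerD.
  rewrite -!mulrA ler_pM2l// ler_wpM2l//.
  apply: (le_trans (Q_sq i)); rewrite ler_wpM2l ?approx_const_ge0// expr2 ler_pM2l//.
  rewrite -q2 expr2 ler_piMl ?(ltW q0)//.
  by rewrite -sqrtr1 ler_wsqrtr.
rewrite -mulrA ler_pM2l//.
have := mean_mul_le q0 N1_L2 L4 N1_sq_mean h4.
move/le_trans; apply; rewrite hq3 le_eqVlt; apply/orP; left; apply/eqP; ring.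
Qed.

Definition step_const : R :=
  \sum_(i : idx) n%:R * (incr_const R n + 1) + \sum_(i : idx) \sum_(j : idx) pair_const + cubic_const.

(** The error splits into [r1], [r2] and [r3]. The drift subtracted in [r1] and the covariance
    subtracted in [r2] are the two summands of the generator; [r3] is the cubic remainder. *)
Lemma one_step_bound G D1 D2 K E : 0 <= K -> jet G D1 D2 K -> F s E ->
  `|mean P (fun x => \1_E x * (G (U t x) - G (U s x) - h * gen D1 D2 (U s x)))| <=
    K * (step_const * (h * q)).
Proof.
move=> K0 J FE; have sF := filt_sigma hF s0; have sT := filt_sigma hF t0.
have mE : measurable_wrt (F s) (fun x => \1_E x : R) by exact: mwr_indic.
have E1 x : `|\1_E x : R| <= 1 by rewrite indicE; case: (_ \in _); rewrite ?normr1 ?normr0.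
have mB0 u (g : M -> R) : 0 <= u -> measurable_wrt (@borel_mx R n n) g ->
    measurable_wrt (F u) (fun x => g (U u x)).
  by move=> u0 mg; apply: (mwr_mmw (filt_sigma hF u0) (U_mmw Uad u0) mg).
(* The coefficients at time s absorb the indicator of E; they stay measurable for [F s] and bounded
   by [K], as the moment estimates need. *)
pose b1 i x := \1_E x * D1 (U s x) (ebase R i).
pose b2 i j x := \1_E x * D2 (U s x) (ebase R i) (ebase R j).
have mb1 i : measurable_wrt (F s) (b1 i).
  by apply: (mwrM sF) => //; apply: (mB0 s (D1 ^~ _) s0); exact: jet_meas1 J _.
have mb2 i j : measurable_wrt (F s) (b2 i j).
  by apply: (mwrM sF) => //; apply: (mB0 s (fun u => D2 u _ _) s0); exact: jet_meas2 J _ _.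
have b1K i x : `|b1 i x| <= K.
  rewrite /b1 normrM -[K]mul1r; apply: ler_pM => //.
  by apply: (le_trans (jet_bound1 J _ (Uu x s0))); rewrite N1_ebase mulr1.
have b2K i j x : `|b2 i j x| <= K.
  rewrite /b2 normrM -[K]mul1r; apply: ler_pM => //.
  by apply: (le_trans (jet_bound2 J _ _ (Uu x s0))); rewrite !N1_ebase !mulr1.
have b1T i := adapted_meas hF s0 (mb1 i).
have b2T i j := adapted_meas hF s0 (mb2 i j).
pose r1 i x := b1 i x * dU s t i x + n%:R * h * (b1 i x * co (U s x) i).
pose r2 i j x := b2 i j x * (dU s t i x * dU s t j x) - h * \sum_b b2 i j x * (cf i b x * cf j b x).
pose r3 x := \1_E x * (G (U t x) - G (U s x) - D1 (U s x) (U t x - U s x) -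
  D2 (U s x) (U t x - U s x) (U t x - U s x)).
have Uco_L2 i : L2 P (fun x => co (U s x) i).
  apply: (@L2_bnd _ _ _ _ 1); first by apply: (adapted_meas hF s0); exact: U_co_adapted.
  by move=> x; exact: (U_co_bound Uu x i s0).
have Lb1 i : L1 P (fun x => b1 i x * co (U s x) i).
  by apply: (L1M_bnd (b1T i) (b1K i)); exact: L2_L1.
have Lb1d i : L1 P (fun x => b1 i x * dU s t i x).
  by apply: (L1M_bnd (b1T i) (b1K i)); exact: L2_L1.
have Lr1 i : L1 P (r1 i) by apply: L1D => //; exact: L1Z.
have Lb2 i j b : L1 P (fun x => b2 i j x * (cf i b x * cf j b x)).
  by apply: (L1M_bnd (b2T i j) (b2K i j)); exact: L2M.
have Lb2d i j : L1 P (fun x => b2 i j x * (dU s t i x * dU s t j x)).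
  by apply: (L1M_bnd (b2T i j) (b2K i j)); exact: L2M.
have Lr2 i j : L1 P (r2 i j) by apply: L1B => //; apply: L1Z; apply: L1_sum => b _.
have dec x : \1_E x * (G (U t x) - G (U s x) - h * gen D1 D2 (U s x)) =
    \sum_i r1 i x + \sum_i \sum_j r2 i j x + r3 x.
  have e1 : \1_E x * D1 (U s x) (U t x - U s x) = \sum_i b1 i x * dU s t i x.
    rewrite (lin_expand (jet_lin1 J _)) mulr_sumr; apply: eq_bigr => i _.
    by rewrite coB /b1 /dU; ring.
  have e2 : \1_E x * D2 (U s x) (U t x - U s x) (U t x - U s x) =
      \sum_i \sum_j b2 i j x * (dU s t i x * dU s t j x).
    rewrite (bilin_expand (jet_lin2 J _) (jet_lin3 J _)) mulr_sumr; apply: eq_bigr => i _.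
    by rewrite mulr_sumr; apply: eq_bigr => j _; rewrite !coB /b2 /dU; ring.
  have e3 : \1_E x * D1 (U s x) (U s x) = \sum_i b1 i x * co (U s x) i.
    rewrite (lin_expand (jet_lin1 J _)) mulr_sumr; apply: eq_bigr => i _.
    by rewrite /b1; ring.
  have e4 : \1_E x * (\sum_b D2 (U s x) (U s x *m Xb R b) (U s x *m Xb R b)) =
      \sum_i \sum_j \sum_b b2 i j x * (cf i b x * cf j b x).
    rewrite mulr_sumr.
    under [RHS]eq_bigr do rewrite exchange_big/=.
    rewrite [RHS]exchange_big/=; apply: eq_bigr => b _.
    rewrite (bilin_expand (jet_lin2 J _) (jet_lin3 J _)) mulr_sumr; apply: eq_bigr => i _.
    by rewrite mulr_sumr; apply: eq_bigr => j _; rewrite /b2 /cf /noise_coef; ring.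
  have -> : \sum_i r1 i x = \1_E x * D1 (U s x) (U t x - U s x) + n%:R * h * (\1_E x * D1 (U s x) (U s x)).
    by rewrite /r1 big_split/= -mulr_sumr -e1 -e3.
  have -> : \sum_i \sum_j r2 i j x = \1_E x * D2 (U s x) (U t x - U s x) (U t x - U s x) -
      h * (\1_E x * (\sum_b D2 (U s x) (U s x *m Xb R b) (U s x *m Xb R b))).
    rewrite e2 e4 mulr_sumr -sumrB; apply: eq_bigr => i _.
    by rewrite mulr_sumr -sumrB; apply: eq_bigr.
  rewrite /r3 /gen; ring.
have [LN hN] := N1_cubic.
have LKN : L1 P (fun x => K * N1 (U t x - U s x) ^+ 3) by exact: L1Z.
have r3b x : `|r3 x| <= K * N1 (U t x - U s x) ^+ 3.
  rewrite /r3 normrM -[X in _ <= X]mul1r; apply: ler_pM => //.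
  exact: (jet_rem J (Uu x s0) (Uu x t0)).
have mG u : 0 <= u -> measurable_fun setT (fun x => G (U u x)).
  by move=> u0; apply: (adapted_meas hF u0); exact: (mB0 u G u0 (jet_meas0 J)).
(* Integrability is obtained by difference from [dec], all other terms being integrable. *)
have Lr3 : L1 P r3.
  have -> : r3 = (fun x => \1_E x * (G (U t x) - G (U s x) - h * gen D1 D2 (U s x)) -
      (\sum_i r1 i x + \sum_i \sum_j r2 i j x)).
    by apply/funext => x; rewrite dec; ring.
  apply: L1B; last by apply: L1D; apply: L1_sum => i _ //; apply: L1_sum.
  apply: (L1M_bnd (K := 1)) => //; first exact: (adapted_meas hF s0).
  have LG u : 0 <= u -> L1 P (fun x => G (U u x)).
    move=> u0; apply: (@L1_bnd _ _ _ _ K); first exact: mG.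
    by move=> x; apply: (jet_bound0 J); exact: Uu.
  apply: L1B; first by apply: L1B; exact: LG.
  apply: L1Z; apply: (@L1_bnd _ _ _ _ (K * gen_const R n)).
    by apply: (adapted_meas hF s0); apply: (mB0 s _ s0); exact: gen_meas J.
  by move=> x; apply: (gen_bound K0 J); exact: Uu.
have -> : (fun x => \1_E x * (G (U t x) - G (U s x) - h * gen D1 D2 (U s x))) =
    (fun x => \sum_i r1 i x + \sum_i \sum_j r2 i j x + r3 x) by exact/funext.
have LS1 : L1 P (fun x => \sum_i r1 i x) by apply: L1_sum.
have LS2 : L1 P (fun x => \sum_i \sum_j r2 i j x) by apply: L1_sum => i _; apply: L1_sum.
rewrite meanD//; last exact: L1D.
rewrite meanD// !mean_sum//; last by move=> i _; apply: L1_sum.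
apply: (le_trans (ler_normD _ _)); rewrite /step_const mulrDl mulrDr; apply: lerD; last first.
  apply: (le_trans (mean_norm_le Lr3 LKN r3b)).
  by rewrite meanZ// ler_wpM2l.
apply: (le_trans (ler_normD _ _)); rewrite mulrDl mulrDr; apply: lerD.
  apply: (le_trans (ler_norm_sum _ _ _)); rewrite mulr_suml mulr_sumr; apply: ler_sum => i _.
  rewrite /r1 meanD//; last exact: L1Z.
  rewrite meanZ//.
  apply: (le_trans (U_incr_mean hF Uu Uad Uc hW hAW hI i s0 st t1 (mb1 i) (b1K i))).
  by rewrite -/h -/q le_eqVlt; apply/orP; left; apply/eqP; ring.
apply: (le_trans (ler_norm_sum _ _ _)); rewrite mulr_suml mulr_sumr; apply: ler_sum => i _.
rewrite mean_sum//.
apply: (le_trans (ler_norm_sum _ _ _)); rewrite mulr_suml mulr_sumr; apply: ler_sum => j _.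
rewrite /r2 meanB//; last by apply: L1Z; apply: L1_sum.
rewrite meanZ; last by apply: L1_sum.
rewrite mean_sum//.
exact: (second_moment i j (mb2 i j) (b2K i j)).
Qed.

End Step.

End OneStep.

Section OneStepExists.
Context d (T : measurableType d) (R : realType) (P : probability T R) (F : R -> set (set T)).
Hypothesis hF : complete_filtration P F.
Variable n : nat.
Variable U : R -> T -> 'M[R[i]]_n.
Hypothesis hU : brownian_unitary P F U.

(** Hides the driving noise: everything below depends on U only through this estimate, path
    continuity and adaptedness. *)
Lemma one_step : exists2 c : R, 0 <= c & forall G D1 D2 K s t E, 0 <= K -> jet G D1 D2 K ->
  0 <= s -> s < t -> t <= s + 1 -> F s E ->
  `|mean P (fun x => \1_E x * (G (U t x) - G (U s x) - (t - s) * gen D1 D2 (U s x)))| <=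
    K * (c * ((t - s) * Num.sqrt (t - s))).
Proof.
have [_ _ _ [A hA hI]] := hU.
have [W hW hAW] := brownian_u_noise hA.
exists `|step_const R n| => // G D1 D2 K s t E K0 J s0 st t1 FE.
apply: (le_trans (one_step_bound hF hU hW hAW hI s0 st t1 K0 J FE)).
rewrite ler_wpM2l// ler_wpM2r// ?ler_norm// mulr_ge0 ?sqrtr_ge0// subr_ge0 ltW//.
Qed.

End OneStepExists.

(** * Mean value and Taylor estimates on an interval *)

Section Taylor.
Variable R : realType.
Implicit Types (f df : R -> R) (a b x y : R).

(** Allows either order of x and y, and records that the intermediate point is no farther from x
    than y is. *)
Lemma mvt_seg f df a b x y : (forall z, a <= z <= b -> is_derive (z : R) 1 f (df z)) ->
  a <= x <= b -> a <= y <= b ->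
  exists c, [/\ a <= c <= b, `|c - x| <= `|y - x| & f y - f x = df c * (y - x)].
Proof.
move=> fd.
have key u v : a <= u <= b -> a <= v <= b -> u < v ->
    exists c, [/\ u <= c, c <= v & f v - f u = df c * (v - u)].
  move=> /andP[au ub] /andP[av vb] uv.
  have h z : u <= z -> z <= v -> is_derive (z : R) 1 f (df z).
    by move=> uz zv; apply: fd; rewrite (le_trans au)//= (le_trans zv).
  have [] := @MVT R f df u v uv.
  - by move=> z; rewrite in_itv/= => /andP[/ltW uz /ltW zv]; exact: h.
  - apply: derivable_within_continuous => z; rewrite in_itv/= => /andP[uz zv].
    by have [] := h z uz zv.
  by move=> c; rewrite in_itv/= => /andP[/ltW uc /ltW cv] e; exists c.
move=> hx hy; have [xy|yx|<-] := ltgtP x y.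
- have [c [c1 c2 c3]] := key _ _ hx hy xy; exists c; split => //.
    by move/andP: hx => [ax _]; move/andP: hy => [_ yb]; rewrite (le_trans ax)//= (le_trans c2).
  by rewrite !ger0_norm ?subr_ge0 ?(ltW xy)// lerB.
- have [c [c1 c2 c3]] := key _ _ hy hx yx; exists c; split => //.
  + by move/andP: hx => [_ xb]; move/andP: hy => [ay _]; rewrite (le_trans ay)//= (le_trans c2).
  + by rewrite !ler0_norm ?subr_le0 ?(ltW yx)//; lra.
  + by rewrite -opprB c3; ring.
- by exists x; rewrite subrr mulr0 subrr.
Qed.

Lemma mv_bound f df a b x y M : (forall z, a <= z <= b -> is_derive (z : R) 1 f (df z)) ->
  a <= x <= b -> a <= y <= b ->
  (forall z, a <= z <= b -> `|z - x| <= `|y - x| -> `|df z| <= M) ->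
  `|f y - f x| <= M * `|y - x|.
Proof.
move=> fd hx hy dM; have [c [c1 c2 ->]] := mvt_seg fd hx hy.
by rewrite normrM ler_wpM2r// dM.
Qed.

(** The mean value bound is used three times, each time on a function minus its Taylor polynomial at
    x; the constant is therefore C and not the optimal C / 6. *)
Lemma taylor3 (f0 f1 f2 f3 : R -> R) a b C x y :
  (forall z, a <= z <= b -> is_derive (z : R) 1 f0 (f1 z)) ->
  (forall z, a <= z <= b -> is_derive (z : R) 1 f1 (f2 z)) ->
  (forall z, a <= z <= b -> is_derive (z : R) 1 f2 (f3 z)) ->
  (forall z, a <= z <= b -> `|f3 z| <= C) ->
  a <= x <= b -> a <= y <= b ->
  `|f0 y - f0 x - f1 x * (y - x) - 2^-1 * f2 x * (y - x) ^+ 2| <= C * `|y - x| ^+ 3.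
Proof.
move=> d0 d1 d2 f3C hx hy.
have C0 : 0 <= C by exact: (le_trans (normr_ge0 _) (f3C _ hx)).
have e2 z : a <= z <= b -> `|z - x| <= `|y - x| -> `|f2 z - f2 x| <= C * `|y - x|.
  move=> hz zy; apply: (le_trans (mv_bound d2 hx hz (M := C) _)).
    by move=> w hw _; exact: f3C.
  exact: ler_wpM2l.
have e1 z : a <= z <= b -> `|z - x| <= `|y - x| -> `|f1 z - f1 x - f2 x * (z - x)| <= C * `|y - x| ^+ 2.
  move=> hz zy; have g1 w : a <= w <= b -> is_derive (w : R) 1 (fun w => f1 w - f2 x * w) (f2 w - f2 x).
    by move=> hw; have h := d1 w hw; apply: is_derive_eq; rewrite /GRing.scale/= mulr1.
  have := mv_bound g1 hx hz (M := C * `|y - x|).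
  have -> : f1 z - f2 x * z - (f1 x - f2 x * x) = f1 z - f1 x - f2 x * (z - x) by ring.
  move=> h; apply: (le_trans (h _)); first by move=> w hw wz; apply: e2 => //; exact: le_trans zy.
  by rewrite expr2 mulrA; apply: ler_wpM2l => //; rewrite mulr_ge0.
have g0 w : a <= w <= b -> is_derive (w : R) 1
    (fun w => f0 w - f1 x * w - 2^-1 * f2 x * (w - x) ^+ 2) (f1 w - f1 x - f2 x * (w - x)).
  by move=> hw; have h := d0 w hw; apply: is_derive_eq; rewrite /GRing.scale/=; field.
have := mv_bound g0 hx hy (M := C * `|y - x| ^+ 2) e1.
by rewrite subrr (_ : _ - _ = f0 y - f0 x - f1 x * (y - x) - 2^-1 * f2 x * (y - x) ^+ 2) -?mulrA -?exprSr//; ring.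
Qed.

End Taylor.

(** * Calculus of jets *)

Section JetCalculus.
Variables (R : realType) (n : nat).
Local Notation C := R[i].
Local Notation M := 'M[C]_n.
Local Notation idx := (bool * 'I_n * 'I_n)%type.
Let sB := @borel_sigma R n n.
Let bN : R := #|{: idx}|%:R + #|{: idx}|%:R.

Let bN_ge0 : 0 <= bN. Proof. by rewrite addr_ge0. Qed.
Implicit Types (G : M -> R) (K : R).

Lemma unitary_N1B (u u' : M) : u \is unitarymx -> u' \is unitarymx -> N1 (u' - u) <= bN.
Proof. by move=> hu hu'; apply: (le_trans (N1B _ _)); apply: lerD; exact: unitary_N1. Qed.

Lemma jet_co (i : idx) : jet (fun u : M => co u i) (fun _ v => co v i) (fun _ _ _ => 0) 1.
Proof.
split.
- by move=> u c v w; rewrite coD coZ.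
- by move=> *; rewrite mulr0 addr0.
- by move=> *; rewrite mulr0 addr0.
- exact: borel_co.
- by move=> v; exact: mwr_cst.
- by move=> v w; exact: mwr_cst.
- by move=> u hu; exact: unitary_co.
- by move=> u v hu; rewrite mul1r; exact: co_N1.
- by move=> u v w hu; rewrite normr0 mul1r mulr_ge0// N1_ge0.
- by move=> u u' _ _; rewrite coB subr0 subrr normr0 mul1r exprn_ge0// N1_ge0.
Qed.

Lemma jet_const c : jet (fun _ : M => c) (fun _ _ => 0) (fun _ _ _ => 0) `|c|.
Proof.
split => *; rewrite ?mulr0 ?addr0 ?subrr ?subr0 ?normr0 ?mulr_ge0 ?exprn_ge0 ?N1_ge0//.
- exact: mwr_cst.
- exact: mwr_cst.
- exact: mwr_cst.
Qed.

Lemma jetD G (D1 : M -> M -> R) (D2 : M -> M -> M -> R) K (G' : M -> R) (D1' : M -> M -> R) (D2' : M -> M -> M -> R) (K' : R) : jet G D1 D2 K -> jet G' D1' D2' K' ->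
  jet (fun u => G u + G' u) (fun u v => D1 u v + D1' u v) (fun u v w => D2 u v w + D2' u v w) (K + K').
Proof.
move=> J J'; split => *.
- by rewrite (jet_lin1 J) (jet_lin1 J'); ring.
- by rewrite (jet_lin2 J) (jet_lin2 J'); ring.
- by rewrite (jet_lin3 J) (jet_lin3 J'); ring.
- by apply: (mwrD sB); [exact: jet_meas0 J|exact: jet_meas0 J'].
- by apply: (mwrD sB); [exact: jet_meas1 J _|exact: jet_meas1 J' _].
- by apply: (mwrD sB); [exact: jet_meas2 J _ _|exact: jet_meas2 J' _ _].
- by apply: (le_trans (ler_normD _ _)); apply: lerD; [exact: (jet_bound0 J)|exact: (jet_bound0 J')].
- rewrite mulrDl; apply: (le_trans (ler_normD _ _)).
  by apply: lerD; [exact: (jet_bound1 J)|exact: (jet_bound1 J')].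
- rewrite mulrDl; apply: (le_trans (ler_normD _ _)).
  by apply: lerD; [exact: (jet_bound2 J)|exact: (jet_bound2 J')].
rewrite mulrDl.
have -> : forall a b c d a' b' c' d' : R,
   a + a' - (b + b') - (c + c') - (d + d') = (a - b - c - d) + (a' - b' - c' - d') by move=> *; ring.
apply: (le_trans (ler_normD _ _)).
by apply: lerD; [exact: (jet_rem J)|exact: (jet_rem J')].
Qed.

Lemma jet_sum (I : Type) (s : seq I) (G : I -> M -> R) (D1 : I -> M -> M -> R)
    (D2 : I -> M -> M -> M -> R) (K : I -> R) : (forall i : I, jet (G i) (D1 i) (D2 i) (K i)) ->
  jet (fun u => \sum_(i <- s) G i u) (fun u v => \sum_(i <- s) D1 i u v)
    (fun u v w => \sum_(i <- s) D2 i u v w) (\sum_(i <- s) K i).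
Proof.
move=> J; elim: s => [|i s IH].
  have := jet_const 0; rewrite normr0 => J0; rewrite big_nil.
  have e0 (f : I -> R) : \sum_(i <- [::]) f i = 0 by rewrite big_nil.
  move: J0; congr jet; apply/funext => u; rewrite ?e0//; apply/funext => v; rewrite ?e0//.
  by apply/funext => w; rewrite e0.
have e1 (f : I -> R) : \sum_(j <- i :: s) f j = f i + \sum_(j <- s) f j by rewrite big_cons.
have := jetD (J i) IH; rewrite -e1.
by congr jet; apply/funext => u; [|apply/funext => v|apply/funext => v; apply/funext => w]; rewrite e1.
Qed.

(** The chain rule for jets. The outer function needs derivatives only on an interval containing the
    values of G at unitary points. *)
Lemma jet_comp G (D1 : M -> M -> R) (D2 : M -> M -> M -> R) K (f0 f1 f2 f3 : R -> R) a b B : 0 <= K -> jet G D1 D2 K ->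
  (forall u, u \is unitarymx -> a <= G u <= b) ->
  (forall z, a <= z <= b -> is_derive (z : R) 1 f0 (f1 z)) ->
  (forall z, a <= z <= b -> is_derive (z : R) 1 f1 (f2 z)) ->
  (forall z, a <= z <= b -> is_derive (z : R) 1 f2 (f3 z)) ->
  measurable_fun setT f0 -> measurable_fun setT f1 -> measurable_fun setT f2 ->
  (forall z, a <= z <= b -> [/\ `|f0 z| <= B, `|f1 z| <= B, `|f2 z| <= B & `|f3 z| <= B]) -> 0 <= B ->
  exists2 K' : R, 0 <= K' & jet (fun u => f0 (G u)) (fun u v => f1 (G u) * D1 u v)
    (fun u v w => f1 (G u) * D2 u v w + 2^-1 * f2 (G u) * (D1 u v * D1 u w)) K'.
Proof.
move=> K0 J Gab d0 d1 d2 m0 m1 m2 fB B0.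
(* A Lipschitz constant of G between unitary matrices: the quadratic and cubic parts of the
   expansion are linearised using the bound [bN] on their distance. *)
pose L := K * (1 + bN + bN ^+ 2); have L0 : 0 <= L by rewrite mulr_ge0// !addr_ge0// sqr_ge0.
have half : `|2^-1 : R| <= 1 by rewrite ger0_norm; lra.
pose K3 : R := B * K + B * (K * (1 + bN) * (L + K)) + B * L ^+ 3.
have K30 : 0 <= K3 by rewrite !addr_ge0// ?mulr_ge0 ?addr_ge0// ?exprn_ge0.
pose K' : R := B + B * K + (B * K + B * (K * K)) + K3.
have p1 : 0 <= B * K by exact: mulr_ge0.
have p2 : 0 <= B * (K * K) by rewrite !mulr_ge0.
have K'0 : 0 <= K' by rewrite /K'; lra.
have mG (g : R -> R) : measurable_fun setT g -> measurable_wrt (@borel_mx R n n) (fun u => g (G u)).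
  by move=> mg; apply: mwr_comp => //; exact: jet_meas0 J.
exists K'; first exact: K'0.
split.
- by move=> u c v w; rewrite (jet_lin1 J); ring.
- by move=> u c v w z; rewrite (jet_lin1 J) (jet_lin2 J); ring.
- by move=> u c v w z; rewrite (jet_lin1 J) (jet_lin3 J); ring.
- exact: mG.
- by move=> v; apply: (mwrM sB); [exact: mG|exact: jet_meas1 J _].
- move=> v w; apply: (mwrD sB); apply: (mwrM sB).
  + exact: mG.
  + exact: jet_meas2 J _ _.
  + by apply: (mwrM sB); [exact: mwr_cst|exact: mG].
  + by apply: (mwrM sB); exact: jet_meas1 J _.
- move=> u hu; have [h _ _ _] := fB _ (Gab u hu); apply: (le_trans h); rewrite /K'; lra.
- move=> u v hu; have [_ h _ _] := fB _ (Gab u hu); rewrite normrM.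
  apply: (@le_trans _ _ (B * (K * N1 v))); first by apply: ler_pM => //; exact: (jet_bound1 J).
  by rewrite mulrA; apply: ler_wpM2r; [exact: N1_ge0|rewrite /K'; lra].
- move=> u v w hu; have [_ h1 h2 _] := fB _ (Gab u hu).
  apply: (@le_trans _ _ (B * (K * (N1 v * N1 w)) + B * ((K * N1 v) * (K * N1 w)))).
    apply: (le_trans (ler_normD _ _)); apply: lerD; rewrite normrM; apply: ler_pM => //.
    + exact: (jet_bound2 J).
    + by rewrite normrM -[B]mul1r; apply: ler_pM.
    + by rewrite normrM; apply: ler_pM => //; exact: (jet_bound1 J).
  have -> : B * (K * (N1 v * N1 w)) + B * (K * N1 v * (K * N1 w)) = (B * K + B * (K * K)) * (N1 v * N1 w) by ring.
  by apply: ler_wpM2r; [rewrite mulr_ge0// N1_ge0|rewrite /K'; lra].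
move=> u u' hu hu'.
have [_ h1 h2 _] := fB _ (Gab u hu).
have := jet_bound1 J (u' - u) hu; have := jet_bound2 J (u' - u) (u' - u) hu; have := jet_rem J hu hu'.
set N := N1 (u' - u); set D := D1 u (u' - u); set E := D2 u (u' - u) (u' - u).
have N0 : 0 <= N by exact: N1_ge0.
have Nb : N <= bN by exact: (unitary_N1B hu hu').
set rho := G u' - G u - D - E => hr hE hD.
have NN : N ^+ 2 <= bN * N by rewrite expr2; apply: ler_wpM2r.
have N3a : N ^+ 3 <= bN * N ^+ 2 by rewrite exprS; apply: ler_wpM2r; rewrite ?exprn_ge0.
have N3 : N ^+ 3 <= bN ^+ 2 * N.
  apply: (le_trans N3a); rewrite expr2 -mulrA; exact: ler_wpM2l.
have dD : `|G u' - G u - D| <= K * (1 + bN) * N ^+ 2.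
  have -> : G u' - G u - D = E + rho by rewrite /rho; ring.
  apply: (le_trans (ler_normD _ _)); have := ler_wpM2l K0 N3a; nra.
have dL : `|G u' - G u| <= L * N.
  have -> : G u' - G u = D + (G u' - G u - D) by ring.
  apply: (le_trans (ler_normD _ _)); have := ler_wpM2l K0 NN.
  have : 0 <= K * bN * (bN * N - N ^+ 2) by rewrite !mulr_ge0// subr_ge0.
  rewrite /L; nra.
have T := taylor3 d0 d1 d2 (fun z hz => let: And4 _ _ _ h := fB z hz in h) (Gab _ hu) (Gab _ hu').
(* The middle term is the factored difference of the squares of G u' - G u and of D: its first
   factor has order N^2, its second order N. The last bracket is the scalar Taylor remainder. *)
have -> : f0 (G u') - f0 (G u) - f1 (G u) * D - (f1 (G u) * E + 2^-1 * f2 (G u) * (D * D)) =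
  f1 (G u) * rho + 2^-1 * f2 (G u) * ((G u' - G u - D) * ((G u' - G u) + D)) +
  (f0 (G u') - f0 (G u) - f1 (G u) * (G u' - G u) - 2^-1 * f2 (G u) * (G u' - G u) ^+ 2).
  rewrite /rho; ring.
apply: (@le_trans _ _ (K3 * N ^+ 3)); last first.
  by apply: ler_wpM2r; [exact: exprn_ge0|rewrite /K'; lra].
have -> : K3 * N ^+ 3 = B * (K * N ^+ 3) + 1 * B * ((K * (1 + bN) * N ^+ 2) * (L * N + K * N)) + B * (L * N) ^+ 3.
  by rewrite /K3; ring.
apply: (le_trans (ler_normD _ _)); apply: lerD; last first.
  apply: (le_trans T); apply: ler_wpM2l => //.
  by rewrite lerXn2r// nnegrE// mulr_ge0.
apply: (le_trans (ler_normD _ _)); apply: lerD; rewrite normrM; apply: ler_pM => //.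
  by rewrite normrM; apply: ler_pM.
rewrite normrM; apply: ler_pM => //.
by apply: (le_trans (ler_normD _ _)); apply: lerD.
Qed.

(** The diffusion chain rule; the last sum is the carre du champ of G. *)
Lemma gen_comp (f1 f2 : R -> R) G (D1 : M -> M -> R) (D2 : M -> M -> M -> R) (u : M) :
  gen (fun u v => f1 (G u) * D1 u v)
    (fun u v w => f1 (G u) * D2 u v w + 2^-1 * f2 (G u) * (D1 u v * D1 u w)) u =
  f1 (G u) * gen D1 D2 u + 2^-1 * f2 (G u) * \sum_b D1 u (u *m Xb R b) ^+ 2.
Proof.
rewrite /gen big_split/= -!mulr_sumr mulrDr mulrCA !addrA.
by congr (_ + _ * _); apply: eq_bigr => b _; rewrite expr2.
Qed.

(** Translation enlarges [N1] by at most 1 + bN^2; the cube of this factor is what the remainder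
    requires. *)
Lemma jet_translate (l r : M) : l \is unitarymx -> r \is unitarymx ->
  forall G D1 D2 K, 0 <= K -> jet G D1 D2 K ->
  jet (fun u => G (l *m u *m r)) (fun u v => D1 (l *m u *m r) (l *m v *m r))
    (fun u v w => D2 (l *m u *m r) (l *m v *m r) (l *m w *m r)) (K * (1 + bN ^+ 2) ^+ 3).
Proof.
move=> hl hr G D1 D2 K K0 J.
pose c := 1 + bN ^+ 2.
have c1 : 1 <= c by rewrite /c lerDl sqr_ge0.
have c0 : 0 <= c by exact: le_trans c1.
have hU u : u \is unitarymx -> l *m u *m r \is unitarymx by move=> hu; exact: (mul_unitarymx (mul_unitarymx hl hu) hr).
have hN v : N1 (l *m v *m r) <= c * N1 v.
  have bl : N1 l <= bN by apply: (le_trans (unitary_N1 hl)); rewrite lerDl.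
  have br : N1 r <= bN by apply: (le_trans (unitary_N1 hr)); rewrite lerDl.
  apply: (le_trans (N1M _ _)).
  apply: (@le_trans _ _ (bN * N1 v * bN)).
    apply: ler_pM; rewrite ?N1_ge0//; apply: (le_trans (N1M _ _)).
    by apply: ler_wpM2r => //; exact: N1_ge0.
  have := N1_ge0 v; rewrite /c; nra.
have hc k : (k <= 3)%N -> c ^+ k <= c ^+ 3.
  by move=> hk; exact: (ler_weXn2l c1).
have lin v w (t : R) : l *m (t%:C%C *: v + w) *m r = t%:C%C *: (l *m v *m r) + l *m w *m r.
  by rewrite mulmxDr mulmxDl -scalemxAr -scalemxAl.
have mt : mmw (@borel_mx R n n) (fun u : M => l *m u *m r).
  apply: (mmwM sB); last exact: (mmw_cst sB).
  by apply: (mmwM sB); [exact: (mmw_cst sB)|exact: borel_mmw].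
split.
- by move=> u t v w; rewrite lin (jet_lin1 J).
- by move=> u t v w z; rewrite lin (jet_lin2 J).
- by move=> u t v w z; rewrite lin (jet_lin3 J).
- exact: (mwr_mmw sB mt (jet_meas0 J)).
- by move=> v; exact: (mwr_mmw sB mt (jet_meas1 J _)).
- by move=> v w; exact: (mwr_mmw sB mt (jet_meas2 J _ _)).
- move=> u hu; apply: (le_trans (jet_bound0 J (hU _ hu))).
  by rewrite -[X in X <= _]mulr1; apply: ler_wpM2l => //; exact: (hc 0).
- move=> u v hu; apply: (le_trans (jet_bound1 J _ (hU _ hu))); rewrite -mulrA.
  apply: ler_wpM2l => //; apply: (le_trans (hN _)); apply: ler_wpM2r; [exact: N1_ge0|exact: (hc 1)].
- move=> u v w hu; apply: (le_trans (jet_bound2 J _ _ (hU _ hu))); rewrite -mulrA.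
  apply: ler_wpM2l => //; apply: (@le_trans _ _ ((c * N1 v) * (c * N1 w))).
    by apply: ler_pM; rewrite ?N1_ge0.
  have -> : (c * N1 v) * (c * N1 w) = c ^+ 2 * (N1 v * N1 w) by ring.
  by apply: ler_wpM2r; [rewrite mulr_ge0// N1_ge0|exact: (hc 2)].
- move=> u u' hu hu'; have := jet_rem J (hU _ hu) (hU _ hu').
  rewrite -mulmxBl -mulmxBr => /le_trans; apply; rewrite -mulrA; apply: ler_wpM2l => //.
  by rewrite -exprMn; apply: lerXn2r; rewrite ?nnegrE ?N1_ge0// mulr_ge0// N1_ge0.
Qed.

End JetCalculus.

(** * Summation of local errors *)

Section Telescope.
Variable R : realType.
Variables (f g : R -> R) (a b C : R).
Hypothesis (ab : a <= b) (C0 : 0 <= C).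
Hypothesis fg : forall s t, a <= s -> s < t -> t <= b -> t <= s + 1 ->
  `|f t - f s - (t - s) * g s| <= C * ((t - s) * Num.sqrt (t - s)).

(** With N + 1 steps of length h the local errors h^(3/2) add up to (b - a) h^(1/2), which tends to
    0. Any local exponent above 1 would serve. *)
Lemma telescope_riem : riem g a b N @[N --> \oo] --> f b - f a.
Proof.
have [<-|neq] := eqVneq a b.
  rewrite subrr (_ : riem _ _ _ = fun=> 0); first exact: cvg_cst.
  by apply/funext => N; rewrite /riem big1// => i _; rewrite subrr !mul0r.
have ltab : a < b by rewrite lt_neqAle neq.
pose h N : R := (b - a) / N.+1%:R.
have h0 N : 0 < h N by rewrite divr_gt0// subr_gt0.
have ch : h N @[N --> \oo] --> 0.
  by rewrite -(mulr0 (b - a)); apply: cvgMr; exact: cvg_harmonic.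
have cs : C * ((b - a) * Num.sqrt (h N)) @[N --> \oo] --> 0.
  have -> : 0 = C * ((b - a) * Num.sqrt 0) :> R by rewrite sqrtr0 !mulr0.
  apply: cvgMr; apply: cvgMr.
  by apply: (cvg_comp _ (@Num.sqrt R) ch); exact: sqrt_continuous.
have bnd N : h N <= 1 -> `|f b - f a - riem g a b N| <= C * ((b - a) * Num.sqrt (h N)).
  move=> h1; pose t (i : nat) := a + h N * i%:R.
  have tS i : t i.+1 - t i = h N by rewrite /t -natr1; ring.
  have hN : h N * N.+1%:R = b - a by rewrite /h divfK// pnatr_eq0.
  have tN : t N.+1 = b by rewrite /t hN; ring.
  have t0 : t 0%N = a by rewrite /t mulr0 addr0.
  have -> : f b - f a - riem g a b N = \sum_(i < N.+1) (f (t i.+1) - f (t i) - h N * g (t i)).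
    rewrite sumrB; congr (_ - _); rewrite -tN -t0.
    by rewrite -(big_mkord xpredT (fun i => f (t i.+1) - f (t i))) telescope_sumr.
  apply: (le_trans (ler_norm_sum _ _ _)).
  apply: (@le_trans _ _ (\sum_(i < N.+1) C * (h N * Num.sqrt (h N)))).
    apply: ler_sum => i _; rewrite -(tS i); apply: fg.
    - by rewrite /t lerDl mulr_ge0// ltW.
    - by rewrite -subr_gt0 tS.
    - by rewrite -tN /t lerD2l ler_wpM2l ?(ltW (h0 _))// ler_nat.
    - by rewrite -lerBlDl tS.
  rewrite sumr_const card_ord -[X in X <= _]mulr_natr -hN le_eqVlt.
  by apply/orP; left; apply/eqP; ring.
have -> : riem g a b = (fun N => f b - f a - (f b - f a - riem g a b N)).
  by apply/funext => N; ring.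
rewrite -[X in _ --> X]subr0; apply: cvgB; first exact: cvg_cst.
apply/norm_cvg0P.
apply: (@squeeze_cvgr _ _ _ _ (fun=> 0) (fun N => C * ((b - a) * Num.sqrt (h N)))) => //; last exact: cvg_cst.
near=> N; rewrite normr_ge0/=; apply: bnd.
near: N; apply: (cvgr_le 0 ch); exact: ltr01.
Unshelve. all: by end_near. Qed.

End Telescope.

(** * Nonvanishing of the entries *)

Section NoiseSums.
Variables (R : realType) (n : nat).
Local Notation C := R[i].
Local Notation M := 'M[C]_n.
Implicit Types u : M.

Lemma noise_mul u k j h l :
  \sum_b (u *m Xb R b) k j * (u *m Xb R b) h l = - 2 * (u k l * u h j).
Proof.
under eq_bigr => b _ do rewrite !mxE mulr_suml.
rewrite exchange_big/=.
under eq_bigr => p _.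
  under eq_bigr => b _ do rewrite mulr_sumr.
  rewrite exchange_big/=.
  under eq_bigr => q _.
    under eq_bigr => b _ do rewrite mulrACA.
    rewrite -mulr_sumr casimir.
    over.
  over.
rewrite (bigD1 l)//= [X in _ + X]big1 ?addr0; last first.
  by move=> p pl; rewrite big1// => q _; rewrite (negbTE pl) mulr0 mulr0.
rewrite (bigD1 j)//= big1 ?addr0; last first.
  by move=> q qj; rewrite eq_sym (negbTE qj) andbF !mulr0.
by rewrite !eqxx mulr1; ring.
Qed.

(** Skew-Hermiticity of the basis reduces the conjugated sum to [casimir], and orthonormality of the
    rows of u collapses what is left. *)
Lemma noise_mul_conj u k j h l : u \is unitarymx ->
  \sum_b (u *m Xb R b) k j * ((u *m Xb R b) h l)^* = 2 * ((j == l) && (k == h))%:R.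
Proof.
move=> /unitarymxP/matrixP/(_ k h); rewrite !mxE => hu.
under eq_bigr => b _ do rewrite !mxE mulr_suml.
rewrite exchange_big/=.
under eq_bigr => p _.
  under eq_bigr => b _ do rewrite rmorph_sum/= mulr_sumr.
  rewrite exchange_big/=.
  under eq_bigr => q _.
    under eq_bigr => b _ do rewrite rmorphM/= mulrACA Xb_skew mulrN mulrN.
    rewrite sumrN -mulr_sumr casimir.
    over.
  over.
transitivity (\sum_p (2 * (j == l)%:R) * (u k p * (u h p)^*)).
  apply: eq_bigr => p _; rewrite (bigD1 p)//= big1 ?addr0; last first.
    by move=> q qp; rewrite eq_sym (negbTE qp) !mulr0 oppr0.
  by rewrite eqxx/=; ring.
rewrite -mulr_sumr; move: hu; under eq_bigr do rewrite !mxE.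
by move=> ->; case: (j == l); case: (k == h); rewrite /= ?mulr1 ?mulr0 ?mul0r.
Qed.

End NoiseSums.

(** * The logarithmic barrier *)

Section LogBarrier.
Variables (R : realType) (n : nat) (k j : 'I_n).
Local Notation C := R[i].
Local Notation M := 'M[C]_n.

Definition sqmod (z : C) : R := \sum_(e : bool) pt e z ^+ 2.

Lemma sqmodE z : (sqmod z)%:C%C = z * z^*.
Proof.
apply: eq_pt => e; rewrite ptM !ptJ /sqmod big_bool/=.
by case: e => /=; ring.
Qed.

Lemma sqmod_ge0 z : 0 <= sqmod z. Proof. by apply: sumr_ge0 => e _; exact: sqr_ge0. Qed.

Lemma sqmod_eq0 z : (sqmod z == 0) = (z == 0).
Proof. by rewrite -(inj_eq (@complexI R)) sqmodE mulf_eq0 conjC_eq0 orbb. Qed.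

Lemma sqmod_unitary (u : M) : u \is unitarymx -> 0 <= sqmod (u k j) <= 1.
Proof.
move=> hu; rewrite sqmod_ge0/= -(unitary_row k hu) (bigD1 j)//= /sqmod big_bool/= addrC lerDl.
by apply: sumr_ge0 => i _; rewrite addr_ge0// sqr_ge0.
Qed.

Let ix (e : bool) : bool * 'I_n * 'I_n := (e, k, j).
Let Z (u : M) : R := \sum_(e : bool) (co u (ix e)) ^+ 2.
Let Z1 (u v : M) : R := \sum_(e : bool) 2 * co u (ix e) * co v (ix e).
(** Kept in the exact shape delivered by [jet_comp] for the square, including the vanishing
    contribution of the zero second-order part of [jet_co]. *)
Let Z2 (u v w : M) : R := \sum_(e : bool) (2 * co u (ix e) * 0 + 2^-1 * 2 * (co v (ix e) * co w (ix e))).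

Lemma sqmod_jet : exists2 K : R, 0 <= K & jet (fun u : M => sqmod (u k j)) Z1 Z2 K.
Proof.
have H (e : bool) : exists2 K : R, 0 <= K & jet (fun u : M => co u (ix e) ^+ 2)
    (fun u v => 2 * co u (ix e) * co v (ix e))
    (fun u v w => 2 * co u (ix e) * 0 + 2^-1 * 2 * (co v (ix e) * co w (ix e))) K.
  apply: (@jet_comp _ _ _ _ _ 1 (fun x => x ^+ 2) (fun x => 2 * x) (fun=> 2) (fun=> 0) (-1) 1 2) => //.
  - exact: jet_co.
  - by move=> u hu; rewrite -ler_norml; exact: unitary_co.
  - by move=> z _; apply: is_derive_eq; rewrite /GRing.scale/=; ring.
  - by move=> z _; apply: is_derive_eq; rewrite /GRing.scale/=; ring.
  - exact: measurable_funM.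
  move=> z; rewrite -ler_norml => z1; have z0 := normr_ge0 z.
  rewrite normrX normrM normr0 (@ger0_norm _ 2)//; split => //; last lra.
  have := ler_piMr z0 z1; rewrite -expr2; lra.
have [K1 K10 J1] := H true; have [K2 K20 J2] := H false.
exists (\sum_(e : bool) if e then K1 else K2); first by rewrite big_bool/= addr_ge0.
by apply: jet_sum => -[].
Qed.

Lemma gen_sqmod u : u \is unitarymx -> gen Z1 Z2 u = 2 - 2 * n%:R * sqmod (u k j).
Proof.
move=> hu; have h : \sum_b sqmod ((u *m Xb R b) k j) = 2.
  apply: (@complexI R); rewrite rmorph_sum/= (eq_bigr _ (fun b _ => sqmodE _)) noise_mul_conj// !eqxx mulr1.
  by rewrite rmorph_nat.
rewrite /gen -[X in _ + X]subr0.
have -> : \sum_b Z2 u (u *m Xb R b) (u *m Xb R b) = \sum_b sqmod ((u *m Xb R b) k j).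
  by apply: eq_bigr => b _; apply: eq_bigr => e _; rewrite /co /=; field.
by rewrite h /Z1 /sqmod !big_bool/= /co/=; ring.
Qed.

(** The derivative of |u_kj|^2 along u X_b is a + conj a with a = conj(u_kj) (u X_b)_kj; expanding
    the square leaves the two kinds of noise sums. *)
Lemma gamma_sqmod u : u \is unitarymx ->
  \sum_b Z1 u (u *m Xb R b) ^+ 2 = 4 * (sqmod (u k j) - sqmod (u k j) ^+ 2).
Proof.
move=> hu; pose a b := (u k j)^* * (u *m Xb R b) k j.
have e1 b : (Z1 u (u *m Xb R b))%:C%C = a b + (a b)^*.
  apply: eq_pt => e; rewrite ptD ptJ /Z1 /a !ptM !ptJ big_bool/= /co/=.
  by case: e => /=; ring.
apply: (@complexI R); rewrite rmorph_sum/=.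
under eq_bigr do rewrite rmorphXn/= e1.
have -> : \sum_b (a b + (a b)^*) ^+ 2 = (u k j)^* ^+ 2 * \sum_b (u *m Xb R b) k j * (u *m Xb R b) k j +
    (\sum_b (u *m Xb R b) k j * (u *m Xb R b) k j)^* * (u k j) ^+ 2 +
    2 * (u k j * (u k j)^*) * \sum_b (u *m Xb R b) k j * ((u *m Xb R b) k j)^*.
  rewrite rmorph_sum/= mulr_suml !mulr_sumr -!big_split/=; apply: eq_bigr => b _.
  by rewrite /a !rmorphM/= conjCK; ring.
rewrite noise_mul noise_mul_conj// !eqxx mulr1 !rmorphM/= !rmorphB/= rmorphXn/= sqmodE rmorphN/= !conjC_nat.
have -> : (4 : R)%:C%C = 4 :> C by rewrite rmorph_nat.
by ring.
Qed.

Lemma log_barrier (ep : R) : 0 < ep -> exists D1 D2 (K : R), [/\ 0 <= K,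
  jet (fun u : M => - ln (sqmod (u k j) + ep)) D1 D2 K &
  forall u, u \is unitarymx -> gen D1 D2 u <= 2 * n%:R].
Proof.
move=> ep0; have [K K0 J] := sqmod_jet.
pose iv (z : R) : R := (z + ep)^-1.
pose B : R := `|ln ep| + `|ln (1 + ep)| + ep^-1 + ep ^- 2 + 2 * ep ^- 3.
have zp z : 0 <= z <= 1 -> 0 < z + ep by move=> /andP[z0 _]; rewrite ltr_wpDl.
have dS (z : R) : is_derive (z : R) 1 (fun z : R => z + ep) 1.
  by apply: is_derive_eq; rewrite addr0.
have dln z : 0 <= z <= 1 -> is_derive (z : R) 1 (fun z => - ln (z + ep)) (- iv z).
  move=> /zp hz; have h := @is_derive1_comp R (@ln R) (fun z => z + ep) z _ _ (is_derive1_ln hz) (dS z).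
  by apply: is_derive_eq; rewrite mulr1.
have div z : 0 <= z <= 1 -> is_derive (z : R) 1 iv (- iv z ^+ 2).
  move=> /zp hz; have z0 : z + ep != 0 by rewrite gt_eqF.
  have h := @is_deriveV _ (fun z : R => z + ep) z 1 1 z0 (dS z).
  by apply: (is_derive_eq h); rewrite /GRing.scale/= mulr1 /iv exprVn.
have [|||||||K' K'0 J'] := @jet_comp _ _ _ _ _ K (fun z => - ln (z + ep)) (fun z => - iv z)
  (fun z => iv z ^+ 2) (fun z => - 2 * iv z ^+ 3) 0 1 B K0 J
  (fun u hu => sqmod_unitary hu) dln.
- by move=> z hz; have h := div z hz; apply: is_derive_eq; rewrite opprK.
- by move=> z hz; have h := div z hz; apply: is_derive_eq; rewrite /GRing.scale/=; ring.
- apply: measurable_funN; apply: measurableT_comp; first exact: measurable_ln.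
  exact: measurable_funD.
- apply: measurable_funN; apply: measurableT_comp; first exact: measurable_inv.
  exact: measurable_funD.
- apply: measurable_funX; apply: measurableT_comp; first exact: measurable_inv.
  exact: measurable_funD.
- move=> z hz; have z0 := zp z hz; have /andP[z1 z2] := hz.
  have i0 : 0 < iv z by rewrite invr_gt0.
  have ie : iv z <= ep^-1 by rewrite lef_pV2 ?posrE// lerDr.
  have a1 : 0 <= ep^-1 by rewrite invr_ge0 ltW.
  have a2 : iv z ^+ 2 <= ep ^- 2 by rewrite -exprVn lerXn2r// nnegrE ltW.
  have a3 : iv z ^+ 3 <= ep ^- 3 by rewrite -exprVn lerXn2r// nnegrE ltW.
  have b2 : 0 <= ep ^- 2 by rewrite invr_ge0 exprn_ge0// ltW.
  have b3 : 0 <= ep ^- 3 by rewrite invr_ge0 exprn_ge0// ltW.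
  have n1 := normr_ge0 (ln ep); have n2 := normr_ge0 (ln (1 + ep)).
  have c2 : 0 <= iv z ^+ 2 by exact: sqr_ge0.
  have c3 : 0 <= iv z ^+ 3 by rewrite exprn_ge0// ltW.
  have -> : `|- 2 * iv z ^+ 3| = 2 * iv z ^+ 3 by rewrite normrM normrN (ger0_norm c3) (@ger0_norm _ 2).
  rewrite (ger0_norm c2) !normrN (ger0_norm (ltW i0)).
  split; rewrite /B; try lra.
  have l1 : ln ep <= ln (z + ep) by rewrite ler_ln ?posrE// lerDr.
  have l2 : ln (z + ep) <= ln (1 + ep) by rewrite ler_ln ?posrE// ?lerD2r// ltr_wpDl.
  have m1 := ler_norm (ln (1 + ep)); have m2 := ler_norm (- ln ep).
  rewrite normrN in m2.
  by rewrite ler_norml; apply/andP; split; lra.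
- by rewrite /B !addr_ge0// ?mulr_ge0// invr_ge0 ?exprn_ge0// ltW.
eexists; eexists; exists K'; split.
- exact: K'0.
- exact: J'.
move=> u hu; rewrite (gen_comp (fun z => - iv z) (fun z => iv z ^+ 2)) gen_sqmod// gamma_sqmod//.
have hz := sqmod_unitary hu; have z0 := zp _ hz; move: hz z0; set z := sqmod _ => /andP[z1 z2] z0.
have i0 : 0 < iv z by rewrite invr_gt0.
have e : iv z * (z + ep) = 1 by rewrite mulVf// gt_eqF.
set y := iv z in i0 e *.
have yz : y * z <= 1 by rewrite -e ler_pM2l// lerDl ltW.
have yz0 : 0 <= y * z by rewrite mulr_ge0// ltW.
have n0 : 0 <= n%:R :> R by [].
(* Since 0 <= yz <= 1, only the first term can be positive, and it is at most 2n whatever ep is. *)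
have -> : - y * (2 - 2 * n%:R * z) + 2^-1 * y ^+ 2 * (4 * (z - z ^+ 2)) =
  2 * n%:R * (y * z) - 2 * y * (1 - y * z) - 2 * (y * z) ^+ 2 by field.
have s := sqr_ge0 (y * z); have q : 0 <= y * (1 - y * z) by rewrite mulr_ge0 ?subr_ge0// ltW.
have : n%:R * (y * z) <= n%:R * 1 by exact: ler_wpM2l.
lra.
Qed.

End LogBarrier.

(** * Dynkin's formula and the maximal inequality *)

Section Polarity.
Context d (T : measurableType d) (R : realType) (P : probability T R) (F : R -> set (set T)).
Hypothesis hF : complete_filtration P F.
Variable n : nat.
Variable U : R -> T -> 'M[R[i]]_n.
Hypothesis hU : brownian_unitary P F U.

Lemma bu_unitary t x : 0 <= t -> U t x \is unitarymx. Proof. by case: hU => h _ _ _; exact: h. Qed.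
Lemma bu_adapted : mx_adapted F U. Proof. by case: hU. Qed.
Lemma bu_continuous : mx_continuous_paths P U. Proof. by case: hU. Qed.
Lemma bu_wcont i : {ae P, forall x, wcont (fun t => co (U t x) i)}.
Proof. exact: (U_co_wcont bu_continuous i). Qed.
Lemma bu_mwr t (g : 'M[R[i]]_n -> R) : 0 <= t -> measurable_wrt (@borel_mx R n n) g ->
  measurable_wrt (F t) (fun x => g (U t x)).
Proof.
by move=> t0 mg; apply: (mwr_mmw (filt_sigma hF t0) (U_mmw bu_adapted t0) mg).
Qed.
Lemma bu_meas t (g : 'M[R[i]]_n -> R) : 0 <= t -> measurable_wrt (@borel_mx R n n) g ->
  measurable_fun setT (fun x => g (U t x)).
Proof. by move=> t0 mg; apply: (adapted_meas hF t0); exact: bu_mwr. Qed.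

Lemma bu_L1 t (g : 'M[R[i]]_n -> R) K : 0 <= t -> measurable_wrt (@borel_mx R n n) g ->
  (forall u, u \is unitarymx -> `|g u| <= K) -> L1 P (fun x => g (U t x)).
Proof.
move=> t0 mg gK; apply: (@L1_bnd _ _ _ _ K); first exact: bu_meas.
by move=> x; apply: gK; exact: bu_unitary.
Qed.

Lemma filt_indic t E : 0 <= t -> F t E -> measurable_fun setT (\1_E : T -> R).
Proof.
by move=> t0 FE; apply: (adapted_meas hF t0); exact: (mwr_indic (filt_sigma hF t0) FE).
Qed.

Lemma indic_le1 (E : set T) x : `|\1_E x : R| <= 1.
Proof. by rewrite indicE; case: (_ \in _); rewrite ?normr1 ?normr0. Qed.

(** Stated with Riemann sums because a jet has only measurable coefficients, so the generator along
    a path need not be continuous. *)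
Lemma dynkin_riem G D1 D2 K s t E : 0 <= K -> jet G D1 D2 K -> 0 <= s -> s <= t -> F s E ->
  riem (fun r => mean P (fun x => \1_E x * gen D1 D2 (U r x))) s t N @[N --> \oo] -->
  mean P (fun x => \1_E x * (G (U t x) - G (U s x))).
Proof.
move=> K0 J s0 st FE; have [c c0 step] := one_step hF hU.
have mE := filt_indic s0 FE.
have LG r : 0 <= r -> L1 P (fun x => \1_E x * G (U r x)).
  move=> r0; apply: (L1M_bnd mE (indic_le1 E)).
  by apply: (bu_L1 r0 (jet_meas0 J)) => u hu; exact: (jet_bound0 J).
have LL r : 0 <= r -> L1 P (fun x => \1_E x * gen D1 D2 (U r x)).
  move=> r0; apply: (L1M_bnd mE (indic_le1 E)).
  by apply: (bu_L1 r0 (gen_meas J)) => u hu; exact: (gen_bound K0 J).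
have -> : mean P (fun x => \1_E x * (G (U t x) - G (U s x))) =
   mean P (fun x => \1_E x * G (U t x)) - mean P (fun x => \1_E x * G (U s x)).
  rewrite -meanB; [|by apply: LG; exact: (le_trans s0)|exact: LG].
  by congr mean; apply/funext => x; rewrite mulrBr.
apply: (@telescope_riem _ (fun r => mean P (fun x => \1_E x * G (U r x))) _ _ _ (K * c)) => //.
move=> a b sa ab bt b1; have a0 := le_trans s0 sa; have b0 := le_trans a0 (ltW ab).
have -> : mean P (fun x => \1_E x * G (U b x)) - mean P (fun x => \1_E x * G (U a x)) -
    (b - a) * mean P (fun x => \1_E x * gen D1 D2 (U a x)) =
    mean P (fun x => \1_E x * (G (U b x) - G (U a x) - (b - a) * gen D1 D2 (U a x))).
  rewrite -meanZ; last exact: LL.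
  rewrite -meanB; [|exact: LG..].
  rewrite -meanB; [|by apply: L1B; exact: LG|by apply: L1Z; exact: LL].
  by congr mean; apply/funext => x; ring.
rewrite -mulrA; apply: step => //; exact: (filt_mono hF s0 sa FE).
Qed.

Lemma dynkin_le G D1 D2 K c s t E : 0 <= K -> jet G D1 D2 K -> 0 <= c ->
  (forall u, u \is unitarymx -> gen D1 D2 u <= c) -> 0 <= s -> s <= t -> F s E ->
  mean P (fun x => \1_E x * (G (U t x) - G (U s x))) <= (t - s) * c.
Proof.
move=> K0 J c0 gc s0 st FE; have h := dynkin_riem K0 J s0 st FE.
rewrite -(cvg_lim _ h)//; apply: limr_le; first by apply/cvg_ex; eexists; exact: h.
near=> N; rewrite /riem.
have dl0 : 0 <= (t - s) / N.+1%:R by rewrite divr_ge0// subr_ge0.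
apply: (@le_trans _ _ (\sum_(i < N.+1) (t - s) / N.+1%:R * c)).
  apply: ler_sum => i _; apply: ler_wpM2l => //; set r := s + _.
  have r0 : 0 <= r by rewrite addr_ge0// mulr_ge0.
  apply: mean_le_cst.
    apply: (L1M_bnd (filt_indic s0 FE) (indic_le1 E)).
    by apply: (bu_L1 r0 (gen_meas J)) => u hu; exact: (gen_bound K0 J).
  move=> x; rewrite indicE; case: (_ \in _); rewrite ?mul0r// mul1r.
  by apply: gc; exact: bu_unitary.
rewrite sumr_const card_ord -[X in X <= _]mulr_natr.
have -> // : forall y, y != 0 -> (t - s) / y * c * y = (t - s) * c by move=> y y0; field.
Unshelve. all: by end_near. Qed.

(* Discrete maximal inequality: [S i] is the event that the nonnegative process has stayed below
   [l] at the first i grid times. *)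
Lemma barrier_grid G D1 D2 K c l h N : 0 <= K -> jet G D1 D2 K -> 0 <= c ->
  (forall u, u \is unitarymx -> gen D1 D2 u <= c) ->
  (forall u, u \is unitarymx -> 0 <= G u) -> 0 <= l -> 0 <= h ->
  l * pr P [set x | exists2 i, (i < N)%N & l <= G (U (h * i%:R) x)] <=
    mean P (fun x => G (U 0 x)) + (h * N%:R) * c.
Proof.
move=> K0 J c0 gc G0 l0 h0.
pose t (i : nat) := h * i%:R; have t0 i : 0 <= t i by rewrite mulr_ge0.
have tS i : t i <= t i.+1 by rewrite ler_wpM2l// ler_nat.
pose A i := [set x | l <= G (U (t i) x)].
pose B i := [set x | exists2 k, (k < i)%N & l <= G (U (t k) x)].
have BS i : B i.+1 = B i `|` A i.
  apply/seteqP; split => x /=.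
    move=> [k]; rewrite ltnS leq_eqVlt => /orP[/eqP->|ki] h1; first by right.
    by left; exists k.
  by case=> [[k ki h1]|h1]; [exists k => //; exact: ltnW|exists i].
have FA i : F (t i) (A i).
  have -> : A i = (fun x => G (U (t i) x)) @^-1` `[l, +oo[.
    by apply/seteqP; split => x /=; rewrite in_itv/= andbT.
  by apply: (bu_mwr (t0 i) (jet_meas0 J)).
have FU s : 0 <= s -> forall X Y, F s X -> F s Y -> F s (X `|` Y).
  move=> s0 X Y FX FY; have [h1 _ hU'] := filt_sigma hF s0.
  by rewrite -bigcup2E; apply: hU' => -[|[|k]].
have FB i : F (t i) (B i).
  elim: i => [|i IH].
    have -> : B 0%N = set0 by apply/seteqP; split => x // [].
    by have [] := filt_sigma hF (t0 0%N).
  by rewrite BS; apply: (FU _ (t0 _)); apply: (filt_mono hF (t0 i) (tS i)).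
have FC s X : 0 <= s -> F s X -> F s (~` X).
  by move=> s0 FX; rewrite -setTD; have [_ hC _] := filt_sigma hF s0; exact: hC.
have mB i := filt_meas hF (t0 i) (FB i).
have LG E i r : 0 <= r -> F (t i) E -> L1 P (fun x => \1_E x * G (U r x)).
  move=> r0 FE; apply: (L1M_bnd (filt_indic (t0 i) FE) (indic_le1 E)).
  by apply: (bu_L1 r0 (jet_meas0 J)) => u hu; exact: (jet_bound0 J).
have main i : l * pr P (B i) + mean P (fun x => \1_(~` B i) x * G (U (t i) x)) <=
    mean P (fun x => G (U 0 x)) + t i * c.
  elim: i => [|i IH].
    have -> : B 0%N = set0 by apply/seteqP; split => x // [].
    rewrite /pr measure0/= mulr0 add0r /t mulr0 mul0r addr0 setC0.
    by under eq_fun do rewrite indicT mul1r.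
  have FBi := FB i; have FBC := FC _ _ (t0 i) (FB i); have FSC : F (t i) (~` B i.+1).
    by apply: FC => //; rewrite BS; apply: FU.
  (* Paths in [B i.+1] but not in [B i] carry a value at least l at time [t i]; the other paths
     outside [B i] are outside [B i.+1]. *)
  have e1 : mean P (fun x => \1_(~` B i) x * G (U (t i) x)) >=
      l * (pr P (B i.+1) - pr P (B i)) + mean P (fun x => \1_(~` B i.+1) x * G (U (t i) x)).
    rewrite -!mean_indic// -meanB; [|exact: L1_indic..].
    rewrite -meanZ; last by apply: L1B; exact: L1_indic.
    rewrite -meanD; [|by apply: L1Z; apply: L1B; exact: L1_indic|exact: (LG _ i)].
    apply: mean_le; [apply: L1D|exact: (LG _ i)|].
    - by apply: L1Z; apply: L1B; exact: L1_indic.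
    - exact: (LG _ i).
    move=> x; rewrite BS !indicE !in_setC in_setU; have Gx := G0 _ (bu_unitary x (t0 i)).
    case: (x \in B i) => /=; first by rewrite !mul0r subrr mulr0 addr0.
    have [Ax|Ax] := boolP (x \in A i) => /=.
      by rewrite !mul0r subr0 !mulr1 addr0 mul1r; move: Ax; rewrite inE.
    by rewrite subrr mulr0 add0r.
  have e2 := dynkin_le K0 J c0 gc (t0 i) (tS i) FSC.
  have e3 : mean P (fun x => \1_(~` B i.+1) x * (G (U (t i.+1) x) - G (U (t i) x))) =
      mean P (fun x => \1_(~` B i.+1) x * G (U (t i.+1) x)) - mean P (fun x => \1_(~` B i.+1) x * G (U (t i) x)).
    rewrite -meanB; [|by apply: (LG _ i)..].
    by congr mean; apply/funext => x; rewrite mulrBr.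
  rewrite e3 in e2; nra.
apply: le_trans (main N); rewrite lerDl; apply: mean_ge0 => x.
by rewrite mulr_ge0// ?indicE// G0// bu_unitary.
Qed.

Variable u0 : 'M[R[i]]_n.
Hypothesis U0 : {ae P, forall x, U 0 x = u0}.
Variables k j : 'I_n.
Hypothesis u0kj : u0 k j != 0.

(** Adding ln 2 makes the barrier nonnegative, as |u_kj|^2 + ep <= 2, and turns |u_kj|^2 <= ep into
    the barrier exceeding -ln ep exactly. The constant depends neither on ep nor on the grid. *)
Lemma near_zero_grid : exists2 c : R, 0 <= c & forall (ep h : R) N, 0 < ep -> ep < 1 -> 0 <= h ->
  - ln ep * pr P [set x | exists2 i, (i < N)%N & sqmod (U (h * i%:R) x k j) <= ep] <=
    c * (1 + h * N%:R).
Proof.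
have z0 : 0 < sqmod (u0 k j) by rewrite lt_neqAle sqmod_ge0 eq_sym sqmod_eq0 u0kj.
pose c : R := `|ln 2| + `|ln (sqmod (u0 k j))| + 2 * n%:R.
have a2 := normr_ge0 (ln 2 : R); have az := normr_ge0 (ln (sqmod (u0 k j))).
have an : 0 <= 2 * n%:R :> R by [].
exists c; first by rewrite /c; lra.
move=> ep h N ep0 ep1 h0.
have [D1 [D2 [K [K0 J gc]]]] := log_barrier k j ep0.
have J2 := jetD J (jet_const n (ln 2)).
have gen0 : gen (fun u v => D1 u v + 0) (fun u v w => D2 u v w + 0) = gen D1 D2.
  apply/funext => u; rewrite /gen addr0; congr (_ + _); apply: eq_bigr => b _; exact: addr0.
have l0 : 0 <= - ln ep by rewrite oppr_ge0 ln_le0// ltW.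
have Gpos (u : 'M[R[i]]_n) : u \is unitarymx -> 0 <= - ln (sqmod (u k j) + ep) + ln 2.
  move=> hu; have /andP[a b] := sqmod_unitary k j hu.
  rewrite addrC subr_ge0 ler_ln ?posrE ?ltr_wpDl//; lra.
have gc' (u : 'M[R[i]]_n) : u \is unitarymx ->
    gen (fun u v => D1 u v + 0) (fun u v w => D2 u v w + 0) u <= 2 * n%:R.
  by rewrite gen0; exact: gc.
have H := barrier_grid N (addr_ge0 K0 (normr_ge0 _)) J2 an gc' Gpos l0 h0.
have eA : [set x | exists2 i, (i < N)%N & sqmod (U (h * i%:R) x k j) <= ep] =
    [set x | exists2 i, (i < N)%N & - ln ep <= - ln (sqmod (U (h * i%:R) x k j) + ep) + ln 2].
  have e z : 0 <= z -> (z <= ep) = (- ln ep <= - ln (z + ep) + ln 2).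
    move=> zp; have -> : (- ln ep <= - ln (z + ep) + ln 2) = (ln (z + ep) <= ln (2 * ep)).
      by rewrite lnM ?posrE//; apply/idP/idP; lra.
    by rewrite ler_ln ?posrE ?ltr_wpDl ?mulr_gt0//; apply/idP/idP; lra.
  by apply/seteqP; split => x [i iN hi]; exists i => //; move: hi; rewrite e// sqmod_ge0.
rewrite eA; apply: (le_trans H).
have m0 : mean P (fun x => - ln (sqmod (U 0 x k j) + ep) + ln 2) <= `|ln 2| + `|ln (sqmod (u0 k j))|.
  rewrite (@mean_ae _ _ _ _ _ (fun=> - ln (sqmod (u0 k j) + ep) + ln 2)).
  - rewrite mean_cst; have := ler_norm (ln 2 : R); have := ler_norm (- ln (sqmod (u0 k j))).
    have : ln (sqmod (u0 k j)) <= ln (sqmod (u0 k j) + ep).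
      by rewrite ler_ln ?posrE ?ltr_wpDl// ?lerDl ltW.
    rewrite normrN; lra.
  - exact: (bu_meas (lexx 0) (jet_meas0 J2)).
  - exact: measurable_cst.
  - by apply: filterS U0 => x ->.
have hN : 0 <= h * N%:R by rewrite mulr_ge0.
have q1 : 0 <= h * N%:R * (`|ln 2| + `|ln (sqmod (u0 k j))|) by rewrite mulr_ge0// addr_ge0.
rewrite /c; nra.
Qed.

(** By continuity, a zero at time t forces values of |u_kj|^2 below every threshold at times of all
    sufficiently fine dyadic grids. The event of going below the p-th threshold has probability of
    order 1 / (p + 1), so their intersection is null. *)
Lemma entry_neq0 : {ae P, forall x, forall t, 0 <= t -> U t x k j != 0}.
Proof.
have [c c0 grid] := near_zero_grid.
have path0 := bu_wcont (false, k, j); have path1 := bu_wcont (true, k, j).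
have upto H : {ae P, forall x, forall t, 0 <= t -> t <= H.+1%:R -> U t x k j != 0}.
  pose h q : R := H.+1%:R / (2 ^ q)%:R.
  have h0 q : 0 <= h q by rewrite divr_ge0.
  (* Chosen so that -ln ep is p + 1. *)
  pose ep p : R := expR (- p.+1%:R).
  have ep0 p : 0 < ep p by exact: expR_gt0.
  have ep1 p : ep p < 1 by rewrite expR_lt1 oppr_lt0.
  pose A p q := [set x | exists2 i, (i < (2 ^ q).+1)%N & sqmod (U (h q * i%:R) x k j) <= ep p].
  have mA p q : measurable (A p q).
    have -> : A p q = \bigcup_(i in [set i | (i < (2 ^ q).+1)%N])
        ((fun x => sqmod (U (h q * i%:R) x k j)) @^-1` `]-oo, ep p]).
      apply/seteqP; split => x.
        by move=> [i iq hi]; exists i => //=; rewrite in_itv.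
      by move=> [i iq /=]; rewrite in_itv/= => hi; exists i.
    have [K _ J] := sqmod_jet R k j.
    apply: bigcup_measurable => i _; rewrite -[X in measurable X]setTI.
    apply: (bu_meas _ (jet_meas0 J)) => //; exact: mulr_ge0.
  (* Dyadic grids are nested, so continuity from below passes to the union over q. *)
  have Ainc p : nondecreasing_seq (A p).
    apply/nondecreasing_seqP => q; apply/subsetPset => x [i iq hi].
    exists (2 * i)%N; first by rewrite ltnS expnS leq_pmul2l.
    have -> // : h q.+1 * (2 * i)%:R = h q * i%:R.
    by rewrite /h expnS !natrM; field; rewrite pnatr_eq0 expn_eq0.
  have Apr p q : (P (A p q) <= (c * (1 + 2 * H.+1%:R) / p.+1%:R)%:E)%E.
    rewrite -[P _]fineK ?fin_num_measure// lee_fin -/(pr P _) ler_pdivlMr// mulrC.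
    have := grid (ep p) (h q) (2 ^ q).+1 (ep0 p) (ep1 p) (h0 q).
    rewrite expRK opprK => /le_trans; apply; apply: ler_wpM2l => //.
    (* The grid has 2^q + 1 points, so its step times their number is (H + 1) (1 + 2^-q), at most 2
       (H + 1). *)
    rewrite lerD2l /h -mulrA mulrC ler_pM2r// -natr1 mulrDr mulVf ?mulr1; last by rewrite pnatr_eq0 expn_eq0.
    have : (2 ^ q)%:R^-1 <= 1 :> R by rewrite invf_le1 ?ler1n ?ltr0n expn_gt0.
    lra.
  have AU p : (P (\bigcup_q A p q) <= (c * (1 + 2 * H.+1%:R) / p.+1%:R)%:E)%E.
    have cv := nondecreasing_cvg_mu (mA p) (bigcup_measurable (fun q _ => mA p q)) (Ainc p) (mu := P).
    rewrite -(cvg_lim _ cv)//; apply: lime_le; first by apply/cvg_ex; eexists; exact: cv.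
    by near=> q; exact: Apr.
  have bad0 : P.-negligible (\bigcap_p \bigcup_q A p q).
    exists (\bigcap_p \bigcup_q A p q); split => //.
      by apply: bigcap_measurable => // p _; exact: bigcup_measurable.
    apply/eqP; rewrite eq_le measure_ge0 andbT.
    have cv : (c * (1 + 2 * H.+1%:R) / p.+1%:R)%:E @[p --> \oo] --> (0 : R)%:E.
      by apply: cvg_EFin; [near=> p|]; rewrite // -(mulr0 (c * (1 + 2 * H.+1%:R))); apply: cvgMr; exact: cvg_harmonic.
    rewrite -[X in (_ <= X)%E](cvg_lim _ cv)//; apply: lime_ge; first by apply/cvg_ex; eexists; exact: cv.
    near=> p; apply: le_trans (AU p); apply: le_measure; rewrite ?inE.
    - by apply: bigcap_measurable => // p' _; exact: bigcup_measurable.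
    - exact: bigcup_measurable.
    - by move=> x; apply.
  have : {ae P, forall x, ~ (\bigcap_p \bigcup_q A p q) x}.
    by apply: negligibleS bad0 => x /contrapT.
  apply: filterS3 path0 path1 => x w0 w1 nb t t0 tH; apply/eqP => Uz; apply: nb => p _.
  have e2 : 0 < ep p / 2 by rewrite divr_gt0.
  have [d0 d00 hd0] := w0 t t0 _ e2; have [d1 d10 hd1] := w1 t t0 _ e2.
  have dm : 0 < Num.min d0 d1 by rewrite lt_min d00.
  have [q hq] : exists q, h q < Num.min d0 d1.
    pose q := (Num.truncn (H.+1%:R / Num.min d0 d1)).+1; exists q.
    rewrite /h ltr_pdivrMr ?ltr0n ?expn_gt0// mulrC -ltr_pdivrMr//.
    have /andP[_ h2] := Num.Theory.truncn_itv (divr_ge0 (ler0n R H.+1) (ltW dm)).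
    apply: (lt_le_trans h2); rewrite ler_nat; exact: ltnW (ltn_expl _ _).
  exists q => //; pose i := Num.truncn (t / h q).
  have hq0 : 0 < h q by rewrite divr_gt0// ltr0n expn_gt0.
  have /andP[i1 i2] := Num.Theory.truncn_itv (divr_ge0 t0 (h0 q)).
  have j1 : h q * i%:R <= t by rewrite mulrC -ler_pdivlMr.
  have j2 : t < h q * i%:R + h q by move: i2; rewrite ltr_pdivrMr// -natr1 mulrDl mul1r mulrC.
  exists i.
    rewrite ltnS -(ler_nat R); apply: (le_trans i1).
    by rewrite ler_pdivrMr// /h mulrC divfK// pnatr_eq0 expn_eq0.
  have hi0 : 0 <= h q * i%:R by rewrite mulr_ge0.
  have dt : `|h q * i%:R - t| < Num.min d0 d1.
    by rewrite distrC ger0_norm ?subr_ge0//; lra.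
  move: dt; rewrite lt_min => /andP[dt0 dt1].
  have := hd0 _ hi0 dt0; have := hd1 _ hi0 dt1.
  have z e : co (U t x) (e, k, j) = 0 by rewrite /co Uz pt0.
  rewrite !z !subr0 /sqmod big_bool => x1 x0.
  have sq (a : R) : `|a| < ep p / 2 -> a ^+ 2 <= ep p / 2.
    move=> ha; rewrite -(real_normK (num_real a)) expr2.
    apply: (@le_trans _ _ (ep p / 2 * 1)); last by rewrite mulr1.
    by apply: ler_pM => //; have := ep1 p; lra.
  by have h1 := lerD (sq _ x1) (sq _ x0); rewrite (splitr (ep p)).
have := ae_foralln upto; apply: filterS => x h t t0.
apply: (h (Num.truncn t) t t0).
by have /andP[_ /ltW] := Num.Theory.truncn_itv t0.
Unshelve. all: by end_near. Qed.

End Polarity.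

(** * Invariance of the law and the Markov property *)

Section ProductMean.
Context d1 d2 (T1 : measurableType d1) (T2 : measurableType d2) (R : realType).
Variables (P1 : probability T1 R) (P2 : probability T2 R).
Let Q : probability (T1 * T2)%type R := (P1 \x P2)%E.
Variables (H : T1 * T2 -> R) (K : R).
Hypotheses (mH : measurable_fun setT H) (HK : forall z, `|H z| <= K).

Let LH : L1 Q H. Proof. exact: (L1_bnd Q mH HK). Qed.
Let mE : measurable_fun setT (EFin \o H). Proof. exact/measurable_EFinP. Qed.

Lemma sect_L1 x : L1 P2 (fun y => H (x, y)).
Proof.
apply: (@L1_bnd _ _ _ _ K) => //; apply: (measurableT_comp mH).
exact: measurable_pair1.
Qed.

Lemma sect_L1' y : L1 P1 (fun x => H (x, y)).
Proof.
apply: (@L1_bnd _ _ _ _ K) => //; apply: (measurableT_comp mH).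
exact: measurable_pair2.
Qed.

Let sectE x : (\int[P2]_y (H (x, y))%:E = (mean P2 (fun y => H (x, y)))%:E)%E.
Proof. by rewrite /mean /Rintegral fineK//; apply: integrable_fin_num => //; exact: sect_L1. Qed.

Let sectE' y : (\int[P1]_x (H (x, y))%:E = (mean P1 (fun x => H (x, y)))%:E)%E.
Proof. by rewrite /mean /Rintegral fineK//; apply: integrable_fin_num => //; exact: sect_L1'. Qed.

Lemma mean_prod : mean Q H = mean P1 (fun x => mean P2 (fun y => H (x, y))).
Proof.
rewrite {1}/mean /Rintegral -(integral12_prod_meas1 LH) /fubini_F /=.
by under eq_integral do rewrite sectE.
Qed.

Lemma mean_prod' : mean Q H = mean P2 (fun y => mean P1 (fun x => H (x, y))).
Proof.
rewrite {1}/mean /Rintegral -(integral21_prod_meas1 LH) /fubini_G /=.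
by under eq_integral do rewrite sectE'.
Qed.

Lemma meas_sect_mean : measurable_fun setT (fun x => mean P2 (fun y => H (x, y))).
Proof.
apply/measurable_EFinP; have := measurable_fubini_F LH.
by apply: eq_measurable_fun => x _; rewrite /fubini_F /= sectE.
Qed.

Lemma meas_sect_mean' : measurable_fun setT (fun y => mean P1 (fun x => H (x, y))).
Proof.
apply/measurable_EFinP; have := measurable_fubini_G LH.
by apply: eq_measurable_fun => x _; rewrite /fubini_G /= sectE'.
Qed.

End ProductMean.

(** * Equality of laws tested on boxes *)

Section LawEquality.
Context d (S : measurableType d) (R : realType) (Q : probability S R) (a b : nat).
Local Notation M := 'M[R[i]]_(a, b).
Local Notation idx := (bool * 'I_a * 'I_b)%type.

(** Lower orthants in real coordinates: a pi-system generating the Borel sets, and sets that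
    exponentials of coordinates approximate. *)
Definition box (c : idx -> R) : set M := [set w | forall i, co w i < c i].

Let boxes : set (set M) := range box.

Let borel_boxes : @borel_mx R a b `<=` <<s boxes>>.
Proof.
have sB : sigma_algebra setT (<<s boxes>> : set (set M)) by exact: smallest_sigma_algebra.
have mco i : measurable_wrt <<s boxes>> (fun w : M => co w i).
  apply/(mwrP sB); apply: (measurability _ (RGenInftyO.measurableE R)) => //.
  move=> _ [_ [x ->] <-]; rewrite setTI.
  have -> : (fun w : M => co w i) @^-1` `]-oo, x[ =
      \bigcup_N box (fun j => if j == i then x else N%:R).
    apply/seteqP; split => w /=; rewrite in_itv/=.
      move=> wx; exists (Num.truncn (N1 w)).+1 => // j; case: eqP => [->//|_].
      apply: (le_lt_trans (ler_norm _)); apply: (le_lt_trans (co_N1 _ _)).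
      by have /andP[] := Num.Theory.truncn_itv (N1_ge0 w).
    by move=> [N _ /(_ i)]; rewrite eqxx.
  apply: bigcup_measurable => N _; apply: sub_gen_smallest; apply: sub_gen_smallest.
  by exists (fun j => if j == i then x else N%:R).
apply: smallest_sub => // _ [k [j [B [mB [->|->]]]]].
  exact: (mco (false, k, j) B mB).
exact: (mco (true, k, j) B mB).
Qed.

Let boxI : setI_closed boxes.
Proof.
move=> _ _ [c _ <-] [c' _ <-]; exists (fun i => Num.min (c i) (c' i)) => //.
apply/seteqP; split => w /=.
  by move=> h; split => i; have := h i; rewrite lt_min => /andP[].
by move=> [h h'] i; rewrite lt_min h h'.
Qed.

Lemma borel_box c : @borel_mx R a b (box c).
Proof.
have -> : box c = \bigcap_(i in [set: idx]) ((fun w : M => co w i) @^-1` `]-oo, c i[).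
  by apply/seteqP; split => w /= h i; have := h i; rewrite /= ?in_itv//= => ->.
have := @fin_bigcap_measurable _ (g_sigma_algebraType (@borel_mx R a b)) idx setT
  (fun i => (fun w : M => co w i) @^-1` `]-oo, c i[) finite_finset.
rewrite /measurable/= sigma_algebra_id; last exact: borel_sigma.
by apply=> i _; exact: borel_co.
Qed.

Variables (A : set S) (Y Y' : S -> M).
Hypotheses (mA : measurable A) (mY : mmw measurable Y) (mY' : mmw measurable Y').

Let sM : sigma_algebra setT (measurable : set (set S)).
Proof.
split => [|B mB|B mB]; [exact: measurable0| |exact: bigcupT_measurable].
by rewrite setTD; exact: measurableC.
Qed.

Hypothesis agree : forall c, pr Q (A `&` Y @^-1` box c) = pr Q (A `&` Y' @^-1` box c).

Let mpre (Z : S -> M) B : mmw measurable Z -> @borel_mx R a b B -> measurable (Z @^-1` B).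
Proof. by move=> mZ; exact: (mmw_preimage sM mZ). Qed.

(** The images under Y and Y' of Q restricted to A are finite measures that agree on boxes, and the
    boxes with equal integer bounds exhaust the space. *)
Lemma law_eq_set B : @borel_mx R a b B -> pr Q (A `&` Y @^-1` B) = pr Q (A `&` Y' @^-1` B).
Proof.
move=> bB; have sY Z : mmw measurable Z -> measurable_fun setT (Z : S -> g_sigma_algebraType (@borel_mx R a b)).
  move=> mZ _ C; rewrite setTI /measurable/= sigma_algebra_id; last exact: borel_sigma.
  exact: mpre.
pose X : measurableType _ := g_sigma_algebraType (@borel_mx R a b).
pose m1_ : {measure set X -> \bar R} := pushforward (mrestr Q mA) (Y : S -> X).
pose m2_ : {measure set X -> \bar R} := pushforward (mrestr Q mA) (Y' : S -> X).
pose m1 := m1_ (sY _ mY); pose m2 := m2_ (sY _ mY').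
have fin (Z : S -> M) C : mmw measurable Z -> @borel_mx R a b C -> Q (Z @^-1` C `&` A) \is a fin_num.
  by move=> mZ bC; apply: fin_num_measure; apply: measurableI => //; exact: mpre.
suff : m1 B = m2 B.
  by rewrite /m1 /m2 /= /pushforward /mrestr /pr !(setIC A) => ->.
apply: (@g_sigma_algebra_measure_unique _ R X boxes _ (fun N => box (fun=> N%:R)) _ _ m1 m2 _ _ _ B).
- move=> _ [c _ <-]; rewrite /measurable/= sigma_algebra_id; [exact: borel_box|exact: borel_sigma].
- by move=> N; exists (fun=> N%:R).
- apply/seteqP; split => // w _; exists (Num.truncn (N1 w)).+1 => // i.
  apply: (le_lt_trans (ler_norm _)); apply: (le_lt_trans (co_N1 _ _)).
  by have /andP[] := Num.Theory.truncn_itv (N1_ge0 w).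
- exact: boxI.
- move=> _ [c _ <-]; have := agree c; rewrite /m1 /m2 /= /pushforward /mrestr /pr !(setIC A) => h.
  by rewrite -[LHS]fineK ?h ?fineK//; apply: fin => //; exact: borel_box.
- move=> N; rewrite /m1 /= /pushforward /mrestr ltey_eq fin//; exact: borel_box.
exact: borel_boxes.
Qed.

(** The shifted function (N + 1) (g + K) is replaced by its integer part, the sum of the indicators
    of its superlevel sets at positive integers. The error in g is at most 1 / (N + 1), and each
    superlevel set falls under [law_eq_set]. *)
Lemma law_eq (g : M -> R) (K : R) : measurable_wrt (@borel_mx R a b) g -> (forall w, `|g w| <= K) ->
  mean Q (fun z => \1_A z * g (Y z)) = mean Q (fun z => \1_A z * g (Y' z)).
Proof.
move=> mg gK; have K0 : 0 <= K by exact: (le_trans (normr_ge0 _) (gK 0)).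
have mgY (Z : S -> M) : mmw measurable Z -> measurable_fun setT (fun z => g (Z z)).
  by move=> mZ; have h := mwr_mmw sM mZ mg; move=> _ B mB; rewrite setTI; exact: h.
have m1A : measurable_fun setT (\1_A : S -> R) by exact: measurable_indic.
have LA (Z : S -> M) : mmw measurable Z -> L1 Q (fun z => \1_A z * g (Z z)).
  move=> mZ; apply: (L1M_bnd m1A (indic_le1 R A)).
  by apply: (L1_bnd Q (mgY Z mZ)) => z; exact: gK.
pose L N k : set M := [set w | k.+1%:R <= N.+1%:R * (g w + K)].
have bL N k : @borel_mx R a b (L N k).
  have -> : L N k = (fun w => N.+1%:R * (g w + K)) @^-1` `[k.+1%:R, +oo[.
    by apply/seteqP; split => w /=; rewrite in_itv/= andbT.
  have sB := @borel_sigma R a b.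
  have h : measurable_wrt (@borel_mx R a b) (fun w => N.+1%:R * (g w + K)).
    by apply: (mwrM sB); [exact: mwr_cst|apply: (mwrD sB) => //; exact: mwr_cst].
  exact: h.
(* Enough levels, since g + K is at most 2K. *)
pose J N := (Num.truncn (N.+1%:R * (K + K))).+1.
pose G N w : R := N.+1%:R^-1 * (\sum_(k < J N) \1_(L N k) w) - K.
have GN N w : `|g w - G N w| <= N.+1%:R^-1.
  pose y := N.+1%:R * (g w + K); have N0 : 0 < N.+1%:R :> R by [].
  have gw := gK w; rewrite ler_norml in gw; case/andP: gw => gw1 gw2.
  have y0 : 0 <= y by rewrite mulr_ge0//; lra.
  have sumE : \sum_(k < J N) \1_(L N k) w = (Num.truncn y)%:R :> R.
    have yJ : (Num.truncn y <= J N)%N.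
      by apply: leqW; apply: le_truncn; rewrite ler_wpM2l// lerD2r.
    transitivity ((\sum_(k < J N) (k < Num.truncn y)%N)%:R : R).
      rewrite natr_sum; apply: eq_bigr => k _; rewrite indicE; congr ((_ : bool)%:R).
      by rewrite truncn_gt_nat; apply/idP/idP => [/set_mem//|h]; apply/mem_set.
    congr (_%:R); rewrite -[RHS]card_ord -sum1_card (big_ord_widen _ (fun=> 1%N) yJ) [RHS]big_mkcond/=.
    by apply: eq_bigr => k _; case: ltnP.
  rewrite /G sumE; have /andP[t1 t2] := Num.Theory.truncn_itv y0.
  have -> : g w - (N.+1%:R^-1 * (Num.truncn y)%:R - K) = N.+1%:R^-1 * (y - (Num.truncn y)%:R).
    by rewrite /y; field.
  rewrite normrM ger0_norm ?invr_ge0// -[X in _ <= X]mulr1 ler_wpM2l ?invr_ge0//.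
  by rewrite ger0_norm ?subr_ge0//; move: t2; rewrite -natr1; lra.
have GE N (Z : S -> M) : mmw measurable Z -> mean Q (fun z => \1_A z * G N (Z z)) =
    N.+1%:R^-1 * (\sum_(k < J N) pr Q (A `&` Z @^-1` L N k)) - K * pr Q A.
  move=> mZ; have mAL k : measurable (A `&` Z @^-1` L N k) by apply: measurableI => //; exact: mpre.
  transitivity (mean Q (fun z => N.+1%:R^-1 * (\sum_(k < J N) \1_(A `&` Z @^-1` L N k) z) - K * \1_A z)).
    congr mean; apply/funext => z; rewrite /G mulrBr mulrCA mulr_sumr [K * _]mulrC; congr (_ * _ - _).
    by apply: eq_bigr => k _; rewrite !indicE in_setI -natrM mulnb.
  have LS : L1 Q (fun z => \sum_(k < J N) \1_(A `&` Z @^-1` L N k) z).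
    by apply: L1_sum => k _; exact: L1_indic.
  rewrite meanB; [|exact: L1Z|by apply: L1Z; exact: L1_indic].
  rewrite !meanZ//; last exact: L1_indic.
  rewrite mean_indic// mean_sum; last by move=> k _; exact: L1_indic.
  by congr (_ * _ - _); apply: eq_bigr => k _; rewrite mean_indic.
have LG N (Z : S -> M) : mmw measurable Z -> L1 Q (fun z => \1_A z * G N (Z z)).
  move=> mZ; apply: (L1M_bnd m1A (indic_le1 R A)).
  apply: L1B; last exact: L1_cst.
  apply: L1Z; apply: L1_sum => k _.
  have h : measurable (Z @^-1` L N k) by exact: mpre.
  exact: (L1_indic Q h).
have close N (Z : S -> M) : mmw measurable Z ->
    `|mean Q (fun z => \1_A z * g (Z z)) - mean Q (fun z => \1_A z * G N (Z z))| <= N.+1%:R^-1.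
  move=> mZ; rewrite -meanB; [|exact: LA|exact: LG].
  rewrite -[X in _ <= X](mean_cst Q); apply: mean_norm_le.
  - by apply: L1B; [exact: LA|exact: LG].
  - exact: L1_cst.
  - move=> z; rewrite -mulrBr normrM -[X in _ <= X]mul1r.
    by apply: ler_pM => //; exact: indic_le1.
apply/eqP; rewrite -subr_eq0 -normr_le0.
have cv : 2 * N.+1%:R^-1 @[N --> \oo] --> (0 : R).
  by rewrite -(mulr0 2); apply: cvgMr; exact: cvg_harmonic.
rewrite -(cvg_lim _ cv)//; apply: limr_ge; first by apply/cvg_ex; eexists; exact: cv.
near=> N; have := close N Y mY; have := close N Y' mY'.
have -> : mean Q (fun z => \1_A z * G N (Y' z)) = mean Q (fun z => \1_A z * G N (Y z)).
  by rewrite !GE//; congr (_ * _ - _); apply: eq_bigr => k _; rewrite law_eq_set.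
move: (mean _ _) (mean _ _) (mean _ _) (N.+1%:R^-1) => x y z e.
rewrite !ler_norml => /andP[a1 a2] /andP[b1 b2]; apply/andP; split; lra.
Unshelve. all: by end_near. Qed.

End LawEquality.

(** * Smooth approximation of boxes *)

Section Smoothing.
Variables (R : realType) (n : nat).
Local Notation M := 'M[R[i]]_n.
Local Notation idx := (bool * 'I_n * 'I_n)%type.

Lemma exp_jet (G : M -> R) (D1 : M -> M -> R) (D2 : M -> M -> M -> R) K a b l c : 0 <= K -> jet G D1 D2 K ->
  (forall u, u \is unitarymx -> a <= G u <= b) ->
  exists D1' D2' (K' : R), 0 <= K' /\ jet (fun u => expR (l * (G u - c))) D1' D2' K'.
Proof.
move=> K0 J Gab; pose f (z : R) := expR (l * (z - c)).
have df (z : R) : is_derive (z : R) 1 f (l * f z).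
  have h : is_derive (z : R) 1 (fun z => l * (z - c)) l.
    by apply: is_derive_eq; rewrite /GRing.scale/=; ring.
  have := @is_derive1_comp R (@expR R) (fun z => l * (z - c)) z _ _ (is_derive_expR _) h.
  by rewrite mulrC.
pose B : R := (1 + `|l|) ^+ 3 * expR (`|l| * (`|a| + `|b| + `|c|)).
have fB z : a <= z <= b -> 0 <= f z <= expR (`|l| * (`|a| + `|b| + `|c|)).
  move=> /andP[az zb]; rewrite expR_ge0 ler_expR; apply: (le_trans (ler_norm _)).
  rewrite normrM ler_wpM2l//; apply: (le_trans (ler_normB _ _)); rewrite lerD2r.
  rewrite ler_norml; have := ler_norm b; have := ler_norm (- a); rewrite normrN.
  have := normr_ge0 a; have := normr_ge0 b; move=> *; apply/andP; split; lra.
have mf : measurable_fun setT f.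
  apply: measurableT_comp; first exact: measurable_expR.
  by apply: measurable_funM => //; exact: measurable_funB.
have [||||||K' K'0 J'] := @jet_comp _ _ _ _ _ K f (fun z => l * f z) (fun z => l ^+ 2 * f z)
    (fun z => l ^+ 3 * f z) a b B K0 J Gab (fun z _ => df z) _ _ mf _ _ _ _.
- by move=> z _; have h := df z; apply: is_derive_eq; rewrite /GRing.scale/=; ring.
- by move=> z _; have h := df z; apply: is_derive_eq; rewrite /GRing.scale/=; ring.
- exact: measurable_funM.
- exact: measurable_funM.
- move=> z hz; have /andP[f0 fb] := fB z hz; have l0 := normr_ge0 l.
  have e0 := le_trans f0 fb.
  have q k : (k <= 3)%N -> `|l ^+ k * f z| <= B.
    move=> k3; rewrite normrM (ger0_norm f0) normrX; apply: ler_pM => //.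
    apply: (@le_trans _ _ ((1 + `|l|) ^+ k)); first by rewrite lerXn2r ?nnegrE//; lra.
    by apply: ler_weXn2l => //; lra.
  split; [have := q 0%N isT|have := q 1%N isT|exact: (q 2%N)|exact: (q 3%N)].
    by rewrite expr0 mul1r.
  by rewrite expr1.
- by rewrite /B mulr_ge0 ?expR_ge0// exprn_ge0// addr_ge0.
by eexists; eexists; exists K'; split; [exact: K'0|exact: J'].
Qed.

(** Inside the box every k exp(k (w_i - c_i)) tends to 0. If some w_i >= c_i, the outer factor k
    sends the exponent to minus infinity even on the boundary, so the limit is the indicator of the
    open box. The zero subtracted matches [exp_jet]. *)
Definition soft_box (c : idx -> R) (k : nat) (w : M) : R :=
  expR (- k%:R * (\sum_i expR (k%:R * (co w i - c i)) - 0)).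

Lemma soft_box_jet c k : exists D1 D2 (K : R), 0 <= K /\ jet (soft_box c k) D1 D2 K.
Proof.
have /choice[D H] (i : idx) : exists D : (M -> M -> R) * (M -> M -> M -> R) * R, 0 <= D.2 /\
    jet (fun u : M => expR (k%:R * (co u i - c i))) D.1.1 D.1.2 D.2.
  have [|D1 [D2 [K [K0 J]]]] := @exp_jet _ _ _ 1 (-1) 1 k%:R (c i) ler01 (jet_co R i).
    by move=> u hu; rewrite -ler_norml; exact: unitary_co.
  by exists (D1, D2, K).
have J := @jet_sum R n _ (index_enum idx) _ _ _ _ (fun i => (H i).2).
pose b := \sum_i expR (k%:R * (1 + `|c i|)).
apply: (@exp_jet _ _ _ (\sum_i (D i).2) 0 b _ _ _ J).
  by apply: sumr_ge0 => i _; exact: (H i).1.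
move=> u hu; apply/andP; split; first by apply: sumr_ge0 => i _; exact: expR_ge0.
apply: ler_sum => i _.
rewrite ler_expR ler_wpM2l//; have := unitary_co i hu; have := ler_norm (- c i); rewrite normrN.
rewrite ler_norml => h1 /andP[_ h2]; lra.
Qed.

Lemma soft_box_bound c k w : 0 <= soft_box c k w <= 1.
Proof.
rewrite expR_ge0 -[X in _ <= X]expR0 ler_expR mulNr oppr_le0 subr0 mulr_ge0// sumr_ge0// => i _.
Qed.

Lemma exp_decay (e : R) : 0 < e -> k%:R * expR (- (k%:R * e)) @[k --> \oo] --> (0 : R).
Proof.
move=> e0; pose f (k : nat) : R := (4 / e ^+ 2) * k%:R^-1.
have cf : f k @[k --> \oo] --> (0 : R).
  rewrite -(mulr0 (4 / e ^+ 2)); apply: cvgMr.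
  by rewrite -(cvg_shiftS (fun k : nat => k%:R^-1 : R)); exact: cvg_harmonic.
apply: (@squeeze_cvgr _ _ _ _ (fun=> 0) f) => //; last exact: cvg_cst.
near=> k; rewrite mulr_ge0 ?expR_ge0//= /f.
have k0 : 0 < k%:R :> R by rewrite ltr0n; near: k; exists 1%N.
pose y := k%:R * e / 2; have y0 : 0 < y by rewrite !mulr_gt0// invr_gt0.
have h : y ^+ 2 <= expR (k%:R * e).
  have -> : k%:R * e = y + y by rewrite /y; field.
  rewrite expRD -expr2 lerXn2r ?nnegrE ?expR_ge0 ?(ltW y0)//.
  by apply: le_trans (expR_ge1Dx y); lra.
rewrite expRN ler_pdivrMr ?expR_gt0//.
apply: (@le_trans _ _ (4 / e ^+ 2 / k%:R * y ^+ 2)); last first.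
  by apply: ler_wpM2l => //; rewrite divr_ge0 ?(ltW k0)// divr_ge0// sqr_ge0.
by rewrite /y le_eqVlt; apply/orP; left; apply/eqP; field; rewrite !gt_eqF.
Unshelve. all: by end_near. Qed.

Lemma soft_box_cvg c w : soft_box c k w @[k --> \oo] --> (\1_(box c) w : R).
Proof.
rewrite indicE; have [hb|hb] := pselect (box c w).
  rewrite mem_set//.
  have cs : - k%:R * (\sum_i expR (k%:R * (co w i - c i)) - 0) @[k --> \oo] --> (0 : R).
    have -> : (fun k : nat => - k%:R * (\sum_i expR (k%:R * (co w i - c i)) - 0) : R) =
        (fun k => - \sum_(i : idx) k%:R * expR (- (k%:R * (c i - co w i)))).
      apply/funext => k; rewrite subr0 mulNr mulr_sumr; congr (- _); apply: eq_bigr => i _.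
      by congr (_ * expR _); ring.
    rewrite -[X in _ --> X]oppr0; apply: cvgN.
    have e0 : \sum_(i : idx) (0 : R) = 0 by rewrite big1.
    rewrite -[X in _ --> X]e0; apply: cvg_big; first exact: add_continuous.
    by move=> i _; apply: exp_decay; rewrite subr_gt0; exact: hb.
  rewrite -[X in _ --> X]expR0.
  by apply: (cvg_comp _ (@expR R) cs); exact: continuous_expR.
rewrite memNset//.
have [i hi] : exists i, c i <= co w i.
  by apply: contra_notP hb => hn i; rewrite ltNge; apply/negP => h; apply: hn; exists i.
apply: (@squeeze_cvgr _ _ _ _ (fun=> 0) (fun k => k.+1%:R^-1)); [|exact: cvg_cst|exact: cvg_harmonic].
near=> k; rewrite expR_ge0/=.
have h : k%:R <= k%:R * (\sum_i expR (k%:R * (co w i - c i)) - 0).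
  rewrite -[X in X <= _]mulr1 subr0; apply: ler_wpM2l => //.
  rewrite (bigD1 i)//= -[X in X <= _]addr0; apply: lerD.
    by rewrite -[X in X <= _]expR0 ler_expR mulr_ge0// subr_ge0.
  by apply: sumr_ge0 => j _; exact: expR_ge0.
rewrite /soft_box mulNr expRN lef_pV2 ?posrE ?expR_gt0//.
apply: (@le_trans _ _ (expR k%:R)); last by rewrite ler_expR.
by rewrite -natr1 addrC; exact: expR_ge1Dx.
Unshelve. all: by end_near. Qed.

End Smoothing.

(** * Translation invariance of the generator *)

Section Invariance.
Variables (R : realType) (n : nat).
Local Notation C := R[i].
Local Notation M := 'M[C]_n.

(** A product of real or imaginary parts of z and z' is a combination of parts of z z' and z
    conj(z'), so two complex covariance identities determine all real covariances. *)
Lemma pt_quadratic (I : finType) (y y' z z' : I -> C) e e' :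
  \sum_b y b * y' b = \sum_b z b * z' b -> \sum_b y b * (y' b)^* = \sum_b z b * (z' b)^* ->
  \sum_b pt e (y b) * pt e' (y' b) = \sum_b pt e (z b) * pt e' (z' b).
Proof.
pose c1 (e e' : bool) : R := if e && e' then - 2^-1 else 2^-1.
pose c2 (e e' : bool) : R := if ~~ e && e' then - 2^-1 else 2^-1.
have H (u u' : C) : pt e u * pt e' u' =
    c1 e e' * pt (e (+) e') (u * u') + c2 e e' * pt (e (+) e') (u * u'^*).
  by rewrite !ptM !ptJ /c1 /c2; case: e; case: e' => /=; field.
move=> h1 h2; under eq_bigr do rewrite H; under [RHS]eq_bigr do rewrite H.
by rewrite !big_split/= -!mulr_sumr -!pt_sum h1 h2.
Qed.

(** Conjugation-invariance of the covariance of Brownian motion on the Lie algebra, in the form in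
    which v X_b r is compared with v r X_b. *)
Lemma noise_conj_invariant (v r : M) (i j : bool * 'I_n * 'I_n) : v \is unitarymx -> r \is unitarymx ->
  \sum_b co (v *m Xb R b *m r) i * co (v *m Xb R b *m r) j =
  \sum_b co (v *m r *m Xb R b) i * co (v *m r *m Xb R b) j.
Proof.
case: i => -[e k] p; case: j => -[e' h] q hv hr; have hvr := mul_unitarymx hv hr.
have colr : \sum_s r s p * (r s q)^* = (p == q)%:R.
  have hrt : r^T \is unitarymx by rewrite trmx_unitary; exact: hr.
  move/unitarymxP/matrixP/(_ p q): hrt.
  by rewrite !mxE => <-; apply: eq_bigr => s _; rewrite !mxE.
apply: pt_quadratic.
  rewrite noise_mul.
  under eq_bigr => b _ do rewrite mxE [X in _ * X]mxE mulr_suml.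
  rewrite exchange_big/=.
  under eq_bigr => s _.
    under eq_bigr => b _ do rewrite mulr_sumr.
    rewrite exchange_big/=.
    under eq_bigr => s' _.
      under eq_bigr => b _ do rewrite mulrACA.
      rewrite -mulr_suml noise_mul.
      over.
    over.
  rewrite mxE [X in _ * (_ * X)]mxE mulr_suml mulr_sumr exchange_big/=; apply: eq_bigr => s' _.
  by rewrite !mulr_sumr; apply: eq_bigr => s _; ring.
rewrite noise_mul_conj//.
under eq_bigr => b _ do rewrite mxE [X in _ * X^*]mxE mulr_suml.
rewrite exchange_big/=.
under eq_bigr => s _.
  under eq_bigr => b _ do rewrite rmorph_sum/= mulr_sumr.
  rewrite exchange_big/=.
  under eq_bigr => s' _.
    under eq_bigr => b _ do rewrite rmorphM/= mulrACA.
    rewrite -mulr_suml noise_mul_conj//.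
    over.
  rewrite (bigD1 s)//= big1 ?addr0; last first.
    by move=> s' ss; rewrite eq_sym (negbTE ss) mulr0 mul0r.
  rewrite eqxx/=.
  over.
rewrite -mulr_sumr colr -mulrA -natrM mulnb andbC.
by [].
Qed.

(** Left translation only renames u, as the noise acts on the right; right translation is absorbed
    by [noise_conj_invariant] after expanding D2 in coordinates. *)
Lemma gen_translate (l r u : M) (D1 : M -> M -> R) (D2 : M -> M -> M -> R) :
  l \is unitarymx -> r \is unitarymx -> u \is unitarymx ->
  (forall u c v w z, D2 u (c%:C%C *: v + w) z = c * D2 u v z + D2 u w z) ->
  (forall u c v w z, D2 u z (c%:C%C *: v + w) = c * D2 u z v + D2 u z w) ->
  gen (fun u v => D1 (l *m u *m r) (l *m v *m r))
    (fun u v w => D2 (l *m u *m r) (l *m v *m r) (l *m w *m r)) u = gen D1 D2 (l *m u *m r).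
Proof.
move=> hl hr hu b1 b2; rewrite /gen; congr (_ + _); set w := l *m u *m r.
under eq_bigr => b _ do rewrite mulmxA (bilin_expand (b1 w) (b2 w)).
under [RHS]eq_bigr => b _ do rewrite (bilin_expand (b1 w) (b2 w)).
rewrite exchange_big/= [RHS]exchange_big/=; apply: eq_bigr => i _.
rewrite exchange_big/= [RHS]exchange_big/=; apply: eq_bigr => j _.
by rewrite -!mulr_suml (noise_conj_invariant i j (mul_unitarymx hl hu) hr).
Qed.

End Invariance.

Section ProductMeasurability.
Context d1 d2 (T1 : measurableType d1) (T2 : measurableType d2) (R : realType).

Lemma measurable_sigma d' (S : measurableType d') : sigma_algebra setT (measurable : set (set S)).
Proof.
split => [|B mB|B mB]; [exact: measurable0| |exact: bigcupT_measurable].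
by rewrite setTD; exact: measurableC.
Qed.

Lemma mmw_fst a b (X : T1 -> 'M[R[i]]_(a, b)) : mmw measurable X ->
  mmw (measurable : set (set (T1 * T2))) (fun z => X z.1).
Proof.
move=> mX k j e B mB; have := mX k j e B mB => mB'.
by have := @measurable_fst _ _ T1 T2 measurableT _ mB'; rewrite setTI.
Qed.

Lemma mmw_snd a b (X : T2 -> 'M[R[i]]_(a, b)) : mmw measurable X ->
  mmw (measurable : set (set (T1 * T2))) (fun z => X z.2).
Proof.
move=> mX k j e B mB; have := mX k j e B mB => mB'.
by have := @measurable_snd _ _ T1 T2 measurableT _ mB'; rewrite setTI.
Qed.

End ProductMeasurability.

(** * Moving time to an independent copy *)

Section Kernel.
Context d (T : measurableType d) (R : realType) (P : probability T R) (F : R -> set (set T)).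
Hypothesis hF : complete_filtration P F.
Variable n : nat.
Variable U : R -> T -> 'M[R[i]]_n.
Hypothesis hU : brownian_unitary P F U.
Local Notation M := 'M[R[i]]_n.
Local Notation TT := (T * T)%type.
Let Q : probability TT R := (P \x P)%E.

Lemma bu_mmw t : 0 <= t -> mmw measurable (U t).
Proof.
move=> t0 k j e B mB; apply: (filt_meas hF t0).
have h := U_mmw (bu_adapted hU) t0.
exact: (h k j e B mB).
Qed.

Variables (l r : M).
Hypotheses (hl : l \is unitarymx) (hr : r \is unitarymx).

Let W a b (z : TT) : M := l *m U a z.1 *m r *m U b z.2.

Let Wu a b z : 0 <= a -> 0 <= b -> W a b z \is unitarymx.
Proof.
move=> a0 b0; exact: (mul_unitarymx (mul_unitarymx (mul_unitarymx hl (bu_unitary hU _ a0)) hr) (bu_unitary hU _ b0)).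
Qed.

Let mW a b : 0 <= a -> 0 <= b -> mmw (measurable : set (set TT)) (W a b).
Proof.
move=> a0 b0; have sTT := @measurable_sigma _ TT.
apply: (mmwM sTT); last by apply: mmw_snd; exact: bu_mmw.
apply: (mmwM sTT); last exact: (mmw_cst sTT).
apply: (mmwM sTT); first exact: (mmw_cst sTT).
by apply: mmw_fst; exact: bu_mmw.
Qed.

Let mgW a b (g : M -> R) : 0 <= a -> 0 <= b -> measurable_wrt (@borel_mx R n n) g ->
  measurable_fun setT (fun z => g (W a b z)).
Proof.
move=> a0 b0 mg; have h := mwr_mmw (@measurable_sigma _ TT) (mW a0 b0) mg.
by move=> _ B mB; rewrite setTI; exact: h.
Qed.

Lemma kernel_meas a b g K : 0 <= a -> 0 <= b -> measurable_wrt (@borel_mx R n n) g -> (forall w, `|g w| <= K) ->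
  measurable_fun setT (fun x => mean P (fun y => g (l *m U a x *m r *m U b y))).
Proof. by move=> a0 b0 mg gK; exact: (meas_sect_mean P P (mgW a0 b0 mg) (fun z => gK _)). Qed.

Variables (s : R) (E : set T).
Hypotheses (s0 : 0 <= s) (FE : F s E).

Let mE1 : measurable_fun setT (fun z : TT => \1_E z.1 : R).
Proof.
move=> _ B mB; have := filt_indic hF s0 FE measurableT mB; rewrite setTI => mB'.
exact: (@measurable_fst _ _ T T measurableT _ mB').
Qed.

Section Jet.
Variables (G : M -> R) (D1 : M -> M -> R) (D2 : M -> M -> M -> R) (K : R).
Hypotheses (K0 : 0 <= K) (J : jet G D1 D2 K).
Let cT : R := (1 + (#|{: bool * 'I_n * 'I_n}|%:R + #|{: bool * 'I_n * 'I_n}|%:R) ^+ 2) ^+ 3.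
Let cT0 : 0 <= cT. Proof. by rewrite exprn_ge0// addr_ge0// sqr_ge0. Qed.
Let KT0 : 0 <= K * cT. Proof. exact: mulr_ge0. Qed.

Let step_fun a b a' b' dl z := \1_E z.1 * (G (W a' b' z) - G (W a b z) - dl * gen D1 D2 (W a b z)).

Let B (dl : R) : R := K + K + `|dl| * (K * gen_const R n).

Let step_meas a b a' b' dl : 0 <= a -> 0 <= b -> 0 <= a' -> 0 <= b' ->
  measurable_fun setT (step_fun a b a' b' dl).
Proof.
move=> a0 b0 a0' b0'; apply: (measurable_funM mE1); apply: measurable_funB.
  by apply: measurable_funB; apply: mgW => //; exact: jet_meas0 J.
by apply: measurable_funM => //; apply: mgW => //; exact: gen_meas J.
Qed.

Let step_bnd a b a' b' dl z : 0 <= a -> 0 <= b -> 0 <= a' -> 0 <= b' ->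
  `|step_fun a b a' b' dl z| <= B dl.
Proof.
move=> a0 b0 a0' b0'; rewrite normrM -[B dl]mul1r; apply: ler_pM => //; first exact: indic_le1.
apply: (le_trans (ler_normB _ _)); apply: lerD.
  by apply: (le_trans (ler_normB _ _)); apply: lerD; apply: (jet_bound0 J); exact: Wu.
by rewrite normrM ler_wpM2l//; apply: (gen_bound K0 J); exact: Wu.
Qed.

(** A step in either time has the same first-order term. With the copy fixed it is a step of U
    translated by l and r U_b; with the original fixed it is a step of the copy translated by l U_a
    r on the left. [gen_translate] identifies the two generators. *)
Let kernel_step : exists2 c : R, 0 <= c & forall a b dl, s <= a -> 0 <= b -> 0 < dl -> dl <= 1 ->
  `|mean Q (step_fun a b (a + dl) b dl)| <= K * cT * (c * (dl * Num.sqrt dl)) /\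
  `|mean Q (step_fun a b a (b + dl) dl)| <= K * cT * (c * (dl * Num.sqrt dl)).
Proof.
have [c1 c0 step] := one_step hF hU.
exists c1 => // a b dl sa b0 dl0 dl1; have a0 := le_trans s0 sa.
have a1 : 0 <= a + dl by rewrite addr_ge0// ltW.
have b1 : 0 <= b + dl by rewrite addr_ge0// ltW.
have tdl t : t + dl - t = dl by rewrite addrAC subrr add0r.
have bd : 0 <= K * cT * (c1 * (dl * Num.sqrt dl)).
  by apply: mulr_ge0 => //; apply: mulr_ge0 => //; apply: mulr_ge0; [exact: ltW|exact: sqrtr_ge0].
split.
  have mS := step_meas dl a0 b0 a1 b0; have bS z := step_bnd dl z a0 b0 a1 b0.
  rewrite (mean_prod' P P mS bS) -[X in _ <= X](mean_cst P).
  have bnd y : `|mean P (fun x => step_fun a b (a + dl) b dl (x, y))| <= K * cT * (c1 * (dl * Num.sqrt dl)).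
    have hry : r *m U b y \is unitarymx := mul_unitarymx hr (bu_unitary hU y b0).
    have := step _ _ _ _ a (a + dl) E KT0 (jet_translate hl hry K0 J) a0.
    rewrite tdl ltrDl lerD2l => /(_ dl0 dl1 (filt_mono hF s0 sa FE)).
    congr (`|mean P _| <= _); apply/funext => x.
    rewrite (gen_translate D1 hl hry (bu_unitary hU x a0) (jet_lin2 J) (jet_lin3 J)).
    by rewrite /step_fun /W /= !mulmxA.
  apply: (mean_norm_le _ (L1_cst _ _) bnd).
  exact: (L1_bnd P (meas_sect_mean' P P mS bS) bnd).
have mS := step_meas dl a0 b0 a0 b1; have bS z := step_bnd dl z a0 b0 a0 b1.
rewrite (mean_prod P P mS bS) -[X in _ <= X](mean_cst P).
have bnd x : `|mean P (fun y => step_fun a b a (b + dl) dl (x, y))| <= K * cT * (c1 * (dl * Num.sqrt dl)).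
  have hlx : l *m U a x *m r \is unitarymx := mul_unitarymx (mul_unitarymx hl (bu_unitary hU x a0)) hr.
  have h1 : (1%:M : M) \is unitarymx by apply/unitarymxP; rewrite mul1mx trmx1 map_mx1.
  have e : (fun y => step_fun a b a (b + dl) dl (x, y)) =
    (fun y => \1_E x * (\1_setT y * (G (l *m U a x *m r *m U (b + dl) y *m 1%:M) - G (l *m U a x *m r *m U b y *m 1%:M) -
       dl * gen (fun u v => D1 (l *m U a x *m r *m u *m 1%:M) (l *m U a x *m r *m v *m 1%:M))
    (fun u v w => D2 (l *m U a x *m r *m u *m 1%:M) (l *m U a x *m r *m v *m 1%:M) (l *m U a x *m r *m w *m 1%:M)) (U b y)))).
    apply/funext => y; rewrite (gen_translate D1 hlx h1 (bu_unitary hU y b0) (jet_lin2 J) (jet_lin3 J)).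
    by rewrite /step_fun /W /= !mulmx1 indicT mul1r.
  have := step _ _ _ _ b (b + dl) setT KT0 (jet_translate hlx h1 K0 J) b0.
  rewrite tdl ltrDl lerD2l => /(_ dl0 dl1 (filtT hF b0)) hst.
  have [Ex|Ex] := boolP (x \in E); last first.
    by under eq_fun do rewrite /step_fun /= indicE (negbTE Ex) mul0r; rewrite mean_cst normr0.
  by rewrite e; under eq_fun do rewrite indicE Ex mul1r.
apply: (mean_norm_le _ (L1_cst _ _) bnd).
exact: (L1_bnd P (meas_sect_mean P P mS bS) bnd).
Qed.

Let Phi a b := mean Q (fun z => \1_E z.1 * G (W a b z)).

(** Moving time dl from one argument of [Phi] to the other changes it by order dl^(3/2), so t -> Phi
    (s + t) (h - t) is constant by [telescope_riem] with zero rate. *)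
Lemma kernel_jet h : 0 <= h -> Phi (s + h) 0 = Phi s h.
Proof.
move=> h0; have [c c0 step] := kernel_step.
have LG g B' a b : 0 <= a -> 0 <= b -> measurable_wrt (@borel_mx R n n) g ->
    (forall u, u \is unitarymx -> `|g u| <= B') -> L1 Q (fun z => \1_E z.1 * g (W a b z)).
  move=> a0 b0 mg gB; apply: (L1M_bnd mE1 (fun z => indic_le1 R E z.1)).
  by apply: (L1_bnd Q (mgW a0 b0 mg)) => z; apply: gB; exact: Wu.
have stepE a b a' b' dl : 0 <= a -> 0 <= b -> 0 <= a' -> 0 <= b' ->
    mean Q (step_fun a b a' b' dl) = Phi a' b' - Phi a b - dl * mean Q (fun z => \1_E z.1 * gen D1 D2 (W a b z)).
  move=> a0 b0 a0' b0'.
  have L0 := LG _ _ _ _ a0 b0 (jet_meas0 J) (jet_bound0 J).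
  have L1' := LG _ _ _ _ a0' b0' (jet_meas0 J) (jet_bound0 J).
  have L2' := LG _ _ _ _ a0 b0 (gen_meas J) (fun u => gen_bound K0 J (u := u)).
  rewrite -meanZ// -meanB// -meanB//; [|exact: L1B|exact: L1Z].
  by congr mean; apply/funext => z; rewrite /step_fun; ring.
have key a b dl : s <= a -> 0 <= b -> 0 < dl -> dl <= 1 ->
    `|Phi (a + dl) b - Phi a (b + dl)| <= 2 * (K * cT * c) * (dl * Num.sqrt dl).
  move=> sa b0 dl0 dl1; have a0 := le_trans s0 sa.
  have a1 : 0 <= a + dl by rewrite addr_ge0// ltW.
  have b1 : 0 <= b + dl by rewrite addr_ge0// ltW.
  have tri (x x' p y k : R) : `|x - p - y| <= k -> `|x' - p - y| <= k -> `|x - x'| <= 2 * k.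
    by rewrite !ler_norml => /andP[h1 h2] /andP[h3 h4]; apply/andP; split; lra.
  have [e1 e2] := step a b dl sa b0 dl0 dl1.
  rewrite stepE// in e1; rewrite stepE// in e2.
  by rewrite -!mulrA; apply: (le_trans (tri _ _ _ _ _ e1 e2)); rewrite -!mulrA.
have cv : riem (fun=> 0) 0 h N @[N --> \oo] --> Phi (s + h) (h - h) - Phi (s + 0) (h - 0).
  apply: (@telescope_riem _ (fun t => Phi (s + t) (h - t)) _ _ _ (2 * (K * cT * c))) => //.
  move=> a b a0 ab bh b1; rewrite mulr0 subr0.
  have := key (s + a) (h - b) (b - a); rewrite lerDl subr_ge0 subr_gt0 lerBlDl.
  move=> /(_ a0 bh ab b1); have -> : s + a + (b - a) = s + b by ring.
  by have -> : h - b + (b - a) = h - a by ring.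
rewrite (subrr h) (addr0 s) (subr0 h) in cv.
have cv0 : riem (fun=> 0) 0 h N @[N --> \oo] --> (0 : R).
  rewrite (_ : riem _ _ _ = fun=> 0); first exact: cvg_cst.
  by apply/funext => N; rewrite /riem big1// => i _; rewrite mulr0.
apply: subr0_eq; exact: (cvg_unique (@norm_hausdorff _ _) cv cv0).
Qed.

End Jet.

Lemma kernel_law (g : M -> R) K h : measurable_wrt (@borel_mx R n n) g -> (forall w, `|g w| <= K) -> 0 <= h ->
  mean Q (fun z => \1_E z.1 * g (W (s + h) 0 z)) = mean Q (fun z => \1_E z.1 * g (W s h z)).
Proof.
move=> mg gK h0; have sh0 : 0 <= s + h by exact: addr_ge0.
pose A : set TT := [set z | E z.1].
have E1 z : \1_E z.1 = \1_A z :> R by rewrite !indicE; congr (_%:R); apply/idP/idP => /set_mem hz; apply/mem_set.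
have mA : measurable A.
  have mE : measurable E by exact: (filt_meas hF s0).
  by have := @measurable_fst _ _ T T measurableT _ mE; rewrite setTI.
have -> : (fun z : TT => \1_E z.1 * g (W (s + h) 0 z)) = (fun z => \1_A z * g (W (s + h) 0 z)).
  by apply/funext => z; rewrite E1.
have -> : (fun z : TT => \1_E z.1 * g (W s h z)) = (fun z => \1_A z * g (W s h z)).
  by apply/funext => z; rewrite E1.
apply: (law_eq mA (mW sh0 (lexx 0)) (mW s0 h0) _ mg gK) => c.
have lim a b : 0 <= a -> 0 <= b ->
    mean Q (fun z => \1_E z.1 * soft_box c k (W a b z)) @[k --> \oo] --> pr Q (A `&` W a b @^-1` box c).
  move=> a0 b0; have mAB : measurable (A `&` W a b @^-1` box c).
    apply: measurableI => //; apply: (mmw_preimage (@measurable_sigma _ TT) (mW a0 b0)).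
    exact: borel_box.
  rewrite -mean_indic//.
  apply: (@mean_cvg _ _ _ Q _ _ 1).
  - exact: measurable_indic.
  - move=> k; have [D1 [D2 [K' [K'0 J]]]] := soft_box_jet c k.
    by apply: (measurable_funM mE1); apply: mgW => //; exact: jet_meas0 J.
  - move=> k; near=> z; have /andP[q0 q1] := soft_box_bound c k (W a b z).
    rewrite normrM -[X in _ <= X]mulr1; apply: ler_pM => //; first exact: indic_le1.
    by rewrite ger0_norm.
  near=> z; have -> : \1_(A `&` W a b @^-1` box c) z = \1_E z.1 * \1_(box c) (W a b z) :> R.
    by rewrite E1 !indicE in_setI -natrM mulnb; congr (_ && _)%:R.
  apply: cvgMr.
  exact: soft_box_cvg.
apply: (cvg_unique (@norm_hausdorff _ _) (lim _ _ sh0 (lexx 0))).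
have -> : (fun k => mean Q (fun z => \1_E z.1 * soft_box c k (W (s + h) 0 z))) =
    (fun k => mean Q (fun z => \1_E z.1 * soft_box c k (W s h z))).
  apply/funext => k; have [D1 [D2 [K' [K'0 J]]]] := soft_box_jet c k.
  exact: (kernel_jet K'0 J h0).
exact: lim.
Unshelve. all: by end_near. Qed.
(** Fubini applied to [kernel_law]: the copy at time 0 is almost surely u0, so the left side
    involves U alone. *)
Lemma kernel_start (u0 : M) (g : M -> R) K h : {ae P, forall x, U 0 x = u0} ->
  measurable_wrt (@borel_mx R n n) g -> (forall w, `|g w| <= K) -> 0 <= h ->
  mean P (fun x => \1_E x * g (l *m U (s + h) x *m r *m u0)) =
  mean P (fun x => \1_E x * mean P (fun y => g (l *m U s x *m r *m U h y))).
Proof.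
move=> U0 mg gK h0; have sh0 : 0 <= s + h by exact: addr_ge0.
have mH a b : 0 <= a -> 0 <= b -> measurable_fun setT (fun z => \1_E z.1 * g (W a b z)).
  by move=> a0 b0; apply: (measurable_funM mE1); exact: mgW.
have HK a b z : `|\1_E z.1 * g (W a b z)| <= K.
  by rewrite normrM -[K]mul1r; apply: ler_pM => //; exact: indic_le1.
have mSec a b x : 0 <= a -> 0 <= b -> L1 P (fun y => g (W a b (x, y))).
  move=> a0 b0; apply: (@sect_L1 _ _ _ _ _ P (fun z => g (W a b z)) K) => //; exact: mgW.
have e1 : (fun x => mean P (fun y => \1_E (x, y).1 * g (W (s + h) 0 (x, y)))) =
    (fun x => \1_E x * g (l *m U (s + h) x *m r *m u0)).
  apply/funext => x; rewrite /= meanZ; last exact: mSec.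
  congr (_ * _); rewrite -[RHS](mean_cst P); apply: mean_ae.
  - exact: (L1_meas (mSec _ _ _ _ _)).
  - exact: measurable_cst.
  - by apply: filterS U0 => y; rewrite /W /= => ->.
have e2 : (fun x => mean P (fun y => \1_E (x, y).1 * g (W s h (x, y)))) =
    (fun x => \1_E x * mean P (fun y => g (l *m U s x *m r *m U h y))).
  by apply/funext => x; rewrite /= meanZ//; exact: mSec.
have q1 := etrans (mean_prod P P (mH _ _ sh0 (lexx 0)) (HK _ _)) (congr1 (mean P) e1).
have q2 := etrans (mean_prod P P (mH _ _ s0 h0) (HK _ _)) (congr1 (mean P) e2).
exact: (etrans (esym q1) (etrans (kernel_law mg gK h0) q2)).
Qed.

End Kernel.

(** * Conjugation invariance of the right increment *)

Section ConjugationInvariance.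
Context d (T : measurableType d) (R : realType) (P : probability T R) (F : R -> set (set T)).
Hypothesis hF : complete_filtration P F.
Variable n : nat.
Variable U : R -> T -> 'M[R[i]]_n.
Hypothesis hU : brownian_unitary P F U.
Local Notation M := 'M[R[i]]_n.
Local Notation adj u := (map_mx Num.conj (trmx u)).
Variable u0 : M.
Hypotheses (hu0 : u0 \is unitarymx) (U0 : {ae P, forall x, U 0 x = u0}).

Lemma adj_unitary (u : M) : u \is unitarymx -> adj u \is unitarymx.
Proof. by move=> hu; rewrite trmxC_unitary; exact: hu. Qed.

Lemma mul_adj (u : M) : u \is unitarymx -> u *m adj u = 1%:M.
Proof. by move/unitarymxP. Qed.

Lemma adj_mul (u : M) : u \is unitarymx -> adj u *m u = 1%:M.
Proof. by move/unitarymxP/mulmx1C. Qed.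

Lemma unitary1 : (1%:M : M) \is unitarymx.
Proof. by apply/unitarymxP; rewrite mul1mx trmx1 map_mx1. Qed.

(** [kernel_start] at time 0 with left factor D u0^-1 and right factor D^-1 u0^-1: as U_0 = u0, the
    product l U_0 r reduces to u0^-1. *)
Lemma conj_law (D : M) (g : M -> R) K h : D \is unitarymx ->
  measurable_wrt (@borel_mx R n n) g -> (forall w, `|g w| <= K) -> 0 <= h ->
  mean P (fun y => g (D *m adj u0 *m U h y *m adj D)) = mean P (fun y => g (adj u0 *m U h y)).
Proof.
move=> hD mg gK h0; have F0 := filtT hF (lexx 0).
have hl := mul_unitarymx hD (adj_unitary hu0).
have hr := mul_unitarymx (adj_unitary hD) (adj_unitary hu0).
have := kernel_start hF hU hl hr (lexx 0) F0 U0 mg gK h0.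
have -> : (fun x => \1_setT x * g (D *m adj u0 *m U (0 + h) x *m (adj D *m adj u0) *m u0)) =
    (fun x => g (D *m adj u0 *m U h x *m adj D)).
  by apply/funext => x; rewrite indicT mul1r add0r -!mulmxA (adj_mul hu0) mulmx1.
move=> ->; set k := mean P (fun y => g (adj u0 *m U h y)); rewrite -(mean_cst P k).
have hk x : U 0 x = u0 -> mean P (fun y => g (D *m adj u0 *m U 0 x *m (adj D *m adj u0) *m U h y)) = k.
  move=> ->; congr mean; apply/funext => y; congr g.
  by rewrite -!mulmxA (mulmxA (adj u0) u0) (adj_mul hu0) mul1mx !mulmxA (mul_adj hD) mul1mx.
apply: mean_ae.
- apply: (measurable_funM (filt_indic hF (lexx 0) F0)).
  exact: (kernel_meas hF hU _ _ (lexx 0) h0 mg gK).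
- exact: measurable_cst.
- by apply: filterS U0 => x /hk ->; rewrite indicT mul1r.
Qed.

End ConjugationInvariance.

(** * A measurable section of the chart *)

Section Chart.
Variables (R : realType) (m : nat).
Local Notation C := R[i].
Local Notation n := m.+1.
Local Notation M := 'M[C]_n.
Local Notation state := 'M[C]_(m, n).
Local Notation wd := (widen_ord (leqnSn m)).

Lemma chart_mmw (S : pointedType) (G : set (set S)) (X : S -> M) : sigma_algebra setT G ->
  mmw G X -> mmw G (fun x => flag_chart (X x)).
Proof.
move=> hG mX k j.
have -> : (fun x => flag_chart (X x) k j) = (fun x => X x (wd k) j * (X x ord_max j)^-1).
  by apply/funext => x; rewrite mxE.
by apply: (cmwM hG); [exact: mX|apply: (cmwV hG); exact: mX].
Qed.

Lemma chart_torus (v : M) (t : 'I_n -> C) : (forall j, t j != 0) ->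
  flag_chart (v *m diag_mx (\row_j t j)) = flag_chart v.
Proof.
move=> t0; apply/matrixP => k j; rewrite !mxE.
have e (a : 'I_n) : \sum_i v a i * diag_mx (\row_j t j) i j = v a j * t j.
  rewrite (bigD1 j)//= big1 ?addr0; last first.
    by move=> i ij; rewrite mxE (negbTE ij) mulr0n mulr0.
  by rewrite !mxE eqxx mulr1n.
by rewrite !e -mulf_div divff// mulr1.
Qed.

Lemma last_row_radius (u : M) j : flag_domain u ->
  1 + \sum_(k < m) sqmod (flag_chart u k j) = (sqmod (u ord_max j))^-1.
Proof.
move=> [hu uj]; have u0 : sqmod (u ord_max j) != 0 by rewrite sqmod_eq0.
have col : \sum_(k < n) sqmod (u k j) = 1.
  have hut : u^T \is unitarymx by rewrite trmx_unitary; exact: hu.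
  rewrite -(unitary_row j hut); apply: eq_bigr => k _.
  by rewrite /sqmod big_bool/= !mxE addrC.
have e k : sqmod (flag_chart u k j) = sqmod (u (wd k) j) / sqmod (u ord_max j).
  apply: (@complexI R); rewrite rmorphM/= fmorphV/= !sqmodE mxE rmorphM/= fmorphV/=.
  by rewrite invfM mulrACA.
under eq_bigr do rewrite e.
rewrite -mulr_suml; move: col; rewrite big_ord_recr/= => col.
have -> : \sum_(i < m) sqmod (u (wd i) j) = 1 - sqmod (u ord_max j) by rewrite -col addrK.
by rewrite mulrBl divff// mul1r addrC subrK.
Qed.

Definition col_scale (w : state) (j : 'I_n) : R := (Num.sqrt (1 + \sum_(k < m) sqmod (w k j)))^-1.

(* A section of the chart: the representative in the fibre of w whose last row is positive. *)
Definition chart_section (w : state) : M :=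
  \matrix_(k, j) ((if insub (val k) is Some k' then w k' j else 1) * (col_scale w j)%:C%C).

(** The unit complex number that makes the last entry of column j positive. *)
Definition phase (u : M) (j : 'I_n) : C := (u ord_max j)^* * ((Num.sqrt (sqmod (u ord_max j)))^-1)%:C%C.

Lemma phase_neq0 u j : flag_domain u -> phase u j != 0.
Proof.
move=> [hu uj]; rewrite mulf_neq0 ?conjC_eq0// -(rmorph0 (@real_complex R)) (inj_eq (@complexI R)).
by rewrite invr_eq0 gt_eqF// sqrtr_gt0 lt_neqAle sqmod_ge0 eq_sym sqmod_eq0 uj.
Qed.

Lemma phase_unitary u : flag_domain u -> diag_mx (\row_j phase u j) \is unitarymx.
Proof.
move=> [hu uj]; apply/unitarymxP/matrixP => k j; rewrite !mxE (bigD1 k)//= big1 ?addr0; last first.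
  by move=> i ik; rewrite !mxE eq_sym (negbTE ik) mulr0n mul0r.
rewrite !mxE eqxx mulr1n eq_sym; case: eqP => [->|_]; last by rewrite mulr0n conjC0 mulr0.
rewrite mulr1n /phase rmorphM/= conjCK.
set a := u ord_max j; set c := (Num.sqrt _)^-1.
have -> : (c%:C%C)^* = c%:C%C by apply: eq_pt => -[]; rewrite ptJ /= ?oppr0.
have -> : a^* * c%:C%C * (a * c%:C%C) = (a * a^*) * (c * c)%:C%C by rewrite rmorphM/=; ring.
rewrite -sqmodE -rmorphM/= -invfM -expr2 sqr_sqrtr ?sqmod_ge0// divff ?rmorph1//.
by rewrite sqmod_eq0 uj.
Qed.

Lemma chart_sectionE u : flag_domain u ->
  chart_section (flag_chart u) = u *m diag_mx (\row_j phase u j).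
Proof.
move=> hu; have [hU uj] := hu; apply/matrixP => k j; rewrite !mxE.
rewrite (bigD1 j)//= big1 ?addr0; last first.
  by move=> i ij; rewrite !mxE (negbTE ij) mulr0n mulr0.
have -> : diag_mx (\row_j0 phase u j0) j j = phase u j by rewrite !mxE eqxx mulr1n.
rewrite /col_scale last_row_radius// sqrtrV ?sqmod_ge0// invrK /phase.
set a := u ord_max j; set s := sqmod a; set c := Num.sqrt s.
have s0 : 0 < s by rewrite lt_neqAle sqmod_ge0 eq_sym sqmod_eq0 uj.
have c0 : c != 0 by rewrite gt_eqF// sqrtr_gt0.
have key : a^-1 * c%:C%C = a^* * (c^-1)%:C%C.
  apply: (mulfI (uj j)); rewrite mulrA divff// mul1r mulrA -sqmodE -/s -rmorphM/=.
  by congr (_%:C%C); rewrite -[s]sqr_sqrtr ?(ltW s0)// -/c expr2 -mulrA divff// mulr1.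
case: insubP => [k' _ kk'|]; rewrite ?mxE.
  have -> : wd k' = k by apply: val_inj; rewrite /= kk'.
  by rewrite -mulrA key.
rewrite -leqNgt => mk; have -> : k = ord_max by apply: val_inj; apply/eqP; rewrite eqn_leq mk leq_ord.
by rewrite mul1r -key mulrA divff// mul1r.
Qed.

Lemma chart_section_mmw : mmw (@borel_mx R m n) chart_section.
Proof.
have sB := @borel_sigma R m n; move=> k j.
have -> : (fun w => chart_section w k j) =
    (fun w : state => (if insub (val k) is Some k' then w k' j else 1) * (col_scale w j)%:C%C).
  by apply/funext => w; rewrite mxE.
apply: (cmwM sB).
  by case: insubP => [k' _ _|_]; [exact: borel_mmw|exact: (cmw_cst sB)].
apply: (cmw_pt sB); rewrite /col_scale.
apply: (@mwr_comp _ _ _ (fun x : R => (Num.sqrt x)^-1)).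
  by apply: (measurableT_comp (@measurable_inv R)); apply: continuous_measurable_fun; exact: sqrt_continuous.
apply: (mwrD sB); first exact: mwr_cst.
apply: (mwr_sum sB) => k' _; apply: (mwr_sum sB) => e _.
by apply: (@mwr_comp _ _ _ (fun x : R => x ^+ 2)); [exact: measurable_funX|exact: borel_mmw].
Qed.

End Chart.

(** * Markov property of the chart process *)

Section Markov.
Context d (T : measurableType d) (R : realType) (P : probability T R) (F : R -> set (set T)).
Hypothesis hF : complete_filtration P F.
Variable m : nat.
Variable U : R -> T -> 'M[R[i]]_(m.+1).
Hypothesis hU : brownian_unitary P F U.
Local Notation M := 'M[R[i]]_(m.+1).
Local Notation state := 'M[R[i]]_(m, m.+1).
Local Notation adj u := (map_mx Num.conj (trmx u)).
Variable u0 : M.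
Hypotheses (hu0 : flag_domain u0) (U0 : {ae P, forall x, U 0 x = u0}).

Lemma bu_flag_domain : {ae P, forall x, forall t, 0 <= t -> flag_domain (U t x)}.
Proof.
have : {ae P, forall x, forall j, forall t, 0 <= t -> U t x ord_max j != 0}.
  by apply: filter_forall => j; apply: (entry_neq0 hF hU U0); exact: hu0.2.
by apply: filterS => x h t t0; split => [|j]; [exact: (bu_unitary hU)|exact: h].
Qed.

Lemma cond_expectationP t (X Y : T -> R) : 0 <= t -> measurable_wrt (F t) Y -> L1 P X -> L1 P Y ->
  (forall E, F t E -> mean P (fun x => \1_E x * Y x) = mean P (fun x => \1_E x * X x)) ->
  cond_expectation P (F t) X Y.
Proof.
move=> t0 mY LX LY h; split => // E FE; have mE := filt_meas hF t0 FE.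
have bridge (Z : T -> R) : L1 P Z -> (\int[P]_(x in E) (Z x)%:E = (mean P (fun x => \1_E x * Z x))%:E)%E.
  move=> LZ; have L := L1M_bnd (filt_indic hF t0 FE) (indic_le1 R E) LZ.
  rewrite /mean /Rintegral fineK; last exact: integrable_fin_num.
  rewrite [LHS]integral_mkcond; apply: eq_integral => x _; rewrite /patch indicE.
  by case: (x \in E); rewrite ?mul1r ?mul0r.
by rewrite !bridge// h.
Qed.

Variables (h : R) (phi : state -> R) (K : R).
Hypotheses (h0 : 0 <= h) (mphi : measurable_wrt (@borel_mx R m m.+1) phi) (phiK : forall w, `|phi w| <= K).

Let g (u : M) : R := phi (flag_chart u).

Let mg : measurable_wrt (@borel_mx R m.+1 m.+1) g.
Proof.
have sB := @borel_sigma R m.+1 m.+1.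
by apply: (mwr_mmw sB _ mphi); apply: (chart_mmw sB); exact: borel_mmw.
Qed.

(** Starting from u, the process is continued by an independent copy of the right increment U_0^-1
    U_h. *)
Definition transition (u : M) : R := mean P (fun y => phi (flag_chart (u *m adj u0 *m U h y))).

(** By [conj_law] the increment may be conjugated by D; the inner phases cancel and the outer
    diagonal factor is invisible to the chart. *)
Let transition_torus u : flag_domain u -> transition (u *m diag_mx (\row_j phase u j)) = transition u.
Proof.
move=> hu; set D := diag_mx _; have hD : D \is unitarymx by exact: phase_unitary.
have mgu : measurable_wrt (@borel_mx R m.+1 m.+1) (fun v => g (u *m v)).
  have sB := @borel_sigma R m.+1 m.+1; apply: (mwr_mmw sB _ mg).
  by apply: (mmwM sB); [exact: (mmw_cst sB)|exact: borel_mmw].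
have := conj_law hF hU hu0.1 U0 hD mgu (fun w => phiK _) h0.
rewrite /transition (_ : (fun y => phi (flag_chart (u *m adj u0 *m U h y))) =
    (fun y => g (u *m (adj u0 *m U h y)))); last by apply/funext => y; rewrite mulmxA.
move=> <-; congr mean; apply/funext => y; rewrite /g !mulmxA.
have -> : adj D = diag_mx (\row_j (phase u j)^*).
  apply/matrixP => i j; rewrite !mxE eq_sym; case: eqP => [->|_]; by rewrite ?mulr1n ?mulr0n// conjC0.
by rewrite chart_torus// => j; rewrite conjC_eq0 phase_neq0.
Qed.

Lemma transition_meas : measurable_wrt (@borel_mx R m m.+1) (fun w => transition (chart_section w)).
Proof.
have sB := @borel_sigma R m m.+1; apply/(mwrP sB).
pose X := g_sigma_algebraType (@borel_mx R m m.+1).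
pose H (z : X * T) := phi (flag_chart (chart_section z.1 *m adj u0 *m U h z.2)).
have mH : measurable_fun setT H.
  have sXT := @measurable_sigma _ (X * T)%type.
  suff mW : mmw (measurable : set (set (X * T))) (fun z : X * T => flag_chart (chart_section z.1 *m adj u0 *m U h z.2)).
    by have hm := mwr_mmw sXT mW mphi; move=> _ B mB; rewrite setTI; exact: hm.
  apply: (chart_mmw sXT); apply: (mmwM sXT); last by apply: mmw_snd; exact: (bu_mmw hF hU).
  apply: (mmwM sXT); last exact: (mmw_cst sXT).
  apply: (@mmw_fst _ _ X T) => k j e B mB; rewrite /measurable/= sigma_algebra_id//.
  exact: chart_section_mmw.
(* Any probability on the state space would do: it only provides the product on which measurability
   of sections is known. *)
pose P0 : probability X R := \d_(point : X).
exact: (meas_sect_mean P0 P mH (fun z => phiK _)).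
Qed.

Lemma markov_identity s : 0 <= s ->
  cond_expectation P (F s) (fun x => phi (flag_chart (U (s + h) x)))
    (fun x => transition (chart_section (flag_chart (U s x)))).
Proof.
move=> s0; have sh0 : 0 <= s + h by exact: addr_ge0.
have mX : measurable_wrt (F s) (fun x => transition (chart_section (flag_chart (U s x)))).
  apply: (mwr_mmw (filt_sigma hF s0) _ transition_meas).
  by apply: (chart_mmw (filt_sigma hF s0)); exact: (U_mmw (bu_adapted hU) s0).
have trK u : `|transition u| <= K.
  have L : L1 P (fun y => phi (flag_chart (u *m adj u0 *m U h y))).
    apply: (@L1_bnd _ _ _ _ K) => //.
    have sT := @measurable_sigma _ T.
    have mW : mmw (measurable : set (set T)) (fun y => u *m adj u0 *m U h y).
      by apply: (mmwM sT); [exact: (mmw_cst sT)|exact: (bu_mmw hF hU)].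
    by have hm := mwr_mmw sT mW mg; move=> _ B mB; rewrite setTI; exact: hm.
  by rewrite -[X in _ <= X](mean_cst P K); apply: (mean_norm_le L (L1_cst P K)).
apply: cond_expectationP => //.
- by apply: (@L1_bnd _ _ _ _ K) => //; exact: (bu_meas hF hU sh0 mg).
- by apply: (@L1_bnd _ _ _ _ K) => //; exact: (adapted_meas hF s0 mX).
move=> E FE; have := kernel_start hF hU (@unitary1 R _) (adj_unitary hu0.1) s0 FE U0 mg (fun w => phiK _) h0.
have -> : (fun x => \1_E x * g (1%:M *m U (s + h) x *m adj u0 *m u0)) =
    (fun x => \1_E x * phi (flag_chart (U (s + h) x))).
  by apply/funext => x; rewrite mul1mx -mulmxA (adj_mul hu0.1) mulmx1.
have mE := filt_indic hF s0 FE.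
move=> ->; apply: mean_ae.
- by apply: measurable_funM => //; exact: (adapted_meas hF s0 mX).
- apply: (measurable_funM mE); exact: (kernel_meas hF hU _ _ s0 h0 mg (fun w => phiK _)).
apply: filterS bu_flag_domain => x dx.
by rewrite (chart_sectionE (dx _ s0)) (transition_torus (dx _ s0)) /transition /g mul1mx.
Qed.

End Markov.

(** * Smooth functions and Taylor expansion *)

Section SmoothCalculus.
Variables (R : realType) (V : normedModType R).
Implicit Types (g : V -> R) (v w x y : V).

Lemma smooth_continuous g : smooth g -> continuous g.
Proof. by move/(_ 0%N). Qed.

Lemma smooth_derive g v : smooth g -> smooth ('D_v g).
Proof. by move=> sg p; have [_ /(_ v)[]] := sg p.+1. Qed.

Lemma smooth_derivable g x v : smooth g -> derivable g x v.
Proof. by move=> sg; have [_ /(_ v)[h _]] := sg 1%N; exact: h. Qed.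

Lemma is_derive_line g x v (t : R) : smooth g ->
  is_derive t 1 (fun t : R => g (x + t *: v)) ('D_v g (x + t *: v)).
Proof.
move=> sg; have h : derivable g (x + t *: v) v by exact: smooth_derivable.
have e : (fun h : R => h^-1 *: (((fun t : R => g (x + t *: v)) \o shift t) (h *: (1 : R)) - g (x + t *: v))) =
  (fun h : R => h^-1 *: ((g \o shift (x + t *: v)) (h *: v) - g (x + t *: v))).
  apply/funext => s /=; congr (_ *: (g _ - _)).
  have -> : s%:A = s by rewrite /GRing.scale/= mulr1.
  by rewrite scalerDl addrCA.
by split; [rewrite /derivable e|rewrite /derive e].
Qed.

Lemma mvt_line g x v (h : R) : smooth g ->
  exists2 th : R, `|th| <= `|h| & g (x + h *: v) - g x = h * 'D_v g (x + th *: v).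
Proof.
move=> sg; have a0 : - `|h| <= 0 <= `|h| by rewrite oppr_le0 normr_ge0.
have ah : - `|h| <= h <= `|h| by rewrite -ler_norml.
have [c [_ ch e]] := mvt_seg (fun z _ => is_derive_line x v z sg) a0 ah.
exists c; first by rewrite !subr0 in ch.
by move: e; rewrite scale0r addr0 subr0 mulrC.
Qed.

Let close_line v w (e : R) : 0 < e -> exists2 d : R, 0 < d & forall h a b : R,
  `|h| < d -> `|a| <= `|h| -> `|b| <= `|h| -> `|a *: v + b *: w| < e.
Proof.
move=> e0; exists (e / (`|v| + `|w| + 1)).
  by rewrite divr_gt0// ltr_wpDl// addr_ge0.
move=> h a b; rewrite ltr_pdivlMr ?ltr_wpDl// ?addr_ge0// => hd ah bh.
apply: le_lt_trans hd; apply: (le_trans (ler_normD _ _)); rewrite !normrZ !mulrDr mulr1.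
rewrite -[X in X <= _]addr0; apply: lerD => //; apply: lerD; exact: ler_wpM2r.
Qed.

(** Linearity in the direction does not follow from the existence of directional derivatives alone.
    The increment along a v is written by the mean value theorem as a derivative at a nearby point,
    and continuity of 'D_v g concludes. *)
Lemma deriveDZ g x v w (a : R) : smooth g -> 'D_(a *: v + w) g x = a * 'D_v g x + 'D_w g x.
Proof.
move=> sg; set z := a *: v + w.
pose q u (h : R) := h^-1 * (g (x + h *: u) - g x).
have cq u : q u h @[h --> 0^'] --> 'D_u g x.
  have h : derivable g x u by exact: smooth_derivable.
  have -> : q u = (fun h => h^-1 *: ((g \o shift x) (h *: u) - g x)).
    by apply/funext => s; rewrite /q /= [x + _]addrC.
  exact: h.
have cr : q z h - q w h @[h --> 0^'] --> a * 'D_v g x.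
  apply/cvgrPdist_lt => e e0.
  have a1 : 0 < 1 + `|a| by rewrite ltr_pwDl.
  have e1 : 0 < e / (1 + `|a|) by rewrite divr_gt0.
  have /cvgrPdist_lt/(_ _ e1)/nbhs_ballP[d1 /= d10 hd1] := @smooth_continuous _ (smooth_derive v sg) x.
  have [d2 d20 hd2] := close_line v w (divr_gt0 d10 a1).
  near=> h; have h0 : h != 0 by near: h; exact: nbhs_dnbhs_neq.
  have hd : `|h| < d2.
    near: h; apply: nbhs_dnbhs; apply/nbhs_ballP; exists d2 => //= s; by rewrite -ball_normE /= sub0r normrN.
  have [th hth e2] := mvt_line (x + h *: w) v (h * a) sg.
  have -> : q z h - q w h = a * 'D_v g (x + h *: w + th *: v).
    rewrite /q -mulrBr opprB addrA subrK.
    have -> : x + h *: z = x + h *: w + (h * a) *: v by rewrite /z scalerDr scalerA -addrA [h *: w + _]addrC.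
    by rewrite e2; field.
  rewrite -mulrBr normrM; apply: (@le_lt_trans _ _ (`|a| * (e / (1 + `|a|)))).
    apply: ler_wpM2l => //; apply: ltW; apply: hd1; rewrite -ball_normE /= -addrA opprD addNKr normrN addrC.
    rewrite normrM in hth.
    (* Rescaling by 1 + |a| brings both coefficients below |h|, as [close_line] requires. *)
    have -> : th *: v + h *: w = (1 + `|a|) *: ((th / (1 + `|a|)) *: v + (h / (1 + `|a|)) *: w).
      by rewrite scalerDr !scalerA ![_ * (_ / _)]mulrC !divfK// gt_eqF.
    rewrite normrZ (gtr0_norm a1) mulrC -ltr_pdivlMr//; apply: (hd2 h) => //.
      rewrite normrM normfV (gtr0_norm a1) ler_pdivrMr//; apply: (le_trans hth).
      by rewrite ler_wpM2l// lerDr.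
    rewrite normrM normfV (gtr0_norm a1) ler_pdivrMr//.
    by rewrite -[X in X <= _]mulr1; apply: ler_wpM2l => //; rewrite lerDl.
  rewrite mulrA ltr_pdivrMr// mulrC ltr_pM2l//; lra.
have cz : q z h @[h --> 0^'] --> a * 'D_v g x + 'D_w g x.
  have -> : q z = (fun h => (q z h - q w h) + q w h) by apply/funext => h; rewrite subrK.
  by apply: cvgD.
exact: (cvg_unique (@norm_hausdorff _ _) (cq z) cz).
Unshelve. all: by end_near. Qed.

(** Schwarz's theorem: the second difference over the parallelogram spanned by h v and h w is
    symmetric in v and w, and two mean value steps show that it equals h^2 times either mixed
    derivative up to o(h^2). *)
Lemma derive_comm g x v w : smooth g -> 'D_v ('D_w g) x = 'D_w ('D_v g) x.
Proof.
move=> sg; apply/eqP; rewrite -subr_eq0 -normr_le0; apply/ler_addgt0Pr => e e0; rewrite add0r.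
have e2 : 0 < e / 2 by rewrite divr_gt0.
have approx v' w' : exists2 d : R, 0 < d & forall h, 0 < h -> h < d ->
    `|(g (x + h *: v' + h *: w') - g (x + h *: v') - (g (x + h *: w') - g x)) - h * (h * 'D_w' ('D_v' g) x)| <= h * (h * (e / 2)).
  have sd := smooth_derive v' sg.
  have /cvgrPdist_lt/(_ _ e2)/nbhs_ballP[d1 /= d10 hd1] := @smooth_continuous _ (smooth_derive w' sd) x.
  have [d2 d20 hd2] := close_line v' w' d10.
  exists d2 => // h h0 hd; have hn : `|h| = h by rewrite gtr0_norm.
  have ah : - h <= h <= h by rewrite lexx andbT; lra.
  have a0 : - h <= 0 <= h by apply/andP; split; lra.
  have dF (t : R) : - h <= t <= h -> is_derive (t : R) 1 (fun t : R => g (x + h *: w' + t *: v') - g (x + t *: v'))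
      ('D_v' g (x + h *: w' + t *: v') - 'D_v' g (x + t *: v')).
    by move=> _; have i1 := is_derive_line (x + h *: w') v' t sg; have i2 := is_derive_line x v' t sg; exact: is_deriveB.
  have [c [_ ch ec]] := mvt_seg dF a0 ah.
  rewrite !subr0 hn in ch; rewrite !scale0r !addr0 subr0 in ec.
  have [th hth eth] := mvt_line (x + c *: v') w' h sd.
  have -> : g (x + h *: v' + h *: w') - g (x + h *: v') - (g (x + h *: w') - g x) = h * (h * 'D_w' ('D_v' g) (x + c *: v' + th *: w')).
    rewrite -eth mulrC; move: ec; rewrite (addrAC x (h *: w')) (addrAC x (h *: w')) => <-.
    by [].
  rewrite -!mulrBr !normrM hn !ler_pM2l// distrC; apply: ltW; apply: hd1.
  rewrite -ball_normE /= -addrA opprD addNKr normrN; apply: (hd2 h) => //; by rewrite hn.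
have [d1 d10 h1] := approx v w; have [d2 d20 h2] := approx w v.
pose h := Num.min d1 d2 / 2; have m0 : 0 < Num.min d1 d2 by rewrite lt_min d10.
have hp : 0 < h by rewrite divr_gt0.
have hm : h < Num.min d1 d2 by rewrite /h; lra.
move: (hm); rewrite lt_min => /andP[k1 k2].
have := h1 h hp k1; have := h2 h hp k2.
have -> : g (x + h *: w + h *: v) - g (x + h *: w) - (g (x + h *: v) - g x) =
  g (x + h *: v + h *: w) - g (x + h *: v) - (g (x + h *: w) - g x).
  by rewrite (addrAC x (h *: w)); ring.
move: (g _ - _ - _) => y A B.
rewrite -(ler_pM2l hp) -(ler_pM2l hp).
move: ('D_v ('D_w g) x) ('D_w ('D_v g) x) A B => p q A B; clearbody h.
have e3 : (y - h * (h * q)) - (y - h * (h * p)) = h * (h * (p - q)) by ring.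
have -> : h * (h * `|p - q|) = `|(y - h * (h * q)) - (y - h * (h * p))|.
  by rewrite e3 !normrM (gtr0_norm hp).
apply: (le_trans (ler_normB _ _)); apply: (le_trans (lerD B A)); lra.
Qed.

Lemma taylor_line g x v (B : R) : smooth g -> (forall y, `|'D_v ('D_v ('D_v g)) y| <= B) ->
  `|g (x + v) - g x - 'D_v g x - 2^-1 * 'D_v ('D_v g) x| <= B.
Proof.
move=> sg gB; have s1 := smooth_derive v sg; have s2 := smooth_derive v s1.
have := @taylor3 R (fun t => g (x + t *: v)) (fun t => 'D_v g (x + t *: v))
  (fun t => 'D_v ('D_v g) (x + t *: v)) (fun t => 'D_v ('D_v ('D_v g)) (x + t *: v)) 0 1 B 0 1
  (fun z _ => is_derive_line x v z sg) (fun z _ => is_derive_line x v z s1) (fun z _ => is_derive_line x v z s2)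
  (fun z _ => gB _).
rewrite !scale0r !addr0 scale1r subr0 normr1 !expr1n !mulr1; apply; by rewrite lexx ler01.
Qed.

Lemma derive_vanish g v (K : R) : (forall y, K < `|y| -> g y = 0) -> forall y, K < `|y| -> 'D_v g y = 0.
Proof.
move=> g0 y Ky; rewrite (@near_eq_derive _ _ _ g (fun=> 0)); first exact: derive_cst.
have d0 : 0 < `|y| - K by rewrite subr_gt0.
apply/nbhs_ballP; exists (`|y| - K) => //= z hz; apply: g0.
have h : `|y - z| < `|y| - K by move: hz; rewrite -ball_normE.
have := ler_dist_dist y z; rewrite ler_norml => /andP[_ h']; lra.
Qed.

End SmoothCalculus.

(** * Directional derivatives in real coordinates *)

Section RealCoordinateCalculus.
Variables (R : realType) (a b : nat).
Local Notation C := R[i].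
Local Notation M := 'M[C]_(a, b).
Local Notation V := ('M[R]_(a, b) * 'M[R]_(a, b))%type.
Local Notation idx := (bool * 'I_a * 'I_b)%type.

Lemma to_of_xy (z : V) : to_xy (of_xy z) = z.
Proof. by case: z => x y; congr pair; apply/matrixP => k j; rewrite !mxE. Qed.

Lemma of_to_xy (w : M) : of_xy (to_xy w) = w.
Proof. by apply/matrixP => k j; rewrite !mxE /=; case: (w k j). Qed.

Lemma to_xyD (v w : M) : to_xy (v + w) = to_xy v + to_xy w.
Proof. by congr pair; apply/matrixP => k j; rewrite !mxE; case: (v k j); case: (w k j). Qed.

Lemma to_xyZ c (v : M) : to_xy (c%:C%C *: v) = c *: to_xy v.
Proof. by congr pair; apply/matrixP => k j; rewrite !mxE; case: (v k j) => p q /=; ring. Qed.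

Definition vb (i : idx) : V := to_xy (ebase R i).

Lemma to_xy_expand (w : M) : to_xy w = \sum_i co w i *: vb i.
Proof.
rewrite {1}(co_expand w); elim: (index_enum _) => [|i s IH].
  by rewrite !big_nil; congr pair; apply/matrixP => k j; rewrite !mxE.
by rewrite !big_cons to_xyD to_xyZ IH.
Qed.

Lemma derive_expand (g : V -> R) x (w : M) : smooth g -> 'D_(to_xy w) g x = \sum_i co w i * 'D_(vb i) g x.
Proof.
move=> sg; rewrite to_xy_expand; elim: (index_enum _) => [|i s IH].
  by rewrite !big_nil; have := deriveDZ x 0 0 (-1) sg; rewrite scaler0 addr0 mulN1r addNr.
by rewrite !big_cons deriveDZ// IH.
Qed.

Lemma derive_expand2 (g : V -> R) x v (w : M) : smooth g ->
  'D_v ('D_(to_xy w) g) x = \sum_i co w i * 'D_v ('D_(vb i) g) x.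
Proof.
move=> sg; have -> : 'D_(to_xy w) g = (fun y => \sum_i co w i * 'D_(vb i) g y).
  by apply/funext => y; exact: derive_expand.
have d i : derivable ('D_(vb i) g) x v by apply: smooth_derivable; exact: smooth_derive.
suff h (s : seq idx) : is_derive x v (fun y => \sum_(i <- s) co w i * 'D_(vb i) g y)
    (\sum_(i <- s) co w i * 'D_v ('D_(vb i) g) x).
  by have [_ ->] := h (index_enum idx).
elim: s => [|i s IH].
  rewrite big_nil (_ : (fun _ => _) = fun=> 0); first exact: is_derive_cst.
  by apply/funext => y; rewrite big_nil.
rewrite big_cons (_ : (fun _ => _) = (fun y => co w i * 'D_(vb i) g y + \sum_(j <- s) co w j * 'D_(vb j) g y)).
  apply: is_deriveD; have := @is_deriveZ _ _ _ ('D_(vb i) g) (co w i) x v ('D_v ('D_(vb i) g) x).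
  by apply; split.
by apply/funext => y; rewrite big_cons.
Qed.

(** A box in row vectors is compact and is mapped continuously onto a set of coordinate pairs
    containing the support. *)
Lemma compact_support_bounded (g : V -> R) (K : R) : continuous g -> (forall y, K < `|y| -> g y = 0) ->
  exists2 B : R, 0 <= B & forall y, `|g y| <= B.
Proof.
move=> cg g0; pose N := #|{: idx}|.
pose f (z : 'rV[R]_N) : V := \sum_(i < N) z ord0 i *: vb (enum_val i).
have cf : continuous f.
  move=> z; apply: cvg_big; [exact: add_continuous|exact: nbhs_filter|].
  move=> i _; have ci : continuous (fun z : 'rV[R]_N => z ord0 i) by exact: coord_continuous.
  exact: (cvg_comp _ _ (ci z) (@scalel_continuous _ _ (vb (enum_val i)) _)).
pose A := [set z : 'rV[R]_N | forall i, z ord0 i \in `[- K, K]].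
have cA : compact A.
  have := @rV_compact R N (fun=> `[- K, K]%classic) (fun=> @segment_compact R (- K) K).
  by congr compact.
have cgf : {within A, continuous (g \o f)}.
  apply: continuous_subspaceT => z; apply: continuous_comp; [exact: cf|exact: cg].
have [B [Br hB]] := compact_bounded (continuous_compact cgf cA).
exists (`|B| + 1); first by rewrite addr_ge0.
move=> y; have [Ky|yK] := ltP K `|y|; first by rewrite g0// normr0 addr_ge0.
have B1 : B < `|B| + 1 by rewrite (le_lt_trans (ler_norm _))// ltrDl.
apply: (hB _ B1); exists (\row_i co (of_xy y) (enum_val i)).
  move=> i; rewrite mxE in_itv/= -ler_norml; apply: (le_trans (co_xy_norm _ _)).
  by rewrite to_of_xy.
rewrite /= /f -[in RHS](to_of_xy y) to_xy_expand; congr g.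
rewrite [RHS](reindex_onto enum_val (enum_rank : idx -> 'I_N))/=; last by move=> i _; exact: enum_rankK.
by apply: eq_big => [i|i _]; rewrite ?enum_valK ?eqxx// mxE.
Qed.

End RealCoordinateCalculus.

Section ContinuousMeasurability.
Variables (R : realType) (a b : nat).
Local Notation M := 'M[R[i]]_(a, b).
Local Notation V := ('M[R]_(a, b) * 'M[R]_(a, b))%type.
Local Notation idx := (bool * 'I_a * 'I_b)%type.

(* A continuous function is the limit of its values at the points of ever finer grids, and such a
   discretisation has countably many values. *)
Lemma continuous_mwr (g : V -> R) : continuous g -> measurable_wrt (@borel_mx R a b) (fun w => g (to_xy w)).
Proof.
move=> cg; have sB := @borel_sigma R a b.
pose p N (w : M) : {ffun idx -> int} := [ffun i => Num.floor (co w i * N.+1%:R)].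
pose at_ N (q : {ffun idx -> int}) : V := \sum_i ((q i)%:~R / N.+1%:R) *: vb R i.
have N0 (N : nat) : 0 < N.+1%:R :> R by [].
apply/(mwrP sB); apply: (@measurable_fun_cvg _ (g_sigma_algebraType (@borel_mx R a b)) R setT
    (fun N w => g (at_ N (p N w)))).
  move=> N; apply/(mwrP sB) => B mB.
  have -> : (fun w => g (at_ N (p N w))) @^-1` B =
      \bigcup_q (if asbool (B (g (at_ N q))) then \bigcap_i [set w : M | p N w i = q i] else set0).
    apply/seteqP; split => w /=.
      by move=> Bw; exists (p N w) => //; rewrite asboolT.
    move=> [q _]; case: asboolP => // Bq hw; have -> // : p N w = q.
    by apply/ffunP => i; exact: hw.
  have := @countable_bigcupT_measurable _ (g_sigma_algebraType (@borel_mx R a b)) {ffun idx -> int}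
    (fun q => if asbool (B (g (at_ N q))) then \bigcap_i [set w : M | p N w i = q i] else set0) (countableP _).
  rewrite {2}/measurable/= sigma_algebra_id//; apply=> q; case: asboolP => _; last exact: measurable0.
  apply: fin_bigcap_measurable; first exact: finite_finset.
  move=> i _; rewrite /measurable/= sigma_algebra_id//.
  have -> : [set w : M | p N w i = q i] =
      (fun w => co w i * N.+1%:R) @^-1` `[(q i)%:~R, (q i + 1)%:~R[.
    apply/seteqP; split => w /=; rewrite ffunE in_itv/= -floor_eq.
      by move=> ->; exact: eqxx.
    by move/eqP.
  have mi : measurable_wrt (@borel_mx R a b) (fun w : M => co w i * N.+1%:R).
    by apply: (mwrM sB); [exact: borel_co|exact: mwr_cst].
  exact: mi.
move=> w _; apply: (cvg_comp (fun N => at_ N (p N w)) g _ (cg _)).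
rewrite to_xy_expand /at_; apply: cvg_big; first exact: add_continuous.
move=> i _; apply: (cvg_comp (fun N => (p N w i)%:~R / N.+1%:R) (fun k => k *: vb R i) _ (@scalel_continuous _ _ (vb R i) _)).
have cl : co w i - N.+1%:R^-1 @[N --> \oo] --> co w i.
  by rewrite -[X in _ --> X]subr0; apply: cvgB; [exact: cvg_cst|exact: cvg_harmonic].
apply: (squeeze_cvgr _ cl (cvg_cst _)).
near=> N; rewrite ffunE; have /andP[h1 h2] := floor_itv (co w i * N.+1%:R).
rewrite ler_pdivrMr// h1 andbT ler_pdivlMr// mulrBl mulVf// lerBlDr.
by rewrite -[X in _ + X]/(1%:~R) -intrD ltW.
Unshelve. all: by end_near. Qed.

End ContinuousMeasurability.

(** * Uniform second-order Taylor expansion *)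

Section SecondOrder.
Variables (R : realType) (a b : nat).
Local Notation M := 'M[R[i]]_(a, b).
Local Notation V := ('M[R]_(a, b) * 'M[R]_(a, b))%type.
Local Notation idx := (bool * 'I_a * 'I_b)%type.
Variable g : V -> R.

Definition pd (i : idx) (w : M) : R := 'D_(vb R i) g (to_xy w).
Definition pd2 (i j : idx) (w : M) : R := 'D_(vb R i) ('D_(vb R j) g) (to_xy w).
Definition lform (w eta : M) : R := \sum_i co eta i * pd i w.
Definition qform (w eta eta' : M) : R := \sum_i \sum_j co eta i * co eta' j * pd2 i j w.

Lemma lformD w c eta eta' : lform w (c%:C%C *: eta + eta') = c * lform w eta + lform w eta'.
Proof.
by rewrite /lform mulr_sumr -big_split/=; apply: eq_bigr => i _; rewrite coD coZ; ring.
Qed.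

Lemma qformDl w c eta eta' z : qform w (c%:C%C *: eta + eta') z = c * qform w eta z + qform w eta' z.
Proof.
rewrite /qform mulr_sumr -big_split/=; apply: eq_bigr => i _.
by rewrite mulr_sumr -big_split/=; apply: eq_bigr => j _; rewrite coD coZ; ring.
Qed.

Lemma qformDr w c eta eta' z : qform w z (c%:C%C *: eta + eta') = c * qform w z eta + qform w z eta'.
Proof.
rewrite /qform mulr_sumr -big_split/=; apply: eq_bigr => i _.
by rewrite mulr_sumr -big_split/=; apply: eq_bigr => j _; rewrite coD coZ; ring.
Qed.

Lemma co_sum_bound (f : idx -> R) B (eta : M) : (forall i, `|f i| <= B) ->
  `|\sum_i co eta i * f i| <= B * N1 eta.
Proof.
move=> fB; apply: (le_trans (ler_norm_sum _ _ _)); rewrite mulr_sumr; apply: ler_sum => i _.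
by rewrite normrM mulrC ler_wpM2r.
Qed.

Lemma lform_bound w B eta : (forall i, `|pd i w| <= B) -> `|lform w eta| <= B * N1 eta.
Proof. exact: co_sum_bound. Qed.

Lemma qform_bound w B eta eta' : (forall i j, `|pd2 i j w| <= B) ->
  `|qform w eta eta'| <= B * (N1 eta * N1 eta').
Proof.
move=> fB; have -> : qform w eta eta' = \sum_i co eta i * (\sum_j co eta' j * pd2 i j w).
  by apply: eq_bigr => i _; rewrite mulr_sumr; apply: eq_bigr => j _; rewrite mulrA.
rewrite mulrC -mulrA mulrC; apply: co_sum_bound => i.
by rewrite mulrC; exact: co_sum_bound.
Qed.

Variable K0 : R.
Hypotheses (sg : smooth g) (g0 : forall y, K0 < `|y| -> g y = 0).

Lemma pd_vanish i w : K0 < `|to_xy w| -> pd i w = 0.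
Proof. by move=> h; exact: (derive_vanish _ g0 h). Qed.

Lemma pd2_vanish i j w : K0 < `|to_xy w| -> pd2 i j w = 0.
Proof. by move=> h; exact: (derive_vanish _ (derive_vanish _ g0) h). Qed.

(** Derivatives up to order three in coordinate directions are continuous and vanish outside a ball,
    hence bounded; a third derivative along eta is then expanded in coordinates three times, giving
    the cube of [N1]. *)
Lemma taylor_bounds : exists2 B : R, 0 <= B & [/\ forall w : M, `|g (to_xy w)| <= B,
  forall i w, `|pd i w| <= B, forall i j w, `|pd2 i j w| <= B &
  forall w eta : M, `|g (to_xy (w + eta)) - g (to_xy w) - lform w eta - 2^-1 * qform w eta eta| <= B * N1 eta ^+ 3].
Proof.
have s1 i : smooth ('D_(vb R i) g) by exact: smooth_derive.
have s2 i j : smooth ('D_(vb R i) ('D_(vb R j) g)) by exact: smooth_derive.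
have s3 i j k : smooth ('D_(vb R i) ('D_(vb R j) ('D_(vb R k) g))) by exact: smooth_derive.
have v1 i := derive_vanish (vb R i) g0.
have v2 i j := derive_vanish (vb R i) (v1 j).
have v3 i j k := derive_vanish (vb R i) (v2 j k).
have [B0 B00 h0] := compact_support_bounded (smooth_continuous sg) g0.
have /choice[B1 h1] : forall i, exists B : R, forall y, `|'D_(vb R i) g y| <= B.
  by move=> i; have [B _ h] := compact_support_bounded (smooth_continuous (s1 i)) (v1 i); exists B.
have /choice[B2 h2] : forall q : idx * idx, exists B : R, forall y, `|'D_(vb R q.1) ('D_(vb R q.2) g) y| <= B.
  by move=> q; have [B _ h] := compact_support_bounded (smooth_continuous (s2 q.1 q.2)) (v2 q.1 q.2); exists B.
have /choice[B3 h3] : forall q : idx * idx * idx, exists B : R,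
    forall y, `|'D_(vb R q.1.1) ('D_(vb R q.1.2) ('D_(vb R q.2) g)) y| <= B.
  by move=> [[i j] k]; have [B _ h] := compact_support_bounded (smooth_continuous (s3 i j k)) (v3 i j k); exists B.
pose B := B0 + \sum_i B1 i + \sum_q B2 q + \sum_q B3 q.
have p1 i : 0 <= B1 i by exact: le_trans (h1 i 0).
have p2 q : 0 <= B2 q by exact: le_trans (h2 q 0).
have p3 q : 0 <= B3 q by exact: le_trans (h3 q 0).
have S1 : 0 <= \sum_i B1 i by exact: sumr_ge0.
have S2 : 0 <= \sum_q B2 q by exact: sumr_ge0.
have S3 : 0 <= \sum_q B3 q by exact: sumr_ge0.
have le1 (I : finType) (f : I -> R) i : (forall i, 0 <= f i) -> f i <= \sum_i f i.
  by move=> f0; rewrite (bigD1 i)//= lerDl sumr_ge0.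
have b3 i j k y : `|'D_(vb R i) ('D_(vb R j) ('D_(vb R k) g)) y| <= B.
  by apply: (le_trans (h3 (i, j, k) y)); have := le1 _ B3 (i, j, k) p3; rewrite /B; lra.
exists B; first by rewrite /B; lra.
split.
- by move=> w; apply: (le_trans (h0 _)); rewrite /B; lra.
- by move=> i w; apply: (le_trans (h1 i _)); have := le1 _ B1 i p1; rewrite /B; lra.
- by move=> i j w; apply: (le_trans (h2 (i, j) _)); have := le1 _ B2 (i, j) p2; rewrite /B; lra.
move=> w eta; set v := to_xy eta.
have e1 : lform w eta = 'D_v g (to_xy w) by rewrite /lform derive_expand.
have e2 : qform w eta eta = 'D_v ('D_v g) (to_xy w).
  rewrite derive_expand; last exact: smooth_derive.
  apply: eq_bigr => i _; rewrite derive_expand2// mulr_sumr; apply: eq_bigr => j _.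
  by rewrite mulrA.
rewrite to_xyD e1 e2; apply: taylor_line => // y.
rewrite derive_expand; last by apply: smooth_derive; exact: smooth_derive.
have -> : B * N1 eta ^+ 3 = (B * N1 eta ^+ 2) * N1 eta by rewrite -mulrA -exprSr.
apply: co_sum_bound => i; rewrite derive_expand2; last exact: smooth_derive.
rewrite expr2 mulrA; apply: co_sum_bound => j.
(* Commuting the derivatives exposes the remaining direction v to [derive_expand2]. *)
have -> : 'D_(vb R j) ('D_v g) = 'D_v ('D_(vb R j) g) by apply/funext => z; exact: derive_comm.
by rewrite derive_expand2//; apply: co_sum_bound => k; exact: b3.
Qed.

End SecondOrder.

(** * The chart and its generator *)

Section ChartJet.
Variables (R : realType) (m : nat).
Local Notation C := R[i].
Local Notation n := m.+1.
Local Notation M := 'M[C]_n.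
Local Notation state := 'M[C]_(m, n).
Local Notation V := ('M[R]_(m, n) * 'M[R]_(m, n))%type.
Local Notation idx := (bool * 'I_m * 'I_n)%type.
Local Notation wd := (widen_ord (leqnSn m)).

(* First and second order parts of the expansion of the chart; the second one is not symmetrised. *)
Definition chart1 (u v : M) : state :=
  \matrix_(k, j) ((v (wd k) j - flag_chart u k j * v ord_max j) / u ord_max j).
Definition chart2 (u v v' : M) : state :=
  \matrix_(k, j) (- (chart1 u v k j * v' ord_max j / u ord_max j)).
Definition chart_rem (u u' : M) : state :=
  \matrix_(k, j) (chart1 u (u' - u) k j * ((u' - u) ord_max j * (u' - u) ord_max j *
    ((u ord_max j)^-1 * (u' ord_max j)^-1))).

Implicit Types u v : M.

(** An exact identity: the increment of the chart is (v_k - w v_n) / u'_n with v = u' - u, and 1 /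
    u'_n is expanded as a geometric series with its exact remainder. *)
Lemma chart_expand u u' : (forall j, u ord_max j != 0) -> (forall j, u' ord_max j != 0) ->
  flag_chart u' = flag_chart u + (chart1 u (u' - u) + chart2 u (u' - u) (u' - u) + chart_rem u u').
Proof.
move=> u0 u0'; apply/matrixP => k j; rewrite !mxE.
have := u0 j; have := u0' j; move: (u ord_max j) (u' ord_max j) (u (wd k) j) (u' (wd k) j) => x y z t y0 x0.
by field; rewrite x0 y0.
Qed.

Lemma chart1D u c v v' : chart1 u (c%:C%C *: v + v') = c%:C%C *: chart1 u v + chart1 u v'.
Proof. by apply/matrixP => k j; rewrite !mxE; ring. Qed.

Lemma chart2Dl u c v v' z : chart2 u (c%:C%C *: v + v') z = c%:C%C *: chart2 u v z + chart2 u v' z.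
Proof. by apply/matrixP => k j; rewrite !mxE; ring. Qed.

Lemma chart2Dr u c v v' z : chart2 u z (c%:C%C *: v + v') = c%:C%C *: chart2 u z v + chart2 u z v'.
Proof. by apply/matrixP => k j; rewrite !mxE; ring. Qed.

(** The chart is homogeneous of degree 0 in each column, so the Ito drift, a multiple of u, is
    vertical and disappears. *)
Lemma chart1_self u : (forall j, u ord_max j != 0) -> chart1 u u = 0.
Proof. by move=> u0; apply/matrixP => k j; rewrite !mxE divfK// subrr mul0r. Qed.

(** Both inner noise sums equal -2 u_kj u_nj once multiplied by their coefficients and cancel, so
    the chart contributes no first-order term to the generator. *)
Lemma chart2_noise u : (forall j, u ord_max j != 0) -> \sum_b chart2 u (u *m Xb R b) (u *m Xb R b) = 0.
Proof.
move=> u0; apply/matrixP => k j; rewrite summxE mxE.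
pose y b := u *m Xb R b.
transitivity (- ((u ord_max j)^-1 ^+ 2) * ((\sum_b y b (wd k) j * y b ord_max j) -
    flag_chart u k j * (\sum_b y b ord_max j * y b ord_max j))).
  rewrite mulr_sumr -sumrB mulr_sumr; apply: eq_bigr => b _; rewrite /chart2 /chart1 mxE mxE /y; ring.
rewrite !noise_mul mxE.
by field.
Qed.

Lemma chart1_noise u k j h l : (forall j, u ord_max j != 0) ->
  \sum_b chart1 u (u *m Xb R b) k j * chart1 u (u *m Xb R b) h l =
  - 2 * ((flag_chart u k l - flag_chart u k j) * (flag_chart u h j - flag_chart u h l)).
Proof.
move=> u0; pose y b := u *m Xb R b.
transitivity ((u ord_max j)^-1 * (u ord_max l)^-1 * (
   (\sum_b y b (wd k) j * y b (wd h) l) - flag_chart u h l * (\sum_b y b (wd k) j * y b ord_max l)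
   - flag_chart u k j * (\sum_b y b ord_max j * y b (wd h) l)
   + flag_chart u k j * flag_chart u h l * (\sum_b y b ord_max j * y b ord_max l))).
  rewrite !mulr_sumr -!sumrB -big_split/= mulr_sumr; apply: eq_bigr => b _.
  by rewrite /chart1 !(mxE _ (fun k j => _ / _)) /y; ring.
rewrite !noise_mul !mxE; have := u0 j; have := u0 l; move=> l0 j0.
by field; rewrite l0 j0.
Qed.

(** The cross terms vanish because the last row differs from the others. The final factor is 1 +
    r_j^2 by [last_row_radius]. *)
Lemma chart1_noise_conj u k j h l : flag_domain u ->
  \sum_b chart1 u (u *m Xb R b) k j * (chart1 u (u *m Xb R b) h l)^* =
  2 * (j == l)%:R * ((k == h)%:R + flag_chart u k j * (flag_chart u h j)^*) * ((sqmod (u ord_max j))^-1)%:C%C.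
Proof.
move=> [hu u0]; pose y b := u *m Xb R b.
transitivity ((u ord_max j)^-1 * ((u ord_max l)^-1)^* * (
   (\sum_b y b (wd k) j * (y b (wd h) l)^*) - (flag_chart u h l)^* * (\sum_b y b (wd k) j * (y b ord_max l)^*)
   - flag_chart u k j * (\sum_b y b ord_max j * (y b (wd h) l)^*)
   + flag_chart u k j * (flag_chart u h l)^* * (\sum_b y b ord_max j * (y b ord_max l)^*))).
  rewrite !mulr_sumr -!sumrB -big_split/= mulr_sumr; apply: eq_bigr => b _.
  by rewrite /chart1 !(mxE _ (fun k j => _ / _)) /y !rmorphM/= !rmorphB/= rmorphM/=; ring.
rewrite !noise_mul_conj// eqxx andbT.
have -> : (wd k == ord_max) = false by apply/negbTE; rewrite neq_ltn /= ltn_ord.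
have -> : (ord_max == wd h) = false by apply/negbTE; rewrite neq_ltn /= ltn_ord orbT.
have -> : (wd k == wd h) = (k == h) by [].
rewrite !andbF !mulr0 !subr0; case: eqP => [<-|_]; last by rewrite /= !(mulr0, mul0r, addr0).
have -> : ((sqmod (u ord_max j))^-1)%:C%C = (u ord_max j)^-1 * ((u ord_max j)^-1)^*.
  by rewrite fmorphV/= sqmodE invfM (fmorphV Num.conj).
by rewrite /=; ring.
Qed.

End ChartJet.

(** If all real coordinates of the chart are at most K0, then r_j^2 <= 2 m K0^2 and |u_nj|^2 is at
    least four times this number. *)
Definition cutoff (R : realType) (m : nat) (K0 : R) : R := (4 * (1 + m%:R * (2 * K0 ^+ 2)))^-1.

(** * Pull-back of a compactly supported function *)

Section Pullback.
Variables (R : realType) (m : nat).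
Local Notation C := R[i].
Local Notation n := m.+1.
Local Notation M := 'M[C]_n.
Local Notation state := 'M[C]_(m, n).
Local Notation V := ('M[R]_(m, n) * 'M[R]_(m, n))%type.
Local Notation idx := (bool * 'I_m * 'I_n)%type.
Local Notation wd := (widen_ord (leqnSn m)).
Variables (g : V -> R) (K0 : R).
Hypotheses (sg : smooth g) (g0 : forall y, K0 < `|y| -> g y = 0).
Implicit Types u v : M.

Local Notation a0 := (cutoff m K0).

Let c0 : 1 <= 1 + m%:R * (2 * K0 ^+ 2). Proof. by rewrite lerDl mulr_ge0// mulr_ge0// sqr_ge0. Qed.
Let a0_gt0 : 0 < a0. Proof. by rewrite invr_gt0 mulr_gt0// (lt_le_trans ltr01). Qed.
Let a0_le1 : a0 <= 1. Proof. rewrite invf_le1 ?mulr_gt0 ?(lt_le_trans ltr01 c0)//; apply: (le_trans c0); apply: ler_peMl; [exact: (le_trans ler01 c0)|by rewrite ler1n]. Qed.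

Let lt4 x : x < a0 -> x < 4 * a0.
Proof. by move=> h; apply: (lt_le_trans h); apply: ler_peMl; [exact: ltW|rewrite ler1n]. Qed.

(* Off this set the pulled back function vanishes; the threshold is a quarter of what the support
   condition allows, so that it also vanishes on a neighbourhood of the complement. *)
Definition good u : bool := [forall j, a0 <= sqmod (u ord_max j)].

Let good_neq0 u : good u -> forall j, u ord_max j != 0.
Proof. by move=> /forallP gu j; rewrite -sqmod_eq0 gt_eqF// (lt_le_trans a0_gt0). Qed.

Let good_domain u : good u -> u \is unitarymx -> flag_domain u.
Proof. by move=> gu hu; split => //; exact: good_neq0. Qed.

Lemma chart_far u j : flag_domain u -> sqmod (u ord_max j) < 4 * a0 -> K0 < `|to_xy (flag_chart u)|.
Proof.
move=> hu; apply: contraTT; rewrite -!leNgt => hK.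
have s0 : 0 < sqmod (u ord_max j) by rewrite lt_neqAle sqmod_ge0 eq_sym sqmod_eq0 hu.2.
have -> : 4 * a0 = (1 + m%:R * (2 * K0 ^+ 2))^-1 by rewrite /cutoff invfM mulVKf.
rewrite -[sqmod _]invrK lef_pV2 ?posrE ?invr_gt0//; last exact: lt_le_trans c0.
rewrite -last_row_radius// lerD2l -[m in m%:R]card_ord -sum1_card natr_sum mulr_suml.
apply: ler_sum => k _; rewrite mul1r mulr_natl mulr2n /sqmod big_bool.
have b e : pt e (flag_chart u k j) ^+ 2 <= K0 ^+ 2.
  have h := le_trans (co_xy_norm (flag_chart u) (e, k, j)) hK.
  by rewrite -(real_normK (num_real (pt _ _))) lerXn2r// nnegrE (le_trans _ h).
exact: (lerD (b true) (b false)).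
Qed.

Lemma sqmod_near (z z' : C) : sqmod z <= 2 * sqmod z' + 2 * nm (z - z') ^+ 2.
Proof.
have sqE w : sqmod w = pt true w ^+ 2 + pt false w ^+ 2 by rewrite /sqmod big_bool.
rewrite !sqE /nm !ptB.
move: (pt true z) (pt false z) (pt true z') (pt false z') => x y x' y'.
have p : 0 <= `|y - y'| * `|x - x'| by rewrite mulr_ge0.
have q (w : R) : `|w| ^+ 2 = w ^+ 2 by rewrite real_normK ?num_real.
rewrite sqrrD !q; have := sqr_ge0 (x - 2 * x'); have := sqr_ge0 (y - 2 * y'); rewrite -mulr_natl; nra.
Qed.

Definition pull u : R := if good u then g (to_xy (flag_chart u)) else 0.
Definition pull1 u v : R := if good u then lform g (flag_chart u) (chart1 u v) else 0.
Definition pull2 u v v' : R := if good u then lform g (flag_chart u) (chart2 u v v') +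
  2^-1 * qform g (flag_chart u) (chart1 u v) (chart1 u v') else 0.

Lemma pull_chart u : flag_domain u -> pull u = g (to_xy (flag_chart u)).
Proof.
move=> hu; rewrite /pull; case: ifPn => // /forallPn[j]; rewrite -ltNge => hj.
by rewrite g0//; exact: (chart_far hu (lt4 hj)).
Qed.

(** The formula persists off [good]: there the left side is 0 by definition and the second
    derivatives of g vanish at the chart point. *)
Lemma gen_pull u : flag_domain u -> gen pull1 pull2 u =
  2^-1 * \sum_i \sum_j (\sum_b co (chart1 u (u *m Xb R b)) i * co (chart1 u (u *m Xb R b)) j) *
    pd2 g i j (flag_chart u).
Proof.
move=> hu; rewrite /gen /pull1 /pull2; case: ifPn => [gu|/forallPn[j]]; last first.
  rewrite -ltNge => hj; have far : K0 < `|to_xy (flag_chart u)|.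
    exact: (chart_far hu (lt4 hj)).
  rewrite mulr0 add0r big1// big1 ?mulr0// => i _; rewrite big1// => i' _.
  by rewrite (pd2_vanish g0)// mulr0.
have u0 := good_neq0 gu.
have lz : lform g (flag_chart u) 0 = 0.
  by rewrite /lform big1// => i _; rewrite co0 mul0r.
rewrite chart1_self// lz mulr0 add0r big_split/= -mulr_sumr.
have -> : \sum_b lform g (flag_chart u) (chart2 u (u *m Xb R b) (u *m Xb R b)) = 0.
  transitivity (lform g (flag_chart u) (\sum_b chart2 u (u *m Xb R b) (u *m Xb R b))); last by rewrite chart2_noise.
  by rewrite /lform exchange_big/=; apply: eq_bigr => i _; rewrite co_sum mulr_suml.
rewrite add0r; congr (_ * _); rewrite /qform exchange_big/=; apply: eq_bigr => i _.
by rewrite exchange_big/=; apply: eq_bigr => j _; rewrite mulr_suml.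
Qed.

Let N1_const (v : state) x : (forall k j, nm (v k j) <= x) -> N1 v <= (m * n)%:R * x.
Proof.
move=> h; rewrite N1_nm; apply: (@le_trans _ _ (\sum_(k < m) \sum_(j < n) x)).
  by apply: ler_sum => k _; apply: ler_sum.
by rewrite !sumr_const !card_ord -mulrnA mulnC -[X in X <= _]mulr_natl.
Qed.

Let nm_entry u k j : u \is unitarymx -> nm (u k j) <= 2.
Proof.
move=> hu; have a := unitary_co (false, k, j) hu; have b := unitary_co (true, k, j) hu.
by rewrite /nm -[2]/(1 + 1); apply: lerD.
Qed.

Let c : R := 2 / a0.
Let c_ge0 : 0 <= c. Proof. by rewrite divr_ge0// ltW. Qed.

Let nm_inv u j : good u -> u \is unitarymx -> nm (u ord_max j)^-1 <= c.
Proof.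
move=> gu hu; have uj := good_neq0 gu j; have /forallP/(_ j) gj := gu.
have -> : (u ord_max j)^-1 = ((sqmod (u ord_max j))^-1)%:C%C * (u ord_max j)^*.
  by rewrite fmorphV/= sqmodE invfM -mulrA mulVf ?mulr1// conjC_eq0.
have s0 : 0 < sqmod (u ord_max j) by exact: lt_le_trans gj.
rewrite nmZ ger0_norm ?invr_ge0 ?(ltW s0)// /c mulrC; apply: ler_pM.
- exact: nm_ge0.
- by rewrite invr_ge0 ltW.
- by rewrite /nm !ptJ normrN; exact: nm_entry.
- by rewrite lef_pV2 ?posrE.
Qed.

Let nm_chart u k j : good u -> u \is unitarymx -> nm (flag_chart u k j) <= 2 * c.
Proof.
move=> gu hu; rewrite mxE; apply: (le_trans (nmM _ _)); apply: ler_pM.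
- exact: nm_ge0.
- exact: nm_ge0.
- exact: nm_entry.
- exact: nm_inv.
Qed.

Let l1 : R := (1 + 2 * c) * c.
Let l1_ge0 : 0 <= l1. Proof. by rewrite mulr_ge0// addr_ge0// mulr_ge0. Qed.

Let nm_chart1 u v k j : good u -> u \is unitarymx -> nm (chart1 u v k j) <= l1 * N1 v.
Proof.
move=> gu hu; rewrite mxE; apply: (le_trans (nmM _ _)); rewrite mulrAC; apply: ler_pM.
- exact: nm_ge0.
- exact: nm_ge0.
- apply: (le_trans (nmD _ _)); rewrite nmN mulrDl mul1r; apply: lerD; first exact: nm_N1.
  apply: (le_trans (nmM _ _)); apply: ler_pM; rewrite ?nm_ge0//; [exact: nm_chart|exact: nm_N1].
- exact: nm_inv.
Qed.

Let L : R := (m * n)%:R * l1.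
Let L_ge0 : 0 <= L. Proof. exact: mulr_ge0. Qed.

Let N1_chart1 u v : good u -> u \is unitarymx -> N1 (chart1 u v) <= L * N1 v.
Proof.
move=> gu hu; have -> : L * N1 v = (m * n)%:R * (l1 * N1 v) by rewrite /L; ring.
by apply: N1_const => k j; exact: nm_chart1.
Qed.

Let N1_chart2 u v v' : good u -> u \is unitarymx -> N1 (chart2 u v v') <= L * c * (N1 v * N1 v').
Proof.
move=> gu hu; have -> : L * c * (N1 v * N1 v') = (m * n)%:R * ((l1 * N1 v * N1 v') * c) by rewrite /L; ring.
apply: N1_const => k j; rewrite mxE nmN.
apply: (le_trans (nmM _ _)); apply: ler_pM; rewrite ?nm_ge0//; last exact: nm_inv.
apply: (le_trans (nmM _ _)); apply: ler_pM; rewrite ?nm_ge0//; [exact: nm_chart1|exact: nm_N1].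
Qed.

Let N1_rem u u' : good u -> u \is unitarymx -> good u' -> u' \is unitarymx ->
  N1 (chart_rem u u') <= L * c ^+ 2 * N1 (u' - u) ^+ 3.
Proof.
move=> gu hu gu' hu'; set N := N1 (u' - u); have N0 : 0 <= N by exact: N1_ge0.
have -> : L * c ^+ 2 * N ^+ 3 = (m * n)%:R * ((l1 * N) * ((N * N) * (c * c))) by rewrite /L; ring.
apply: N1_const => k j; rewrite mxE.
apply: (le_trans (nmM _ _)); apply: ler_pM; rewrite ?nm_ge0//; first exact: nm_chart1.
apply: (le_trans (nmM _ _)); apply: ler_pM; rewrite ?nm_ge0//.
  by apply: (le_trans (nmM _ _)); apply: ler_pM; rewrite ?nm_ge0//; exact: nm_N1.
by apply: (le_trans (nmM _ _)); apply: ler_pM; rewrite ?nm_ge0//; exact: nm_inv.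
Qed.

Let lformA w x y : lform g w (x + y) = lform g w x + lform g w y.
Proof. by have := lformD g w 1 x y; rewrite mul1r (_ : 1%:C%C *: x = x) ?scale1r. Qed.

Let qformA w x y z : qform g w (x + y) z = qform g w x z + qform g w y z.
Proof. by have := qformDl g w 1 x y z; rewrite mul1r (_ : 1%:C%C *: x = x) ?scale1r. Qed.

Let qformB w x y z : qform g w z (x + y) = qform g w z x + qform g w z y.
Proof. by have := qformDr g w 1 x y z; rewrite mul1r (_ : 1%:C%C *: x = x) ?scale1r. Qed.

Let sB := @borel_sigma R n n.

Let good_meas : measurable_wrt (@borel_mx R n n) (fun u => (good u)%:R : R).
Proof.
have -> : (fun u => (good u)%:R : R) = (fun u => \1_[set u | good u] u).
  apply/funext => u; rewrite indicE; have -> // : (u \in [set u | good u]) = good u.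
  by apply/idP/idP => [/set_mem//|gu]; exact/mem_set.
apply: (mwr_indic sB).
have -> : [set u | good u] = \bigcap_(j in [set: 'I_n]) ((fun u : M => sqmod (u ord_max j)) @^-1` `[a0, +oo[).
  apply/seteqP; split => u /=.
    by move=> /forallP gu j _; rewrite /= in_itv/= andbT.
  by move=> gu; apply/forallP => j; have := gu j I; rewrite /= in_itv/= andbT.
have := @fin_bigcap_measurable _ (g_sigma_algebraType (@borel_mx R n n)) 'I_n setT
  (fun j => (fun u : M => sqmod (u ord_max j)) @^-1` `[a0, +oo[) finite_finset.
rewrite /measurable/= sigma_algebra_id//; apply=> j _.
have mj : measurable_wrt (@borel_mx R n n) (fun u : M => sqmod (u ord_max j)).
  apply: (mwr_sum sB) => e _.
  by apply: (@mwr_comp _ _ _ (fun x : R => x ^+ 2)); [exact: measurable_funX|exact: borel_mmw].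
exact: mj.
Qed.

Let chart_meas (f : V -> R) : continuous f -> measurable_wrt (@borel_mx R n n) (fun u => f (to_xy (flag_chart u))).
Proof.
move=> cf; apply: (mwr_mmw sB _ (continuous_mwr cf)).
by apply: (chart_mmw sB); exact: borel_mmw.
Qed.

Let pd_meas i : measurable_wrt (@borel_mx R n n) (fun u => pd g i (flag_chart u)).
Proof. exact: (chart_meas (smooth_continuous (smooth_derive (vb R i) sg))). Qed.

Let pd2_meas i j : measurable_wrt (@borel_mx R n n) (fun u => pd2 g i j (flag_chart u)).
Proof. exact: (chart_meas (smooth_continuous (smooth_derive (vb R i) (smooth_derive (vb R j) sg)))). Qed.

Let chart1_meas v : mmw (@borel_mx R n n) (fun u => chart1 u v).
Proof.
move=> k j; rewrite (_ : (fun u => _) = (fun u : M => (v (wd k) j + - (flag_chart u k j * v ord_max j)) * (u ord_max j)^-1)).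
  apply: (cmwM sB); last by apply: (cmwV sB); exact: borel_mmw.
  apply: (cmwD sB); first exact: (cmw_cst sB).
  apply: cmwN; apply: (cmwM sB); last exact: (cmw_cst sB).
  by apply: (chart_mmw sB); exact: borel_mmw.
by apply/funext => u; rewrite mxE.
Qed.

Let chart2_meas v v' : mmw (@borel_mx R n n) (fun u => chart2 u v v').
Proof.
move=> k j; rewrite (_ : (fun u => _) = (fun u : M => - (chart1 u v k j * v' ord_max j * (u ord_max j)^-1))).
  apply: cmwN; apply: (cmwM sB); last by apply: (cmwV sB); exact: borel_mmw.
  by apply: (cmwM sB); [exact: chart1_meas|exact: (cmw_cst sB)].
by apply/funext => u; rewrite mxE.
Qed.

Let if_good (x : R) u : (if good u then x else 0) = (good u)%:R * x.
Proof. by case: ifP; rewrite ?mul1r ?mul0r. Qed.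

(** Long steps are handled by crude bounds. For short steps, either both points are good and the
    expansions of the chart and of g are composed, or one is good and then already outside the
    support, or neither is. *)
Lemma pull_jet : exists2 K : R, 0 <= K & jet pull pull1 pull2 K.
Proof.
have [B B0 [h0 h1 h2 hT]] := taylor_bounds sg g0.
pose b : R := #|{: bool * 'I_n * 'I_n}|%:R + #|{: bool * 'I_n * 'I_n}|%:R.
have b0 : 0 <= b by exact: addr_ge0.
pose k2 : R := B * (L * c) + B * L ^+ 2.
have LL0 : 0 <= L ^+ 2 by exact: sqr_ge0.
have cc0 : 0 <= c ^+ 2 by exact: sqr_ge0.
have bb0 : 0 <= b ^+ 2 by exact: sqr_ge0.
have k20 : 0 <= k2 by apply: addr_ge0; apply: mulr_ge0 => //; exact: mulr_ge0.
pose L2 : R := L * c + L * c ^+ 2 * b.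
have L20 : 0 <= L2 by apply: addr_ge0; [exact: mulr_ge0|apply: mulr_ge0 => //; exact: mulr_ge0].
pose L1 : R := L + L2 * b.
have L10 : 0 <= L1 by apply: addr_ge0 => //; exact: mulr_ge0.
(* Bounds the whole remainder for arbitrary unitary u and u'; only long steps use it. *)
pose E : R := 2 * B + B * L * b + k2 * b ^+ 2.
have E0 : 0 <= E.
  apply: addr_ge0; last exact: mulr_ge0.
  by apply: addr_ge0; [exact: mulr_ge0|apply: mulr_ge0 => //; exact: mulr_ge0].
pose Q : R := B * (L1 ^+ 3 + L * c ^+ 2 + L2 * L1 + L * L2).
have Q0 : 0 <= Q.
  apply: mulr_ge0 => //; apply: addr_ge0; last exact: mulr_ge0.
  apply: addr_ge0; last exact: mulr_ge0.
  by apply: addr_ge0; [exact: exprn_ge0|exact: mulr_ge0].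
pose K : R := B + B * L + k2 + E / a0 ^+ 2 + Q.
have BL0 : 0 <= B * L by exact: mulr_ge0.
have Ea0 : 0 <= E / a0 ^+ 2 by rewrite divr_ge0// sqr_ge0.
have K_ge0 : 0 <= K by rewrite /K; lra.
have bd0 u : `|pull u| <= B by rewrite /pull; case: ifP => _ //; rewrite normr0.
have bd1 u v : u \is unitarymx -> `|pull1 u v| <= B * L * N1 v.
  move=> hu; rewrite /pull1; case: ifP => gu; last by rewrite normr0 mulr_ge0// N1_ge0.
  apply: (le_trans (lform_bound _ (fun i => h1 i _))); rewrite -mulrA; apply: ler_wpM2l => //.
  exact: N1_chart1.
have bd2 u v v' : u \is unitarymx -> `|pull2 u v v'| <= k2 * (N1 v * N1 v').
  move=> hu; rewrite /pull2; case: ifP => gu; last by rewrite normr0 mulr_ge0// mulr_ge0// N1_ge0.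
  rewrite /k2 mulrDl; apply: (le_trans (ler_normD _ _)); apply: lerD.
    apply: (le_trans (lform_bound _ (fun i => h1 i _))); rewrite -(mulrA B (L * c)); apply: ler_wpM2l => //.
    exact: N1_chart2.
  rewrite normrM; apply: (@le_trans _ _ (1 * `|qform g (flag_chart u) (chart1 u v) (chart1 u v')|)).
    by apply: ler_wpM2r => //; rewrite ger0_norm; lra.
  rewrite mul1r; apply: (le_trans (qform_bound _ _ (fun i j => h2 i j _))); rewrite -mulrA; apply: ler_wpM2l => //.
  have -> : L ^+ 2 * (N1 v * N1 v') = (L * N1 v) * (L * N1 v') by ring.
  by apply: ler_pM; rewrite ?N1_ge0//; exact: N1_chart1.
exists K; first exact: K_ge0.
split.
- move=> u t v w; rewrite /pull1; case: ifP => _; first by rewrite chart1D lformD.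
  by rewrite mulr0 addr0.
- move=> u t v w z; rewrite /pull2; case: ifP => _; last by rewrite mulr0 addr0.
  by rewrite chart1D chart2Dl lformD qformDl; ring.
- move=> u t v w z; rewrite /pull2; case: ifP => _; last by rewrite mulr0 addr0.
  by rewrite chart1D chart2Dr lformD qformDr; ring.
- rewrite /pull; under eq_fun do rewrite if_good.
  by apply: (mwrM sB) => //; apply: chart_meas; exact: smooth_continuous.
- move=> v; rewrite /pull1; under eq_fun do rewrite if_good.
  apply: (mwrM sB) => //; apply: (mwr_sum sB) => i _; apply: (mwrM sB) => //.
  exact: (mmw_co _ (chart1_meas v)).
- move=> v v'; rewrite /pull2; under eq_fun do rewrite if_good.
  apply: (mwrM sB) => //; apply: (mwrD sB).
    apply: (mwr_sum sB) => i _; apply: (mwrM sB) => //.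
    exact: (mmw_co _ (chart2_meas v v')).
  apply: (mwrM sB); first exact: mwr_cst.
  apply: (mwr_sum sB) => i _; apply: (mwr_sum sB) => j _; apply: (mwrM sB) => //.
  by apply: (mwrM sB); [exact: (mmw_co _ (chart1_meas v))|exact: (mmw_co _ (chart1_meas v'))].
- by move=> u _; apply: (le_trans (bd0 u)); rewrite /K; lra.
- move=> u v hu; apply: (le_trans (bd1 u v hu)); apply: ler_wpM2r; first exact: N1_ge0.
  by rewrite /K; lra.
- move=> u v v' hu; apply: (le_trans (bd2 u v v' hu)); apply: ler_wpM2r; first by rewrite mulr_ge0// N1_ge0.
  by rewrite /K; lra.
move=> u u' hu hu'; set N := N1 (u' - u).
have N0 : 0 <= N by exact: N1_ge0.
have Nb : N <= b by exact: (unitary_N1B hu hu').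
have far_case : a0 <= N ^+ 2 -> `|pull u' - pull u - pull1 u (u' - u) - pull2 u (u' - u) (u' - u)| <= K * N ^+ 3.
  (* Since a0 <= 1, a0 <= N^2 forces a0 <= N as well, so N^3 >= a0^2 absorbs the constant E. *)
  move=> aN; have aN1 : a0 <= N.
    rewrite leNgt; apply/negP => Na; have : N ^+ 2 < a0.
      rewrite expr2; apply: (@le_lt_trans _ _ (N * 1)); last by rewrite mulr1.
      by apply: ler_wpM2l => //; exact: (ltW (lt_le_trans Na a0_le1)).
    by rewrite ltNge aN.
  apply: (@le_trans _ _ E).
    apply: (le_trans (ler_normB _ _)); apply: lerD; last first.
      apply: (le_trans (bd2 u _ _ hu)); rewrite expr2; apply: ler_wpM2l => //.
      by apply: ler_pM.
    apply: (le_trans (ler_normB _ _)); apply: lerD; last first.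
      by apply: (le_trans (bd1 u _ hu)); apply: ler_wpM2l.
    apply: (le_trans (ler_normB _ _)); rewrite mulr_natl mulr2n; apply: lerD; exact: bd0.
  apply: (@le_trans _ _ (E / a0 ^+ 2 * N ^+ 3)).
    rewrite -[X in X <= _](divfK (x := a0 ^+ 2)); last by rewrite expf_neq0// gt_eqF.
    apply: ler_wpM2l => //; rewrite [_ ^+ 2]expr2 [N ^+ 3]exprSr.
    by apply: ler_pM => //; exact: ltW.
  by apply: ler_wpM2r; [exact: exprn_ge0|rewrite /K; lra].
have dN j : nm (u' ord_max j - u ord_max j) <= N.
  by have := nm_N1 (u' - u) ord_max j; rewrite !mxE.
have dN' j : nm (u ord_max j - u' ord_max j) <= N by rewrite -opprB nmN; exact: dN.
(* If v' has a last-row entry below the cutoff and N^2 is below it too, the corresponding entry of v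
   is below 2 + 2 = 4 times the cutoff by [sqmod_near]. This is where the quarter is spent. *)
have edge v v' : v \is unitarymx -> v' \is unitarymx -> (forall j, nm (v ord_max j - v' ord_max j) <= N) ->
    N ^+ 2 < a0 -> good v -> ~~ good v' -> K0 < `|to_xy (flag_chart v)|.
  move=> hv hv' vN Na gv /forallPn[j]; rewrite -ltNge => hj.
  apply: (@chart_far _ j); first exact: good_domain.
  have aux (A x y z : R) : y < A -> z < A -> x <= 2 * y + 2 * z -> x < 4 * A by lra.
  apply: (aux _ _ _ _ hj _ (sqmod_near (v ord_max j) (v' ord_max j))); apply: le_lt_trans Na.
  by apply: lerXn2r; rewrite ?nnegrE ?nm_ge0.
have [aN|Na] := leP a0 (N ^+ 2); first exact: far_case.
have NN0 : 0 <= K * N ^+ 3 by rewrite mulr_ge0// exprn_ge0.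
have [gu|gu] := boolP (good u); last first.
  have [gu'|gu'] := boolP (good u'); last first.
    by rewrite /pull /pull1 /pull2 (negbTE gu) (negbTE gu') !subr0 normr0.
  have far := edge _ _ hu' hu dN Na gu' gu.
  by rewrite /pull /pull1 /pull2 gu' (negbTE gu) g0// !subr0 normr0.
have [gu'|gu'] := boolP (good u'); last first.
  have far := edge _ _ hu hu' dN' Na gu gu'.
  rewrite /pull /pull1 /pull2 gu (negbTE gu') g0// /lform /qform.
  rewrite big1 ?big1 ?big1 ?mulr0 ?addr0 ?subr0 ?normr0// => i _.
  - by rewrite big1// => j _; rewrite (pd2_vanish g0)// mulr0.
  - by rewrite (pd_vanish g0)// mulr0.
  - by rewrite (pd_vanish g0)// mulr0.
rewrite /pull /pull1 /pull2 gu gu' (chart_expand (good_neq0 gu) (good_neq0 gu')).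
set w := flag_chart u; set lam := chart1 _ _; set kap := chart2 _ _ _; set rho := chart_rem _ _.
have n1 : N1 lam <= L * N by exact: (N1_chart1 _ gu hu).
have n2 : N1 kap <= L * c * N ^+ 2 by rewrite expr2; exact: (N1_chart2 _ _ gu hu).
have n3 : N1 rho <= L * c ^+ 2 * N ^+ 3 by exact: (N1_rem gu hu gu' hu').
have N2b : N ^+ 2 <= b * N by rewrite expr2; apply: ler_wpM2r.
have N3b : N ^+ 3 <= b * N ^+ 2 by rewrite exprS; apply: ler_wpM2r => //; exact: sqr_ge0.
pose eps := kap + rho.
have ne : N1 eps <= L2 * N ^+ 2.
  apply: (le_trans (N1D _ _)); apply: (le_trans (lerD n2 n3)); rewrite /L2 mulrDl lerD2l.
  have -> : L * c ^+ 2 * b * N ^+ 2 = L * c ^+ 2 * (b * N ^+ 2) by ring.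
  by apply: ler_wpM2l N3b; apply: mulr_ge0 => //; exact: sqr_ge0.
have etaE : lam + kap + rho = lam + eps by rewrite /eps addrA.
have nh : N1 (lam + eps) <= L1 * N.
  apply: (le_trans (N1D _ _)); apply: (le_trans (lerD n1 ne)).
  have -> : L1 * N = L * N + L2 * (b * N) by rewrite /L1; ring.
  by apply: lerD => //; apply: ler_wpM2l N2b.
have T := hT w (lam + eps); rewrite etaE.
(* With eps the part of the increment beyond lam: the Taylor remainder at the full increment, the
   linear form on rho, and the quadratic terms containing eps, all of order N^3. *)
have -> : g (to_xy (w + (lam + eps))) - g (to_xy w) - lform g w lam -
    (lform g w kap + 2^-1 * qform g w lam lam) =
  (g (to_xy (w + (lam + eps))) - g (to_xy w) - lform g w (lam + eps) - 2^-1 * qform g w (lam + eps) (lam + eps))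
  + lform g w rho + 2^-1 * (qform g w eps (lam + eps) + qform g w lam eps).
  by rewrite /eps !lformA !qformA !qformB; field.
apply: (@le_trans _ _ (Q * N ^+ 3)); last first.
  by apply: ler_wpM2r; [exact: exprn_ge0|rewrite /K; lra].
have -> : Q * N ^+ 3 = B * (L1 * N) ^+ 3 + B * (L * c ^+ 2 * N ^+ 3) +
    1 * (B * ((L2 * N ^+ 2) * (L1 * N)) + B * ((L * N) * (L2 * N ^+ 2))) by rewrite /Q; ring.
apply: (le_trans (ler_normD _ _)); apply: lerD.
  apply: (le_trans (ler_normD _ _)); apply: lerD.
    apply: (le_trans T); apply: ler_wpM2l => //; apply: lerXn2r => //; rewrite nnegrE ?N1_ge0//.
    exact: mulr_ge0.
  by apply: (le_trans (lform_bound _ (fun i => h1 i _))); apply: ler_wpM2l.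
rewrite normrM; apply: ler_pM => //; first by rewrite ger0_norm; lra.
apply: (le_trans (ler_normD _ _)); apply: lerD;
  apply: (le_trans (qform_bound _ _ (fun i j => h2 i j _))); apply: ler_wpM2l => //; apply: ler_pM => //; exact: N1_ge0.
Qed.

End Pullback.

(** * Wirtinger derivatives and the Laplacian *)

Section Wirtinger.
Variables (R : realType) (m : nat).
Local Notation C := R[i].
Local Notation n := m.+1.
Local Notation state := 'M[C]_(m, n).
Local Notation V := ('M[R]_(m, n) * 'M[R]_(m, n))%type.
Local Notation idx := (bool * 'I_m * 'I_n)%type.
Implicit Types (f g : state -> C) (w : state) (v : V).

Definition part f (e : bool) (z : V) : R := pt e (f (of_xy z)).

Lemma pt_real_deriv e v f w : pt e (real_deriv v f w) = 'D_v (part f e) (to_xy w).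
Proof. by case: e. Qed.

Lemma part_real_deriv v f e : part (real_deriv v f) e = 'D_v (part f e).
Proof. by apply/funext => z; rewrite /part pt_real_deriv to_of_xy. Qed.

Lemma real_derivD v f g (c c' : C) w : (forall e, smooth (part f e)) -> (forall e, smooth (part g e)) ->
  real_deriv v (fun w => c * f w + c' * g w) w = c * real_deriv v f w + c' * real_deriv v g w.
Proof.
move=> sf sg; apply: eq_pt => e; rewrite pt_real_deriv.
have df e' : derivable (part f e') (to_xy w) v by exact: smooth_derivable.
have dg e' : derivable (part g e') (to_xy w) v by exact: smooth_derivable.
have lin (a1 a2 a3 a4 : R) : 'D_v (fun z => (a1 * part f false z + a2 * part f true z) +
    (a3 * part g false z + a4 * part g true z)) (to_xy w) =
    (a1 * 'D_v (part f false) (to_xy w) + a2 * 'D_v (part f true) (to_xy w)) +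
    (a3 * 'D_v (part g false) (to_xy w) + a4 * 'D_v (part g true) (to_xy w)).
  have Z (a : R) (h : V -> R) : derivable h (to_xy w) v ->
      is_derive (to_xy w) v (fun z => a * h z) (a * 'D_v h (to_xy w)).
    move=> dh; have := @is_deriveZ _ _ _ h a (to_xy w) v ('D_v h (to_xy w)).
    by apply; split.
  have [_ ->//] : is_derive (to_xy w) v (fun z => (a1 * part f false z + a2 * part f true z) +
    (a3 * part g false z + a4 * part g true z)) ((a1 * 'D_v (part f false) (to_xy w) + a2 * 'D_v (part f true) (to_xy w)) +
    (a3 * 'D_v (part g false) (to_xy w) + a4 * 'D_v (part g true) (to_xy w))).
  by apply: is_deriveD; apply: is_deriveD; exact: Z.
rewrite ptD !ptM !pt_real_deriv; case: e.
  have -> : part (fun w => c * f w + c' * g w) true = (fun z => (pt true c * part f false z +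
      pt false c * part f true z) + (pt true c' * part g false z + pt false c' * part g true z)).
    by apply/funext => z; rewrite /part ptD !ptM; congr (_ + _); exact: addrC.
  by rewrite lin; congr (_ + _); exact: addrC.
have -> : part (fun w => c * f w + c' * g w) false = (fun z => (pt false c * part f false z +
    - pt true c * part f true z) + (pt false c' * part g false z + - pt true c' * part g true z)).
  by apply/funext => z; rewrite /part ptD !ptM !mulNr.
by rewrite lin !mulNr.
Qed.

Lemma pt_real_deriv2 e v v' f w :
  pt e (real_deriv v (real_deriv v' f) w) = 'D_v ('D_v' (part f e)) (to_xy w).
Proof.
apply: (etrans (pt_real_deriv e v (real_deriv v' f) w)).
exact: (congr1 (fun h => 'D_v h (to_xy w)) (part_real_deriv v' f e)).
Qed.

Lemma real_deriv_comm v v' f w : (forall e, smooth (part f e)) ->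
  real_deriv v (real_deriv v' f) w = real_deriv v' (real_deriv v f) w.
Proof.
move=> sf; apply: eq_pt => e; apply: (etrans (pt_real_deriv2 e v v' f w)).
apply: (etrans _ (esym (pt_real_deriv2 e v' v f w))).
have := @derive_comm R _ (part f e) (to_xy w) v v' (sf e).
by [].
Qed.

Lemma smooth_real_deriv v f : (forall e, smooth (part f e)) -> forall e, smooth (part (real_deriv v f) e).
Proof. by move=> sf e; rewrite part_real_deriv; exact: smooth_derive. Qed.

Definition hess f (i i' : idx) w : C := real_deriv (vb R i) (real_deriv (vb R i') f) w.

Lemma pt_hess e f i i' w : pt e (hess f i i' w) = pd2 (part f e) i i' w.
Proof. exact: pt_real_deriv2. Qed.

Lemma vb_delta k j : vb R (false, k, j) = (delta_mx k j, 0) /\ vb R (true, k, j) = (0, delta_mx k j) :> V.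
Proof.
split; rewrite /vb /to_xy; congr pair; apply/matrixP => h l; rewrite /ebase !mxE; case: (_ && _);
  by rewrite ?mulr1n ?mulr0n ?mulr1 ?mulr0.
Qed.

(** The sign s = -1 gives the holomorphic derivative and s = 1 the antiholomorphic one, so one
    computation covers all second derivatives. *)
Definition wirt (s : C) k j f w : C :=
  2^-1 * real_deriv (vb R (false, k, j)) f w + s * 'i%C / 2 * real_deriv (vb R (true, k, j)) f w.

Let half_sub (A B : C) : (A - 'i%C * B) / 2 = 2^-1 * A + -1 * 'i%C / 2 * B.
Proof. by field. Qed.
Let half_add (A B : C) : (A + 'i%C * B) / 2 = 2^-1 * A + 1 * 'i%C / 2 * B.
Proof. by field. Qed.

Lemma d_wE k j : d_w k j = wirt (-1) k j.
Proof.
apply/funext => f; apply/funext => w; rewrite /d_w /wirt.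
by have [-> ->] := vb_delta k j; exact: half_sub.
Qed.

Lemma d_wbarE k j : d_wbar k j = wirt 1 k j.
Proof.
apply/funext => f; apply/funext => w; rewrite /d_wbar /wirt.
by have [-> ->] := vb_delta k j; exact: half_add.
Qed.

Let i2 : 'i%C * 'i%C = -1 :> C. Proof. by rewrite -expr2 sqr_i. Qed.

Let wirt_alg (s s' A B D E : C) :
  2^-1 * (2^-1 * A + s' * 'i%C / 2 * B) + s * 'i%C / 2 * (2^-1 * D + s' * 'i%C / 2 * E) =
  4^-1 * (A + s' * 'i%C * B + s * 'i%C * D - s * s' * E).
Proof.
transitivity (4^-1 * (A + s' * 'i%C * B + s * 'i%C * D + s * s' * ('i%C * 'i%C) * E)); first by field.
by rewrite i2; ring.
Qed.

(* Second Wirtinger derivatives in terms of a real Hessian [H]. *)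
Definition wirt2 (H : idx -> idx -> C) (s s' : C) k j h l : C :=
  4^-1 * (H (false, k, j) (false, h, l) + s' * 'i%C * H (false, k, j) (true, h, l) +
    s * 'i%C * H (true, k, j) (false, h, l) - s * s' * H (true, k, j) (true, h, l)).

Lemma wirt_wirt s s' k j h l f w : (forall e, smooth (part f e)) ->
  wirt s k j (wirt s' h l f) w = wirt2 (fun i i' => hess f i i' w) s s' k j h l.
Proof.
move=> sf; rewrite /wirt2 -wirt_alg {1}/wirt.
have D v : real_deriv v (wirt s' h l f) w =
    2^-1 * real_deriv v (real_deriv (vb R (false, h, l)) f) w +
    s' * 'i%C / 2 * real_deriv v (real_deriv (vb R (true, h, l)) f) w.
  exact: (real_derivD v _ _ w (smooth_real_deriv _ sf) (smooth_real_deriv _ sf)).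
by rewrite (D (vb R (false, k, j))) (D (vb R (true, k, j))).
Qed.

Lemma hess_comm f i i' w : (forall e, smooth (part f e)) -> hess f i i' w = hess f i' i w.
Proof. exact: real_deriv_comm. Qed.

Lemma wirt2_comm (H : idx -> idx -> C) s s' k j h l : (forall i i', H i i' = H i' i) ->
  wirt2 H s s' k j h l = wirt2 H s' s h l k j.
Proof.
move=> HC; rewrite /wirt2 (HC (false, h, l) (false, k, j)) (HC (false, h, l) (true, k, j)).
by rewrite (HC (true, h, l) (false, k, j)) (HC (true, h, l) (true, k, j)); ring.
Qed.

Lemma sum_idx (A : nmodType) (G : idx -> A) :
  \sum_i G i = \sum_k \sum_j (G (false, k, j) + G (true, k, j)).
Proof.
rewrite (eq_bigr (fun i => G (i.1.1, i.1.2, i.2))); last by move=> [[]].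
transitivity (\sum_(ek : bool * 'I_m) \sum_j G (ek.1, ek.2, j)); first by rewrite pair_bigA.
transitivity (\sum_e \sum_k \sum_j G (e, k, j)); first by rewrite (pair_bigA _ (fun e k => \sum_j G (e, k, j))).
rewrite big_bool [LHS]addrC.
by rewrite -[LHS]big_split; apply: eq_bigr => k _; rewrite -[LHS]big_split.
Qed.

Lemma conjE_pt (z : C) : z = (pt false z)%:C%C + 'i%C * (pt true z)%:C%C /\
  z^* = (pt false z)%:C%C - 'i%C * (pt true z)%:C%C.
Proof.
case: z => x y; split; apply: eq_pt => e; rewrite ?ptJ ?ptB ?ptD ptM; case: e => /=; ring.
Qed.

Let wirt_term (a b c e A B D E : C) :
  a * c * A + a * e * B + (b * c * D + b * e * E) =
  (a + 'i%C * b) * (c + 'i%C * e) * (4^-1 * (A + -1 * 'i%C * B + -1 * 'i%C * D - -1 * -1 * E)) +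
  (a + 'i%C * b) * (c - 'i%C * e) * (4^-1 * (A + 1 * 'i%C * B + -1 * 'i%C * D - -1 * 1 * E)) +
  ((a - 'i%C * b) * (c + 'i%C * e) * (4^-1 * (A + -1 * 'i%C * B + 1 * 'i%C * D - 1 * -1 * E)) +
   (a - 'i%C * b) * (c - 'i%C * e) * (4^-1 * (A + 1 * 'i%C * B + 1 * 'i%C * D - 1 * 1 * E))).
Proof.
(* The imaginary unit is first an arbitrary element; I I = -1 is substituted afterwards. *)
have g (I : C) : (a + I * b) * (c + I * e) * (4^-1 * (A + -1 * I * B + -1 * I * D - -1 * -1 * E)) +
  (a + I * b) * (c - I * e) * (4^-1 * (A + 1 * I * B + -1 * I * D - -1 * 1 * E)) +
  ((a - I * b) * (c + I * e) * (4^-1 * (A + -1 * I * B + 1 * I * D - 1 * -1 * E)) +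
   (a - I * b) * (c - I * e) * (4^-1 * (A + 1 * I * B + 1 * I * D - 1 * 1 * E))) =
  a * c * A - (I * I) * (a * e) * B - (I * I) * (b * c) * D - (I * I) * (b * e) * E by field.
by rewrite g i2; ring.
Qed.

Let wirt_term2 (z z' A B D E : C) :
  (pt false z * pt false z')%:C%C * A + (pt false z * pt true z')%:C%C * B +
  ((pt true z * pt false z')%:C%C * D + (pt true z * pt true z')%:C%C * E) =
  z * z' * (4^-1 * (A + -1 * 'i%C * B + -1 * 'i%C * D - -1 * -1 * E)) +
  z * z'^* * (4^-1 * (A + 1 * 'i%C * B + -1 * 'i%C * D - -1 * 1 * E)) +
  (z^* * z' * (4^-1 * (A + -1 * 'i%C * B + 1 * 'i%C * D - 1 * -1 * E)) +
   z^* * z'^* * (4^-1 * (A + 1 * 'i%C * B + 1 * 'i%C * D - 1 * 1 * E))).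
Proof.
have cM (x y : R) : (x * y)%:C%C = x%:C%C * y%:C%C by exact: rmorphM.
rewrite !cM; have := conjE_pt z; have := conjE_pt z'.
move: (pt false z)%:C%C (pt true z)%:C%C (pt false z')%:C%C (pt true z')%:C%C => a b c e.
by move=> [e1 e2] [e3 e4]; rewrite e2 e4 e1 e3; exact: wirt_term.
Qed.

(** A real Hessian evaluated on a complex direction y, rewritten through y and conj y. *)
Lemma hess_wirt (H : idx -> idx -> C) (y : state) :
  \sum_i \sum_i' (co y i * co y i')%:C%C * H i i' =
  \sum_k \sum_j \sum_h \sum_l
    (y k j * y h l * wirt2 H (-1) (-1) k j h l + y k j * (y h l)^* * wirt2 H (-1) 1 k j h l +
     ((y k j)^* * y h l * wirt2 H 1 (-1) k j h l + (y k j)^* * (y h l)^* * wirt2 H 1 1 k j h l)).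
Proof.
rewrite sum_idx; apply: eq_bigr => k _; apply: eq_bigr => j _.
rewrite (sum_idx (fun i' => (co y (false, k, j) * co y i')%:C%C * H (false, k, j) i')).
rewrite (sum_idx (fun i' => (co y (true, k, j) * co y i')%:C%C * H (true, k, j) i')).
rewrite -[LHS]big_split; apply: eq_bigr => h _; rewrite -[LHS]big_split; apply: eq_bigr => l _.
exact: wirt_term2.
Qed.

Let S4 (G : 'I_m -> 'I_n -> 'I_m -> 'I_n -> C) : C := \sum_k \sum_j \sum_h \sum_l G k j h l.

Let S4E G G' : (forall k j h l, G k j h l = G' k j h l) -> S4 G = S4 G'.
Proof. by move=> e; do 4 (apply: eq_bigr => ? _); exact: e. Qed.

Let S4D G G' : S4 (fun k j h l => G k j h l + G' k j h l) = S4 G + S4 G'.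
Proof.
by rewrite /S4; do 3 (rewrite -big_split; apply: eq_bigr => ? _); rewrite -big_split.
Qed.

Let S4_swap G : S4 G = S4 (fun k j h l => G h l k j).
Proof.
rewrite /S4; under eq_bigr => k _ do rewrite exchange_big/=.
rewrite exchange_big/=; apply: eq_bigr => h _.
under eq_bigr => k _ do rewrite exchange_big/=.
by rewrite exchange_big.
Qed.

Let S4_offdiag G : (forall k j h, G k j h j = 0) ->
  \sum_j \sum_(l < n | j != l) \sum_k \sum_h G k j h l = S4 G.
Proof.
move=> G0; rewrite /S4 exchange_big/=; apply: eq_bigr => j _.
transitivity (\sum_l \sum_k \sum_h G k j h l).
  rewrite big_mkcond/=; apply: eq_bigr => l _; case: eqP => //= <-.
  by rewrite big1// => k _; rewrite big1.
by rewrite exchange_big/=; apply: eq_bigr => k _; rewrite exchange_big.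
Qed.

Let S4_diag (G : 'I_m -> 'I_n -> 'I_m -> C) (a : 'I_n -> C) (G' : 'I_m -> 'I_n -> 'I_m -> 'I_n -> C) :
  S4 (fun k j h l => (j == l)%:R * G k j h * a j * G' k j h l) =
  \sum_j a j * \sum_k \sum_h G k j h * G' k j h j.
Proof.
rewrite /S4 exchange_big/=; apply: eq_bigr => j _; rewrite mulr_sumr; apply: eq_bigr => k _.
rewrite mulr_sumr; apply: eq_bigr => h _; rewrite (bigD1 j)//= eqxx big1 ?addr0.
  by rewrite mul1r mulrCA mulrA.
by move=> l; rewrite eq_sym => /negbTE ->; rewrite !mul0r.
Qed.

Lemma col_radius_sqr w j : (col_radius w j)%:C%C ^+ 2 = (\sum_(k < m) sqmod (w k j))%:C%C.
Proof.
rewrite -rmorphXn/= /col_radius sqr_sqrtr; last by apply: sumr_ge0 => k _; exact: sqr_ge0.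
congr (_%:C%C); apply: eq_bigr => k _; rewrite /sqmod big_bool/=.
case: (w k j) => x y /=; rewrite sqr_sqrtr; first exact: addrC.
by rewrite addr_ge0 ?sqr_ge0.
Qed.

(** The covariance of the chart increments splits by [hess_wirt] into pure parts [S1], [S5], given
    by [chart1_noise], and mixed parts [S2], [S3], given by [chart1_noise_conj]. In the pure parts
    the terms with equal columns vanish, whence sums over distinct ones. *)
Lemma flag_laplacian_hess f (u : 'M[C]_n) : (forall e, smooth (part f e)) -> flag_domain u ->
  \sum_i \sum_i' (\sum_b co (chart1 u (u *m Xb R b)) i * co (chart1 u (u *m Xb R b)) i')%:C%C *
    hess f i i' (flag_chart u) = flag_laplacian f (flag_chart u).
Proof.
move=> sf hu; set w := flag_chart u; pose y b := chart1 u (u *m Xb R b).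
pose H i i' := hess f i i' w.
have HC i i' : H i i' = H i' i by exact: hess_comm.
transitivity (\sum_b \sum_i \sum_i' (co (y b) i * co (y b) i')%:C%C * H i i').
  rewrite [RHS]exchange_big/=; apply: eq_bigr => i _; rewrite [RHS]exchange_big/=; apply: eq_bigr => i' _.
  by rewrite rmorph_sum/= mulr_suml.
under eq_bigr do rewrite hess_wirt.
pose D := wirt2 H.
pose S1 := S4 (fun k j h l => (\sum_b y b k j * y b h l) * D (-1) (-1) k j h l).
pose S2 := S4 (fun k j h l => (\sum_b y b k j * (y b h l)^*) * D (-1) 1 k j h l).
pose S3 := S4 (fun k j h l => (\sum_b y b h l * (y b k j)^*) * D 1 (-1) k j h l).
pose S5 := S4 (fun k j h l => (\sum_b y b k j * y b h l)^* * D 1 1 k j h l).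
transitivity (S1 + S2 + (S3 + S5)).
  rewrite /S1 /S2 /S3 /S5 -!S4D /S4 exchange_big/=; apply: eq_bigr => k _; rewrite exchange_big/=; apply: eq_bigr => j _.
  rewrite exchange_big/=; apply: eq_bigr => h _; rewrite exchange_big/=; apply: eq_bigr => l _.
  rewrite !big_split/= rmorph_sum !mulr_suml /D.
  congr (_ + (_ + _)); apply: eq_bigr => b _; first by rewrite (mulrC (y b h l)).
  by rewrite rmorphM.
(* Symmetry of the Hessian doubles the mixed part and turns the factor 2 of [chart1_noise_conj] into
   the coefficient 4. *)
have -> : S3 = S2.
  by rewrite /S3 S4_swap; apply: S4E => k j h l; rewrite /D (wirt2_comm _ _ _ _ _ _ HC).
have -> : S2 = 2 * \sum_j (1 + (col_radius w j)%:C%C ^+ 2) * \sum_k \sum_h ((k == h)%:R + w k j * (w h j)^*) * D (-1) 1 k j h j.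
  rewrite /S2 -(S4_diag (fun k j h => _) (fun j => _) (D (-1) 1)) /S4 mulr_sumr.
  do 3 (apply: eq_bigr => ? _; rewrite mulr_sumr); apply: eq_bigr => l _.
  rewrite /y (chart1_noise_conj _ _ _ _ hu) -(last_row_radius _ hu) col_radius_sqr rmorphD.
  by rewrite rmorph1; ring.
have e1 : S1 =
    - 2 * \sum_j \sum_(l < n | j != l) \sum_k \sum_h
      (w k l - w k j) * (w h j - w h l) * D (-1) (-1) k j h l.
  rewrite /S1 (@S4_offdiag (fun k j h l => (w k l - w k j) * (w h j - w h l) * D (-1) (-1) k j h l)); last first.
    by move=> k j h; rewrite subrr !mul0r.
  rewrite /S4 mulr_sumr; do 3 (apply: eq_bigr => ? _; rewrite mulr_sumr); apply: eq_bigr => l _.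
  by rewrite /y (chart1_noise _ _ _ _ hu.2); ring.
have e2 : S5 =
    - 2 * \sum_j \sum_(l < n | j != l) \sum_k \sum_h
      ((w k l)^* - (w k j)^*) * ((w h j)^* - (w h l)^*) * D 1 1 k j h l.
  rewrite /S5 (@S4_offdiag (fun k j h l => ((w k l)^* - (w k j)^*) * ((w h j)^* - (w h l)^*) * D 1 1 k j h l)); last first.
    by move=> k j h; rewrite subrr !mul0r.
  rewrite /S4 mulr_sumr; do 3 (apply: eq_bigr => ? _; rewrite mulr_sumr); apply: eq_bigr => l _.
  rewrite /y (chart1_noise _ _ _ _ hu.2) !rmorphM !rmorphB rmorphN rmorph_nat; ring.
rewrite e1 e2 /flag_laplacian.
have W s s' k j h l : D s s' k j h l = wirt s k j (wirt s' h l f) w by rewrite (wirt_wirt _ _ _ _ _ _ _ sf).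
have F1 : \sum_(j < n) (1 + (col_radius w j)%:C%C ^+ 2) * \sum_(k < m) \sum_(h < m)
    ((k == h)%:R + w k j * (w h j)^*) * d_w k j (d_wbar h j f) w =
    \sum_j (1 + (col_radius w j)%:C%C ^+ 2) * \sum_k \sum_h ((k == h)%:R + w k j * (w h j)^*) * D (-1) 1 k j h j.
  by apply: eq_bigr => j _; congr (_ * _); do 2 (apply: eq_bigr => ? _); rewrite W d_wE d_wbarE.
have F2 : \sum_(j < n) \sum_(l < n | j != l) \sum_(k < m) \sum_(h < m)
    (w k l - w k j) * (w h j - w h l) * d_w k j (d_w h l f) w =
    \sum_j \sum_(l < n | j != l) \sum_k \sum_h (w k l - w k j) * (w h j - w h l) * D (-1) (-1) k j h l.
  by do 4 (apply: eq_bigr => ? _); rewrite W !d_wE.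
have F3 : \sum_(j < n) \sum_(l < n | j != l) \sum_(k < m) \sum_(h < m)
    ((w k l)^* - (w k j)^*) * ((w h j)^* - (w h l)^*) * d_wbar k j (d_wbar h l f) w =
    \sum_j \sum_(l < n | j != l) \sum_k \sum_h
      ((w k l)^* - (w k j)^*) * ((w h j)^* - (w h l)^*) * D 1 1 k j h l.
  by do 4 (apply: eq_bigr => ? _); rewrite W !d_wbarE.
rewrite F1 F2 F3.
set A := \sum_j _ * _; set B := \sum_j _; set E := \sum_j _.
by ring.
Qed.

Lemma gen_pull_laplacian f (K0 : R) (u : 'M[C]_n) e : (forall e, smooth (part f e)) ->
  (forall y, K0 < `|y| -> part f e y = 0) -> flag_domain u ->
  gen (pull1 (part f e) K0) (pull2 (part f e) K0) u = pt e (2^-1 * flag_laplacian f (flag_chart u)).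
Proof.
move=> sf f0 hu; rewrite (gen_pull f0 hu).
have -> : 2^-1 = (2^-1)%:C%C :> C by rewrite fmorphV/= rmorph_nat.
rewrite ptZ -(flag_laplacian_hess sf hu) pt_sum; congr (_ * _); apply: eq_bigr => i _.
rewrite pt_sum; apply: eq_bigr => i' _.
by rewrite ptZ pt_hess.
Qed.

End Wirtinger.

(** * Continuity of paths and martingales *)

Section Paths.
Variable R : realType.
Local Notation C := R[i].

Lemma wcont_cvgP (V : normedModType R) (g : R -> V) :
  wcont g <-> forall t : R, 0 <= t -> g y @[y --> within `[0, +oo[%classic (nbhs t)] --> g t.
Proof.
rewrite -wcontP; split => [/subspace_continuousP h t t0|h].
  by apply: h; rewrite /= in_itv/= t0.
by apply/subspace_continuousP => t /=; rewrite in_itv/= andbT; exact: h.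
Qed.

Lemma wcont_ext (V : normedModType R) (g h : R -> V) :
  (forall t : R, 0 <= t -> g t = h t) -> wcont g -> wcont h.
Proof.
by move=> gh cg t t0 e e0; have [del del0 H] := cg t t0 e e0; exists del => // y y0 yt; rewrite -!gh//; exact: H.
Qed.

Lemma wcont_cst (c : R) : wcont (fun=> c).
Proof. by apply/wcont_cvgP => t _; exact: cvg_cst. Qed.

Lemma wcontD (g h : R -> R) : wcont g -> wcont h -> wcont (fun t => g t + h t).
Proof.
move=> /wcont_cvgP cg /wcont_cvgP ch; apply/wcont_cvgP => t t0.
by apply: cvgD; [exact: cg|exact: ch].
Qed.

Lemma wcontM (g h : R -> R) : wcont g -> wcont h -> wcont (fun t => g t * h t).
Proof.
move=> /wcont_cvgP cg /wcont_cvgP ch; apply/wcont_cvgP => t t0.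
by apply: cvgM; [exact: cg|exact: ch].
Qed.

Lemma wcontN (g : R -> R) : wcont g -> wcont (fun t => - g t).
Proof.
by move=> /wcont_cvgP cg; apply/wcont_cvgP => t t0; apply: cvgN; exact: cg.
Qed.

Lemma wcontV (g : R -> R) : (forall t : R, 0 <= t -> g t != 0) -> wcont g -> wcont (fun t => (g t)^-1).
Proof.
move=> g0 /wcont_cvgP cg; apply/wcont_cvgP => t t0.
by apply: cvgV; [exact: g0|exact: cg].
Qed.

Lemma wcont_sum (I : Type) (s : seq I) (g : I -> R -> R) : (forall i, wcont (g i)) ->
  wcont (fun t => \sum_(i <- s) g i t).
Proof.
move=> cg; elim: s => [|i s IH].
  by under eq_fun do rewrite big_nil; exact: wcont_cst.
by under eq_fun do rewrite big_cons; exact: wcontD.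
Qed.

Definition zcont (z : R -> C) := forall e, wcont (fun t => pt e (z t)).

Lemma zcontB z z' : zcont z -> zcont z' -> zcont (fun t => z t - z' t).
Proof.
move=> hz hz' e; under eq_fun do rewrite ptB.
by apply: wcontD => //; exact: wcontN.
Qed.

Lemma zcontM z z' : zcont z -> zcont z' -> zcont (fun t => z t * z' t).
Proof.
move=> hz hz' e; under eq_fun do rewrite ptM.
case: e; first by apply: wcontD; exact: wcontM.
by apply: wcontD; [exact: wcontM|apply: wcontN; exact: wcontM].
Qed.

Lemma zcontV z : (forall t : R, 0 <= t -> z t != 0) -> zcont z -> zcont (fun t => (z t)^-1).
Proof.
move=> z0 hz e.
apply: (@wcont_ext _ (fun t => (sqmod (z t))^-1 * pt e ((z t)^*))).
  move=> t t0; rewrite -ptZ; congr pt; rewrite fmorphV/= sqmodE.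
  by rewrite invfM -mulrA mulVf ?mulr1// conjC_eq0 z0.
apply: wcontM.
  apply: wcontV; first by move=> t t0; rewrite sqmod_eq0 z0.
  rewrite /sqmod; apply: wcont_sum => e'.
  by under eq_fun do rewrite expr2; exact: wcontM.
under eq_fun do rewrite ptJ; case: e; last exact: hz.
exact: wcontN.
Qed.

Lemma zcont_sum (I : Type) (s : seq I) (z : I -> R -> C) : (forall i, zcont (z i)) ->
  zcont (fun t => \sum_(i <- s) z i t).
Proof. by move=> hz e; under eq_fun do rewrite pt_sum; apply: wcont_sum => i; exact: hz. Qed.

Definition mxcont (a b : nat) (X : R -> 'M[C]_(a, b)) := forall k j, zcont (fun t => X t k j).

Lemma mxcont_xy (a b : nat) (X : R -> 'M[C]_(a, b)) (h : 'M[R]_(a, b) * 'M[R]_(a, b) -> R) :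
  continuous h -> mxcont X -> wcont (fun t => to_xy (X t)) /\ wcont (fun t => h (to_xy (X t))).
Proof.
move=> ch cX.
have c : forall t : R, 0 <= t -> to_xy (X y) @[y --> within `[0, +oo[%classic (nbhs t)] --> to_xy (X t).
  move=> t t0; rewrite to_xy_expand; under eq_fun do rewrite to_xy_expand.
  apply: cvg_big; first exact: add_continuous.
  move=> i _; apply: (cvg_comp (fun y => co (X y) i) (fun k => k *: vb R i) _ (@scalel_continuous _ _ (vb R i) _)).
  by have /wcont_cvgP := cX i.1.2 i.2 i.1.1; apply.
split; apply/wcont_cvgP => // t t0.
exact: (cvg_comp (fun y => to_xy (X y)) h (c t t0) (ch _)).
Qed.

Variable m : nat.
Local Notation M := 'M[C]_m.+1.

Lemma chart_cont (u : R -> M) : (forall t : R, 0 <= t -> flag_domain (u t)) -> mxcont u ->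
  mxcont (fun t => flag_chart (u t)).
Proof.
move=> du cu k j; under eq_fun do rewrite mxE; apply: zcontM => //.
by apply: zcontV => // t t0; have [_] := du t t0; exact.
Qed.

Lemma chart1_cont (u : R -> M) (v : M) : (forall t : R, 0 <= t -> flag_domain (u t)) -> mxcont u ->
  mxcont (fun t => chart1 (u t) (u t *m v)).
Proof.
move=> du cu.
have cv k j : zcont (fun t => (u t *m v) k j).
  under eq_fun do rewrite mxE; apply: zcont_sum => i; apply: zcontM => // e; exact: wcont_cst.
move=> k j; rewrite /chart1; under eq_fun do rewrite (mxE _ (fun k j => _ / _)).
apply: zcontM; first by apply: zcontB => //; apply: zcontM => //; exact: chart_cont.
by apply: zcontV => // t t0; have [_] := du t t0; exact.
Qed.

(** [pull1] and [pull2] are defined by cases, so continuity is read off the uniform formula of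
    [gen_pull], valid on the whole chart domain. *)
Lemma gen_pull_cont (g : 'M[R]_(m, m.+1) * 'M[R]_(m, m.+1) -> R) K0 (u : R -> M) : smooth g ->
  (forall y, K0 < `|y| -> g y = 0) -> (forall t : R, 0 <= t -> flag_domain (u t)) -> mxcont u ->
  wcont (fun t => gen (pull1 g K0) (pull2 g K0) (u t)).
Proof.
move=> sg g0 du cu.
have e t : 0 <= t -> _ = gen (pull1 g K0) (pull2 g K0) (u t) := fun t0 => esym (gen_pull g0 (du t t0)).
apply: (wcont_ext e).
apply: wcontM; first exact: wcont_cst.
apply: wcont_sum => i; apply: wcont_sum => j; apply: wcontM.
  by apply: wcont_sum => b; apply: wcontM; [have := chart1_cont (Xb R b) du cu i.1.2 i.2 i.1.1|
    have := chart1_cont (Xb R b) du cu j.1.2 j.2 j.1.1].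
have cp : continuous ('D_(vb R i) ('D_(vb R j) g)).
  by apply: smooth_continuous; do 2 apply: smooth_derive.
by have [] := mxcont_xy cp (chart_cont du cu).
Qed.

End Paths.

(** * The martingale problem for the chart process *)

Section FlagDiffusion.
Context d (T : measurableType d) (R : realType) (P : probability T R) (F : R -> set (set T)).
Hypothesis hF : complete_filtration P F.
Variable m : nat.
Variable U : R -> T -> 'M[R[i]]_(m.+1).
Hypothesis hU : brownian_unitary P F U.
Local Notation M := 'M[R[i]]_(m.+1).
Local Notation state := 'M[R[i]]_(m, m.+1).

(** [dynkin_riem] and [mean_tint] are limits of the same Riemann sums, so uniqueness of limits gives
    the martingale identity. Y need only agree almost surely with the natural expression, since the
    chart formulas hold only along paths staying in the domain. *)
Lemma dynkin_martingale G D1 D2 K (Y : R -> T -> R) : 0 <= K -> jet G D1 D2 K ->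
  {ae P, forall x, wcont (fun t => gen D1 D2 (U t x))} ->
  (forall t, 0 <= t -> {ae P, forall x, Y t x = G (U t x) - G (U 0 x) - tint (fun s => gen D1 D2 (U s x)) t}) ->
  martingale P F Y.
Proof.
move=> K0 J gc YE s t s0 st; have t0 := le_trans s0 st.
pose g r x := gen D1 D2 (U r x).
have gad r : 0 <= r -> measurable_wrt (F r) (g r) by move=> r0; exact: (bu_mwr hF hU r0 (gen_meas J)).
have gK r x : 0 <= r -> `|g r x| <= K * gen_const R m.+1.
  by move=> r0; exact: (gen_bound K0 J (bu_unitary hU x r0)).
pose Z r x := G (U r x) - G (U 0 x) - tint (g ^~ x) r.
have mG r : 0 <= r -> measurable_wrt (F r) (fun x => G (U r x)).
  by move=> r0; exact: (bu_mwr hF hU r0 (jet_meas0 J)).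
have mt r : 0 <= r -> measurable_wrt (F r) (fun x => tint (g ^~ x) r) by exact: (tint_adapted hF gad gc).
have mZ r : 0 <= r -> measurable_wrt (F r) (Z r).
  move=> r0; have sF := filt_sigma hF r0; apply: (mwrB sF); last exact: mt.
  by apply: (mwrB sF); [exact: mG|apply: (mwr_sub (filt_mono hF (lexx 0) r0)); exact: mG].
have mY r : 0 <= r -> measurable_wrt (F r) (Y r).
  by move=> r0; exact: (mwr_ae hF r0 (YE r r0) (mZ r r0)).
have LG r : 0 <= r -> L1 P (fun x => G (U r x)).
  by move=> r0; exact: (bu_L1 hF hU r0 (jet_meas0 J) (fun u => jet_bound0 J (u := u))).
have tint0 h : tint h 0 = 0 :> R by rewrite /tint set_itv1 Rintegral_set1.
have Lt r : 0 <= r -> L1 P (fun x => tint (g ^~ x) r).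
  move=> r0; apply: L2_L1; apply: (L2_bnd_ae (K := r * (K * gen_const R m.+1))).
    by apply: (adapted_meas hF r0); exact: mt.
  apply: filterS (tint_ae_bound gK gc (lexx 0) r0) => x.
  by rewrite tint0 !subr0.
have LZ r : 0 <= r -> L1 P (Z r).
  by move=> r0; apply: L1B; [apply: L1B; exact: LG|exact: Lt].
have L1_ae (X X' : T -> R) : measurable_fun setT X -> {ae P, forall x, X x = X' x} -> L1 P X' -> L1 P X.
  move=> mX XX LX'; have mX' := L1_meas LX'; have /integrableP[_ fX'] := LX'.
  apply/integrableP; split; first exact/measurable_EFinP.
  rewrite (ae_eq_integral (fun x => `|(X' x)%:E|%E))//; first by apply/measurable_EFinP; exact: measurableT_comp.
    by apply/measurable_EFinP; exact: measurableT_comp.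
  by apply: filterS XX => x XX _ /=; rewrite XX.
have LY r : 0 <= r -> L1 P (Y r).
  move=> r0; apply: (L1_ae _ (Z r)); [|exact: YE|exact: LZ].
  by apply: (adapted_meas hF r0); exact: mY.
apply: (cond_expectationP hF s0 (mY s s0) (LY t t0) (LY s s0)) => E FE.
have mE := filt_indic hF s0 FE.
have YZ r : 0 <= r -> mean P (fun x => \1_E x * Y r x) = mean P (fun x => \1_E x * Z r x).
  move=> r0; apply: mean_ae.
  - by apply: measurable_funM => //; exact: L1_meas (LY r r0).
  - by apply: measurable_funM => //; exact: L1_meas (LZ r r0).
  - by apply: filterS (YE r r0) => x ->.
rewrite (YZ s s0) (YZ t t0); apply/esym/eqP; rewrite -subr_eq0.
have LE X : L1 P X -> L1 P (fun x => \1_E x * X x) by exact: L1M_bnd mE (indic_le1 R E).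
rewrite -meanB; [|exact: LE (LZ t t0)|exact: LE (LZ s s0)].
have -> : (fun x => \1_E x * Z t x - \1_E x * Z s x) =
  (fun x => \1_E x * (G (U t x) - G (U s x)) - \1_E x * (tint (g ^~ x) t - tint (g ^~ x) s)).
  by apply/funext => x; rewrite /Z; ring.
rewrite meanB; [|by apply: LE; apply: L1B; exact: LG|by apply: LE; apply: L1B; exact: Lt].
rewrite subr_eq0; apply/eqP.
apply: (cvg_unique _ (dynkin_riem hF hU K0 J s0 st FE)); first exact: Rhausdorff.
exact: (mean_tint hF gad gK gc s0 st mE (indic_le1 R E)).
Qed.

Variable u0 : M.
Hypotheses (hu0 : flag_domain u0) (U0 : {ae P, forall x, U 0 x = u0}).

Let paths : {ae P, forall x, (forall t, 0 <= t -> flag_domain (U t x)) /\ mxcont (fun t => U t x)}.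
Proof.
have : {ae P, forall x, forall i, wcont (fun t => co (U t x) i)}.
  by apply: filter_forall => i; exact: (bu_wcont hU).
apply: filterS2 (bu_flag_domain hF hU hu0 U0) => x h1 h2; split => // k j e.
exact: (h2 (e, k, j)).
Qed.

Lemma chart_continuous_paths : mx_continuous_paths P (fun t x => flag_chart (U t x)).
Proof.
apply: filterS paths => x [dx cx]; apply/wcontP.
by have [] := mxcont_xy (h := fun=> 0 : R) (fun=> @cvg_cst _ _ _ _ _) (chart_cont dx cx).
Qed.

Lemma chart_martingale f e : test_function f ->
  martingale P F (fun t x => pt e (f (flag_chart (U t x)) - f (flag_chart (U 0 x)) -
    time_integral (fun s => 2^-1 * flag_laplacian f (flag_chart (U s x))) t)).
Proof.
move=> [sr si [K0 f0]].
have sf e' : smooth (part f e') by case: e'; [exact: si|exact: sr].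
have p0 e' (y : 'M[R]_(m, m.+1) * 'M[R]_(m, m.+1)) : K0 < `|y| -> part f e' y = 0.
  by move=> hy; rewrite /part f0 ?pt0// to_of_xy.
have [K K_ge0 J] := pull_jet (sf e) (p0 e).
apply: (dynkin_martingale K_ge0 J).
  by apply: filterS paths => x [dx cx]; exact: (gen_pull_cont (sf e) (p0 e) dx cx).
move=> t t0; apply: filterS paths => x [dx _].
have pc r : 0 <= r -> pull (part f e) K0 (U r x) = pt e (f (flag_chart (U r x))).
  by move=> r0; rewrite (pull_chart (p0 e) (dx r r0)) /part of_to_xy.
rewrite !pc// !ptB; congr (_ - _).
transitivity (tint (fun s => pt e (2^-1 * flag_laplacian f (flag_chart (U s x)))) t); first by case: e {J pc}.
apply: eq_Rintegral => s; rewrite inE/= in_itv/= => /andP[s0 _].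
by rewrite (gen_pull_laplacian sf (p0 e) (dx s s0)).
Qed.

End FlagDiffusion.

(* The n of the source is m.+1. *)
Theorem proposition3p3 (R : realType) (d : measure_display) (T : measurableType d)
    (P : probability T R) (F : R -> set (set T)) (m : nat)
    (U : R -> T -> 'M[R[i]]_(m.+1)) (u0 : 'M[R[i]]_(m.+1)) :
  (2 <= m.+1)%N ->
  complete_filtration P F ->
  brownian_unitary P F U ->
  flag_domain u0 ->
  {ae P, forall x, U 0 x = u0} ->
  diffusion_with_generator P F
    (fun f w => 2^-1 * flag_laplacian f w)
    (fun t x => flag_chart (U t x)).
Proof.
move=> _ hF hU hu0 U0; split.
- move=> t t0 k j.
  have h e := chart_mmw (filt_sigma hF t0) (U_mmw (bu_adapted hU) t0) k j e.
  by split; [exact: (h false)|exact: (h true)].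
- exact: (chart_continuous_paths hF hU hu0 U0).
- move=> h phi h0 mphi [K phiK].
  (* The section chooses a representative in the fibre of w, which makes the transition function
     independent of s. *)
  exists (fun w => transition P U u0 h phi (chart_section w)).
    exact: (transition_meas hF hU u0 h0 mphi phiK).
  by move=> s s0; exact: (markov_identity hF hU hu0 U0 h0 mphi phiK s0).
- move=> f tf; split.
    exact: (chart_martingale hF hU hu0 U0 false tf).
  exact: (chart_martingale hF hU hu0 U0 true tf).
Qed.
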